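(* Let $\xi$ be a Lévy process with $\psi(u)=\log\mathbb E e^{u\xi(1)}<\infty$ for all $u\in\mathbb R$, such that the distribution of $\xi(1)$ is non-lattice, and let $\xi_i$, $i\in\mathbb N$, be independent copies of $\xi$. Let $(s_N)$ be non-negative with \[ \lambda:=\lim_{N\to\infty}\frac{\log N}{s_N}\in(0,\lambda_2), \] and let $Z_N(t)=\sum_{i=1}^N e^{\xi_i(s_N+t)}$. Let $\alpha\in(0,2)$ be the unique positive solution of $I(\psi'(\alpha))=\lambda$. For $t\ge0$ define \[ B_N(t)=e^{\frac{\psi(\alpha)}{\alpha}t}\exp\Big\{s_N I^{-1}\Big(\frac{\log N-\log(\alpha\sqrt{2\pi\psi''(\alpha)s_N})}{s_N}\Big)\Big\}, \] and \[ A_N(t)=\begin{cases}0,&\lambda\in(0,\lambda_1),\\ e^{\psi(1)t}N\,\mathbb E\big[e^{\xi(s_N)}1_{\{\xi(s_N)\le\log B_N(0)\}}\big],&\lambda=\lambda_1,\\ e^{\psi(1)t}\,\mathbb E Z_N(0),&\lambda\in(\lambda_1,\lambda_2).\end{cases} \] Then for every $T>0$, weakly on the Skorokhod space $D[0,T]$, \[ \frac{Z_N(\cdot)-A_N(\cdot)}{B_N(\cdot)}\Longrightarrow \mathcal Y_{\alpha;\xi}(\cdot),\qquad N\to\infty. \]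
   Context: A Lévy process is a process with stationary independent increments and càdlàg sample paths, started at $0$; $\xi(1)$ is not a.s. constant. A random variable is lattice if it takes values in $\{an+b:n\in\mathbb Z\}$ for some $a,b\in\mathbb R$. The function $\psi$ is smooth and strictly convex, $\psi'$ maps $[0,\infty)$ bijectively onto $[\beta_0,\beta_\infty)$ with $\beta_0=\mathbb E\xi(1)$, $\beta_\infty=\lim_{u\to\infty}\psi'(u)$. The Legendre–Fenchel transform $I:[\beta_0,\beta_\infty)\to[0,\infty)$ is defined by $I(\psi'(u))=u\psi'(u)-\psi(u)$, $u\ge0$; it is strictly increasing, and $I^{-1}$ denotes its inverse. Critical values: $\lambda_1=\psi'(1)-\psi(1)$, $\lambda_2=2\psi'(2)-\psi(2)$. The process $\mathcal Y_{\alpha;\xi}$ on $t\ge0$: let $\xi_i$, $i\in\mathbb N$, be i.i.d. copies of $\xi$, independent of a unit-intensity Poisson process on $(0,\infty)$ with arrivals $\Gamma_1<\Gamma_2<\dots$, and set $U_i=\Gamma_i^{-1/\alpha}$ (points of a Poisson process with intensity $\alpha u^{-\alpha-1}du$, in descending order). Then $\mathcal Y_{\alpha;\xi}(t)=\sum_{i}U_ie^{\xi_i(t)-\frac{\psi(\alpha)}{\alpha}t}$ if $0<\alpha<1$; $\mathcal Y_{\alpha;\xi}(t)=\lim_{\tau\downarrow0}\big(\sum_{i:U_i>\tau}U_ie^{\xi_i(t)-\psi(1)t}-\log\frac1\tau\big)$ if $\alpha=1$; $\mathcal Y_{\alpha;\xi}(t)=\lim_{\tau\downarrow0}\big(\sum_{i:U_i>\tau}U_ie^{\xi_i(t)-\frac{\psi(\alpha)}{\alpha}t}-\frac{\alpha\tau^{1-\alpha}}{\alpha-1}e^{(\psi(1)-\frac{\psi(\alpha)}{\alpha})t}\big)$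 if $1<\alpha<2$. These limits exist a.s., uniformly on compact subsets of $[0,\infty)$, so $\mathcal Y_{\alpha;\xi}$ has càdlàg paths. *)

(* Defs.v *)
From HB Require Import structures.
From mathcomp Require Import all_boot all_order all_algebra.
From mathcomp Require Import all_classical all_reals all_analysis.
Set Implicit Arguments. Unset Strict Implicit. Unset Printing Implicit Defensive.
Import Order.TTheory GRing.Theory Num.Theory.
Import numFieldNormedType.Exports.
Local Open Scope classical_set_scope.
Local Open Scope ring_scope.

Section Paths.
Context {R : realType}.

Definition cadlag0 (x : R -> R) : Prop :=
  (forall t, 0 <= t -> x @ t^'+ --> x t) /\
  (forall t, 0 < t -> cvg (x @ t^'-)).

Definition cadlag_on (T : R) (x : R -> R) : Prop :=
  (forall t, 0 <= t < T -> x @ t^'+ --> x t) /\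
  (forall t, 0 < t <= T -> cvg (x @ t^'-)).

Definition time_change (T : R) (lam : R -> R) : Prop :=
  [/\ lam 0 = 0, lam T = T,
      (forall s t, 0 <= s -> s < t -> t <= T -> lam s < lam t) &
      {within [set t | 0 <= t <= T], continuous lam}].

(* Skorokhod J1 distance between x and y on [0,T] is at most delta
   (attained by some time change) *)
Definition J1close (T delta : R) (x y : R -> R) : Prop :=
  exists lam, time_change T lam /\
    forall t, 0 <= t <= T -> `|lam t - t| <= delta /\ `|x (lam t) - y t| <= delta.

Definition J1continuous (T : R) (F : (R -> R) -> R) : Prop :=
  forall x, cadlag_on T x -> forall e, 0 < e ->
    exists2 delta, 0 < delta &
      forall y, cadlag_on T y -> J1close T delta x y -> `|F x - F y| < e.
End Paths.

Section Prob.
Context {d : measure_display} {Om : measurableType d} {R : realType}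
  (P : probability Om R).

Definition prob (A : set Om) : R := fine (P A).
Definition Ex (f : Om -> R) : R := fine (\int[P]_w (f w)%:E)%E.

(* Lévy process (indexed by t >= 0; values at t < 0 are irrelevant) *)
Definition levy (X : R -> Om -> R) : Prop :=
  [/\ (forall t, measurable_fun setT (X t)) /\ (forall w, X 0 w = 0),
      forall w, cadlag0 (fun t => X t w),
      (forall (n : nat) (t : nat -> R) (B : nat -> set R),
          0 <= t 0%N -> (forall k, t k <= t k.+1) -> (forall k, measurable (B k)) ->
          prob (\bigcap_(k in `I_n) [set w | B k (X (t k.+1) w - X (t k) w)]) =
          \prod_(k < n) prob [set w | B k (X (t k.+1) w - X (t k) w)]),
      (forall s t (B : set R), 0 <= s -> 0 <= t -> measurable B ->
          prob [set w | B (X (s + t) w - X s w)] = prob [set w | B (X t w)]) &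
      ~ (exists c, prob [set w | X 1 w = c] = 1)].

Definition indep_family (xi : nat -> R -> Om -> R) : Prop :=
  forall (n m : nat) (t : nat -> R) (B : nat -> nat -> set R),
    (forall k, 0 <= t k) -> (forall i k, measurable (B i k)) ->
    prob (\bigcap_(i in `I_n) \bigcap_(k in `I_m) [set w | B i k (xi i (t k) w)]) =
    \prod_(i < n) prob (\bigcap_(k in `I_m) [set w | B i k (xi i (t k) w)]).

Definition lattice (X : Om -> R) : Prop :=
  exists a b : R, prob [set w | exists n : int, X w = a * n%:~R + b] = 1.

Definition psi (X : R -> Om -> R) (u : R) : R := ln (Ex (fun w => expR (u * X 1 w))).

Definition exp_indep (E : nat -> Om -> R) (xi : nat -> R -> Om -> R) : Prop :=
  [/\ forall j, measurable_fun setT (E j),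
      forall j x, 0 <= x -> prob [set w | x < E j w] = expR (- x) &
      forall (n m : nat) (t : nat -> R) (C : nat -> set R) (B : nat -> nat -> set R),
        (forall k, 0 <= t k) -> (forall j, measurable (C j)) ->
        (forall i k, measurable (B i k)) ->
        prob (\bigcap_(j in `I_n) [set w | C j (E j w)] `&`
              \bigcap_(i in `I_n) \bigcap_(k in `I_m) [set w | B i k (xi i (t k) w)]) =
        (\prod_(j < n) prob [set w | C j (E j w)]) *
        prob (\bigcap_(i in `I_n) \bigcap_(k in `I_m) [set w | B i k (xi i (t k) w)])].
End Prob.

Definition fdd_eq {R : realType} {d1 d2 : measure_display}
  {O1 : measurableType d1} {O2 : measurableType d2}
  (P1 : probability O1 R) (X1 : R -> O1 -> R)
  (P2 : probability O2 R) (X2 : R -> O2 -> R) : Prop :=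
  forall (m : nat) (t : nat -> R) (B : nat -> set R),
    (forall k, 0 <= t k) -> (forall k, measurable (B k)) ->
    prob P1 (\bigcap_(k in `I_m) [set w | B k (X1 (t k) w)]) =
    prob P2 (\bigcap_(k in `I_m) [set w | B k (X2 (t k) w)]).

Definition weak_conv_D {R : realType} {d1 d2 : measure_display}
  {O1 : measurableType d1} {O2 : measurableType d2} (T : R)
  (P : probability O1 R) (X : nat -> O1 -> R -> R)
  (Q : probability O2 R) (Y : O2 -> R -> R) : Prop :=
  forall F : (R -> R) -> R,
    (exists M, forall x, cadlag_on T x -> `|F x| <= M) -> J1continuous T F ->
    ((fun N => \int[P]_w (F (X N w))%:E) @ \oo --> \int[Q]_w (F (Y w))%:E)%E.

Section Psi.
Context {R : realType} (ps : R -> R).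
Definition IofPsi' (u : R) : R := u * derive1 ps u - ps u.
Definition Iinv (y : R) : R := derive1 ps (xget 0 [set u | 0 <= u /\ IofPsi' u = y]).
Definition lambda1 : R := derive1 ps 1 - ps 1.
Definition lambda2 : R := 2 * derive1 ps 2 - ps 2.
End Psi.

Section Norming.
Context {d : measure_display} {Om : measurableType d} {R : realType}
  (P : probability Om R) (xi : nat -> R -> Om -> R) (s : nat -> R)
  (lam alpha : R).
Let ps := psi P (xi 0%N).

Definition Z (N : nat) (w : Om) (t : R) : R := \sum_(i < N) expR (xi i (s N + t) w).

Definition Bn (N : nat) (t : R) : R :=
  expR (ps alpha / alpha * t) *
  expR (s N * Iinv ps ((ln N%:R - ln (alpha * Num.sqrt (2 * pi * derive1n 2 ps alpha * s N)))
                        / s N)).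

Definition An (N : nat) (t : R) : R :=
  if lam < lambda1 ps then 0
  else if lam == lambda1 ps then
    expR (ps 1 * t) * N%:R *
    Ex P (fun w => expR (xi 0%N (s N) w) *
                   (if xi 0%N (s N) w <= ln (Bn N 0) then 1 else 0))
  else expR (ps 1 * t) * Ex P (fun w => Z N w 0).
End Norming.

(* The limit process Y_{alpha;xi}, given Gamma_j = E_0 + ... + E_j and
   U_j = Gamma_j^(-1/alpha); [Ylim] says Y w t is the defining (a.s.) limit. *)
Section Limit.
Context {d : measure_display} {Om : measurableType d} {R : realType}
  (ps : R -> R) (alpha : R) (xi : nat -> R -> Om -> R) (E : nat -> Om -> R).

Definition Gam (j : nat) (w : Om) : R := \sum_(l < j.+1) E l w.
Definition Upt (j : nat) (w : Om) : R := Gam j w `^ (- alpha^-1).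

Definition Ylim (w : Om) (t y : R) : Prop :=
  if alpha < 1 then
    (fun n => \sum_(i < n) Upt i w * expR (xi i t w - ps alpha / alpha * t)) @ \oo --> y
  else if alpha == 1 then
    (fun tau => limn (fun n => \sum_(i < n) (if tau < Upt i w then Upt i w * expR (xi i t w - ps 1 * t) else 0))
               - ln tau^-1) @ 0^'+ --> y
  else
    (fun tau => limn (fun n => \sum_(i < n) (if tau < Upt i w
                               then Upt i w * expR (xi i t w - ps alpha / alpha * t) else 0))
               - alpha * tau `^ (1 - alpha) / (alpha - 1) *
                 expR ((ps 1 - ps alpha / alpha) * t)) @ 0^'+ --> y.
End Limit.

(* Main.v *)
(** Tilting the law of [xi(s_N)] by [e^(alpha x)] and a local limit theorem give, with
    bounds uniform in the level, [N P(xi(s_N) - log B_N(0) > x) -> e^(- alpha x)].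
    By the Renyi representation the decreasing rearrangement of the [N] weights is the
    quantile function evaluated at sums of exponentials, so that on a suitable space the
    [j]-th largest weight converges almost surely to [Gamma_j^(-1/alpha)]; the increments
    after time [s_N] are exchangeable and independent of the rearrangement, and comparing
    Laplace transforms shows that the resulting process has the law of [Z_N] on finite grids.
    The compensated contribution of the weights below a level [u] is an [L^2] martingale after
    division by its mean growth, hence uniformly small by Kolmogorov's inequality, with a
    variance that vanishes as [u -> -oo] because [alpha < 2]. Levels and indices chosen along
    a Borel-Cantelli sequence then give almost sure uniform convergence of the coupled
    processes to [Y], and [J1]-continuity is only ever applied to paths that are approximated
    by step functions read off on a finite grid. *)

Require Import Defs.
From HB Require Import structures.
From mathcomp Require Import all_boot all_order all_algebra.
From mathcomp Require Import all_classical all_reals all_analysis measurable_realfun.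
From mathcomp Require Import ring lra.
Set Implicit Arguments. Unset Strict Implicit. Unset Printing Implicit Defensive.
Import Order.TTheory GRing.Theory Num.Theory.
Import numFieldNormedType.Exports.
Local Open Scope classical_set_scope.
Local Open Scope ring_scope.

(** * Independence and expectations *)

(** The two sides live on unrelated spaces and are known through finite-dimensional laws only. The
    coupling is therefore built on the space [Q] of the limit: the exponentials [E] behind the
    arrivals Gamma_j also produce, through spacings and the quantile function of xi(s_N), the
    ordered weights, while [xi'] supplies the growth. Estimates proved on [P] reach [Q] only through
    equality of laws on finite grids. The tilt has to move with N: it solves I(psi'(th)) = y_N, with
    y_N the argument of I^-1 in B_N, so that the logarithmic correction in B_N cancels the
    local-limit factor exactly. Bounds on characteristic functions must then be uniform over tilts
    near alpha. Smoothing uses the Fejer kernel, whose transform has compact support: only a bounded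
    frequency window occurs, where a non-lattice law is controlled. The smoothing is undone by the
    one-sided bound T(x + h) <= e^(th h) T(x). Truncated sums converge without a rate, so
    subsequences are chosen against tail probabilities. J1-continuity of F is also the source of its
    measurability along paths. *)

Section Decoupling.
Context {d : measure_display} {Om : measurableType d} {R : realType}
  (P : probability Om R).

(** The product formula on rectangles forces the law of the pair to be the product of the marginal
    laws; Tonelli does the rest. *)
Lemma integral_indep d1 d2 (T1 : measurableType d1) (T2 : measurableType d2)
    (X : Om -> T1) (Y : Om -> T2) (K : T1 * T2 -> \bar R) :
  measurable_fun setT X -> measurable_fun setT Y ->
  (forall A B, measurable A -> measurable B ->
    P (X @^-1` A `&` Y @^-1` B) = P (X @^-1` A) * P (Y @^-1` B))%E ->
  measurable_fun setT K -> (forall x, 0 <= K x)%E ->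
  (\int[P]_w K (X w, Y w) = \int[P]_w \int[P]_w' K (X w, Y w'))%E.
Proof.
move=> mX mY ind mK K0.
have mXY : measurable_fun setT (fun w => (X w, Y w)).
  exact/measurable_fun_pair.
pose X' : {mfun Om >-> T1} := HB.pack X (isMeasurableFun.Build _ _ _ _ X mX).
pose Y' : {mfun Om >-> T2} := HB.pack Y (isMeasurableFun.Build _ _ _ _ Y mY).
pose Z : {mfun Om >-> (T1 * T2)%type} :=
  HB.pack (fun w => (X w, Y w)) (isMeasurableFun.Build _ _ _ _ _ mXY).
transitivity (\int[distribution P Z]_z K z)%E.
  by rewrite ge0_integral_distribution.
have E A : measurable A ->
    (distribution P X' \x distribution P Y')%E A = distribution P Z A.
  by move=> mA; apply: product_measure_unique => // B C mB mC; exact: ind.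
rewrite -(eq_measure_integral _ (fun A mA _ => E A mA)).
rewrite fubini_tonelli1//.
have mF := @measurable_fun_fubini_tonelli_F _ _ T1 T2 R (distribution P Y') K mK K0.
rewrite /fubini_F (ge0_integral_distribution X' mF); last first.
  by move=> x; apply: integral_ge0.
apply: eq_integral => w _ /=; rewrite /fubini_F/=.
rewrite (ge0_integral_distribution Y' (f := fun y => K (X w, y)))//.
exact: measurableT_comp.
Qed.

(** With [B] fixed, the product formula is stable under complements and disjoint countable unions,
    so Dynkin's theorem applies. *)
Lemma dynkin_indep (G : set (set Om)) (B : set Om) :
  (G `<=` measurable) -> setI_closed G -> measurable B ->
  (forall A, G A -> P (A `&` B) = P A * P B)%E ->
  forall A, <<s G >> A -> (P (A `&` B) = P A * P B)%E.
Proof.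
move=> Gm GI mB H A.
have sm C : <<s G >> C -> measurable C.
  by apply: smallest_sub => //; exact: sigma_algebra_measurable.
have fin (C : set Om) : measurable C -> P C \is a fin_num.
  by move=> ?; exact: fin_num_measure.
have auxC (S : set Om) : measurable S -> (P (S `&` B) = P S * P B)%E ->
    (P (~` S `&` B) = P (~` S) * P B)%E.
  move=> mS HS.
  have -> : (P (~` S `&` B) = P B - P (S `&` B))%E.
    rewrite setIC -setDE measureD//; last by rewrite (le_lt_trans (probability_le1 _ mB)) ?ltry.
    by rewrite (setIC B).
  rewrite HS probability_setC// muleBl ?mul1e//; first by exact: fin.
have auxU (F : (set Om)^nat) : (forall n, measurable (F n)) -> trivIset setT F ->
    (forall n, P (F n `&` B) = P (F n) * P B)%E ->
    (P (\bigcup_k F k `&` B) = P (\bigcup_k F k) * P B)%E.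
  move=> mF tF HF.
  rewrite setI_bigcupl !measure_bigcup//; last 2 first.
  - by move=> n _; apply: measurableI.
  - by apply: trivIset_setIr.
  rewrite muleC -(fineK (fin _ mB)) -nneseriesZl//.
  by apply: eq_eseriesr => n _; rewrite fineK ?fin// muleC; exact: HF.
apply: (@dynkin_induction _ (g_sigma_algebraType G) G
  (fun A => P (A `&` B) = P A * P B)%E) => //.
- by rewrite setTI probability_setT mul1e.
- by move=> S /sm mS HS; exact: auxC.
- by move=> F mF tF HF; exact: (auxU F (fun n => sm _ (mF n)) tF HF).
Qed.

Lemma gsigma_indep (G H : set (set Om)) :
  (G `<=` measurable) -> (H `<=` measurable) -> setI_closed G -> setI_closed H ->
  (forall A B, G A -> H B -> P (A `&` B) = P A * P B)%E ->
  forall A B, <<s G >> A -> <<s H >> B -> (P (A `&` B) = P A * P B)%E.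
Proof.
move=> Gm Hm GI HI ind A B sA sB.
have mA : measurable A.
  by move: A sA; apply: smallest_sub => //; exact: sigma_algebra_measurable.
rewrite setIC muleC; apply: (dynkin_indep Hm HI mA _ sB) => C HC.
rewrite setIC muleC; apply: (dynkin_indep Gm GI _ _ sA); first exact: Hm.
by move=> D GD; exact: ind.
Qed.

(** Stated for pi-systems, so that independence is checked on cylinders only; [decouple] passes to
    the generated sigma-algebras. *)
Definition indep_sys (G H : set (set Om)) :=
  [/\ G `<=` measurable, H `<=` measurable, setI_closed G, setI_closed H &
   forall A B, G A -> H B -> (P (A `&` B) = P A * P B)%E].

(** Conditioning in Fubini form: the identity, seen as a map into each of the two generated
    sigma-algebras, plays the role of an independent pair, so one half of the randomness is frozen
    while the other is integrated. *)
Lemma decouple (G H : set (set Om))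
   (K : g_sigma_algebraType G * g_sigma_algebraType H -> \bar R) :
  indep_sys G H -> measurable_fun setT K -> (forall x, 0 <= K x)%E ->
  (\int[P]_w K (w, w) = \int[P]_w \int[P]_w' K (w, w'))%E.
Proof.
move=> [Gm Hm GI HI ind] mK K0.
apply: (@integral_indep _ _ (g_sigma_algebraType G) (g_sigma_algebraType H)
  idfun idfun K _ _ _ mK K0).
- move=> _ A mA; rewrite setTI.
  by move: A mA; apply: smallest_sub => //; exact: sigma_algebra_measurable.
- move=> _ A mA; rewrite setTI.
  by move: A mA; apply: smallest_sub => //; exact: sigma_algebra_measurable.
- by move=> A B mA mB; exact: (gsigma_indep Gm Hm).
Qed.

(** The generated sigma-algebra is imposed by retyping the domain of [f], so ordinary measurability
    lemmas apply to it. *)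
Definition gmeas (G : set (set Om)) (f : Om -> R) :=
  measurable_fun setT (f : g_sigma_algebraType G -> R).

Lemma gmeasP (G : set (set Om)) f : G `<=` measurable -> gmeas G f -> measurable_fun setT f.
Proof.
move=> Gm mf _ A mA; rewrite setTI.
have := mf measurableT A mA; rewrite setTI.
by move: (f @^-1` A); apply: smallest_sub => //; exact: sigma_algebra_measurable.
Qed.

Lemma gmeas_sub (G H : set (set Om)) f : G `<=` H -> gmeas G f -> gmeas H f.
Proof.
move=> GH mf _ A mA.
have := mf measurableT A mA.
by apply: sub_smallest2r => //; exact: smallest_sigma_algebra.
Qed.

Lemma Ex_bnd_int (f : Om -> R) M : measurable_fun setT f ->
  (forall w, `|f w| <= M) -> P.-integrable setT (EFin \o f).
Proof.
move=> mf fM.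
apply: (@le_integrable _ _ _ _ _ measurableT _ (EFin \o cst M)).
- exact/measurable_EFinP.
- by move=> w _ /=; rewrite lee_fin (le_trans (fM w))// ler_norm.
- exact: finite_measure_integrable_cst.
Qed.

Lemma Ex_EFin (f : Om -> R) : P.-integrable setT (EFin \o f) ->
  (\int[P]_w (f w)%:E = (Ex P f)%:E)%E.
Proof. by move=> fi; rewrite /Ex fineK//; exact: integrable_fin_num. Qed.

Lemma Ex_indep_ge0 (G H : set (set Om)) (f g : Om -> R) :
  indep_sys G H -> gmeas G f -> gmeas H g -> 
  (forall w, 0 <= f w) -> (forall w, 0 <= g w) ->
  (\int[P]_w (f w * g w)%:E = \int[P]_w (f w)%:E * \int[P]_w (g w)%:E)%E.
Proof.
move=> ind mf mg f0 g0.
have [Gm Hm _ _ _] := ind.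
have mf' := gmeasP Gm mf; have mg' := gmeasP Hm mg.
have -> : (\int[P]_w (f w * g w)%:E = \int[P]_w \int[P]_w' (f w * g w')%:E)%E.
  apply: (@decouple G H (fun z => (f z.1 * g z.2)%:E)) => //.
    apply/measurable_EFinP; apply: measurable_funM.
      exact: (@measurableT_comp _ _ _ _ _ _ (f : g_sigma_algebraType G -> R)).
    exact: (@measurableT_comp _ _ _ _ _ _ (g : g_sigma_algebraType H -> R)).
  by move=> x; rewrite lee_fin mulr_ge0.
under eq_integral do under eq_integral do rewrite EFinM.
under eq_integral => w _.
  rewrite ge0_integralZl//; last 3 first.
  - exact/measurable_EFinP.
  - by move=> w' _; rewrite lee_fin.
  - by rewrite lee_fin.
  over.
rewrite ge0_integralZr//; first exact/measurable_EFinP.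
- by move=> w _; rewrite lee_fin.
- by apply: integral_ge0 => w' _; rewrite lee_fin.
Qed.

(** Positive and negative parts reduce it to the nonnegative case, which also yields integrability
    of the product. *)
Lemma Ex_indep (G H : set (set Om)) (f g : Om -> R) :
  indep_sys G H -> gmeas G f -> gmeas H g -> 
  P.-integrable setT (EFin \o f) -> P.-integrable setT (EFin \o g) ->
  P.-integrable setT (EFin \o (fun w => f w * g w)) /\
  Ex P (fun w => f w * g w) = Ex P f * Ex P g.
Proof.
move=> ind mf mg fi gi.
have [Gm Hm _ _ _] := ind.
have mf' := gmeasP Gm mf; have mg' := gmeasP Hm mg.
have key u v : gmeas G u -> gmeas H v -> P.-integrable setT (EFin \o u) -> P.-integrable setT (EFin \o v) ->
   (forall w, 0 <= u w) -> (forall w, 0 <= v w) ->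
   P.-integrable setT (EFin \o (fun w => u w * v w)) /\
   Ex P (fun w => u w * v w) = Ex P u * Ex P v.
  move=> mu mv ui vi u0 v0.
  have E := Ex_indep_ge0 ind mu mv u0 v0.
  have mu' := gmeasP Gm mu; have mv' := gmeasP Hm mv.
  rewrite (Ex_EFin ui) (Ex_EFin vi) -EFinM in E.
  split; last by rewrite /Ex E.
  apply/integrableP; split; first by apply/measurable_EFinP; exact: measurable_funM.
  under eq_integral => w _ do rewrite /= ger0_norm ?mulr_ge0//.
  by rewrite E ltry.
pose fp w := Num.max (f w) 0; pose fn w := Num.max (- f w) 0.
pose gp w := Num.max (g w) 0; pose gn w := Num.max (- g w) 0.
have fE w : f w = fp w - fn w.
  by rewrite /fp /fn; case: (leP (f w) 0) => h; case: (leP (- f w) 0) => h'; lra.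
have gE w : g w = gp w - gn w.
  by rewrite /gp /gn; case: (leP (g w) 0) => h; case: (leP (- g w) 0) => h'; lra.
have mfp : gmeas G fp by apply: measurable_maxr => //; exact: measurable_cst.
have mfn : gmeas G fn.
  by apply: measurable_maxr; [exact: measurableT_comp mf | exact: measurable_cst].
have mgp : gmeas H gp by apply: measurable_maxr => //; exact: measurable_cst.
have mgn : gmeas H gn.
  by apply: measurable_maxr; [exact: measurableT_comp mg | exact: measurable_cst].
have dom (h k : Om -> R) : measurable_fun setT h -> (forall w, `|h w| <= `|k w|) ->
   P.-integrable setT (EFin \o k) -> P.-integrable setT (EFin \o h).
  move=> mh hk; apply: le_integrable => //; first exact/measurable_EFinP.
  by move=> w _; rewrite /= lee_fin.
have nb (x : R) : `|Num.max x 0| <= `|x| /\ `|Num.max (- x) 0| <= `|x|.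
  by split; [case: (leP x 0) | case: (leP (- x) 0)]; rewrite ?normr0 ?normrN.
have fpi : P.-integrable setT (EFin \o fp) by apply: (dom _ f) => //; [exact: (gmeasP Gm mfp)|move=> w; case: (nb (f w))].
have fni : P.-integrable setT (EFin \o fn) by apply: (dom _ f) => //; [exact: (gmeasP Gm mfn)|move=> w; case: (nb (f w))].
have gpi : P.-integrable setT (EFin \o gp) by apply: (dom _ g) => //; [exact: (gmeasP Hm mgp)|move=> w; case: (nb (g w))].
have gni : P.-integrable setT (EFin \o gn) by apply: (dom _ g) => //; [exact: (gmeasP Hm mgn)|move=> w; case: (nb (g w))].
have ge (x : R) : 0 <= Num.max x 0 by rewrite le_max lexx orbT.
have [i1 e1] := key _ _ mfp mgp fpi gpi (fun w => ge _) (fun w => ge _).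
have [i2 e2] := key _ _ mfp mgn fpi gni (fun w => ge _) (fun w => ge _).
have [i3 e3] := key _ _ mfn mgp fni gpi (fun w => ge _) (fun w => ge _).
have [i4 e4] := key _ _ mfn mgn fni gni (fun w => ge _) (fun w => ge _).
have E : (fun w => f w * g w) =
   (fun w => (fp w * gp w - fp w * gn w) - (fn w * gp w - fn w * gn w)).
  by apply/funext => w; rewrite fE gE; ring.
have i12 : P.-integrable setT (EFin \o (fun w => fp w * gp w - fp w * gn w)).
  exact: (integrableB measurableT i1 i2).
have i34 : P.-integrable setT (EFin \o (fun w => fn w * gp w - fn w * gn w)).
  exact: (integrableB measurableT i3 i4).
rewrite E; split; first exact: (integrableB measurableT i12 i34).
have -> : Ex P f = Ex P fp - Ex P fn.
  rewrite -[RHS](@RintegralB _ _ _ P setT)//.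
  by apply: eq_Rintegral => w _; rewrite fE.
have -> : Ex P g = Ex P gp - Ex P gn.
  rewrite -[RHS](@RintegralB _ _ _ P setT)//.
  by apply: eq_Rintegral => w _; rewrite gE.
transitivity (Ex P (fun w => fp w * gp w - fp w * gn w) - Ex P (fun w => fn w * gp w - fn w * gn w)).
  exact: (@RintegralB _ _ _ P setT).
have -> : Ex P (fun w => fp w * gp w - fp w * gn w) = Ex P (fun w => fp w * gp w) - Ex P (fun w => fp w * gn w).
  exact: (@RintegralB _ _ _ P setT).
have -> : Ex P (fun w => fn w * gp w - fn w * gn w) = Ex P (fun w => fn w * gp w) - Ex P (fun w => fn w * gn w).
  exact: (@RintegralB _ _ _ P setT).
by rewrite e1 e2 e3 e4; ring.
Qed.

End Decoupling.

Section Cylinders.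
Context {d : measure_display} {Om : measurableType d} {R : realType}
  (P : probability Om R).

Lemma prob_EFin (A : set Om) : measurable A -> P A = (prob P A)%:E.
Proof. by move=> mA; rewrite /prob fineK//; exact: fin_num_measure. Qed.

Lemma prob_setT : prob P setT = 1.
Proof. by rewrite /prob probability_setT. Qed.

Lemma Ex_indic (A : set Om) : measurable A -> Ex P (\1_A) = prob P A.
Proof. by move=> mA; rewrite /Ex integral_indic// setIT. Qed.

Lemma indep_sysP (G H : set (set Om)) : G `<=` measurable -> H `<=` measurable ->
  setI_closed G -> setI_closed H ->
  (forall A B, G A -> H B -> prob P (A `&` B) = prob P A * prob P B) ->
  indep_sys P G H.
Proof.
move=> Gm Hm GI HI ind; split => // A B GA HB.
rewrite !prob_EFin ?ind ?EFinM//; [exact: Hm|exact: Gm|].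
by apply: measurableI; [exact: Gm|exact: Hm].
Qed.

Lemma indep_sys_sym (G H : set (set Om)) : indep_sys P G H -> indep_sys P H G.
Proof.
by move=> [? ? ? ? ind]; split => // A B HA GB; rewrite setIC ind// muleC.
Qed.

Lemma Ex_cst c : Ex P (fun=> c) = c.
Proof.
transitivity (c * prob P setT); last by rewrite prob_setT mulr1.
exact: (@Rintegral_cst _ _ _ P setT).
Qed.

Definition cyl (I : choiceType) (X : I -> Om -> R) (A : set I) : set (set Om) :=
  [set C | exists B : I -> set R, (forall i, measurable (B i)) /\
     C = \bigcap_(i in A) X i @^-1` B i].

Section cyl.
Context (I : choiceType) (X : I -> Om -> R) (A : set I).
Hypotheses (mX : forall i, measurable_fun setT (X i)) (fA : finite_set A).

Lemma cyl_measurable : cyl X A `<=` measurable.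
Proof.
move=> _ [B [mB ->]]; apply: fin_bigcap_measurable => // i _.
by rewrite -[X in measurable X]setTI; exact: mX.
Qed.

Lemma cylI : setI_closed (cyl X A).
Proof.
move=> _ _ [B [mB ->]] [B' [mB' ->]].
exists (fun i => B i `&` B' i); split; first by move=> i; exact: measurableI.
by rewrite -bigcapI; apply: eq_bigcapr.
Qed.

Lemma cylT : cyl X A setT.
Proof.
exists (fun=> setT); split => //; apply/esym/seteqP; split => // w _ i _ //.
Qed.

Lemma cyl_gmeas i : A i -> gmeas (cyl X A) (X i).
Proof.
move=> Ai _ B mB; rewrite setTI; apply: sub_sigma_algebra.
exists (fun j => if j == i then B else setT); split.
  by move=> j; case: ifP.
apply/seteqP; split=> [w Bw j Aj /=|w /(_ i Ai)/=]; last by rewrite eqxx.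
by case: eqP => // ->.
Qed.

End cyl.

(** Indices outside a block receive [setT]. Both cylinders and their intersection then become
    intersections over the whole index type, where the mutual product formula applies. *)
Lemma mutual_indep (I : finType) (X : I -> Om -> R) (A A' : pred I) :
  (forall i, measurable_fun setT (X i)) ->
  (forall B : I -> set R, (forall i, measurable (B i)) ->
    prob P (\bigcap_i X i @^-1` B i) = \prod_i prob P (X i @^-1` B i)) ->
  (forall i, A i -> A' i -> False) ->
  indep_sys P (cyl X [set i | A i]) (cyl X [set i | A' i]).
Proof.
move=> mX mut dis.
have fin (D : set I) : finite_set D by exact: finite_finset.
apply: indep_sysP.
- exact: cyl_measurable.
- exact: cyl_measurable.
- exact: cylI.
- exact: cylI.
have red (D : pred I) (B : I -> set R) : (forall i, measurable (B i)) ->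
   prob P (\bigcap_(i in [set i | D i]) X i @^-1` B i) =
   \prod_i prob P (X i @^-1` (if D i then B i else setT)).
  move=> mB; rewrite -mut; last by move=> i; case: ifP.
  congr prob; apply/seteqP; split=> w H i /=.
    by move=> _; case: ifP => // Di; exact: H.
  by move=> Di; have := H i Logic.I => /=; rewrite Di.
move=> _ _ [B [mB ->]] [B' [mB' ->]].
rewrite !red// -big_split/=.
transitivity (\prod_i prob P (X i @^-1` (if A i then B i else if A' i then B' i else setT))).
  rewrite -mut; last by move=> i; case: ifP => //; case: ifP.
  congr prob; apply/seteqP; split=> [w [H1 H2] i _/=|w H].
    case: ifP => Ai; first exact: H1.
    by case: ifP => // A'i; exact: H2.
  split=> i /= Ai; have := H i Logic.I => /=; rewrite ?Ai//.
  by case: ifP => // Ai' _; case: (dis _ Ai' Ai).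
apply: eq_bigr => i _; case: ifP => Ai; case: ifP => A'i; rewrite ?preimage_setT ?prob_setT ?mulr1 ?mul1r//.
by case: (dis _ Ai A'i).
Qed.

(** Serves as the past of block [n] in inductions over independent blocks. *)
Definition joint (n : nat) (G : nat -> set (set Om)) : set (set Om) :=
  [set C | exists A : nat -> set Om, (forall i, G i (A i)) /\
    C = \bigcap_(i in `I_n) A i].

Section joint.
Context (G : nat -> set (set Om)).
Hypotheses (Gm : forall i, G i `<=` measurable) (GI : forall i, setI_closed (G i))
  (GT : forall i, G i setT).
Hypothesis ind : forall n (A : nat -> set Om), (forall i, G i (A i)) ->
  prob P (\bigcap_(i in `I_n) A i) = \prod_(i < n) prob P (A i).

Lemma joint_measurable n : joint n G `<=` measurable.
Proof.
move=> _ [A [GA ->]]; apply: fin_bigcap_measurable => // i _; exact: Gm.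
Qed.

Lemma jointI n : setI_closed (joint n G).
Proof.
move=> _ _ [A [GA ->]] [B [GB ->]].
exists (fun i => A i `&` B i); split; first by move=> i; exact: GI.
by rewrite -bigcapI.
Qed.

Lemma joint_sub n i : (i < n)%N -> G i `<=` joint n G.
Proof.
move=> ilt A GA; exists (fun j => if j == i then A else setT); split.
  by move=> j; case: eqP => // ->.
apply/seteqP; split=> [w Aw j _ /=|w /(_ i ilt)]; last by rewrite eqxx.
by case: ifP.
Qed.

Lemma joint_indep n : indep_sys P (joint n G) (G n).
Proof.
apply: indep_sysP => //; [exact: joint_measurable|exact: jointI|].
move=> _ B [A [GA ->]] GB; rewrite ind//.
transitivity (prob P (\bigcap_(i in `I_n.+1) (if (i < n)%N then A i else
    if i == n then B else setT))).
  congr prob; apply/seteqP; split=> [w [H Bw] i /= _|w H].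
    by case: ifPn => // ilt; [exact: H|case: ifP].
  split=> [i /= ilt|]; first by have := H i (ltnW ilt); rewrite ilt.
  by have := H n (ltnSn n); rewrite ltnn eqxx.
rewrite ind; last first.
  by move=> i; case: ifP => // _; case: eqP => // ->.
rewrite big_ord_recr/= ltnn eqxx; congr (_ * _).
by apply: eq_bigr => i _; rewrite ltn_ord.
Qed.

Lemma gmeas_prod (I : Type) (H : set (set Om)) (r : seq I) (p : pred I) (f : I -> Om -> R) :
  (forall i, p i -> gmeas H (f i)) -> gmeas H (fun w => \prod_(i <- r | p i) f i w).
Proof.
move=> mf; elim: r => [|i r IH].
  by under eq_fun do rewrite big_nil; exact: measurable_cst.
have [pi|pi] := boolP (p i); last first.
  by under eq_fun do rewrite big_cons (negbTE pi).
under eq_fun do rewrite big_cons pi.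
by apply: measurable_funM => //; exact: mf.
Qed.

Lemma Ex_prod n (f : nat -> Om -> R) :
  (forall i, gmeas (G i) (f i)) -> (forall i, P.-integrable setT (EFin \o f i)) ->
  P.-integrable setT (EFin \o (fun w => \prod_(i < n) f i w)) /\
  Ex P (fun w => \prod_(i < n) f i w) = \prod_(i < n) Ex P (f i).
Proof.
move=> mf fi; elim: n => [|n [IH1 IH2]].
  under eq_fun do rewrite big_ord0.
  rewrite big_ord0 Ex_cst; split => //.
  exact: finite_measure_integrable_cst.
under eq_fun do rewrite big_ord_recr/=.
rewrite big_ord_recr/= -IH2.
apply: (Ex_indep (joint_indep n)) => //.
apply: gmeas_prod => i _; apply: gmeas_sub (mf i).
exact: joint_sub.
Qed.

(** The product formula for expectations, applied to indicators, upgrades independence from the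
    generating pi-systems to their sigma-algebras. *)
Lemma joint_prob n (A : nat -> set Om) : (forall i, <<s G i >> (A i)) ->
  prob P (\bigcap_(i in `I_n) A i) = \prod_(i < n) prob P (A i).
Proof.
move=> sA.
have mA i : measurable (A i).
  by move: (A i) (sA i); apply: smallest_sub => //; exact: sigma_algebra_measurable.
have [] := @Ex_prod n (fun i => \1_(A i)).
- by move=> i; rewrite /gmeas; apply: measurable_indic; exact: sA.
- move=> i; apply: (@Ex_bnd_int _ _ _ _ _ 1); first exact: measurable_indic.
  by move=> w; rewrite indicE ger0_norm// lern1 leq_b1.
move=> _; rewrite -Ex_indic; last by apply: fin_bigcap_measurable.
have -> : \prod_(i < n) prob P (A i) = \prod_(i < n) Ex P (\1_(A i)).
  by apply: eq_bigr => i _; rewrite Ex_indic.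
move=> <-; congr Ex; apply/funext => w.
rewrite indicE.
have [H|H] := pselect ((\bigcap_(i in `I_n) A i) w).
  rewrite mem_set//= big1// => i _.
  by rewrite indicE (mem_set (H i (ltn_ord i))).
rewrite memNset//=; apply/esym/eqP; rewrite prodf_seq_eq0/=.
move/existsNP : H => [i /not_implyP [/= ilt nA]].
apply/hasP; exists (Ordinal ilt); rewrite ?mem_index_enum//=.
by rewrite indicE memNset.
Qed.

End joint.

End Cylinders.

Section ExLemmas.
Context {d : measure_display} {Om : measurableType d} {R : realType}
  (P : probability Om R).
Local Notation intble f := (P.-integrable setT (EFin \o f)).

Lemma intble_le (f g : Om -> R) : measurable_fun setT f ->
  (forall w, `|f w| <= g w) -> intble g -> intble f.
Proof.
move=> mf fg; apply: le_integrable => //; first exact/measurable_EFinP.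
by move=> w _; rewrite /= lee_fin (le_trans (fg w))// ler_norm.
Qed.

Lemma intble_meas (f : Om -> R) : intble f -> measurable_fun setT f.
Proof. by move=> /integrableP[/measurable_EFinP]. Qed.

Lemma ExD (f g : Om -> R) : intble f -> intble g ->
  Ex P (fun w => f w + g w) = Ex P f + Ex P g.
Proof. by move=> fi gi; exact: (@RintegralD _ _ _ P setT). Qed.

Lemma ExB (f g : Om -> R) : intble f -> intble g ->
  Ex P (fun w => f w - g w) = Ex P f - Ex P g.
Proof. by move=> fi gi; exact: (@RintegralB _ _ _ P setT). Qed.

Lemma ExZl c (f : Om -> R) : intble f -> Ex P (fun w => c * f w) = c * Ex P f.
Proof. by move=> fi; exact: (@RintegralZl _ _ _ P setT). Qed.

Lemma intbleD (f g : Om -> R) : intble f -> intble g -> intble (fun w => f w + g w).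
Proof. by move=> fi gi; exact: (integrableD measurableT fi gi). Qed.

Lemma intbleB (f g : Om -> R) : intble f -> intble g -> intble (fun w => f w - g w).
Proof. by move=> fi gi; exact: (integrableB measurableT fi gi). Qed.

Lemma intbleZl c (f : Om -> R) : intble f -> intble (fun w => c * f w).
Proof. by move=> fi; exact: (integrableZl measurableT c fi). Qed.

Lemma intble_cst c : intble (fun=> c).
Proof. exact: finite_measure_integrable_cst. Qed.

Lemma intble_sum (I : Type) (r : seq I) (p : pred I) (f : I -> Om -> R) :
  (forall i, p i -> intble (f i)) -> intble (fun w => \sum_(i <- r | p i) f i w).
Proof.
move=> fi; elim: r => [|i r IH].
  by under eq_fun do rewrite big_nil; exact: intble_cst.
have [pi|pi] := boolP (p i); last first.
  by under eq_fun do rewrite big_cons (negbTE pi).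
under eq_fun do rewrite big_cons pi.
by apply: intbleD => //; exact: fi.
Qed.

Lemma Ex_sum (I : Type) (r : seq I) (p : pred I) (f : I -> Om -> R) :
  (forall i, p i -> intble (f i)) ->
  Ex P (fun w => \sum_(i <- r | p i) f i w) = \sum_(i <- r | p i) Ex P (f i).
Proof.
move=> fi; elim: r => [|i r IH].
  by under eq_fun do rewrite big_nil; rewrite Ex_cst big_nil.
rewrite big_cons; have [pi|pi] := boolP (p i); last first.
  by under eq_fun do rewrite big_cons (negbTE pi).
under eq_fun do rewrite big_cons pi.
by rewrite ExD ?IH//; [exact: fi|exact: intble_sum].
Qed.

Lemma le_Ex (f g : Om -> R) : intble f -> intble g -> (forall w, f w <= g w) ->
  Ex P f <= Ex P g.
Proof. by move=> fi gi fg; apply: (@le_Rintegral _ _ _ P setT). Qed.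

Lemma Ex_ge0 (f : Om -> R) : (forall w, 0 <= f w) -> 0 <= Ex P f.
Proof. by move=> f0; apply: (@Rintegral_ge0 _ _ _ P setT). Qed.

Lemma Ex_norm (f : Om -> R) : intble f -> `|Ex P f| <= Ex P (fun w => `|f w|).
Proof. by move=> fi; exact: (@le_normr_Rintegral _ _ _ P setT). Qed.

Lemma Ex_bnd (f g : Om -> R) : measurable_fun setT f -> intble g ->
  (forall w, `|f w| <= g w) -> `|Ex P f| <= Ex P g.
Proof.
move=> mf gi fg; have fi := intble_le mf fg gi.
apply: (le_trans (Ex_norm fi)); apply: le_Ex => //.
exact: integrable_norm.
Qed.

Lemma prob_setC (A : set Om) : measurable A -> prob P (~` A) = 1 - prob P A.
Proof. by move=> mA; rewrite /prob probability_setC// fineB// fin_num_measure. Qed.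

Lemma Ex_eq0_ae (f : Om -> R) : intble f -> (forall w, 0 <= f w) -> Ex P f = 0 ->
  prob P [set w | f w = 0] = 1.
Proof.
move=> fi f0 E0.
have mf := intble_meas fi.
have mfE : measurable_fun setT (EFin \o f) by exact/measurable_EFinP.
have /(ae_eq_integral_abs P measurableT mfE) : (\int[P]_w `|(EFin \o f) w| = 0)%E.
  under eq_integral => w _ do rewrite /= ger0_norm//.
  by rewrite Ex_EFin// E0.
move=> [N [mN N0 sub]].
have mA : measurable [set w | f w = 0].
  have := mf measurableT [set 0] (measurable_set1 0); rewrite setTI.
  by congr measurable; apply/seteqP; split.
have -> : prob P [set w | f w = 0] = 1 - prob P (~` [set w | f w = 0]).
  by rewrite prob_setC//; lra.
rewrite [X in _ - X](_ : _ = 0) ?subr0// /prob.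
have /eqP : P (~` [set w | f w = 0]) == 0%E.
  rewrite eq_le measure_ge0 andbT -N0; apply: le_measure; rewrite ?inE//.
    exact: measurableC.
  by move=> w nf; apply: sub => /= /(_ Logic.I) [].
by move=> ->.
Qed.

Lemma Ex_gt0 (f : Om -> R) : intble f -> (forall w, 0 < f w) -> 0 < Ex P f.
Proof.
move=> fi f0; rewrite lt_neqAle Ex_ge0; last by move=> w; exact: ltW.
rewrite andbT; apply/eqP => /esym E0.
have := Ex_eq0_ae fi (fun w => ltW (f0 w)) E0.
rewrite (_ : [set w | _] = set0).
  by rewrite /prob measure0 => /eqP; rewrite eq_sym oner_eq0.
by apply/seteqP; split => w //= fw; have := f0 w; rewrite fw ltxx.
Qed.

Definition sig1 (X : Om -> R) : set (set Om) := [set X @^-1` B | B in measurable].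

Lemma sig1_measurable X : measurable_fun setT X -> sig1 X `<=` measurable.
Proof. by move=> mX _ [B mB <-]; rewrite -[X in measurable X]setTI; exact: mX. Qed.

Lemma sig1I X : setI_closed (sig1 X).
Proof.
by move=> _ _ [B mB <-] [B' mB' <-]; exists (B `&` B') => //; exact: measurableI.
Qed.

Lemma sig1_gmeas X (g : R -> R) : measurable_fun setT g -> gmeas (sig1 X) (g \o X).
Proof.
move=> mg _ B mB; rewrite setTI; apply: sub_sigma_algebra.
by exists (g @^-1` B) => //; rewrite -[X in measurable X]setTI; exact: mg.
Qed.

End ExLemmas.

Section Law1.
Context {d1 d2 : measure_display} {O1 : measurableType d1} {O2 : measurableType d2}
  {R : realType} (P1 : probability O1 R) (P2 : probability O2 R).
Variables (X1 : O1 -> R) (X2 : O2 -> R).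
Hypotheses (mX1 : measurable_fun setT X1) (mX2 : measurable_fun setT X2).
Hypothesis law : forall B, measurable B -> prob P1 (X1 @^-1` B) = prob P2 (X2 @^-1` B).

Lemma law1_ge0_integral (f : R -> \bar R) : measurable_fun setT f ->
  (forall x, 0 <= f x)%E -> (\int[P1]_w f (X1 w) = \int[P2]_w f (X2 w))%E.
Proof.
move=> mf f0.
pose Y1 : {mfun O1 >-> R} := HB.pack X1 (isMeasurableFun.Build _ _ _ _ _ mX1).
pose Y2 : {mfun O2 >-> R} := HB.pack X2 (isMeasurableFun.Build _ _ _ _ _ mX2).
rewrite -(@ge0_integral_distribution _ _ _ _ _ P1 Y1)//.
rewrite -(@ge0_integral_distribution _ _ _ _ _ P2 Y2)//.
apply: eq_measure_integral => A mA _; rewrite /distribution/= /pushforward/=.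
have m1 : measurable (X1 @^-1` A) by rewrite -[X in measurable X]setTI; exact: mX1.
have m2 : measurable (X2 @^-1` A) by rewrite -[X in measurable X]setTI; exact: mX2.
by rewrite !prob_EFin//; congr EFin; exact: law.
Qed.

Lemma law1_intble (f : R -> R) : measurable_fun setT f ->
  P1.-integrable setT (EFin \o (f \o X1)) -> P2.-integrable setT (EFin \o (f \o X2)).
Proof.
move=> mf /integrableP[_ H]; apply/integrableP; split.
  by apply/measurable_EFinP; exact: measurableT_comp.
apply: le_lt_trans H.
rewrite (@law1_ge0_integral (fun x => `|f x|%:E)%E)//.
by apply/measurable_EFinP; exact: measurableT_comp.
Qed.

Lemma law1_Ex (f : R -> R) : measurable_fun setT f ->
  P1.-integrable setT (EFin \o (f \o X1)) ->
  Ex P1 (f \o X1) = Ex P2 (f \o X2).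
Proof.
move=> mf i1; have i2 := law1_intble mf i1.
pose fp x := Num.max (f x) 0; pose fn x := Num.max (- f x) 0.
have fE x : f x = fp x - fn x.
  by rewrite /fp /fn; case: (leP (f x) 0) => h; case: (leP (- f x) 0) => h'; lra.
have mfp : measurable_fun setT fp.
  by apply: measurable_maxr => //; exact: measurable_cst.
have mfn : measurable_fun setT fn.
  by apply: measurable_maxr; [exact: measurableT_comp|exact: measurable_cst].
have nb (x : R) : `|Num.max x 0| <= `|x| /\ `|Num.max (- x) 0| <= `|x|.
  by split; [case: (leP x 0) | case: (leP (- x) 0)]; rewrite ?normr0 ?normrN.
have dom d' (O' : measurableType d') (Q : probability O' R) (X : O' -> R) (g : R -> R) : measurable_fun setT X ->
   measurable_fun setT g -> (forall x, `|g x| <= `|f x|) ->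
   Q.-integrable setT (EFin \o (f \o X)) -> Q.-integrable setT (EFin \o (g \o X)).
  move=> mX mg gf; apply: le_integrable => //; first by apply/measurable_EFinP; exact: measurableT_comp.
  by move=> w _; rewrite /= lee_fin.
have p1 := dom _ _ P1 X1 fp mX1 mfp (fun x => (nb (f x)).1) i1.
have p2 := dom _ _ P2 X2 fp mX2 mfp (fun x => (nb (f x)).1) i2.
have n1 := dom _ _ P1 X1 fn mX1 mfn (fun x => (nb (f x)).2) i1.
have n2 := dom _ _ P2 X2 fn mX2 mfn (fun x => (nb (f x)).2) i2.
transitivity (Ex P1 (fp \o X1) - Ex P1 (fn \o X1)).
  by rewrite -ExB//; congr Ex; apply/funext => w; exact: fE.
transitivity (Ex P2 (fp \o X2) - Ex P2 (fn \o X2)); last first.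
  by rewrite -ExB//; congr Ex; apply/funext => w; apply/esym/fE.
congr (_ - _); rewrite /Ex; congr fine.
- apply: (@law1_ge0_integral (fun x => (fp x)%:E)); first exact/measurable_EFinP.
  by move=> x; rewrite lee_fin /fp le_max lexx orbT.
- apply: (@law1_ge0_integral (fun x => (fn x)%:E)); first exact/measurable_EFinP.
  by move=> x; rewrite lee_fin /fn le_max lexx orbT.
Qed.

End Law1.

(** * Exponential moments and their derivatives *)

Section Mgf.
Context {d : measure_display} {Om : measurableType d} {R : realType}
  (P : probability Om R) (X : Om -> R).
Hypothesis mX : measurable_fun setT X.
Hypothesis mgf : forall u, P.-integrable setT (EFin \o (fun w => expR (u * X w))).

(** The inequality 1 + y <= e^y at y = |x| / k, raised to the k-th power. *)
Lemma norm_pow_le_exp (k : nat) (x : R) :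
  `|x| ^+ k <= k%:R ^+ k * (expR x + expR (- x)).
Proof.
case: k => [|k].
  rewrite !expr0 mul1r.
  have := expR_ge1Dx x; have := expR_ge1Dx (- x); lra.
have k0 : (0 : R) < k.+1%:R by rewrite ltr0n.
have H : `|x| ^+ k.+1 <= k.+1%:R ^+ k.+1 * expR `|x|.
  have -> : expR `|x| = expR (`|x| / k.+1%:R) ^+ k.+1.
    by rewrite -expRM_natr divfK// gt_eqF.
  rewrite -exprMn lerXn2r ?nnegrE ?normr_ge0//.
  rewrite mulrC -ler_pdivrMr//.
  by apply: le_trans (expR_ge1Dx _); rewrite lerDr ler01.
apply: (le_trans H); rewrite ler_wpM2l ?exprn_ge0 ?ler0n//.
by case: (ger0P x) => _; rewrite ?lerDl ?lerDr expR_ge0.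
Qed.

(** One integrable majorant for all exponents within distance 1 of [a]; which endpoint dominates
    depends on the sign of [x]. *)
Lemma expR_between (a u x : R) : `|u - a| <= 1 ->
  expR (u * x) <= expR ((a + 1) * x) + expR ((a - 1) * x).
Proof.
rewrite ler_norml => /andP[h1 h2].
have [x0|x0] := leP 0 x.
  apply: (@le_trans _ _ (expR ((a + 1) * x))); last by rewrite lerDl expR_ge0.
  rewrite ler_expR ler_wpM2r//; lra.
apply: (@le_trans _ _ (expR ((a - 1) * x))); last by rewrite lerDr expR_ge0.
by rewrite ler_expR ler_wnM2r//; [exact: ltW | lra].
Qed.

Lemma mom_intble (k : nat) u : P.-integrable setT (EFin \o (fun w => X w ^+ k * expR (u * X w))).
Proof.
have mf : measurable_fun setT (fun w => X w ^+ k * expR (u * X w)).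
  apply: measurable_funM; first exact: measurable_funX.
  by apply: measurableT_comp => //; exact: measurable_funM.
apply: (@intble_le _ _ _ _ _ (fun w => k%:R ^+ k * (expR ((u + 1) * X w) + expR ((u - 1) * X w))) mf).
  move=> w; rewrite normrM normrX (ger0_norm (expR_ge0 _)).
  rewrite mulrDl mulrBl mul1r !expRD -mulrDr mulrCA mulrC.
  by rewrite ler_wpM2l ?expR_ge0// norm_pow_le_exp.
apply: intbleZl; exact: intbleD.
Qed.

Lemma mom_norm_intble (k : nat) u :
  P.-integrable setT (EFin \o (fun w => `|X w| ^+ k * expR (u * X w))).
Proof.
have := integrable_norm (mom_intble k u).
congr (P.-integrable _ _); apply/funext => w /=.
by rewrite normrM normrX (ger0_norm (expR_ge0 _)).
Qed.

Definition mom (k : nat) (u : R) := Ex P (fun w => X w ^+ k * expR (u * X w)).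

(** Differentiation under the integral on the interval of radius 1 around [u], dominated through the
    two endpoint exponents. *)
Lemma is_derive_mom (k : nat) (u : R) : is_derive u 1 (mom k) (mom k.+1 u).
Proof.
pose f u w := X w ^+ k * expR (u * X w).
have df (w : Om) (x : R) : is_derive x 1 (f^~ w) (X w ^+ k.+1 * expR (x * X w)).
  rewrite /f; apply: is_derive_eq.
  by rewrite scaler0 add0r /GRing.scale/= mulr1 exprS; ring.
have p1 x w : partial1of2 f x w = X w ^+ k.+1 * expR (x * X w).
  by rewrite /partial1of2 derive1E; exact: (@derive_val _ _ _ _ _ _ _ (df w x)).
pose G w := `|X w| ^+ k.+1 * expR ((u + 1) * X w) + `|X w| ^+ k.+1 * expR ((u - 1) * X w).
have uI : `]u - 1, u + 1[%classic u by rewrite /= in_itv/=; lra.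
have i0 x : `]u - 1, u + 1[%classic x -> P.-integrable setT (EFin \o f x).
  by move=> _; exact: mom_intble.
have i1 x w : `]u - 1, u + 1[%classic x -> setT w -> derivable (f^~ w) x 1.
  by move=> _ _; exact: (@ex_derive _ _ _ _ _ _ _ (df w x)).
have G0 w : 0 <= G w by rewrite addr_ge0// mulr_ge0 ?exprn_ge0 ?expR_ge0.
have Gi : P.-integrable setT (EFin \o G) by apply: intbleD; exact: mom_norm_intble.
have Gb x w : `]u - 1, u + 1[%classic x -> setT w -> `|partial1of2 f x w| <= G w.
  rewrite /= in_itv/= => /andP[h1 h2] _.
  rewrite p1 normrM normrX (ger0_norm (expR_ge0 _)) /G -mulrDr ler_wpM2l ?exprn_ge0//.
  by apply: expR_between; rewrite ler_norml; apply/andP; split; lra.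
have D := @derivable_under_integral _ _ _ P f setT measurableT u _ _ uI i0 i1 G G0 Gi Gb.
have E := @differentiation_under_integral _ _ _ P f setT measurableT u _ _ uI i0 i1 G G0 Gi Gb.
apply: DeriveDef; first exact: D.
rewrite -derive1E; rewrite [LHS]E.
by apply: eq_Rintegral => w _; rewrite p1.
Qed.

Lemma mom0_gt0 u : 0 < mom 0 u.
Proof.
apply: Ex_gt0; first exact: mom_intble.
by move=> w; rewrite expr0 mul1r expR_gt0.
Qed.

End Mgf.

(** * Levy processes *)

Section Levy.
Context {d : measure_display} {Om : measurableType d} {R : realType}
  (P : probability Om R) (X : R -> Om -> R).
Hypothesis HX : levy P X.

Lemma levy_meas t : measurable_fun setT (X t).
Proof. by case: HX => -[]. Qed.

Lemma levy0 w : X 0 w = 0.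
Proof. by case: HX => -[]. Qed.

Lemma levy_incr_meas s t : measurable_fun setT (fun w => X t w - X s w).
Proof. by apply: measurable_funB; exact: levy_meas. Qed.

Lemma levy_incr_law s t B : 0 <= s -> 0 <= t -> measurable B ->
  prob P ((fun w => X (s + t) w - X s w) @^-1` B) = prob P (X t @^-1` B).
Proof. by move=> s0 t0 mB; case: HX => _ _ _ /(_ s t B s0 t0 mB). Qed.

Lemma levy_incr_indep s t : 0 <= s -> 0 <= t ->
  indep_sys P (sig1 (X s)) (sig1 (fun w => X (s + t) w - X s w)).
Proof.
move=> s0 t0; apply: indep_sysP.
- by apply: sig1_measurable; exact: levy_meas.
- by apply: sig1_measurable; exact: levy_incr_meas.
- exact: sig1I.
- exact: sig1I.
move=> _ _ [A mA <-] [B mB <-].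
(* Times 0, s, s + t, constant from index 2 on so that the sequence stays monotone. *)
pose r (k : nat) : R := if k is k'.+1 then (if k' is 0%N then s else s + t) else 0.
have rm k : r k <= r k.+1 by case: k => [|[|k]] /=; lra.
pose BB (k : nat) := if k is 0%N then A else B.
have mBB k : measurable (BB k) by case: k.
case: HX => _ _ /(_ 2%N r BB (lexx _) rm mBB) H _ _.
move: H; rewrite !big_ord_recr big_ord0/= mul1r.
have -> : prob P (X s @^-1` A) = prob P [set w | A (X s w - X 0 w)].
  by congr prob; apply/seteqP; split => w /=; rewrite levy0 subr0.
move=> <-; congr prob; apply/seteqP; split => [w [Aw Bw] [|[|//]] _ /=|w H].
- by rewrite levy0 subr0.
- exact: Bw.
- split; first by have := H 0%N isT; rewrite /= levy0 subr0.
  exact: (H 1%N isT).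
Qed.

(** Extended-valued, since finiteness is known at time 1 only and has to be propagated to other
    times. *)
Definition mge (t u : R) : \bar R := (\int[P]_w (expR (u * X t w))%:E)%E.

Lemma exp_meas t u : measurable_fun setT (fun w => expR (u * X t w)).
Proof. by apply: measurableT_comp => //; apply: measurable_funM => //; exact: levy_meas. Qed.

Lemma mge_add s t u : 0 <= s -> 0 <= t -> mge (s + t) u = (mge s u * mge t u)%E.
Proof.
move=> s0 t0.
have me : measurable_fun setT (fun x : R => expR (u * x)).
  by apply: measurableT_comp => //; exact: measurable_funM.
have -> : mge t u = (\int[P]_w (expR (u * (X (s + t) w - X s w)))%:E)%E.
  apply/esym.
  apply: (@law1_ge0_integral _ _ _ _ _ _ _ _ _ _ _ _ (fun x => (expR (u * x))%:E)) => //.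
  - exact: levy_incr_meas.
  - exact: levy_meas.
  - by move=> B mB; exact: levy_incr_law.
  - exact/measurable_EFinP.
have := Ex_indep_ge0 (levy_incr_indep s0 t0) (sig1_gmeas me) (sig1_gmeas me).
move=> /= <-; last 2 first.
- by move=> w; rewrite expR_ge0.
- by move=> w; rewrite expR_ge0.
by apply: eq_integral => w _; rewrite -expRD -mulrDr (addrC (X s w)) subrK.
Qed.

Lemma mge_intble t u : (mge t u < +oo)%E ->
  P.-integrable setT (EFin \o (fun w => expR (u * X t w))).
Proof.
move=> H; apply/integrableP; split; first by apply/measurable_EFinP; exact: exp_meas.
by under eq_integral do rewrite /= ger0_norm ?expR_ge0//.
Qed.

Lemma mge_gt0 t u : (0 < mge t u)%E.
Proof.
have [H|] := ltP (mge t u) +oo%E; last exact: lt_le_trans.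
have i := mge_intble H.
rewrite /mge (Ex_EFin i) lte_fin; apply: Ex_gt0 => // w.
exact: expR_gt0.
Qed.

Hypothesis Hm : forall u, P.-integrable setT (EFin \o (fun w => expR (u * X 1 w))).

(** For t <= 1 the value at 1 is the product of those at t and 1 - t, both positive, so neither can
    be infinite. Larger times are reached by unit steps. *)
Lemma mge_fin t u : 0 <= t -> (mge t u < +oo)%E.
Proof.
have m1 : (mge 1 u < +oo)%E.
  by rewrite /mge Ex_EFin ?ltry//; exact: Hm.
have m1f : mge 1 u \is a fin_num by rewrite gt0_fin_numE// mge_gt0.
have le1 r : 0 <= r <= 1 -> (mge r u < +oo)%E.
  move=> /andP[r0 r1]; rewrite ltNge leye_eq; apply/eqP => E.
  have := @mge_add r (1 - r) u r0; rewrite subr_ge0 => /(_ r1).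
  rewrite (addrC r) subrK E gt0_mulye ?mge_gt0// => H.
  by move: m1; rewrite H ltxx.
move=> t0.
suff H (n : nat) r : 0 <= r <= n%:R -> (mge r u < +oo)%E.
  apply: (H (Num.trunc t).+1); rewrite t0/=.
  by have /andP[_ /ltW] := truncn_itv t0.
elim: n r => [|n IH] r /andP[r0 rn]; first by apply: le1; rewrite r0/=; lra.
have [r1|r1] := leP r 1; first by apply: le1; rewrite r0.
have -> : r = (r - 1) + 1 by rewrite subrK.
rewrite mge_add//; last by rewrite subr_ge0 ltW.
have rf : mge (r - 1) u \is a fin_num.
  rewrite gt0_fin_numE ?mge_gt0//; apply: IH.
  by rewrite subr_ge0 (ltW r1)/= lerBlDr -natr1 in rn *.
by rewrite -(fineK rf) -(fineK m1f) -EFinM ltry.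
Qed.

Lemma exp_intble t u : 0 <= t -> P.-integrable setT (EFin \o (fun w => expR (u * X t w))).
Proof. by move=> t0; apply: mge_intble; exact: mge_fin. Qed.

Let mE u t := Ex P (fun w => expR (u * X t w)).

Let mE_gt0 u t : 0 <= t -> 0 < mE u t.
Proof. by move=> t0; apply: Ex_gt0; [exact: exp_intble|move=> w; exact: expR_gt0]. Qed.

Let mE_add u s t : 0 <= s -> 0 <= t -> mE u (s + t) = mE u s * mE u t.
Proof.
move=> s0 t0; have := mge_add u s0 t0.
rewrite /mge !Ex_EFin ?exp_intble ?addr_ge0//.
by move=> [].
Qed.

Let mE_nat u h n : 0 <= h -> mE u (n%:R * h) = mE u h ^+ n.
Proof.
move=> h0; elim: n => [|n IH].
  rewrite mul0r expr0 /mE; under eq_fun do rewrite levy0 mulr0 expR0.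
  exact: Ex_cst.
by rewrite -natr1 mulrDl mul1r mE_add ?IH ?exprSr// mulr_ge0.
Qed.

Let mE1 u : mE u 1 = expR (psi P X u).
Proof. by rewrite /psi lnK// posrE mE_gt0. Qed.

Let mE_rat u n k : mE u (n%:R / k.+1%:R) = expR (n%:R / k.+1%:R * psi P X u).
Proof.
have k0 : (0 : R) < k.+1%:R by rewrite ltr0n.
have ik0 : (0 : R) <= k.+1%:R^-1 by rewrite invr_ge0 ltW.
have H : mE u k.+1%:R^-1 = expR (k.+1%:R^-1 * psi P X u).
  have : mE u k.+1%:R^-1 ^+ k.+1 = expR (k.+1%:R^-1 * psi P X u) ^+ k.+1.
    by rewrite -mE_nat// divff ?gt_eqF// mE1 -expRM_natl mulrA divff ?gt_eqF// mul1r.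
  by move/pexpIrn => -> //; rewrite ?nnegrE ?expR_ge0 ?ltW// mE_gt0.
by rewrite mE_nat// H -expRM_natl mulrA.
Qed.

(** Fatou along rational times approaching [t] from the right: right-continuity of the paths gives
    pointwise convergence, and Fatou gives this one inequality. *)
Let mE_le u t : 0 <= t -> mE u t <= expR (t * psi P X u).
Proof.
move=> t0.
(* Truncation plus one keeps [q k] strictly above [t], as the right limit of a path requires. *)
pose q (k : nat) : R := (Num.trunc (t * k.+1%:R)).+1%:R / k.+1%:R.
have qk k : t < q k <= t + k.+1%:R^-1.
  have k0 : (0 : R) < k.+1%:R by rewrite ltr0n.
  have tk : 0 <= t * k.+1%:R by rewrite mulr_ge0// ltW.
  have /andP[h1 h2] := truncn_itv tk.
  rewrite /q ltr_pdivlMr// h2/= ler_pdivrMr// mulrDl mulVf ?gt_eqF//.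
  by rewrite -natr1 lerD2r.
have qcvg : q @ \oo --> t.
  apply: (@squeeze_cvgr _ _ _ _ (fun=> t) (fun k => t + k.+1%:R^-1)).
  - by apply: nearW => k; have /andP[/ltW -> ->] := qk k.
  - exact: cvg_cst.
  - rewrite -[X in _ --> X]addr0; apply: cvgD; first exact: cvg_cst.
    exact: cvg_harmonic.
pose f k w := (expR (u * X (q k) w))%:E.
have fcvg w : (f^~ w) @ \oo --> (expR (u * X t w))%:E.
  apply: cvg_EFin; first by near=> k.
  apply: continuous_cvg; first exact: continuous_expR.
  apply: cvgMr => /=.
  have [_ /(_ w)[/(_ t t0) H _] _ _ _] := HX.
  move/cvg_at_rightP : H; apply; split => // k.
  by have /andP[] := qk k.
have := @fatou _ _ _ P setT measurableT f.
have -> : (\int[P]_w limn_einf (f^~ w) = (mE u t)%:E)%E.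
  rewrite -Ex_EFin; last exact: exp_intble.
  by apply: eq_integral => w _; rewrite (cvg_limn_einf_sup (fcvg w)).1.
have E : (fun k => \int[P]_w f k w)%E @ \oo --> (expR (t * psi P X u))%:E.
  have -> : (fun k => \int[P]_w f k w)%E = (fun k => (expR (q k * psi P X u))%:E).
    apply/funext => k; rewrite /f Ex_EFin; last first.
      by apply: exp_intble; rewrite (le_trans t0)// ltW//; have /andP[] := qk k.
    by congr EFin; exact: mE_rat.
  apply: cvg_EFin; first by near=> k.
  apply: continuous_cvg; first exact: continuous_expR.
  exact: cvgMl.
rewrite (cvg_limn_einf_sup E).1 lee_fin; apply.
- by move=> k; apply/measurable_EFinP; exact: exp_meas.
- by move=> k w _; rewrite lee_fin expR_ge0.
Unshelve. all: by end_near.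
Qed.

(** The upper bound holds at both t and n - t, while the product of the two values is exact at the
    integer n; hence equality at t. *)
Lemma levy_mgf u t : 0 <= t -> Ex P (fun w => expR (u * X t w)) = expR (t * psi P X u).
Proof.
move=> t0; apply/eqP; rewrite eq_le mE_le//=.
set n := (Num.trunc t).+1.
have tn : t <= n%:R by have /andP[_ /ltW] := truncn_itv t0.
have nt : 0 <= n%:R - t by rewrite subr_ge0.
have E := mE_add u t0 nt.
have En : mE u n%:R = expR (n%:R * psi P X u).
  by rewrite -[n%:R]mulr1 mE_nat// mE1 -expRM_natl mulr1.
rewrite addrC subrK En in E.
have H := mE_le u nt.
rewrite -(@ler_pM2r _ (mE u (n%:R - t))) ?mE_gt0// -E.
apply: (le_trans (ler_wpM2l (expR_ge0 _) H)).
by rewrite -expRD -mulrDl addrC subrK.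
Qed.

End Levy.

(** * Trigonometric bounds and cumulant functions *)

Section Trig.
Context {R : realType}.
Implicit Types x : R.

Lemma derive_cont (f df : R -> R) : (forall x, is_derive x 1 f (df x)) -> continuous f.
Proof.
move=> Hf x; apply: differentiable_continuous; apply/derivable1_diffP.
exact: (@ex_derive _ _ _ _ _ _ _ (Hf x)).
Qed.

Lemma MVT_all (f df : R -> R) (a b : R) : (forall x, is_derive x 1 f (df x)) ->
  a < b -> exists2 c, a < c < b & f b - f a = df c * (b - a).
Proof.
move=> Hf ab.
have [|c] := @MVT R f df a b ab (fun x _ => Hf x).
  exact/continuous_subspaceT/(derive_cont Hf).
by rewrite in_itv/= => cab E; exists c.
Qed.

Lemma ge0_of_derive (f df : R -> R) : (forall x, is_derive x 1 f (df x)) ->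
  f 0 = 0 -> (forall x, 0 <= x -> 0 <= df x) -> forall x, 0 <= x -> 0 <= f x.
Proof.
move=> Hf f0 df0 x; rewrite le_eqVlt => /predU1P[<-|x0]; first by rewrite f0.
have [c /andP[c0 cx] E] := MVT_all Hf x0.
rewrite f0 !subr0 in E; rewrite E mulr_ge0 ?(ltW x0)//.
by apply: df0; exact: ltW.
Qed.

(** Start of a chain in which each bound is integrated to give the next. The constants of the third
    and fourth bounds are not sharp; only the orders matter. *)
Lemma sin_leid x : 0 <= x -> sin x <= x.
Proof.
move=> x0; rewrite -subr_ge0.
apply: (@ge0_of_derive (fun x => x - sin x) (fun x => 1 - cos x)) => //.
- by rewrite sin0 subrr.
Qed.

Lemma cos_ge_ge0 x : 0 <= x -> 1 - cos x <= x ^+ 2 / 2.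
Proof.
move=> x0; rewrite -subr_ge0.
apply: (@ge0_of_derive (fun x => x ^+ 2 / 2 - (1 - cos x)) (fun x => x - sin x)) => //.
- move=> y; apply: is_derive_eq.
  by rewrite /GRing.scale/= !mulr0 ?addr0 ?add0r; field.
- by rewrite cos0 expr0n/= mul0r; ring.
- by move=> y y0; rewrite subr_ge0 sin_leid.
Qed.

Lemma sin_ge_ge0 x : 0 <= x -> x - sin x <= x ^+ 3.
Proof.
move=> x0; rewrite -subr_ge0.
apply: (@ge0_of_derive (fun x => x ^+ 3 - (x - sin x)) (fun x => 3 * x ^+ 2 - (1 - cos x))) => //.
- move=> y; apply: is_derive_eq.
  by rewrite /GRing.scale/=; ring.
- by rewrite sin0 expr0n/=; ring.
- move=> y y0; have := cos_ge_ge0 y0; have := sqr_ge0 y; lra.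
Qed.

Lemma cos_le_ge0 x : 0 <= x -> cos x - 1 + x ^+ 2 / 2 <= x ^+ 4.
Proof.
move=> x0; rewrite -subr_ge0.
apply: (@ge0_of_derive (fun x => x ^+ 4 - (cos x - 1 + x ^+ 2 / 2)) (fun x => 4 * x ^+ 3 - (x - sin x))) => //.
- move=> y; apply: is_derive_eq.
  by rewrite /GRing.scale/= !mulr0 ?addr0 ?add0r; field.
- by rewrite cos0 !expr0n/=; ring.
- move=> y y0; have := sin_ge_ge0 y0; have : 0 <= y ^+ 3 by rewrite exprn_ge0.
  lra.
Qed.

Lemma cos_ge x : 1 - cos x <= x ^+ 2 / 2.
Proof.
have [x0|x0] := leP 0 x; first exact: cos_ge_ge0.
by have := @cos_ge_ge0 (- x); rewrite cosN sqrrN; apply; lra.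
Qed.

Lemma cos_taylor x : `|cos x - 1 + x ^+ 2 / 2| <= x ^+ 4.
Proof.
rewrite ger0_norm; last by have := cos_ge x; lra.
have [x0|x0] := leP 0 x; first exact: cos_le_ge0.
have := @cos_le_ge0 (- x); rewrite cosN sqrrN.
by rewrite (_ : (- x) ^+ 4 = x ^+ 4); [apply; lra|ring].
Qed.

Lemma sin_taylor x : `|sin x - x| <= `|x| ^+ 3.
Proof.
wlog x0 : x / 0 <= x.
  move=> H; have [x0|x0] := leP 0 x; first exact: H.
  by have := H (- x); rewrite sinN opprK normrN addrC -(normrN (x - _)) opprB; apply; lra.
rewrite (ger0_norm x0) ler0_norm; last by have := sin_leid x0; lra.
by have := sin_ge_ge0 x0; lra.
Qed.

Lemma cosD2pin x (n : nat) : cos (x + n%:R * (pi *+ 2)) = cos x.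
Proof.
elim: n => [|n IH]; first by rewrite mul0r addr0.
by rewrite -natr1 mulrDl mul1r addrA cosD cos2pi sin2pi mulr1 mulr0 subr0.
Qed.

(** After removal of full periods, a point y of (0, 2 pi) has sin(y / 2) > 0, whereas cos y = 1 - 2
    sin(y / 2)^2. *)
Lemma cos_eq1 x : cos x = 1 -> exists n : int, x = n%:~R * (pi *+ 2).
Proof.
have pi0 : 0 < pi *+ 2 :> R by rewrite mulrn_wgt0// pi_gt0.
wlog x0 : x / 0 <= x.
  move=> H cx; have [x0|x0] := leP 0 x; first exact: H.
  have [||n E] := H (- x); first lra; first by rewrite cosN.
  by exists (- n); rewrite intrN mulNr -E opprK.
move=> cx; set n := Num.trunc (x / (pi *+ 2)).
have /andP[n1 n2] : n%:R <= x / (pi *+ 2) < n.+1%:R.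
  by apply: truncn_itv; rewrite divr_ge0// ltW.
set y := x - n%:R * (pi *+ 2).
have cy : cos y = 1 by rewrite -(cosD2pin y n) /y subrK.
have y0 : 0 <= y by rewrite subr_ge0 -ler_pdivlMr.
have yp : y < pi *+ 2.
  by rewrite ltrBlDl -[X in _ + X]mul1r -mulrDl natr1 -ltr_pdivrMr.
suff E : y = 0 by exists n; rewrite -[LHS](subrK (n%:R * (pi *+ 2))) -/y E add0r.
apply/eqP; apply: contraT => yn.
have yp0 : 0 < y by rewrite lt_neqAle eq_sym yn.
have H : 0 < sin (y / 2).
  apply: sin_gt0_pi; apply/andP; split; first by rewrite divr_gt0.
  by rewrite ltr_pdivrMr// mulr_natr.
have := cosD (y / 2) (y / 2); rewrite -splitr cy.
have := cos2Dsin2 (y / 2); rewrite !expr2.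
have : 0 < sin (y / 2) * sin (y / 2) by rewrite mulr_gt0.
lra.
Qed.

End Trig.

Section Cumulant.
Context {d : measure_display} {Om : measurableType d} {R : realType}
  (P : probability Om R) (X : Om -> R).
Hypothesis mX : measurable_fun setT X.
Hypothesis mgf : forall u, P.-integrable setT (EFin \o (fun w => expR (u * X w))).

(** Applied to [X 1] this is convertible to [psi P X]. Its derivatives [dcum] and [d2cum], written
    through moments, are the mean and the variance of the law tilted by e^(u x). *)
Definition cum (u : R) := ln (Ex P (fun w => expR (u * X w))).
Definition dcum u := mom P X 1 u / mom P X 0 u.
Definition d2cum u := (mom P X 2 u * mom P X 0 u - mom P X 1 u ^+ 2) / mom P X 0 u ^+ 2.

Lemma mom0E u : mom P X 0 u = Ex P (fun w => expR (u * X w)).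
Proof. by rewrite /mom; under eq_fun do rewrite expr0 mul1r. Qed.

Lemma expR_cum u : expR (cum u) = Ex P (fun w => expR (u * X w)).
Proof. by rewrite /cum lnK// posrE -mom0E mom0_gt0. Qed.

Lemma is_derive_cum (u : R) : is_derive u 1 cum (dcum u).
Proof.
have -> : cum = (@ln R) \o mom P X 0 by apply/funext => v; rewrite /= mom0E.
have := @is_derive1_comp R (@ln R) (mom P X 0) u _ _
  (is_derive1_ln (mom0_gt0 mX mgf u)) (is_derive_mom mX mgf 0 u).
by rewrite mulrC.
Qed.

Lemma is_derive_dcum (u : R) : is_derive u 1 dcum (d2cum u).
Proof.
have m0 := mom0_gt0 mX mgf u.
have d0 := is_derive_mom mX mgf 0 u.
have d1 := is_derive_mom mX mgf 1 u.
have n0 : mom P X 0 u != 0 by rewrite gt_eqF.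
rewrite (_ : dcum = (fun v => mom P X 1 v * (mom P X 0 v)^-1)); last by [].
have dV : is_derive u 1 (fun v => (mom P X 0 v)^-1) (- (mom P X 0 u) ^- 2 *: mom P X 1 u).
  exact: is_deriveV.
apply: is_derive_eq.
rewrite /d2cum /GRing.scale/=.
by field.
Qed.

Lemma dcum_cont : continuous dcum.
Proof. exact: (derive_cont is_derive_dcum). Qed.

Lemma cum_cont : continuous cum.
Proof. exact: (derive_cont is_derive_cum). Qed.

Lemma mom_cont k : continuous (mom P X k).
Proof. exact: (derive_cont (is_derive_mom mX mgf k)). Qed.

Lemma d2cum_cont : continuous d2cum.
Proof.
move=> u.
have m0 := mom0_gt0 mX mgf u.
have c0 := @mom_cont 0 u; have c1 := @mom_cont 1 u; have c2 := @mom_cont 2 u.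
apply: cvgM.
  apply: cvgB; first exact: cvgM.
  rewrite expr2; under eq_fun do rewrite expr2; exact: cvgM.
apply: cvgV; first by rewrite sqrf_eq0 gt_eqF.
rewrite expr2; under eq_fun do rewrite expr2; exact: cvgM.
Qed.

Hypothesis nonconst : ~ (exists c, prob P [set w | X w = c] = 1).

(** The numerator is the zeroth moment times the weighted mean square of X - m, with m the tilted
    mean; it vanishes only if X = m almost surely. *)
Lemma d2cum_gt0 u : 0 < d2cum u.
Proof.
have m0 := mom0_gt0 mX mgf u.
rewrite /d2cum divr_gt0 ?exprn_gt0//.
set m := mom P X 1 u / mom P X 0 u.
have i k := mom_intble mX mgf k u.
pose f w := X w ^+ 2 * expR (u * X w) - (2 * m) * (X w ^+ 1 * expR (u * X w))
   + m ^+ 2 * (X w ^+ 0 * expR (u * X w)).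
have fE w : f w = (X w - m) ^+ 2 * expR (u * X w) by rewrite /f; ring.
have fi : P.-integrable setT (EFin \o f).
  by apply: intbleD; [apply: intbleB => //; exact: intbleZl|exact: intbleZl].
have f0 w : 0 <= f w by rewrite fE mulr_ge0 ?sqr_ge0 ?expR_ge0.
have E : Ex P f = mom P X 2 u - 2 * m * mom P X 1 u + m ^+ 2 * mom P X 0 u.
  rewrite /f ExD; last 2 first.
  - by apply: intbleB => //; exact: intbleZl.
  - exact: intbleZl.
  rewrite ExB//; last exact: intbleZl.
  by rewrite (ExZl _ (i 1%N)) (ExZl _ (i 0%N)).
have -> : mom P X 2 u * mom P X 0 u - mom P X 1 u ^+ 2 = mom P X 0 u * Ex P f.
  by rewrite E /m; field; rewrite gt_eqF.
rewrite mulr_gt0// lt_neqAle Ex_ge0// andbT.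
apply/eqP => /esym E0; apply: nonconst; exists m.
rewrite -(Ex_eq0_ae fi f0 E0); congr prob.
apply/seteqP; split=> w /=; rewrite fE.
  by move=> ->; rewrite subrr expr0n/= mul0r.
move/eqP; rewrite mulf_eq0 (gt_eqF (expR_gt0 _)) orbF sqrf_eq0 subr_eq0.
by move/eqP.
Qed.

Let J := IofPsi' cum.

Lemma derive1_cum : derive1 cum = dcum.
Proof.
by apply/funext => u; rewrite derive1E (@derive_val _ _ _ _ _ _ _ (is_derive_cum u)).
Qed.

Lemma derive1n2_cum u : derive1n 2 cum u = d2cum u.
Proof.
rewrite /derive1n/= derive1_cum derive1E.
exact: (@derive_val _ _ _ _ _ _ _ (is_derive_dcum u)).
Qed.

(** The two psi'(u) terms cancel and u psi''(u) remains; its sign gives strict monotonicity on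
    nonnegative arguments. *)
Lemma is_derive_J (u : R) : is_derive u 1 J (u * d2cum u).
Proof.
rewrite (_ : J = (fun v => v * dcum v - cum v)); last first.
  by apply/funext => v; rewrite /J /IofPsi' derive1_cum.
have d1 := is_derive_cum u; have d2 := is_derive_dcum u.
apply: is_derive_eq.
by rewrite /GRing.scale/=; ring.
Qed.

Lemma J_lt a b : 0 <= a -> a < b -> J a < J b.
Proof.
move=> a0 ab.
have [c /andP[ac cb] E] := MVT_all is_derive_J ab.
rewrite -subr_gt0 E; apply: mulr_gt0; last by rewrite subr_gt0.
apply: mulr_gt0; [exact: le_lt_trans ac|exact: d2cum_gt0].
Qed.

Lemma J_cont : continuous J.
Proof. exact: (derive_cont is_derive_J). Qed.

Lemma J_inj a b : 0 <= a -> 0 <= b -> J a = J b -> a = b.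
Proof.
move=> a0 b0 E; apply/eqP; rewrite eq_le !leNgt; apply/andP; split; apply/negP.
  by move=> /(J_lt b0); rewrite E ltxx.
by move=> /(J_lt a0); rewrite E ltxx.
Qed.

Lemma J_ltE a b : 0 <= a -> 0 <= b -> (J a < J b) = (a < b).
Proof.
move=> a0 b0; apply/idP/idP => [|ab]; last exact: J_lt.
rewrite !ltNge; apply: contra; rewrite le_eqVlt => /predU1P[->|ba].
  exact: lexx.
by apply: ltW; exact: J_lt.
Qed.

(** [xget] returns an arbitrary preimage, which injectivity on nonnegative reals pins down. *)
Lemma Iinv_J u : 0 <= u -> Iinv cum (J u) = dcum u.
Proof.
move=> u0; rewrite /Iinv derive1_cum; congr dcum.
case: xgetP => [v _ [v0 E]|/(_ u)]; first exact: J_inj.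
by case; split.
Qed.

End Cumulant.

(** * Exponential tilting *)

Section Tilt.
Context {d : measure_display} {Om : measurableType d} {R : realType}
  (P : probability Om R) (X : R -> Om -> R).
Hypothesis HX : levy P X.
Hypothesis Hm : forall u, P.-integrable setT (EFin \o (fun w => expR (u * X 1 w))).
Local Notation intble f := (P.-integrable setT (EFin \o f)).
Local Notation ps := (psi P X).
Local Notation dps := (dcum P (X 1)).

(** Density, relative to P, of the exponentially tilted law at time [s]. In [tilt_mean] the variable
    is centred, s psi'(th) being its mean under the tilt. *)
Definition tilt_wt (s th : R) (x : R) := expR (th * x - s * ps th).
Definition tilt_mean (s th : R) (g : R -> R) :=
  Ex P (fun w => tilt_wt s th (X s w) * g (X s w - s * dps th)).

Lemma wt_meas s th : measurable_fun setT (tilt_wt s th).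
Proof.
apply: measurableT_comp => //; apply: measurable_funB; last exact: measurable_cst.
exact: measurable_funM.
Qed.

Lemma wt_intble s th : 0 <= s -> intble (fun w => tilt_wt s th (X s w)).
Proof.
move=> s0.
have := intbleZl (expR (- (s * ps th))) (exp_intble HX Hm th s0).
congr (P.-integrable _ _); apply/funext => w /=.
by rewrite -expRD addrC.
Qed.

Lemma wt_Ex s th : 0 <= s -> Ex P (fun w => tilt_wt s th (X s w)) = 1.
Proof.
move=> s0; rewrite -(expR0 R) -(subrr (s * ps th)) expRD -(levy_mgf HX Hm th s0).
rewrite mulrC -ExZl; last exact: exp_intble.
by congr Ex; apply/funext => w; rewrite /tilt_wt expRD mulrC.
Qed.

Definition bddm (g : R -> R) := measurable_fun setT g /\ exists M, forall x, `|g x| <= M.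

Lemma bddm_cos v : bddm (fun y => cos (v * y)).
Proof.
split; last by exists 1 => x; rewrite ler_norml cos_geN1 cos_le1.
apply: measurableT_comp; last exact: measurable_funM.
by apply: continuous_measurable_fun; exact: continuous_cos.
Qed.

Lemma bddm_sin v : bddm (fun y => sin (v * y)).
Proof.
split; last by exists 1 => x; rewrite ler_norml sin_geN1 sin_le1.
apply: measurableT_comp; last exact: measurable_funM.
by apply: continuous_measurable_fun; exact: continuous_sin.
Qed.

Let Gf s th (g : R -> R) (x : R) := tilt_wt s th x * g (x - s * dps th).

Let Gf_meas s th g : bddm g -> measurable_fun setT (Gf s th g).
Proof.
move=> [mg _]; apply: measurable_funM; first exact: wt_meas.
by apply: measurableT_comp => //; exact: measurable_funB.
Qed.

Lemma tl_intble s th g : 0 <= s -> bddm g -> intble (fun w => tilt_wt s th (X s w) * g (X s w - s * dps th)).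
Proof.
move=> s0 bg; have [mg [M gM]] := bg.
apply: (@intble_le _ _ _ P _ (fun w => M * tilt_wt s th (X s w))).
- exact: (measurableT_comp (Gf_meas s th bg) (levy_meas HX s)).
- by move=> w; rewrite normrM mulrC (ger0_norm (expR_ge0 _)) ler_wpM2r ?expR_ge0.
- by apply: intbleZl; exact: wt_intble.
Qed.

(** The density factorises over increments, so the tilted process still has independent stationary
    increments. *)
Lemma tl_indep s t th g1 g2 : 0 <= s -> 0 <= t -> bddm g1 -> bddm g2 ->
  let f w := tilt_wt (s + t) th (X (s + t) w) *
     (g1 (X s w - s * dps th) * g2 (X (s + t) w - X s w - t * dps th)) in
  intble f /\ Ex P f = tilt_mean s th g1 * tilt_mean t th g2.
Proof.
move=> s0 t0 b1 b2 f.
have ind := levy_incr_indep HX s0 t0.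
have law B (mB : measurable B) := levy_incr_law HX s0 t0 mB.
have mD := @levy_incr_meas _ _ _ P X HX s (s + t).
have i2 : intble (Gf t th g2 \o X t) by exact: tl_intble.
have law' B : measurable B -> prob P (X t @^-1` B) =
   prob P ((fun w => X (s + t) w - X s w) @^-1` B).
  by move=> mB; rewrite law.
have i2' := law1_intble (levy_meas HX t) mD law' (Gf_meas t th b2) i2.
have E2 := law1_Ex (levy_meas HX t) mD law' (Gf_meas t th b2) i2.
have [i12 E12] := Ex_indep ind (sig1_gmeas (Gf_meas s th b1))
  (sig1_gmeas (Gf_meas t th b2)) (tl_intble th s0 b1) i2'.
have fE : f = (fun w => (Gf s th g1 \o X s) w * (Gf t th g2 \o (fun w => X (s + t) w - X s w)) w).
  apply/funext => w; rewrite /f /Gf /tilt_wt /=.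
  rewrite (_ : th * X (s + t) w - (s + t) * ps th =
    (th * X s w - s * ps th) + (th * (X (s + t) w - X s w) - t * ps th)); last by ring.
  by rewrite expRD; ring.
by rewrite fE; split => //; rewrite E12 -E2.
Qed.

(** Real and imaginary parts of the characteristic function of the centred tilted law; [rr] below is
    its squared modulus, multiplicative in time. *)
Definition tilt_cos s th v := tilt_mean s th (fun y => cos (v * y)).
Definition tilt_sin s th v := tilt_mean s th (fun y => sin (v * y)).

Lemma ca_add s t th v : 0 <= s -> 0 <= t ->
  tilt_cos (s + t) th v = tilt_cos s th v * tilt_cos t th v - tilt_sin s th v * tilt_sin t th v.
Proof.
move=> s0 t0.
have [i1 <-] := tl_indep th s0 t0 (bddm_cos v) (bddm_cos v).
have [i2 <-] := tl_indep th s0 t0 (bddm_sin v) (bddm_sin v).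
rewrite -ExB//; congr Ex; apply/funext => w.
rewrite -mulrBr -cosD; congr (_ * cos _); ring.
Qed.

Lemma sa_add s t th v : 0 <= s -> 0 <= t ->
  tilt_sin (s + t) th v = tilt_sin s th v * tilt_cos t th v + tilt_cos s th v * tilt_sin t th v.
Proof.
move=> s0 t0.
have [i1 <-] := tl_indep th s0 t0 (bddm_sin v) (bddm_cos v).
have [i2 <-] := tl_indep th s0 t0 (bddm_cos v) (bddm_sin v).
rewrite -ExD//; congr Ex; apply/funext => w.
rewrite -mulrDr -sinD; congr (_ * sin _); ring.
Qed.

Definition rr s th v := tilt_cos s th v ^+ 2 + tilt_sin s th v ^+ 2.

Lemma rr_ge0 s th v : 0 <= rr s th v.
Proof. by rewrite addr_ge0// sqr_ge0. Qed.

Lemma rr_add s t th v : 0 <= s -> 0 <= t -> rr (s + t) th v = rr s th v * rr t th v.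
Proof. by move=> s0 t0; rewrite /rr ca_add// sa_add//; ring. Qed.

Lemma tl_rot s th v a b : 0 <= s ->
  tilt_mean s th (fun y => a * cos (v * y) + b * sin (v * y)) = a * tilt_cos s th v + b * tilt_sin s th v.
Proof.
move=> s0.
have i1 := tl_intble th s0 (bddm_cos v); have i2 := tl_intble th s0 (bddm_sin v).
rewrite /tilt_cos /tilt_sin /tilt_mean -!ExZl// -ExD; [|exact: intbleZl|exact: intbleZl].
congr Ex; apply/funext => w; ring.
Qed.

Lemma rot_le (a b y : R) : `|a * cos y + b * sin y| <= Num.sqrt (a ^+ 2 + b ^+ 2).
Proof.
rewrite -sqrtr_sqr ler_wsqrtr//.
have := cos2Dsin2 y; have := sqr_ge0 (a * sin y - b * cos y).
set c := cos y; set s := sin y => H E.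
have -> : a ^+ 2 + b ^+ 2 = (a ^+ 2 + b ^+ 2) * (c ^+ 2 + s ^+ 2) by rewrite E mulr1.
rewrite -subr_ge0; move: H; congr (0 <= _); ring.
Qed.

Lemma tl_bnd (s th : R) (g : R -> R) (M : R) : 0 <= s -> measurable_fun setT g -> (forall x, `|g x| <= M) ->
  `|tilt_mean s th g| <= M.
Proof.
move=> s0 mg gM.
have -> : M = Ex P (fun w => M * tilt_wt s th (X s w)).
  by rewrite ExZl ?wt_Ex ?mulr1//; exact: wt_intble.
apply: Ex_bnd.
- by apply: intble_meas (tl_intble th s0 _); split => //; exists M.
- by apply: intbleZl; exact: wt_intble.
- by move=> w; rewrite normrM mulrC (ger0_norm (expR_ge0 _)) ler_wpM2r ?expR_ge0.
Qed.

Lemma rot_meas (a b v : R) : measurable_fun setT (fun y => a * cos (v * y) + b * sin (v * y)).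
Proof.
have [mc _] := bddm_cos v; have [ms _] := bddm_sin v.
by apply: measurable_funD; apply: measurable_funM => //; exact: measurable_cst.
Qed.

(** The characteristic function is rotated onto the real axis: the test function has tilted mean
    [rr] and is bounded by sqrt(rr), so rr <= sqrt(rr). *)
Lemma rr_le1 s th v : 0 <= s -> rr s th v <= 1.
Proof.
move=> s0.
have H : `|tilt_mean s th (fun y => tilt_cos s th v * cos (v * y) + tilt_sin s th v * sin (v * y))| <=
    Num.sqrt (rr s th v).
  by apply: tl_bnd => //; [exact: rot_meas|move=> x; exact: rot_le].
rewrite tl_rot// -!expr2 ger0_norm ?rr_ge0// in H.
rewrite leNgt; apply/negP => r1.
have : Num.sqrt (rr s th v) < rr s th v.
  rewrite -[X in _ < X](@ger0_norm _ (rr s th v)) ?rr_ge0// -sqrtr_sqr ltr_sqrt.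
    by rewrite expr2 ltr_pMr// (lt_trans _ r1).
  by rewrite exprn_gt0// (lt_trans _ r1).
by rewrite ltNge H.
Qed.

Lemma rr_nat h th v n : 0 <= h -> rr (n%:R * h) th v = rr h th v ^+ n.
Proof.
move=> h0; elim: n => [|n IH]; last first.
  by rewrite -natr1 mulrDl mul1r rr_add ?IH ?exprSr// mulr_ge0.
rewrite mul0r expr0 /rr /tilt_cos /tilt_sin /tilt_mean.
under eq_fun do rewrite (levy0 HX) mul0r subr0 mulr0 cos0 /tilt_wt mulr0 mul0r subr0 expR0 mulr1.
under [X in _ + Ex P X ^+ 2]eq_fun do rewrite (levy0 HX) mul0r subr0 mulr0 sin0 mulr0.
by rewrite !Ex_cst expr1n expr0n/= addr0.
Qed.

(** The fractional remainder of the time has modulus at most 1, so decay at time 1 is enough. *)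
Lemma rr_trunc s th v : 0 <= s -> rr s th v <= rr 1 th v ^+ Num.trunc s.
Proof.
move=> s0; have /andP[ns _] := truncn_itv s0.
rewrite -(rr_nat _ _ _ ler01) mulr1.
rewrite -{1}[s](subrK (Num.trunc s)%:R) addrC rr_add ?subr_ge0//.
by rewrite ler_piMr ?rr_ge0// rr_le1// subr_ge0.
Qed.

Lemma tl_shift s th v y : 0 <= s ->
  tilt_mean s th (fun x => cos (v * (y - x))) = cos (v * y) * tilt_cos s th v + sin (v * y) * tilt_sin s th v.
Proof.
move=> s0; rewrite -tl_rot//; congr Ex; apply/funext => w.
by rewrite mulrBr cosB.
Qed.

Lemma tl_shift_le s th v y : 0 <= s ->
  `|tilt_mean s th (fun x => cos (v * (y - x)))| <= Num.sqrt (rr s th v).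
Proof.
move=> s0; rewrite tl_shift//.
by rewrite mulrC [X in _ + X]mulrC; exact: rot_le.
Qed.

(** * Frequency decay from the non-lattice hypothesis, uniformly in the tilt *)

Section Nonlattice.
Hypothesis nonlat : ~ lattice P (X 1).
Variables (kap : R).
Hypothesis kap0 : 0 < kap.
Local Notation X1 := (X 1).

Let mX1 : measurable_fun setT X1 := levy_meas HX 1.
(** Up to a constant, a common minorant of all tilting densities with |th| <= kap; comparing with it
    makes the decay uniform in the tilt. *)
Let g w := expR (- kap * `|X1 w|).
Let mg : measurable_fun setT g.
Proof.
apply: measurableT_comp => //; apply: measurable_funM => //.
exact: measurableT_comp.
Qed.
Let g_gt0 w : 0 < g w. Proof. exact: expR_gt0. Qed.
Let g_le1 w : g w <= 1.
Proof. by rewrite /g -expR0 ler_expR mulNr oppr_le0 mulr_ge0// ltW. Qed.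

Let gf_intble (f : Om -> R) : intble f -> intble (fun w => g w * f w).
Proof.
move=> fi; have mf := intble_meas fi.
apply: (@intble_le _ _ _ P _ (fun w => `|f w|)).
- exact: measurable_funM.
- by move=> w; rewrite normrM (ger0_norm (ltW (g_gt0 w))) ler_piMl.
- exact: integrable_norm.
Qed.

Let gi : intble g.
Proof.
have := gf_intble (@intble_cst _ _ _ P 1).
by under eq_fun do rewrite mulr1.
Qed.

Let ci v : intble (fun w => cos (v * X1 w)).
Proof.
apply: (@Ex_bnd_int _ _ _ _ _ 1); last by move=> w; rewrite ler_norml cos_geN1 cos_le1.
by apply: (@measurableT_comp _ _ _ _ _ _ (fun y => cos (v * y))) => //; case: (bddm_cos v).
Qed.

Let si v : intble (fun w => sin (v * X1 w)).
Proof.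
apply: (@Ex_bnd_int _ _ _ _ _ 1); last by move=> w; rewrite ler_norml sin_geN1 sin_le1.
by apply: (@measurableT_comp _ _ _ _ _ _ (fun y => sin (v * y))) => //; case: (bddm_sin v).
Qed.

Let a0 := Ex P g.
Let av v := Ex P (fun w => g w * cos (v * X1 w)).
Let bv v := Ex P (fun w => g w * sin (v * X1 w)).
(** With X' an independent copy of X = [X1] and g' the value of [g] there, [H v] is
    E[g g' (1 - cos(v (X - X')))], and [q v x] is the integral over X' alone with X frozen at x. *)
Let H v := a0 ^+ 2 - av v ^+ 2 - bv v ^+ 2.
Let q v x := a0 - cos (v * x) * av v - sin (v * x) * bv v.

Let qE v x : q v x = Ex P (fun w => g w * (1 - cos (v * (x - X1 w)))).
Proof.
rewrite /q /a0 /av /bv -!ExZl; [|exact: gf_intble|exact: gf_intble].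
rewrite -ExB; [|exact: gi|by apply: intbleZl; exact: gf_intble].
rewrite -ExB; [|by apply: intbleB; [exact: gi|apply: intbleZl; exact: gf_intble]
  |by apply: intbleZl; exact: gf_intble].
congr Ex; apply/funext => w; rewrite (mulrBr v x) cosB; ring.
Qed.

Let mcos (v x : R) : measurable_fun setT (fun y : R => cos (v * (x - y))).
Proof.
apply: (@measurableT_comp _ _ _ _ _ _ (fun y : R => cos (v * y))); first by case: (bddm_cos v).
by apply: measurable_funB => //; exact: measurable_cst.
Qed.

Let qi_intble (v x : R) : intble (fun w => g w * (1 - cos (v * (x - X1 w)))).
Proof.
apply: gf_intble; apply: intbleB; first exact: intble_cst.
apply: (@Ex_bnd_int _ _ _ _ _ 1); last by move=> w; rewrite ler_norml cos_geN1 cos_le1.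
exact: (measurableT_comp (mcos v x) mX1).
Qed.

Let q_ge0 v x : 0 <= q v x.
Proof.
rewrite qE; apply: Ex_ge0 => w; apply: mulr_ge0; first exact: ltW.
by rewrite subr_ge0 cos_le1.
Qed.

Let gq_intble v : intble (fun w => g w * q v (X1 w)).
Proof.
apply: gf_intble; apply: intbleB; first apply: intbleB; first exact: intble_cst.
- by under eq_fun do rewrite mulrC; exact: intbleZl.
- by under eq_fun do rewrite mulrC; exact: intbleZl.
Qed.

Let HE v : H v = Ex P (fun w => g w * q v (X1 w)).
Proof.
transitivity (Ex P (fun w => a0 * g w - av v * (g w * cos (v * X1 w)) - bv v * (g w * sin (v * X1 w)))).
  rewrite ExB; [|apply: intbleB; apply: intbleZl => //; exact: gf_intble|apply: intbleZl; exact: gf_intble].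
  rewrite ExB; [|exact: intbleZl|apply: intbleZl; exact: gf_intble].
  rewrite (ExZl _ gi) (ExZl _ (gf_intble (ci v))) (ExZl _ (gf_intble (si v))).
  by rewrite -/a0 -/(av v) -/(bv v) /H; ring.
congr Ex; apply/funext => w; rewrite /q; ring.
Qed.

(** If the double integral vanished, some value x0 would satisfy cos(v (x0 - X)) = 1 almost surely,
    placing X on the lattice x0 + (2 pi / v) Z. *)
Let H_gt0 v : v != 0 -> 0 < H v.
Proof.
move=> v0; rewrite lt_neqAle; apply/andP; split; last first.
  by rewrite HE; apply: Ex_ge0 => w; rewrite mulr_ge0 ?q_ge0// ltW.
apply/eqP => /esym; rewrite HE => E0.
have := Ex_eq0_ae (gq_intble v) (fun w => mulr_ge0 (ltW (g_gt0 w)) (q_ge0 v (X1 w))) E0.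
move=> pr.
have [w0 /= Hw0] : exists w0, g w0 * q v (X1 w0) = 0.
  apply: contrapT => Hn; move: pr; rewrite (_ : [set w | _] = set0).
    by rewrite /prob measure0 => /eqP; rewrite eq_sym oner_eq0.
  by apply/seteqP; split => w //= E; apply: Hn; exists w.
move/eqP : Hw0; rewrite mulf_eq0 (gt_eqF (g_gt0 w0))/= => /eqP q0.
rewrite qE in q0.
have n0 w : 0 <= g w * (1 - cos (v * (X1 w0 - X1 w))).
  by apply: mulr_ge0; [exact: ltW|rewrite subr_ge0 cos_le1].
apply: nonlat; exists ((pi *+ 2) / v), (X1 w0).
apply: etrans (Ex_eq0_ae (qi_intble v (X1 w0)) n0 q0).
congr prob; apply/seteqP; split=> w /=.
  move=> [n ->]; apply/eqP; rewrite mulf_eq0 (gt_eqF (g_gt0 w))/= subr_eq0 eq_sym; apply/eqP.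
  have -> : v * (X1 w0 - (pi *+ 2 / v * n%:~R + X1 w0)) = - (n%:~R * (pi *+ 2)) by field.
  rewrite cosN; case: n => n.
    by rewrite -[_ * _]add0r cosD2pin cos0.
  by rewrite NegzE intrN mulNr cosN -[_ * _]add0r cosD2pin cos0.
move/eqP; rewrite mulf_eq0 (gt_eqF (g_gt0 w))/= subr_eq0 eq_sym => /eqP/cos_eq1[n E].
exists (- n); rewrite intrN.
rewrite (_ : pi *+ 2 / v * - n%:~R = - (n%:~R * (pi *+ 2)) / v); last by ring.
by rewrite -E; field.
Qed.

Let Xk_intble k : intble (fun w => X1 w ^+ k).
Proof.
have := mom_intble mX1 Hm k 0.
by under eq_fun do rewrite mul0r expR0 mulr1.
Qed.

Let ak k := Ex P (fun w => g w * X1 w ^+ k).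

(** a0^2 times the variance of X under the measure g dP normalised to mass 1. *)
Let S := a0 * ak 2 - ak 1 ^+ 2.

Let a0_gt0 : 0 < a0. Proof. by apply: Ex_gt0. Qed.

Let S_gt0 : 0 < S.
Proof.
pose m := ak 1 / a0.
have i k : intble (fun w => g w * X1 w ^+ k) := gf_intble (Xk_intble k).
pose f w := g w * X1 w ^+ 2 - (2 * m) * (g w * X1 w ^+ 1) + m ^+ 2 * g w.
have fE w : f w = g w * (X1 w - m) ^+ 2 by rewrite /f; ring.
have fi : intble f.
  by apply: intbleD; [apply: intbleB => //; exact: intbleZl|exact: intbleZl].
have f0 w : 0 <= f w by rewrite fE mulr_ge0 ?sqr_ge0// ltW.
have E : Ex P f = ak 2 - 2 * m * ak 1 + m ^+ 2 * a0.
  rewrite /f ExD; last 2 first.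
  - by apply: intbleB => //; exact: intbleZl.
  - exact: intbleZl.
  rewrite ExB//; last exact: intbleZl.
  by rewrite (ExZl _ (i 1%N)) (ExZl _ gi).
have -> : S = a0 * Ex P f.
  by rewrite E /m /S; field; rewrite gt_eqF.
rewrite mulr_gt0// lt_neqAle Ex_ge0// andbT.
(* A constant is lattice with span 0. *)
apply/eqP => /esym E0; apply: nonlat; exists 0, m.
apply: etrans (Ex_eq0_ae fi f0 E0); congr prob.
apply/seteqP; split=> w /=; rewrite fE.
  by move=> [n ->]; rewrite mul0r add0r subrr expr0n/= mulr0.
move/eqP; rewrite mulf_eq0 (gt_eqF (g_gt0 w))/= sqrf_eq0 subr_eq0 => /eqP ->.
by exists 0; rewrite mul0r add0r.
Qed.

(** Fourth-order Taylor bound for the cosine. The inequality (x - y)^4 <= 8 (x^4 + y^4) separates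
    the variables, and integrating both terms doubles the 8 into 16. *)
Let H_near0 v : v ^+ 2 * S - 16 * v ^+ 4 * (a0 * ak 4) <= H v.
Proof.
have i k : intble (fun w => g w * X1 w ^+ k) := gf_intble (Xk_intble k).
have qlow x : v ^+ 2 / 2 * (x ^+ 2 * a0 - 2 * x * ak 1 + ak 2)
     - 8 * v ^+ 4 * (x ^+ 4 * a0 + ak 4) <= q v x.
  rewrite qE.
  pose f w := (v ^+ 2 / 2 * x ^+ 2 - 8 * v ^+ 4 * x ^+ 4) * g w - (v ^+ 2 * x) * (g w * X1 w ^+ 1)
     + (v ^+ 2 / 2) * (g w * X1 w ^+ 2) - (8 * v ^+ 4) * (g w * X1 w ^+ 4).
  have j1 : intble (fun w => (v ^+ 2 / 2 * x ^+ 2 - 8 * v ^+ 4 * x ^+ 4) * g w - (v ^+ 2 * x) * (g w * X1 w ^+ 1)).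
    by apply: intbleB; exact: intbleZl.
  have j2 : intble (fun w => (v ^+ 2 / 2 * x ^+ 2 - 8 * v ^+ 4 * x ^+ 4) * g w - (v ^+ 2 * x) * (g w * X1 w ^+ 1)
     + (v ^+ 2 / 2) * (g w * X1 w ^+ 2)).
    by apply: intbleD => //; exact: intbleZl.
  have fi : intble f by apply: intbleB => //; exact: intbleZl.
  have -> : v ^+ 2 / 2 * (x ^+ 2 * a0 - 2 * x * ak 1 + ak 2)
     - 8 * v ^+ 4 * (x ^+ 4 * a0 + ak 4) = Ex P f.
    rewrite /f ExB//; last exact: intbleZl.
    rewrite ExD//; last exact: intbleZl.
    rewrite ExB; [|exact: intbleZl|exact: intbleZl].
    rewrite (ExZl _ gi) (ExZl _ (i 1%N)) (ExZl _ (i 2%N)) (ExZl _ (i 4%N)).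
    by rewrite -/a0 -/(ak 1) -/(ak 2) -/(ak 4); field.
  apply: (le_Ex fi (qi_intble v x)) => w.
  rewrite (_ : f w = g w * ((v * (x - X1 w)) ^+ 2 / 2 - 8 * v ^+ 4 * (x ^+ 4 + X1 w ^+ 4))); last first.
    by rewrite /f; field.
  rewrite ler_wpM2l ?(ltW (g_gt0 w))//.
  have := cos_taylor (v * (x - X1 w)); rewrite ler_norml => /andP[_].
  have : (v * (x - X1 w)) ^+ 4 <= 8 * v ^+ 4 * (x ^+ 4 + X1 w ^+ 4).
    set y := X1 w.
    have -> : (v * (x - y)) ^+ 4 = v ^+ 4 * (x - y) ^+ 4 by rewrite exprMn.
    have -> : 8 * v ^+ 4 * (x ^+ 4 + y ^+ 4) = v ^+ 4 * (8 * (x ^+ 4 + y ^+ 4)) by ring.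
    apply: ler_wpM2l; first by rewrite exprn_even_ge0.
    have : 0 <= (x ^+ 2 - y ^+ 2) ^+ 2 by exact: sqr_ge0.
    have : 0 <= ((x + y) ^+ 2) ^+ 2 by exact: sqr_ge0.
    have : 0 <= x ^+ 2 * y ^+ 2 by rewrite mulr_ge0 ?sqr_ge0.
    have : 0 <= (x + y) ^+ 2 * (x - y) ^+ 2 by rewrite mulr_ge0 ?sqr_ge0.
    rewrite -subr_ge0 => h1 h2 h3 h4.
    have -> : 8 * (x ^+ 4 + y ^+ 4) - (x - y) ^+ 4 =
      ((x + y) ^+ 2) ^+ 2 + 6 * (x ^+ 2 - y ^+ 2) ^+ 2 by ring.
    lra.
  lra.
rewrite HE.
pose f w := (v ^+ 2 / 2 * ak 2 - 8 * v ^+ 4 * ak 4) * g w - (v ^+ 2 * ak 1) * (g w * X1 w ^+ 1)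
     + (v ^+ 2 / 2 * a0) * (g w * X1 w ^+ 2) - (8 * v ^+ 4 * a0) * (g w * X1 w ^+ 4).
have j1 : intble (fun w => (v ^+ 2 / 2 * ak 2 - 8 * v ^+ 4 * ak 4) * g w - (v ^+ 2 * ak 1) * (g w * X1 w ^+ 1)).
  by apply: intbleB; exact: intbleZl.
have j2 : intble (fun w => (v ^+ 2 / 2 * ak 2 - 8 * v ^+ 4 * ak 4) * g w - (v ^+ 2 * ak 1) * (g w * X1 w ^+ 1)
     + (v ^+ 2 / 2 * a0) * (g w * X1 w ^+ 2)).
  by apply: intbleD => //; exact: intbleZl.
have fi : intble f by apply: intbleB => //; exact: intbleZl.
have -> : v ^+ 2 * S - 16 * v ^+ 4 * (a0 * ak 4) = Ex P f.
  rewrite /f ExB//; last exact: intbleZl.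
  rewrite ExD//; last exact: intbleZl.
  rewrite ExB; [|exact: intbleZl|exact: intbleZl].
  rewrite (ExZl _ gi) (ExZl _ (i 1%N)) (ExZl _ (i 2%N)) (ExZl _ (i 4%N)).
  by rewrite -/a0 -/(ak 1) -/(ak 2) -/(ak 4) /S; field.
apply: (le_Ex fi (gq_intble v)) => w.
rewrite (_ : f w = g w * (v ^+ 2 / 2 * (X1 w ^+ 2 * a0 - 2 * X1 w * ak 1 + ak 2)
     - 8 * v ^+ 4 * (X1 w ^+ 4 * a0 + ak 4))); last by rewrite /f; field.
by rewrite ler_wpM2l ?(ltW (g_gt0 w)).
Qed.

Let H_cont : continuous H.
Proof.
have cc (h dh : R -> R) : (forall x : R, is_derive x 1 h (dh x)) -> (forall x, `|h x| <= 1) ->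
    continuous (fun v : R => Ex P (fun w => g w * h (v * X1 w))).
  move=> Hh h1 v.
  have ch := derive_cont Hh.
  apply: (@continuity_under_integral _ _ _ P (fun v w => g w * h (v * X1 w)) setT measurableT
    (v - 1) (v + 1) _ _ g gi); last by rewrite inE/= in_itv/=; lra.
  - move=> x _; apply: gf_intble; apply: (@Ex_bnd_int _ _ _ _ _ 1); last by [].
    apply: measurableT_comp; first exact: continuous_measurable_fun.
    exact: measurable_funM.
  - apply: aeW => w _ x _; apply: cvgMr.
    by apply: continuous_cvg; [exact: ch|exact: cvgMl].
  - by move=> x _; apply: aeW => w _; rewrite normrM (ger0_norm (ltW (g_gt0 w))) ler_piMr// ltW.
move=> v; apply: cvgB; first apply: cvgB; first exact: cvg_cst.
- under eq_fun do rewrite expr2; rewrite expr2.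
  by apply: cvgM; apply: (cc _ _ (@is_derive_cos R)) => x; rewrite ler_norml cos_geN1 cos_le1.
- under eq_fun do rewrite expr2; rewrite expr2.
  by apply: cvgM; apply: (cc _ _ (@is_derive_sin R)) => x; rewrite ler_norml sin_geN1 sin_le1.
Qed.

Let HN v : H (- v) = H v.
Proof.
rewrite /H; congr (_ - _ - _).
  by congr (_ ^+ 2); congr Ex; apply/funext => w; rewrite mulNr cosN.
have -> : bv (- v) = -1 * bv v.
  rewrite -ExZl; last exact: gf_intble.
  by congr Ex; apply/funext => w; rewrite mulNr sinN; ring.
by rewrite mulN1r sqrrN.
Qed.

(** Near 0 the quadratic term wins; on the remaining compact range of |v| the continuous positive
    function [H] has a positive minimum. *)
Let H_low a : 0 < a -> exists2 c, 0 < c & forall v, `|v| <= a -> c * v ^+ 2 <= H v.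
Proof.
move=> a_gt0.
have i4 : 0 <= a0 * ak 4.
  rewrite mulr_ge0 ?(ltW a0_gt0)//; apply: Ex_ge0 => w.
  by rewrite mulr_ge0 ?(ltW (g_gt0 w))// exprn_even_ge0.
(* For v^2 <= S / (2 K) the quartic error is at most half of the quadratic term; the added 1 keeps
   [K] positive. *)
pose K := 16 * (a0 * ak 4) + 1.
have K0 : 0 < K by rewrite /K; lra.
pose del2 := S / (2 * K).
have del20 : 0 < del2 by rewrite divr_gt0 ?S_gt0// mulr_gt0.
have near v : v ^+ 2 <= del2 -> S / 2 * v ^+ 2 <= H v.
  move=> vd; apply: le_trans (H_near0 v).
  have : v ^+ 2 * (v ^+ 2 * (16 * (a0 * ak 4))) <= v ^+ 2 * (S / 2).
    rewrite ler_wpM2l ?sqr_ge0//.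
    apply: (@le_trans _ _ (del2 * K)).
      by apply: ler_pM; [exact: sqr_ge0|rewrite mulr_ge0|exact: vd|rewrite /K lerDl].
    by rewrite /del2 le_eqVlt; apply/orP; left; apply/eqP; field; rewrite gt_eqF.
  rewrite (_ : v ^+ 2 * (v ^+ 2 * (16 * (a0 * ak 4))) = 16 * v ^+ 4 * (a0 * ak 4)); last by ring.
  lra.
pose del := Num.sqrt del2.
have del0 : 0 < del by rewrite sqrtr_gt0.
have [ad|da] := leP a del.
  exists (S / 2); first by rewrite divr_gt0 ?S_gt0.
  move=> v va; apply: near.
  rewrite -(sqr_sqrtr (ltW del20)) -real_normK ?num_real//.
  by rewrite lerXn2r ?nnegrE ?normr_ge0 ?sqrtr_ge0// (le_trans va).
have [c0 c0d c0min] := EVT_min (ltW da) (continuous_subspaceT H_cont).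
have Hc0 : 0 < H c0.
  by apply: H_gt0; rewrite gt_eqF//; move: c0d; rewrite in_itv/= => /andP[/(lt_le_trans del0)].
exists (Num.min (S / 2) (H c0 / a ^+ 2)).
  by rewrite lt_min divr_gt0 ?S_gt0//= divr_gt0// exprn_gt0.
move=> v; wlog v0 : v / 0 <= v.
  move=> W va; have [v0|v0] := leP 0 v; first exact: W.
  by have := W (- v); rewrite HN sqrrN normrN; apply => //; lra.
rewrite ger0_norm// => va.
have [vd|vd] := leP v del.
  apply: le_trans (near v _); first by rewrite ler_wpM2r ?sqr_ge0// ge_min lexx.
  by rewrite -(sqr_sqrtr (ltW del20)) lerXn2r ?nnegrE ?sqrtr_ge0.
apply: (@le_trans _ _ (H c0 / a ^+ 2 * v ^+ 2)).
  by rewrite ler_wpM2r ?sqr_ge0// ge_min lexx orbT.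
apply: (@le_trans _ _ (H c0)).
  rewrite mulrAC ler_pdivrMr ?exprn_gt0// ler_wpM2l ?(ltW Hc0)//.
  by rewrite lerXn2r ?nnegrE// ltW.
by apply: c0min; rewrite in_itv/= va ltW.
Qed.

(** The defect 1 - rr is the same double integral with the tilting densities in place of [g], and
    each of them dominates g / M, where M bounds e^(psi th) over |th| <= kap. *)
Lemma rr_nonlattice a : 0 < a -> exists2 c, 0 < c &
  forall th v, `|th| <= kap -> `|v| <= a -> rr 1 th v <= 1 - c * v ^+ 2.
Proof.
move=> a_gt0; have [c c_gt0 Hc] := H_low a_gt0.
pose M := expR (ps kap) + expR (ps (- kap)).
have M0 : 0 < M by rewrite addr_gt0 ?expR_gt0.
have psM th : `|th| <= kap -> expR (ps th) <= M.
  move=> tk; rewrite /M.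
  have E u : expR (ps u) = Ex P (fun w => expR (u * X1 w)) by exact: (expR_cum mX1 Hm u).
  have -> : expR (ps kap) + expR (ps (- kap)) = Ex P (fun w => expR (kap * X1 w) + expR (- kap * X1 w)).
    exact: etrans (congr2 +%R (E kap) (E (- kap))) (esym (ExD (Hm kap) (Hm (- kap)))).
  rewrite (E th).
  apply: (le_Ex (Hm th) (intbleD (Hm kap) (Hm (- kap)))).
  move=> w; have [x0|x0] := leP 0 (X1 w).
    apply: (@le_trans _ _ (expR (kap * X1 w))); last by rewrite lerDl expR_ge0.
    by rewrite ler_expR ler_wpM2r// (le_trans (ler_norm _)).
  apply: (@le_trans _ _ (expR (- kap * X1 w))); last by rewrite lerDr expR_ge0.
  rewrite ler_expR ler_wnM2r ?(ltW x0)//.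
  by move: tk; rewrite ler_norml => /andP[].
exists (c / M ^+ 2); first by rewrite divr_gt0 // exprn_gt0.
move=> th v tk va.
have psi_low : M^-1 <= expR (- ps th).
  by rewrite expRN lef_pV2 ?posrE ?expR_gt0// psM.
pose m := dps th.
pose W w := tilt_wt 1 th (X1 w).
have WI : intble W by apply: wt_intble.
have W1 : Ex P W = 1 by apply: wt_Ex.
have Wg w : M^-1 * g w <= W w.
  rewrite /W /tilt_wt mul1r expRD mulrC.
  apply: ler_pM; rewrite ?invr_ge0 ?(ltW M0) ?(ltW (g_gt0 w))//.
  rewrite /g ler_expR.
  have : `|th * X1 w| <= kap * `|X1 w| by rewrite normrM ler_wpM2r.
  by rewrite ler_norml mulNr => /andP[].
have ic := tl_intble th ler01 (bddm_cos v); have is_ := tl_intble th ler01 (bddm_sin v).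
pose Y w := X1 w - 1 * m.
pose p w := 1 - cos (v * Y w) * tilt_cos 1 th v - sin (v * Y w) * tilt_sin 1 th v.
have lin a' b' : intble (fun w => W w - a' * (W w * cos (v * Y w)) - b' * (W w * sin (v * Y w))) /\
   Ex P (fun w => W w - a' * (W w * cos (v * Y w)) - b' * (W w * sin (v * Y w))) =
   1 - a' * tilt_cos 1 th v - b' * tilt_sin 1 th v.
  split; first exact: (intbleB (intbleB WI (intbleZl a' ic)) (intbleZl b' is_)).
  rewrite (ExB (intbleB WI (intbleZl a' ic)) (intbleZl b' is_)).
  by rewrite (ExB WI (intbleZl a' ic)) (ExZl a' ic) (ExZl b' is_) W1.
have pE w : p w = Ex P (fun w' => W w' * (1 - cos (v * (X1 w - X1 w')))).
  rewrite /p -(lin (cos (v * Y w)) (sin (v * Y w))).2.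
  congr Ex; apply/funext => w'.
  rewrite (_ : X1 w - X1 w' = Y w - Y w'); last by rewrite /Y; ring.
  rewrite (mulrBr v (Y w)) cosB; ring.
have pq w : M^-1 * q v (X1 w) <= p w.
  rewrite pE qE -(ExZl _ (qi_intble v (X1 w))).
  apply: (le_Ex (intbleZl _ (qi_intble v (X1 w)))).
    have := (lin (cos (v * Y w)) (sin (v * Y w))).1.
    congr (P.-integrable _ _); apply/funext => w' /=; congr EFin.
    rewrite (_ : X1 w - X1 w' = Y w - Y w'); last by rewrite /Y; ring.
    rewrite (mulrBr v (Y w)) cosB; ring.
  by move=> w'; rewrite mulrA ler_wpM2r// subr_ge0 cos_le1.
have E : 1 - rr 1 th v = Ex P (fun w => W w * p w).
  transitivity (1 - tilt_cos 1 th v * tilt_cos 1 th v - tilt_sin 1 th v * tilt_sin 1 th v).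
    by rewrite /rr; ring.
  rewrite -(lin (tilt_cos 1 th v) (tilt_sin 1 th v)).2.
  congr Ex; apply/funext => w; rewrite /p; ring.
suff : c / M ^+ 2 * v ^+ 2 <= 1 - rr 1 th v by lra.
rewrite E; apply: (@le_trans _ _ (M ^- 2 * H v)).
  by rewrite mulrAC mulrC ler_wpM2l ?invr_ge0 ?exprn_ge0 ?(ltW M0)// Hc.
rewrite HE -(ExZl _ (gq_intble v)); apply: (le_Ex (intbleZl _ (gq_intble v))).
  have := (lin (tilt_cos 1 th v) (tilt_sin 1 th v)).1.
  congr (P.-integrable _ _); apply/funext => w /=; congr EFin; rewrite /p; ring.
move=> w; rewrite -exprVn expr2 mulrACA.
apply: ler_pM => //.
- by rewrite mulr_ge0 ?invr_ge0 ?(ltW M0)// ltW.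
- by rewrite mulr_ge0 ?invr_ge0 ?(ltW M0).
Qed.

End Nonlattice.
End Tilt.

(** * Local limit and Tauberian estimates *)

Section Calculus.
Context {R : realType}.
Local Notation mu := (@lebesgue_measure R).
Implicit Types x t u : R.

Lemma FTC_bnd (F f : R -> R) (a b v : R) : F b - F a = v ->
  (forall x : R, is_derive x 1 F (f x)) -> continuous f -> a < b ->
  (\int[mu]_(x in `[a, b]) (f x)%:E = v%:E)%E.
Proof.
move=> <- HF cf ab; rewrite EFinB; apply: continuous_FTC2 => //.
- exact: continuous_subspaceT.
- have cF := derive_cont HF; split.
  + by move=> x _; exact: (@ex_derive _ _ _ _ _ _ _ (HF x)).
  + by apply: cvg_at_right_filter; exact: cF.
  + by apply: cvg_at_left_filter; exact: cF.
- by move=> x _; rewrite derive1E; exact: (@derive_val _ _ _ _ _ _ _ (HF x)).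
Qed.

Lemma FTC_ray (F f : R -> R) (a l v : R) : l - F a = v -> (forall x : R, a <= x -> is_derive x 1 F (f x)) ->
  {within `[a, +oo[, continuous f} -> (forall x, a <= x -> 0 <= f x) -> F x @[x --> +oo] --> l ->
  (\int[mu]_(x in `[a, +oo[) (f x)%:E = v%:E)%E.
Proof.
move=> <- HF cf f0 Fl; rewrite EFinB; apply: ge0_continuous_FTC2y => //.
- by move=> x ax; exact: (@ex_derive _ _ _ _ _ _ _ (HF x (ltW ax))).
- apply: cvg_at_right_filter; apply: differentiable_continuous.
  by apply/derivable1_diffP; exact: (@ex_derive _ _ _ _ _ _ _ (HF a (lexx _))).
- move=> x; rewrite in_itv/= andbT => ax.
  by rewrite derive1E; exact: (@derive_val _ _ _ _ _ _ _ (HF x (ltW ax))).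
Qed.

Lemma lebesgue_shift (c : R) (A : set R) : measurable A ->
  pushforward mu ((fun x => x + c) : R -> measurableTypeR R) A = mu A.
Proof.
have mc : measurable_fun setT ((fun x => x + c) : R -> measurableTypeR R).
  exact: measurable_funD.
move=> mA; apply/esym/lebesgue_measure_unique => //= _ [[a b]] _ <-.
rewrite /pushforward /= (_ : _ @^-1` _ = `]a - c, b - c]%classic); last first.
  by apply/seteqP; split => x /=; rewrite !in_itv/= ltrBlDr lerBrDr.
rewrite !lebesgue_measure_itv/= !lte_fin ltrD2r.
by case: ifP => // _; congr EFin; ring.
Qed.

Lemma integral_shift (c : R) (f : R -> \bar R) : measurable_fun setT f ->
  (forall x, 0 <= f x)%E -> (\int[mu]_x f ((x : R) + c)%R = \int[mu]_x f x)%E.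
Proof.
move=> mf f0.
have mc : measurable_fun setT ((fun x => x + c) : R -> measurableTypeR R).
  exact: measurable_funD.
have := @ge0_integral_pushforward _ _ (measurableTypeR R) (measurableTypeR R) R _ mc mu setT f measurableT mf.
rewrite preimage_setT => <- //.
by apply: eq_measure_integral => A mA _; exact: lebesgue_shift.
Qed.

Lemma integral_exp_ray (a : R) : 0 < a ->
  (\int[mu]_(u in `[0%R, +oo[) (expR (- a * u))%:E = (a^-1)%:E)%E.
Proof.
move=> a0.
apply: (@FTC_ray (fun u => - (a^-1 * expR (- a * u))) _ 0 0).
- by rewrite mulr0 expR0 mulr1 opprK add0r.
- move=> x _; apply: is_derive_eq.
  rewrite /GRing.scale/=; field; by rewrite gt_eqF.
- apply: continuous_subspaceT => x.
  by apply: continuous_cvg; [exact: continuous_expR|exact: cvgMr].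
- by move=> x _; rewrite expR_ge0.
- rewrite -oppr0 -(mulr0 a^-1); apply: cvgN; apply: cvgMr.
  under eq_fun do rewrite mulNr.
  apply: (@cvg_comp _ _ _ (fun u => a * u) (fun y => expR (- y)) _ +oo%R); last exact: cvgr_expR.
  exact: gt0_cvgMry.
Qed.

(** Read off from the total mass of the centred normal density of variance 1 / v, by symmetry. *)
Lemma integral_gauss_ray (v : R) : 0 < v ->
  (\int[mu]_(u in `[0%R, +oo[) (expR (- (v * u ^+ 2 / 2)))%:E = (Num.sqrt (2 * pi / v) / 2)%:E)%E.
Proof.
move=> v0.
have := integral_normal_pdf 0 (Num.sqrt v^-1).
have s0 : Num.sqrt v^-1 != 0 :> R by rewrite gt_eqF// sqrtr_gt0 invr_gt0.
have sE : Num.sqrt v^-1 ^+ 2 = v^-1 :> R by rewrite sqr_sqrtr// invr_ge0 ltW.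
pose p : R := (Num.sqrt (2 * pi / v))^-1.
have p0 : 0 < p by rewrite invr_gt0 sqrtr_gt0 divr_gt0// mulr_gt0// pi_gt0.
pose G u := expR (- (v * u ^+ 2 / 2)).
have -> : normal_pdf 0 (Num.sqrt v^-1) = (fun u => p * G u).
  apply/funext => u; rewrite /normal_pdf (negbTE s0) /normal_peak /normal_fun sE subr0.
  congr (_ * _); first by rewrite /p -mulr_natl; congr (Num.sqrt _)^-1; ring.
  by rewrite /G; congr expR; rewrite -mulr_natl; field; by rewrite gt_eqF.
have G0 u : 0 <= G u by exact: expR_ge0.
have cG : continuous G.
  move=> u; apply: continuous_cvg; first exact: continuous_expR.
  apply: cvgN; apply: cvgMl; apply: cvgMr.
  by under eq_fun do rewrite expr2; rewrite expr2; exact: cvgM.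
rewrite ge0_symfun_integralT; last 3 first.
- by move=> x; rewrite mulr_ge0// ltW.
- by move=> x; apply: cvgMr; exact: cG.
- by move=> x; rewrite /= /G sqrrN.
under eq_integral do rewrite EFinM.
have mG : measurable_fun setT (EFin \o G).
  by apply/measurable_EFinP; exact: continuous_measurable_fun.
have E : [set x : R | (0 <= x)%R] = `[0%R, +oo[%classic.
  by apply/seteqP; split => x /=; rewrite in_itv/= andbT.
rewrite E ge0_integralZl//; last 3 first.
- exact: measurable_funTS.
- by move=> x _; rewrite lee_fin.
- by rewrite lee_fin ltW.
set I := (\int[mu]_(u in _) _)%E => H.
have I0 : (0 <= I)%E by apply: integral_ge0 => x _; rewrite lee_fin.
move: I0 H; case: I => [r _|_|//].
- rewrite -!EFinM => -[] H; congr EFin; rewrite -[RHS]invf_div -[Num.sqrt _]invrK -/p.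
  have pn : 2 * p != 0 by rewrite gt_eqF// mulr_gt0.
  have -> : r = (2 * p)^-1 by apply: (mulfI pn); rewrite divff// -mulrA.
  by field; rewrite gt_eqF.
- by rewrite gt0_muley ?lte_fin// gt0_muley.
Qed.

(** The Fejer kernel, cosine transform of the triangle 1 - u / b on [0, b] (see [fejE]), with its
    continuous extension b / 2 at 0. *)
Definition fej (b x : R) : R := if x == 0 then b / 2 else (1 - cos (b * x)) / (b * x ^+ 2).

Lemma fejE b x : 0 < b ->
  (\int[mu]_(u in `[0%R, b]) ((1 - u / b) * cos (u * x))%:E = (fej b x)%:E)%E.
Proof.
move=> b0; have bn0 : b != 0 by rewrite gt_eqF.
have cf : continuous (fun u => (1 - u / b) * cos (u * x)).
  move=> u; apply: cvgM.
    by apply: cvgB; [exact: cvg_cst|exact: cvgMl].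
  by apply: continuous_cvg; [exact: continuous_cos|exact: cvgMl].
rewrite /fej; have [x0|x0] := eqVneq x 0.
  apply: (@FTC_bnd (fun u => u - u ^+ 2 / (2 * b))) => //.
    by rewrite expr0n/= mul0r !subr0; field.
  move=> u; rewrite x0 mulr0 cos0; apply: is_derive_eq.
  by rewrite /GRing.scale/= !mulr0 ?addr0 ?add0r; field.
apply: (@FTC_bnd (fun u => (1 - u / b) * (sin (u * x) / x) - cos (u * x) / (b * x ^+ 2))) => //.
  rewrite !mul0r sin0 cos0 divff//; field.
  by rewrite x0 bn0.
move=> u; apply: is_derive_eq.
rewrite /GRing.scale/=; field.
by rewrite x0 bn0.
Qed.

Lemma fej_ge0 b x : 0 < b -> 0 <= fej b x.
Proof.
move=> b0; rewrite /fej; case: ifP => _; first by rewrite divr_ge0// ltW.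
apply: divr_ge0; first by rewrite subr_ge0 cos_le1.
by rewrite mulr_ge0 ?sqr_ge0// ltW.
Qed.

Lemma fej_le b x : 0 < b -> fej b x <= b / 2.
Proof.
move=> b0; rewrite /fej; case: eqP => // /eqP x0.
rewrite ler_pdivrMr; last by rewrite mulr_gt0// exprn_even_gt0.
apply: (le_trans (cos_ge _)).
by rewrite le_eqVlt; apply/orP; left; apply/eqP; field.
Qed.

Lemma fej_le2 b x : 0 < b -> x != 0 -> fej b x <= 2 / (b * x ^+ 2).
Proof.
move=> b0 x0; rewrite /fej (negbTE x0) ler_wpM2r//.
  by rewrite invr_ge0 mulr_ge0 ?sqr_ge0// ltW.
by have := cos_geN1 (b * x); lra.
Qed.

Lemma fejN b x : fej b (- x) = fej b x.
Proof. by rewrite /fej oppr_eq0 mulrN cosN sqrrN. Qed.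

Lemma fej_scale b c x : 0 < b -> 0 < c -> c * fej b x = fej (b * c) (x / c).
Proof.
move=> b0 c0; rewrite /fej mulf_eq0 invr_eq0 (gt_eqF c0) orbF.
case: eqP => [_|/eqP x0]; first by ring.
have -> : b * c * (x / c) = b * x by field; by rewrite gt_eqF.
by field; rewrite x0 !gt_eqF.
Qed.

(** The integral representation over a bounded interval treats the point 0 like any other. *)
Lemma fej_cont b : 0 < b -> continuous (fej b).
Proof.
move=> b0 x.
have -> : fej b = (fun x => \int[mu]_(u in `[0%R, b]) ((1 - u / b) * cos (u * x))).
  by apply/funext => y; rewrite /Rintegral fejE.
have ci (g : R -> R) : continuous g -> mu.-integrable `[0%R, b] (EFin \o g).
  move=> cg; apply: continuous_compact_integrable; first exact: segment_compact.
  exact: continuous_subspaceT.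
apply: (@continuity_under_integral _ _ _ mu (fun x u => (1 - u / b) * cos (u * x)) `[0%R, b]%classic _
  (x - 1) (x + 1) _ _ (fun=> 1)) => //.
- move=> y _; apply: ci => u; apply: cvgM.
    by apply: cvgB; [exact: cvg_cst|exact: cvgMl].
  by apply: continuous_cvg; [exact: continuous_cos|exact: cvgMl].
- apply: aeW => u _ y _; apply: cvgMr.
  by apply: continuous_cvg; [exact: continuous_cos|exact: cvgMr].
- by apply: ci => u; exact: cvg_cst.
- move=> y _; apply: aeW => u; rewrite /= in_itv/= => /andP[u0 ub].
  rewrite normrM -[leRHS]mulr1; apply: ler_pM => //.
    rewrite ger0_norm; first by rewrite gerBl divr_ge0// ltW.
    by rewrite subr_ge0 ler_pdivrMr// mul1r.
  by rewrite ler_norml cos_geN1 cos_le1.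
- by rewrite inE/= in_itv/=; lra.
Qed.

Lemma fej_meas b : 0 < b -> measurable_fun setT (fej b).
Proof. by move=> b0; apply: continuous_measurable_fun; exact: fej_cont. Qed.

Let texp x : 0 < x -> (\int[mu]_(t in `[0%R, +oo[) (t * expR (- x * t))%:E = (x ^- 2)%:E)%E.
Proof.
move=> x0; have xn0 : x != 0 by rewrite gt_eqF.
apply: (@FTC_ray (fun t => - ((t / x + x ^- 2) * expR (- x * t))) _ 0 0).
- by rewrite mulr0 expR0 mulr1 mul0r !add0r opprK.
- move=> t _; apply: is_derive_eq.
  by rewrite /GRing.scale/=; field.
- apply: continuous_subspaceT => t; apply: cvgM => //.
  by apply: continuous_cvg; [exact: continuous_expR|exact: cvgMr].
- by move=> t t0; rewrite mulr_ge0 ?expR_ge0.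
- have e0 (c : R) : 0 < c -> expR (- c * t) @[t --> +oo] --> (0 : R).
    move=> c0; under eq_fun do rewrite mulNr.
    apply: (@cvg_comp _ _ _ (fun u => c * u) (fun y => expR (- y)) _ +oo%R); last exact: cvgr_expR.
    exact: gt0_cvgMry.
  rewrite -oppr0; apply: cvgN.
  have E t : (t / x + x ^- 2) * expR (- x * t) = (t / x * expR (- (x/2) * t)) * expR (- (x/2) * t) + x ^- 2 * expR (- x * t).
    have -> : expR (- x * t) = expR (- (x / 2) * t) * expR (- (x / 2) * t).
      by rewrite -expRD; congr expR; field.
    ring.
  under eq_fun do rewrite E.
  have x20 : 0 < x / 2 by rewrite divr_gt0.
  rewrite -(addr0 0); apply: cvgD; last by rewrite -(mulr0 (x ^- 2)); apply: cvgMr; exact: e0.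
  apply: (@squeeze_cvgr _ _ _ _ (fun=> 0) (fun t => 2 / x ^+ 2 * expR (- (x / 2) * t))).
  + near=> t.
    have t0 : 0 <= t by near: t; exact: nbhs_pinfty_ge.
    rewrite !mulr_ge0 ?expR_ge0 ?invr_ge0 ?(ltW x0)//= ler_wpM2r ?expR_ge0//.
    have := expR_ge1Dx (x / 2 * t) => H.
    rewrite mulNr expRN ler_pdivrMr ?expR_gt0//.
    apply: (@le_trans _ _ (2 / x ^+ 2 * (x / 2 * t))).
      by rewrite le_eqVlt; apply/orP; left; apply/eqP; field.
    rewrite ler_wpM2l ?divr_ge0 ?sqr_ge0//; lra.
  + exact: cvg_cst.
  + by rewrite -(mulr0 (2 / x ^+ 2)); apply: cvgMr; exact: e0.
Unshelve. all: by end_near.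
Qed.

Let cexp b t : 0 < t -> 0 < b ->
  (\int[mu]_(x in `[0%R, +oo[) ((1 - cos (b * x)) * expR (- t * x))%:E = (b ^+ 2 / (t * (t ^+ 2 + b ^+ 2)))%:E)%E.
Proof.
move=> t0 b0; have tn0 : t != 0 by rewrite gt_eqF.
have D0 : t ^+ 2 + b ^+ 2 != 0 by rewrite gt_eqF// addr_gt0// exprn_gt0.
apply: (@FTC_ray (fun x => - (expR (- t * x) * (t^-1 + (b * sin (b * x) - t * cos (b * x)) / (t ^+ 2 + b ^+ 2)))) _ 0 0).
- rewrite !mulr0 expR0 cos0 sin0; field.
  by rewrite tn0 D0.
- move=> x _; apply: is_derive_eq.
  rewrite /GRing.scale/=; field.
  by rewrite tn0 D0.
- apply: continuous_subspaceT => x; apply: cvgM.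
    apply: cvgB; first exact: cvg_cst.
    by apply: continuous_cvg; [exact: continuous_cos|exact: cvgMr].
  by apply: continuous_cvg; [exact: continuous_expR|exact: cvgMr].
- by move=> x x0; rewrite mulr_ge0 ?expR_ge0// subr_ge0 cos_le1.
- rewrite -oppr0; apply: cvgN.
  set C := t^-1 + (b + t) / (t ^+ 2 + b ^+ 2).
  apply: norm_cvg0.
  have D1 : 0 < t ^+ 2 + b ^+ 2 by rewrite addr_gt0// exprn_gt0.
  apply: (@squeeze_cvgr _ _ _ _ (fun=> 0) (fun x => C * expR (- t * x))).
  + near=> x; rewrite normr_ge0/= normrM (ger0_norm (expR_ge0 _)) mulrC ler_wpM2r ?expR_ge0//.
    apply: (le_trans (ler_normD _ _)); rewrite ger0_norm ?invr_ge0 ?(ltW t0)// lerD2l.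
    rewrite normrM (ger0_norm (_ : 0 <= (t ^+ 2 + b ^+ 2)^-1)) ?invr_ge0 ?(ltW D1)//.
    rewrite ler_wpM2r ?invr_ge0 ?(ltW D1)// (le_trans (ler_normB _ _))//.
    rewrite !normrM (gtr0_norm t0) (gtr0_norm b0) lerD// ler_piMr ?(ltW t0) ?(ltW b0)//.
      by rewrite ler_norml sin_geN1 sin_le1.
    by rewrite ler_norml cos_geN1 cos_le1.
  + exact: cvg_cst.
  + rewrite -(mulr0 C); apply: cvgMr.
    under eq_fun do rewrite mulNr.
    apply: (@cvg_comp _ _ _ (fun u => t * u) (fun y => expR (- y)) _ +oo%R); last exact: cvgr_expR.
    exact: gt0_cvgMry.
Unshelve. all: by end_near.
Qed.

Let atan_int b : 0 < b ->
  (\int[mu]_(t in `[0%R, +oo[) (b / (t ^+ 2 + b ^+ 2))%:E = (pi / 2)%:E)%E.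
Proof.
move=> b0; have bn0 : b != 0 by rewrite gt_eqF.
have D0 t : t ^+ 2 + b ^+ 2 != 0 by rewrite gt_eqF// ltr_wpDl ?sqr_ge0// exprn_gt0.
apply: (@FTC_ray (fun t => atan (t / b)) _ 0 (pi / 2)).
- by rewrite mul0r atan0 subr0.
- move=> t _; apply: is_derive_eq.
  rewrite /GRing.scale/=; field.
  by rewrite D0 bn0.
- apply: continuous_subspaceT => t; apply: cvgMr; apply: cvgV => //.
  apply: cvgD; last exact: cvg_cst.
  by under eq_fun do rewrite expr2; rewrite expr2; exact: cvgM.
- by move=> t _; rewrite divr_ge0 ?addr_ge0 ?sqr_ge0// ltW.
- apply: (@cvg_comp _ _ _ (fun u => u / b) atan _ +oo%R); last exact: cvgy_atan.
  by apply: gt0_cvgMly; rewrite ?invr_gt0.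
Qed.

(** With 1 / x^2 written as the integral of t e^(-x t), exchanging the integrals leaves that of b /
    (t^2 + b^2), an arctangent. *)
Lemma integral_fej_ray b : 0 < b -> (\int[mu]_(x in `[0%R, +oo[) (fej b x)%:E = (pi / 2)%:E)%E.
Proof.
move=> b0.
pose K (p : R * R) : \bar R :=
  if (0 < p.1) && (0 < p.2) then (b^-1 * (1 - cos (b * p.1)) * (p.2 * expR (- p.1 * p.2)))%:E else 0%E.
have mK : measurable_fun setT K.
  apply: measurable_fun_ifT.
  - apply: measurable_and; apply: measurable_fun_ltr => //; exact: measurable_cst.
  - apply/measurable_EFinP; apply: measurable_funM.
      apply: measurable_funM; first exact: measurable_cst.
      apply: measurable_funB; first exact: measurable_cst.
      apply: (@measurableT_comp _ _ _ _ _ _ (@cos R)).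
        by apply: continuous_measurable_fun; exact: continuous_cos.
      by apply: measurable_funM => //; exact: measurable_cst.
    apply: measurable_funM => //; apply: measurableT_comp => //.
    by apply: measurable_funM => //; exact: measurable_funN.
  - exact: measurable_cst.
have K0 p : (0 <= K p)%E.
  rewrite /K; case: ifP => // /andP[p1 p2].
  by rewrite lee_fin !mulr_ge0 ?expR_ge0 ?invr_ge0 ?(ltW b0) ?(ltW p2)// subr_ge0 cos_le1.
have := @fubini_tonelli _ _ _ _ R mu mu K mK K0.
rewrite /fubini_F /fubini_G.
have ray (f : R -> \bar R) : measurable_fun (`]0%R, +oo[%classic : set R) f ->
    (\int[mu]_(x in `[0%R, +oo[) f x = \int[mu]_x (if (0 < x)%R then f x else 0))%E.
  move=> mf; rewrite -integral_itv_obnd_cbnd//.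
  rewrite integral_mkcond; apply: eq_integral => x _; rewrite patchE.
  by rewrite mem_setE in_itv/= andbT.
have m2 (g : R -> R) : continuous g -> measurable_fun (`]0%R, +oo[%classic : set R) (EFin \o g).
  by move=> cg; apply: measurable_funTS; apply/measurable_EFinP; exact: continuous_measurable_fun.
have ce (c : R) : continuous (fun t : R => expR (- c * t)).
  by move=> t; apply: continuous_cvg; [exact: continuous_expR|exact: cvgMr].
have cc : continuous (fun x : R => 1 - cos (b * x)).
  move=> x; apply: cvgB; first exact: cvg_cst.
  by apply: continuous_cvg; [exact: continuous_cos|exact: cvgMr].
have -> : (\int[mu]_x \int[mu]_y K (x, y) = \int[mu]_(x in `[0%R, +oo[) (fej b x)%:E)%E.
  rewrite ray; last by apply: m2; exact: fej_cont.
  apply: eq_integral => x _; rewrite /K/=; case: (ltP 0 x) => x0 /=; last by rewrite integral0.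
  transitivity (\int[mu]_(t in `[0%R, +oo[) ((b^-1 * (1 - cos (b * x)))%:E * (t * expR (- x * t))%:E))%E.
    rewrite ray; last first.
      apply: (m2 (fun t => b^-1 * (1 - cos (b * x)) * (t * expR (- x * t)))) => t.
      by apply: cvgMr; apply: cvgM => //; exact: ce.
    by apply: eq_integral => t _; case: ifP.
  rewrite ge0_integralZl//; last 3 first.
  - apply: measurable_funTS; apply/measurable_EFinP; apply: continuous_measurable_fun => t.
    by apply: cvgM => //; exact: ce.
  - by move=> t; rewrite /= in_itv/= andbT => t0; rewrite lee_fin mulr_ge0 ?expR_ge0.
  - by rewrite lee_fin mulr_ge0 ?invr_ge0 ?(ltW b0)// subr_ge0 cos_le1.
  rewrite texp// -EFinM /fej gt_eqF//; congr EFin; field.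
  by rewrite !gt_eqF.
move=> ->.
transitivity (\int[mu]_(t in `[0%R, +oo[) (b / (t ^+ 2 + b ^+ 2))%:E)%E; last exact: atan_int.
have D0 t : t ^+ 2 + b ^+ 2 != 0 by rewrite gt_eqF// ltr_wpDl ?sqr_ge0// exprn_gt0.
rewrite ray; last first.
  apply: (m2 (fun t => b / (t ^+ 2 + b ^+ 2))) => t; apply: cvgMr; apply: cvgV => //.
  apply: cvgD; last exact: cvg_cst.
  by under eq_fun do rewrite expr2; rewrite expr2; exact: cvgM.
apply: eq_integral => t _; rewrite /K/=; case: (ltP 0 t) => t0; last first.
  by rewrite integral0_eq// => x _; rewrite andbF.
transitivity (\int[mu]_(x in `[0%R, +oo[) ((b^-1 * t)%:E * ((1 - cos (b * x)) * expR (- t * x))%:E))%E.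
  rewrite ray; last first.
    apply: (m2 (fun x => b^-1 * t * ((1 - cos (b * x)) * expR (- t * x)))) => x.
    by apply: cvgMr; apply: cvgM; [exact: cc|exact: ce].
  apply: eq_integral => x _; rewrite andbT; case: ifP => // _; congr EFin.
  rewrite (_ : - x * t = - t * x); ring.
rewrite ge0_integralZl//; last 2 first.
- apply: measurable_funTS; apply/measurable_EFinP; apply: continuous_measurable_fun => x.
  by apply: cvgM; [exact: cc|exact: ce].
- by rewrite lee_fin mulr_ge0 ?invr_ge0 ?(ltW b0)// ltW.
rewrite cexp// -EFinM; congr EFin; field.
by rewrite D0 !gt_eqF.
Qed.

Lemma integral_fej b : 0 < b -> (\int[mu]_x (fej b x)%:E = pi%:E)%E.
Proof.
move=> b0; rewrite ge0_symfun_integralT.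
- rewrite (_ : [set x : R | (0 <= x)%R] = `[0%R, +oo[%classic).
    by rewrite integral_fej_ray// -EFinM; congr EFin; field.
  by apply/seteqP; split => x /=; rewrite in_itv/= andbT.
- by move=> x; exact: fej_ge0.
- exact: fej_cont.
- by move=> x; rewrite /= fejN.
Qed.

Let inv2_ray e : 0 < e -> (\int[mu]_(x in `[e, +oo[) (x ^- 2)%:E = (e^-1)%:E)%E.
Proof.
move=> e0.
apply: (@FTC_ray (fun x => - x^-1) _ e 0).
- by rewrite opprK add0r.
- move=> x ex; have x0 : x != 0 by rewrite gt_eqF// (lt_le_trans e0).
  have dV := is_deriveV x0 (is_derive_id x (1 : R)).
  apply: is_derive_eq.
  by rewrite /GRing.scale/=; field.
- apply: continuous_in_subspaceT => x; rewrite inE/= in_itv/= andbT => ex.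
  have x0 : x != 0 by rewrite gt_eqF// (lt_le_trans e0).
  apply: cvgV; first by rewrite sqrf_eq0.
  by under eq_fun do rewrite expr2; rewrite expr2; exact: cvgM.
- by move=> x _; rewrite invr_ge0 sqr_ge0.
- by rewrite -oppr0; apply: cvgN; apply/gtr0_cvgV0; [exact: nbhs_pinfty_gt|exact: cvg_id].
Qed.

Lemma integral_fej_tail b e : 0 < b -> 0 < e ->
  (\int[mu]_(x in [set x | (e < `|x|)%R]) (fej b x)%:E <= (4 / (b * e))%:E)%E.
Proof.
move=> b0 e0.
have mfe : measurable_fun setT (EFin \o fej b) by apply/measurable_EFinP; exact: fej_meas.
have E : [set x | (e < `|x|)%R] = `]-oo, - e[%classic `|` `]e, +oo[%classic.
  apply/seteqP; split => x /=; rewrite !in_itv/= andbT ltr_normr.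
    by move=> /orP[h|h]; [right|left; rewrite ltrNr].
  by move=> [h|->//]; rewrite ltrNr h orbT.
have f0 x : (0 <= (fej b x)%:E)%E by rewrite lee_fin fej_ge0.
have R1 : (\int[mu]_(x in `]e, +oo[) (fej b x)%:E <= (2 / (b * e))%:E)%E.
  apply: (@le_trans _ _ (\int[mu]_(x in `[e, +oo[) ((2 / b)%:E * (x ^- 2)%:E))%E).
    rewrite integral_itv_obnd_cbnd; last exact: measurable_funTS.
    apply: ge0_le_integral => //.
    - exact: measurable_funTS.
    - apply/measurable_EFinP; apply: measurable_funM; first exact: measurable_cst.
      apply: subspace_continuous_measurable_fun => //.
      apply: continuous_in_subspaceT => x; rewrite inE/= in_itv/= andbT => ex.
      have x0 : x != 0 by rewrite gt_eqF// (lt_le_trans e0).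
      apply: cvgV; first by rewrite sqrf_eq0.
      by under eq_fun do rewrite expr2; rewrite expr2; exact: cvgM.
    - move=> x; rewrite /= in_itv/= andbT => ex.
      have x0 : x != 0 by rewrite gt_eqF// (lt_le_trans e0).
      by rewrite -EFinM lee_fin -mulrA -invfM; exact: fej_le2.
  rewrite ge0_integralZl//; last 3 first.
  - apply/measurable_EFinP.
    apply: subspace_continuous_measurable_fun => //.
    apply: continuous_in_subspaceT => x; rewrite inE/= in_itv/= andbT => ex.
    have x0 : x != 0 by rewrite gt_eqF// (lt_le_trans e0).
    apply: cvgV; first by rewrite sqrf_eq0.
    by under eq_fun do rewrite expr2; rewrite expr2; exact: cvgM.
  - by move=> x _; rewrite lee_fin invr_ge0 sqr_ge0.
  - by rewrite lee_fin divr_ge0// ltW.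
  by rewrite inv2_ray// -EFinM lee_fin -mulrA -invfM.
have R2 : (\int[mu]_(x in `]-oo, (- e)%R[) (fej b x)%:E = \int[mu]_(x in `]e, +oo[) (fej b x)%:E)%E.
  have := @ge0_integral_pushforward _ _ (measurableTypeR R) (measurableTypeR R) R _ (@oppr_measurable R setT) mu `]e, +oo[%classic (EFin \o fej b).
  rewrite opp_preimage_itvbndy => H.
  transitivity (\int[mu]_(x in `]-oo, (- e)%R[) (EFin \o fej b \o -%R) x)%E.
    by apply: eq_integral => x _; rewrite /= fejN.
  rewrite -(H (measurable_itv _) (measurable_funTS mfe) (fun y _ => f0 y)).
  by apply: eq_measure_integral => A mA _; exact: lebesgue_measureN.
rewrite E ge0_integral_setU//=.
- rewrite R2 (_ : 4 / (b * e) = 2 / (b * e) + 2 / (b * e)); last by field; rewrite !gt_eqF.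
  by rewrite EFinD; exact: leeD.
- exact: measurable_funTS.
- apply/disj_setPS => x /= [] /=; rewrite !in_itv/= andbT => h1 h2; lra.
Qed.

End Calculus.

Opaque psi dcum d2cum.

(** * Quantitative central limit theorem under a moving tilt *)

Section LocalCLT.
Context {d : measure_display} {Om : measurableType d} {R : realType}
  (P : probability Om R) (X : R -> Om -> R).
Hypothesis HX : levy P X.
Hypothesis Hm : forall u, P.-integrable setT (EFin \o (fun w => expR (u * X 1 w))).
Local Notation intble f := (P.-integrable setT (EFin \o f)).
Local Notation ps := (psi P X).
Local Notation dps := (dcum P (X 1)).
Local Notation d2ps := (d2cum P (X 1)).
Local Notation mu := (@lebesgue_measure R).
Local Notation tl := (tilt_mean P X).
Local Notation wt := (tilt_wt P X).
Local Notation ca := (tilt_cos P X).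
Local Notation sa := (tilt_sin P X).
Local Notation rr := (rr P X).

Let mX t : measurable_fun setT (X t) := levy_meas HX t.
Let Xi h (h0 : 0 <= h) u := exp_intble HX Hm u h0.

Let dps_der (u : R) : is_derive u 1 ps (dps u) := is_derive_cum (mX 1) Hm u.
Let d2ps_der (u : R) : is_derive u 1 dps (d2ps u) := is_derive_dcum (mX 1) Hm u.

Let mom0 h u : 0 <= h -> mom P (X h) 0 u = expR (h * ps u).
Proof. by move=> h0; rewrite mom0E (levy_mgf HX Hm). Qed.

(** The moment of order 0 is e^(h psi(u)); differentiating both expressions and equating the
    derivatives gives the next moment. *)
Let mom1 h u : 0 <= h -> mom P (X h) 1 u = expR (h * ps u) * (h * dps u).
Proof.
move=> h0.
have D1 := is_derive_mom (mX h) (Xi h0) 0 u.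
have E : mom P (X h) 0 = (fun v => expR (h * ps v)) by apply/funext => v; exact: mom0.
have dp := dps_der u.
have D2 : is_derive u 1 (fun v => expR (h * ps v)) (expR (h * ps u) * (h * dps u)).
  by apply: is_derive_eq; rewrite /GRing.scale/=; ring.
rewrite E in D1.
by rewrite -(@derive_val _ _ _ _ _ _ _ D1) (@derive_val _ _ _ _ _ _ _ D2).
Qed.

Let mom2 h u : 0 <= h -> mom P (X h) 2 u = expR (h * ps u) * ((h * dps u) ^+ 2 + h * d2ps u).
Proof.
move=> h0.
have D1 := is_derive_mom (mX h) (Xi h0) 1 u.
have E : mom P (X h) 1 = (fun v => expR (h * ps v) * (h * dps v)).
  by apply/funext => v; exact: mom1.
have dp := dps_der u; have d2p := d2ps_der u.
have D2 : is_derive u 1 (fun v => expR (h * ps v) * (h * dps v)) (expR (h * ps u) * ((h * dps u) ^+ 2 + h * d2ps u)).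
  by apply: is_derive_eq; rewrite /GRing.scale/=; ring.
rewrite E in D1.
by rewrite -(@derive_val _ _ _ _ _ _ _ D1) (@derive_val _ _ _ _ _ _ _ D2).
Qed.

Let wtE s th x : wt s th x = expR (- (s * ps th)) * expR (th * x).
Proof. by rewrite /tilt_wt -expRD addrC. Qed.

Let tlm_int h th k : 0 <= h -> intble (fun w => wt h th (X h w) * X h w ^+ k).
Proof.
move=> h0; have := intbleZl (expR (- (h * ps th))) (mom_intble (mX h) (Xi h0) k th).
by congr (P.-integrable _ _); apply/funext => w /=; rewrite wtE; congr EFin; ring.
Qed.

Let tlm_Ex h th k : 0 <= h -> Ex P (fun w => wt h th (X h w) * X h w ^+ k) = expR (- (h * ps th)) * mom P (X h) k th.
Proof.
move=> h0; rewrite /mom -(ExZl _ (mom_intble (mX h) (Xi h0) k th)).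
by congr Ex; apply/funext => w; rewrite wtE; ring.
Qed.

Lemma tl_mean h th : 0 <= h ->
  intble (fun w => wt h th (X h w) * (X h w - h * dps th)) /\
  Ex P (fun w => wt h th (X h w) * (X h w - h * dps th)) = 0.
Proof.
move=> h0; have i0 := wt_intble HX Hm th h0; have i1 := tlm_int th 1 h0.
have E : (fun w => wt h th (X h w) * (X h w - h * dps th)) =
   (fun w => wt h th (X h w) * X h w ^+ 1 - (h * dps th) * wt h th (X h w)).
  by apply/funext => w; ring.
rewrite E; split; first exact: (intbleB i1 (intbleZl _ i0)).
rewrite (ExB i1 (intbleZl _ i0)) (ExZl _ i0) (wt_Ex HX Hm th h0) tlm_Ex// mom1//.
by rewrite mulrA -expRD addNr expR0; ring.
Qed.

Lemma tl_var h th : 0 <= h ->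
  intble (fun w => wt h th (X h w) * (X h w - h * dps th) ^+ 2) /\
  Ex P (fun w => wt h th (X h w) * (X h w - h * dps th) ^+ 2) = h * d2ps th.
Proof.
move=> h0; have i0 := wt_intble HX Hm th h0; have i1 := tlm_int th 1 h0; have i2 := tlm_int th 2 h0.
have E : (fun w => wt h th (X h w) * (X h w - h * dps th) ^+ 2) =
   (fun w => wt h th (X h w) * X h w ^+ 2 - (2 * h * dps th) * (wt h th (X h w) * X h w ^+ 1)
      + (h * dps th) ^+ 2 * wt h th (X h w)).
  by apply/funext => w; ring.
have i21 := intbleB i2 (intbleZl (2 * h * dps th) i1).
rewrite E; split; first exact: (intbleD i21 (intbleZl _ i0)).
rewrite (ExD i21 (intbleZl _ i0)) (ExB i2 (intbleZl _ i1)) (ExZl _ i0) (ExZl _ i1).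
rewrite (wt_Ex HX Hm th h0) (tlm_Ex _ _ h0) (tlm_Ex _ _ h0) (mom1 _ h0) (mom2 _ h0).
have ee : expR (- (h * ps th)) * expR (h * ps th) = 1 by rewrite -expRD addNr expR0.
by rewrite ![expR (- _) * (_ * _)]mulrA ee; ring.
Qed.

Let d2ps_ge0 th : 0 <= d2ps th.
Proof.
have [_ E2] := tl_var th (@ler01 R).
rewrite -[d2ps th]mul1r -E2.
by apply: Ex_ge0 => w; rewrite mulr_ge0 ?expR_ge0 ?sqr_ge0.
Qed.

(** 256 = 4^4 is the constant of [norm_pow_le_exp] at order 4 and also covers 3^3. The exponentials
    bound the tilted means of e^Y and e^(-Y), Y the centred variable, for every time step h <= 1. *)
Definition Cb (th : R) : R := 256 * (expR `|ps (th + 1) - ps th - dps th| + expR `|ps (th - 1) - ps th + dps th|).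

Let Cb_ge0 th : 0 <= Cb th.
Proof. by rewrite /Cb; apply: mulr_ge0; first exact: ler0n; apply: addr_ge0; exact: expR_ge0. Qed.

Lemma tl_exp h th : 0 <= h <= 1 ->
  intble (fun w => wt h th (X h w) * (expR (X h w - h * dps th) + expR (- (X h w - h * dps th)))) /\
  256 * Ex P (fun w => wt h th (X h w) * (expR (X h w - h * dps th) + expR (- (X h w - h * dps th)))) <= Cb th.
Proof.
move=> /andP[h0 h1].
have E : (fun w => wt h th (X h w) * (expR (X h w - h * dps th) + expR (- (X h w - h * dps th)))) =
  (fun w => expR (- (h * ps th) - h * dps th) * expR ((th + 1) * X h w)
     + expR (- (h * ps th) + h * dps th) * expR ((th - 1) * X h w)).
  apply/funext => w; rewrite wtE mulrDr -!expRD; congr (expR _ + expR _); ring.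
rewrite E; have j1 := Xi h0 (th + 1); have j2 := Xi h0 (th - 1).
split; first exact: (intbleD (intbleZl _ j1) (intbleZl _ j2)).
rewrite (ExD (intbleZl _ j1) (intbleZl _ j2)) (ExZl _ j1) (ExZl _ j2).
have ar (a p m : R) : expR (- (h * p) - h * m) * expR (h * a) <= expR `|a - p - m|.
  rewrite -expRD ler_expR (_ : - (h * p) - h * m + h * a = h * (a - p - m)); last by ring.
  by rewrite (le_trans (ler_norm _))// normrM (ger0_norm h0) ler_piMl.
have ar2 (a p m : R) : expR (- (h * p) + h * m) * expR (h * a) <= expR `|a - p + m|.
  rewrite -expRD ler_expR (_ : - (h * p) + h * m + h * a = h * (a - p + m)); last by ring.
  by rewrite (le_trans (ler_norm _))// normrM (ger0_norm h0) ler_piMl.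
rewrite (levy_mgf HX Hm _ h0) (levy_mgf HX Hm _ h0) /Cb.
by apply: ler_wpM2l; first exact: ler0n; apply: lerD; [exact: ar|exact: ar2].
Qed.

Lemma expRN_taylor (x : R) : 0 <= x -> `|expR (- x) - 1 + x| <= x ^+ 2.
Proof.
move=> x0; rewrite ger0_norm; last by have := expR_ge1Dx (- x); lra.
rewrite -subr_ge0.
apply: (@ge0_of_derive R (fun x => x ^+ 2 - (expR (- x) - 1 + x)) (fun x => 2 * x - (1 - expR (- x)))) => //.
- by move=> y; apply: is_derive_eq; rewrite /GRing.scale/=; ring.
- by rewrite oppr0 expR0 expr0n/=; ring.
- by move=> y y0; have := expR_ge1Dx (- y); lra.
Qed.

(** The variance h psi''(th) makes the second-order terms of the cosine and of the Gaussian agree;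
    both remainders are of order v^4. *)
Lemma ca_approx h th v : 0 <= h <= 1 ->
  `|ca h th v - expR (- (h * d2ps th * v ^+ 2 / 2))| <= (Cb th + d2ps th ^+ 2) * v ^+ 4.
Proof.
move=> h01; have /andP[h0 h1] := h01.
have i0 := wt_intble HX Hm th h0.
have [i2 E2] := tl_var th h0.
have ic := tl_intble HX Hm th h0 (bddm_cos v).
have [ie Ee] := tl_exp th h01.
have s0 := d2ps_ge0 th.
have H1 : `|ca h th v - (1 - h * d2ps th * v ^+ 2 / 2)| <= Cb th * v ^+ 4.
  have -> : ca h th v - (1 - h * d2ps th * v ^+ 2 / 2) =
    Ex P (fun w => wt h th (X h w) * cos (v * (X h w - h * dps th)) - wt h th (X h w)
       + (v ^+ 2 / 2) * (wt h th (X h w) * (X h w - h * dps th) ^+ 2)).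
    rewrite (ExD (intbleB ic i0) (intbleZl _ i2)) (ExB ic i0) (ExZl _ i2) E2 (wt_Ex HX Hm th h0).
    rewrite /tilt_cos /tilt_mean; ring.
  apply: (@le_trans _ _ (v ^+ 4 * (256 * Ex P (fun w => wt h th (X h w) * (expR (X h w - h * dps th) + expR (- (X h w - h * dps th))))))).
    rewrite [leRHS]mulrA -(ExZl _ ie); apply: Ex_bnd.
    - exact: intble_meas (intbleD (intbleB ic i0) (intbleZl _ i2)).
    - exact: intbleZl.
    move=> w; set Y := X h w - h * dps th; set W := wt h th (X h w).
    rewrite (_ : _ + _ = W * (cos (v * Y) - 1 + (v * Y) ^+ 2 / 2)); last by field.
    have W0 : 0 <= W by exact: expR_ge0.
    rewrite normrM (ger0_norm W0) mulrCA ler_wpM2l//.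
    apply: (le_trans (cos_taylor _)); rewrite exprMn -[leRHS]mulrA ler_wpM2l ?exprn_even_ge0//.
    have := norm_pow_le_exp 4 Y.
    rewrite -normrX ger0_norm ?exprn_even_ge0// (_ : 4%:R ^+ 4 = 256 :> R)//.
    by rewrite -natrX.
  by rewrite mulrC ler_wpM2r ?exprn_even_ge0.
set x := h * d2ps th * v ^+ 2 / 2.
have x0 : 0 <= x.
  by apply: divr_ge0; [apply: mulr_ge0; [exact: mulr_ge0|exact: sqr_ge0]|exact: ler0n].
have H2 := expRN_taylor x0.
have H3 : x ^+ 2 <= d2ps th ^+ 2 * v ^+ 4.
  rewrite (_ : x ^+ 2 = (h ^+ 2 / 4) * (d2ps th ^+ 2 * v ^+ 4)); last by rewrite /x; field.
  apply: ler_piMl; first by apply: mulr_ge0; [exact: sqr_ge0|rewrite exprn_even_ge0].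
  have : h ^+ 2 <= 1 by rewrite exprn_ile1.
  by move=> ?; lra.
rewrite (_ : _ - _ = (ca h th v - (1 - x)) - (expR (- x) - 1 + x)); last by ring.
apply: (le_trans (ler_normB _ _)); rewrite mulrDl lerD//.
exact: le_trans H3.
Qed.

(** Centring removes the linear term of the sine, leaving order |v|^3. *)
Lemma sa_approx h th v : 0 <= h <= 1 -> `|sa h th v| <= Cb th * `|v| ^+ 3.
Proof.
move=> h01; have /andP[h0 h1] := h01.
have [i1 E1] := tl_mean th h0.
have is_ := tl_intble HX Hm th h0 (bddm_sin v).
have [ie Ee] := tl_exp th h01.
have -> : sa h th v = Ex P (fun w => wt h th (X h w) * sin (v * (X h w - h * dps th))
    - v * (wt h th (X h w) * (X h w - h * dps th))).
  by rewrite (ExB is_ (intbleZl _ i1)) (ExZl _ i1) E1 mulr0 subr0.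
apply: (@le_trans _ _ (`|v| ^+ 3 * (256 * Ex P (fun w => wt h th (X h w) * (expR (X h w - h * dps th) + expR (- (X h w - h * dps th))))))).
  rewrite [leRHS]mulrA -(ExZl _ ie); apply: Ex_bnd.
  - exact: intble_meas (intbleB is_ (intbleZl _ i1)).
  - exact: intbleZl.
  move=> w; set Y := X h w - h * dps th; set W := wt h th (X h w).
  rewrite (_ : _ - _ = W * (sin (v * Y) - v * Y)); last by ring.
  have W0 : 0 <= W by exact: expR_ge0.
  rewrite normrM (ger0_norm W0) mulrCA ler_wpM2l//.
  apply: (le_trans (sin_taylor _)); rewrite normrM exprMn -[leRHS]mulrA ler_wpM2l ?exprn_ge0//.
  apply: (le_trans (norm_pow_le_exp 3 Y)); rewrite ler_wpM2r ?addr_ge0 ?expR_ge0//.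
  by rewrite -natrX ler_nat.
by rewrite mulrC ler_wpM2r ?exprn_ge0.
Qed.

(** One factor is replaced at a time: since |a| + |c| <= 1 + del for a single step, the errors
    satisfy e_(n+1) <= e_n (1 + del) + del. *)
Lemma pair_pow h th v (b del : R) (n : nat) : 0 <= h -> 0 <= b <= 1 ->
  `|ca h th v - b| + `|sa h th v| <= del ->
  `|ca (n%:R * h) th v - b ^+ n| + `|sa (n%:R * h) th v| <= (1 + del) ^+ n - 1.
Proof.
move=> h0 /andP[b0 b1] Hd.
have del0 : 0 <= del by apply: le_trans Hd; rewrite addr_ge0.
elim: n => [|n IH].
  rewrite !expr0 mul0r subrr /tilt_cos /tilt_sin /tilt_mean.
  under eq_fun do rewrite (levy0 HX) mul0r subr0 mulr0 cos0 /tilt_wt mulr0 mul0r subr0 expR0 mulr1.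
  under [X in _ + `|Ex P X|]eq_fun do rewrite (levy0 HX) mul0r subr0 mulr0 sin0 mulr0.
  by rewrite !Ex_cst subrr !normr0 addr0.
rewrite -natr1 mulrDl mul1r (ca_add HX Hm)// ?mulr_ge0// (sa_add HX Hm)// ?mulr_ge0//.
set A := ca (n%:R * h) th v in IH *; set S := sa (n%:R * h) th v in IH *.
set a := ca h th v in Hd *; set c := sa h th v in Hd *.
set B := b ^+ n in IH *.
have B0 : 0 <= B by exact: exprn_ge0.
have B1 : B <= 1 by exact: exprn_ile1.
rewrite !exprSr -/B.
have e1 : `|A * a - S * c - B * b| <= `|A - B| * `|a| + `|S| * `|c| + B * `|a - b|.
  rewrite (_ : A * a - S * c - B * b = (A - B) * a - S * c + B * (a - b)); last by ring.
  rewrite (le_trans (ler_normD _ _))// normrM (ger0_norm B0) lerD2r.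
  by rewrite (le_trans (ler_normB _ _))// !normrM.
have e2 : `|S * a + A * c| <= `|S| * `|a| + `|A - B| * `|c| + B * `|c|.
  rewrite (_ : S * a + A * c = S * a + (A - B) * c + B * c); last by ring.
  rewrite (le_trans (ler_normD _ _))// normrM (ger0_norm B0) lerD2r.
  by rewrite (le_trans (ler_normD _ _))// !normrM.
have e3 : `|a| + `|c| <= 1 + del.
  have : `|a| <= `|a - b| + b.
    by have := ler_normD (a - b) b; rewrite subrK (ger0_norm b0).
  by move=> ?; lra.
have e4 : B * (`|a - b| + `|c|) <= del.
  by rewrite -[leRHS]mul1r ler_pM// addr_ge0.
have e5 : (`|A - B| + `|S|) * (`|a| + `|c|) <= ((1 + del) ^+ n - 1) * (1 + del).
  by apply: ler_pM => //; rewrite addr_ge0.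
move: e1 e2 e4 e5.
set AB := `|A - B|; set na := `|a|; set nc := `|c|; set nS := `|S|; set ab := `|a - b|.
set D := (1 + del) ^+ n; move=> e1 e2 e4 e5; lra.
Qed.

(** Time s is cut into n = trunc(s) + 1 <= 2 s steps of length at most 1 and the frequency is u /
    sqrt(s); n times the one-step error is then O(1 / sqrt(s)). *)
Lemma clt_arith (sg C s u : R) : 1 <= s -> 0 <= sg -> 0 <= C ->
  let r := Num.sqrt s in let n := (Num.trunc s).+1 in let h := s / n%:R in let v := u / r in
  let b := expR (- (h * sg * v ^+ 2 / 2)) in let del := (C + sg ^+ 2) * v ^+ 4 + C * `|v| ^+ 3 in
  [/\ 0 <= h <= 1, n%:R * h = s, 0 <= b <= 1, b ^+ n = expR (- (sg * u ^+ 2 / 2)) &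
   (1 + del) ^+ n - 1 <= expR (2 * ((C + sg ^+ 2) * u ^+ 4 + C * `|u| ^+ 3) / r) - 1].
Proof.
move=> s1 sg0 C0 r n h v b del.
have s0 : 0 < s by rewrite (lt_le_trans ltr01).
have r2 : r ^+ 2 = s by rewrite sqr_sqrtr// ltW.
have r1 : 1 <= r by rewrite -sqrtr1 ler_wsqrtr.
have r0 : 0 < r by rewrite (lt_le_trans ltr01).
have rn0 : r != 0 by rewrite gt_eqF.
have /andP[tn1 tn2] := truncn_itv (ltW s0).
have n0 : (0 : R) < n%:R by rewrite ltr0n.
have ns : n%:R <= 2 * s by rewrite /n -natr1; lra.
have h01 : 0 <= h <= 1 by rewrite divr_ge0 ?(ltW s0) ?(ltW n0)//= ler_pdivrMr// mul1r ltW.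
have /andP[h0 h1] := h01.
have nh : n%:R * h = s by rewrite /h mulrC divfK// gt_eqF.
have del0 : 0 <= del.
  rewrite /del; apply: addr_ge0; apply: mulr_ge0 => //.
  - by rewrite addr_ge0// sqr_ge0.
  - by rewrite exprn_even_ge0.
split => //.
- rewrite /b expR_ge0/= -expR0 ler_expR oppr_le0 divr_ge0//.
  by apply: mulr_ge0; [exact: mulr_ge0|exact: sqr_ge0].
- rewrite /b -expRM_natl; congr expR; rewrite mulrN; congr (- _).
  rewrite (_ : n%:R * (h * sg * v ^+ 2 / 2) = (n%:R * h) * sg * v ^+ 2 / 2); last by ring.
  by rewrite nh /v expr_div_n r2; field; rewrite gt_eqF.
- have Hn : (1 + del) ^+ n <= expR (n%:R * del).
    have d1 : 0 <= 1 + del by rewrite addr_ge0.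
    by rewrite expRM_natl; apply: lerXn2r; rewrite ?nnegrE ?expR_ge0//; exact: expR_ge1Dx.
  rewrite lerD2r (le_trans Hn)// ler_expR.
  apply: (@le_trans _ _ (2 * s * del)); first by rewrite ler_wpM2r.
  rewrite /del /v expr_div_n normrM (ger0_norm (_ : 0 <= r^-1)) ?invr_ge0 ?(ltW r0)// -/(_ / r) expr_div_n.
  set a4 := u ^+ 4; set a3 := `|u| ^+ 3; set K := C + sg ^+ 2.
  have a40 : 0 <= a4 by rewrite exprn_even_ge0.
  have K0 : 0 <= K by rewrite addr_ge0 ?sqr_ge0.
  rewrite -r2.
  have -> : 2 * r ^+ 2 * (K * (a4 / r ^+ 4) + C * (a3 / r ^+ 3)) = (2 * (K * a4 / r + C * a3)) / r by field.
  rewrite ler_wpM2r ?invr_ge0 ?(ltW r0)// ler_pM2l// lerD2r.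
  by rewrite ler_pdivrMr// ler_peMr// mulr_ge0.
Qed.

(** The error is explicit in [th] through continuous functions, which is what lets the tilt vary
    along the sequence. *)
Lemma clt_bound s th u : 1 <= s ->
  let e := expR (2 * ((Cb th + d2ps th ^+ 2) * u ^+ 4 + Cb th * `|u| ^+ 3) / Num.sqrt s) - 1 in
  `|ca s th (u / Num.sqrt s) - expR (- (d2ps th * u ^+ 2 / 2))| <= e /\
  `|sa s th (u / Num.sqrt s)| <= e.
Proof.
move=> s1 e.
have [h01 nh b01 bn He] := clt_arith u s1 (d2ps_ge0 th) (Cb_ge0 th).
set v := u / Num.sqrt s in b01 bn He *.
have Hd := lerD (ca_approx th v h01) (sa_approx th v h01).
have := pair_pow (Num.trunc s).+1 (proj1 (andP h01)) b01 Hd.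
rewrite nh bn => H; split; apply: le_trans He; apply: le_trans H.
  by rewrite lerDl.
by rewrite lerDr.
Qed.

Section Sequence.
Variables (th s : nat -> R) (al : R).
Hypothesis th_cvg : th @ \oo --> al.
Hypothesis s_cvg : s @ \oo --> +oo.
Hypothesis s_ge0 : forall n, 0 <= s n.

Let ps_cont : continuous ps := cum_cont (mX 1) Hm.
Let dps_cont : continuous dps := dcum_cont (mX 1) Hm.
Let d2ps_cont : continuous d2ps := d2cum_cont (mX 1) Hm.

Let seq_cont (f : R -> R) : continuous f -> (fun n => f (th n)) @ \oo --> f al.
Proof. by move=> cf; apply: continuous_cvg => //; exact: cf. Qed.

Let Cb_cont : continuous Cb.
Proof.
have sh (c : R) : continuous (fun x => ps (x + c)).
  move=> x; apply: (@cvg_comp _ _ _ (fun x => x + c) ps _ (nbhs (x + c))).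
    by apply: cvgD; [exact: cvg_id|exact: cvg_cst].
  exact: ps_cont.
move=> x; apply: cvgMr; apply: cvgD.
- apply: continuous_cvg; first exact: continuous_expR.
  apply: cvg_norm; apply: cvgB; last exact: dps_cont.
  by apply: cvgB; [exact: sh|exact: ps_cont].
- apply: continuous_cvg; first exact: continuous_expR.
  apply: cvg_norm; apply: cvgD; last exact: dps_cont.
  by apply: cvgB; [exact: sh|exact: ps_cont].
Qed.

Lemma inv_sqrt_cvg : (fun n => (Num.sqrt (s n))^-1) @ \oo --> (0 : R).
Proof.
apply/cvgrPdist_lt => e e0.
have : \forall n \near \oo, e ^- 2 < s n by move/cvgryPgt : s_cvg; apply.
apply: filterS => n Hn; rewrite sub0r normrN ger0_norm ?invr_ge0 ?sqrtr_ge0//.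
have e1 : 0 < e^-1 by rewrite invr_gt0.
have : e^-1 < Num.sqrt (s n).
  rewrite -[e^-1](ger0_norm (ltW e1)) -sqrtr_sqr exprVn ltr_sqrt//.
  by apply: le_lt_trans Hn; rewrite invr_ge0 sqr_ge0.
by move=> H; rewrite -[e]invrK ltf_pV2// posrE// (lt_trans e1).
Qed.

(** Real part of the characteristic function of (y - Y) / sqrt(s_n), with Y the centred tilted
    variable; [y] stays at unit scale, so its phase disappears in the limit. *)
Definition phi (n : nat) (y u : R) := tl (s n) (th n) (fun x => cos (u / Num.sqrt (s n) * (y - x))).

Lemma clt_phi y u : (fun n => phi n y u) @ \oo --> expR (- (d2ps al * u ^+ 2 / 2)).
Proof.
pose e n := expR (2 * ((Cb (th n) + d2ps (th n) ^+ 2) * u ^+ 4 + Cb (th n) * `|u| ^+ 3) / Num.sqrt (s n)) - 1.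
have e_cvg : e @ \oo --> (0 : R).
  pose K n := 2 * ((Cb (th n) + d2ps (th n) ^+ 2) * u ^+ 4 + Cb (th n) * `|u| ^+ 3).
  have Kc : K @ \oo --> 2 * ((Cb al + d2ps al ^+ 2) * u ^+ 4 + Cb al * `|u| ^+ 3).
    apply: cvgMr; apply: cvgD; last by apply: cvgMl; exact: seq_cont.
    apply: cvgMl; apply: cvgD; first exact: seq_cont.
    by rewrite expr2; under eq_fun do rewrite expr2; apply: cvgM; exact: seq_cont.
  have z : (fun n => K n / Num.sqrt (s n)) @ \oo --> (0 : R).
    rewrite -[X in _ --> X](mulr0 (2 * ((Cb al + d2ps al ^+ 2) * u ^+ 4 + Cb al * `|u| ^+ 3))).
    by apply: cvgM; [exact: Kc|exact: inv_sqrt_cvg].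
  have -> : (0 : R) = expR 0 - 1 by rewrite expR0 subrr.
  apply: cvgB; last exact: cvg_cst.
  by apply: continuous_cvg; [exact: continuous_expR|exact: z].
have s1 : \forall n \near \oo, 1 <= s n by move/cvgryPge : s_cvg; apply.
have cacvg : (fun n => ca (s n) (th n) (u / Num.sqrt (s n))) @ \oo --> expR (- (d2ps al * u ^+ 2 / 2)).
  have g : (fun n => expR (- (d2ps (th n) * u ^+ 2 / 2))) @ \oo --> expR (- (d2ps al * u ^+ 2 / 2)).
    apply: continuous_cvg; first exact: continuous_expR.
    by apply: cvgN; apply: cvgMl; apply: cvgMl; exact: seq_cont.
  have dz : (fun n => ca (s n) (th n) (u / Num.sqrt (s n)) - expR (- (d2ps (th n) * u ^+ 2 / 2))) @ \oo --> (0 : R).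
    apply: norm_cvg0; apply: (@squeeze_cvgr _ _ _ _ (fun=> 0) e) => //; last exact: cvg_cst.
    by apply: filterS s1 => n s1; rewrite normr_ge0/=; case: (clt_bound (th n) u s1).
  have -> : (fun n => ca (s n) (th n) (u / Num.sqrt (s n))) =
    (fun n => (ca (s n) (th n) (u / Num.sqrt (s n)) - expR (- (d2ps (th n) * u ^+ 2 / 2)))
       + expR (- (d2ps (th n) * u ^+ 2 / 2))) by apply/funext => n; rewrite subrK.
  by rewrite -[X in _ --> X]add0r; exact: cvgD dz g.
have sacvg : (fun n => sa (s n) (th n) (u / Num.sqrt (s n))) @ \oo --> (0 : R).
  apply: norm_cvg0; apply: (@squeeze_cvgr _ _ _ _ (fun=> 0) e) => //; last exact: cvg_cst.
  by apply: filterS s1 => n s1; rewrite normr_ge0/=; case: (clt_bound (th n) u s1).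
have vcvg : (fun n => u / Num.sqrt (s n) * y) @ \oo --> (0 : R).
  rewrite -(mul0r y); apply: cvgMl; rewrite -(mulr0 u); apply: cvgMr; exact: inv_sqrt_cvg.
have c1 : (fun n => cos (u / Num.sqrt (s n) * y)) @ \oo --> (1 : R).
  by rewrite -(cos0 R); apply: continuous_cvg => //; exact: continuous_cos.
have c2 : (fun n => sin (u / Num.sqrt (s n) * y)) @ \oo --> (0 : R).
  by rewrite -(sin0 R); apply: continuous_cvg => //; exact: continuous_sin.
have -> : (fun n => phi n y u) = (fun n => cos (u / Num.sqrt (s n) * y) * ca (s n) (th n) (u / Num.sqrt (s n))
   + sin (u / Num.sqrt (s n) * y) * sa (s n) (th n) (u / Num.sqrt (s n))).
  by apply/funext => n; rewrite /phi (tl_shift HX Hm).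
rewrite -[X in _ --> X]mul1r -[X in _ --> X]addr0 -[X in _ --> _ + X](mul0r 0).
by apply: cvgD; [exact: (cvgM c1 cacvg)|exact: (cvgM c2 sacvg)].
Qed.

Hypothesis nonlat : ~ lattice P (X 1).

(** On |v| <= a the squared modulus at time 1 is at most 1 - c v^2. Raised to about s_n powers with
    v = u / sqrt(s_n), this is a Gaussian majorant over the entire window and not merely near 0. *)
Lemma phi_bound a : 0 < a -> exists2 c, 0 < c &
  \forall n \near \oo, forall y u, 0 <= u <= a * Num.sqrt (s n) -> `|phi n y u| <= expR (- (c * u ^+ 2 / 2)).
Proof.
move=> a0.
have k0 : 0 < `|al| + 1 by rewrite ltr_wpDl.
have [c c0 Hc] := rr_nonlattice HX Hm nonlat k0 a0.
exists (c / 2); first by rewrite divr_gt0.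
have s1 : \forall n \near \oo, 1 <= s n by move/cvgryPge : s_cvg; apply.
have t1 : \forall n \near \oo, `|th n| <= `|al| + 1.
  move/cvgrPdist_lt : th_cvg => /(_ 1 ltr01); apply: filterS => n Hn.
  rewrite -[th n](subrK al) addrC (le_trans (ler_normD _ _))// lerD2l.
  by rewrite distrC ltW.
near=> n.
have sn1 : 1 <= s n by near: n.
have tn1 : `|th n| <= `|al| + 1 by near: n.
have s0 : 0 < s n by rewrite (lt_le_trans ltr01).
move=> y u /andP[u0 ua].
set r := Num.sqrt (s n).
have r0 : 0 < r by rewrite sqrtr_gt0.
have r2 : r ^+ 2 = s n by rewrite sqr_sqrtr// ltW.
apply: (le_trans (tl_shift_le HX Hm _ _ _ (ltW s0))).
set v := u / r.
have va : `|v| <= a by rewrite ger0_norm ?divr_ge0 ?(ltW r0)// ler_pdivrMr.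
have H1 := Hc (th n) v tn1 va.
have H2 := rr_trunc HX Hm (th n) v (ltW s0).
have /andP[tr1 tr2] := truncn_itv (ltW s0).
have trs : s n / 2 <= (Num.trunc (s n))%:R.
  have : (1 : R) <= (Num.trunc (s n))%:R by rewrite -[1]/(1%:R) ler_nat truncn_gt0.
  rewrite -natr1 in tr2; lra.
have H3 : rr (s n) (th n) v <= expR (- (c * u ^+ 2 / 2)).
  apply: (le_trans H2).
  apply: (@le_trans _ _ (expR (- (c * v ^+ 2)) ^+ Num.trunc (s n))).
    rewrite lerXn2r ?nnegrE ?expR_ge0 ?rr_ge0//.
    by apply: (le_trans H1); have := expR_ge1Dx (- (c * v ^+ 2)); lra.
  rewrite -expRM_natl ler_expR mulrN lerN2.
  have -> : c * u ^+ 2 / 2 = (s n / 2) * (c * v ^+ 2).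
    by rewrite /v expr_div_n r2; field; rewrite gt_eqF.
  by rewrite ler_wpM2r// mulr_ge0 ?sqr_ge0// ltW.
have -> : expR (- (c / 2 * u ^+ 2 / 2)) = Num.sqrt (expR (- (c * u ^+ 2 / 2))).
  rewrite -[LHS](ger0_norm (expR_ge0 _)) -sqrtr_sqr; congr Num.sqrt.
  by rewrite expr2 -expRD; congr expR; field.
exact: ler_wsqrtr.
Unshelve. all: by end_near.
Qed.

End Sequence.
End LocalCLT.

Transparent psi dcum d2cum.

(** Dominated convergence when the majorant holds only eventually: the sequence is shifted by
    [n0]. *)
Lemma dct_near {d} {T : measurableType d} {R : realType} (mu : {measure set T -> \bar R}) (D : set T)
  (f : nat -> T -> R) (F g : T -> R) : measurable D ->
  (forall n, measurable_fun D (f n)) -> measurable_fun D F ->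
  (forall x, D x -> (f^~ x) @ \oo --> F x) -> mu.-integrable D (EFin \o g) ->
  (\forall n \near \oo, forall x, D x -> `|f n x| <= g x) ->
  (fun n => \int[mu]_(x in D) (f n x)%:E)%E @ \oo --> (\int[mu]_(x in D) (F x)%:E)%E.
Proof.
move=> mD mf mF cf ig [n0 _ Hn].
have H := @dominated_convergence _ _ R mu D mD (fun n x => (f (n + n0)%N x)%:E) (fun x => (F x)%:E) (EFin \o g).
rewrite -(cvg_shiftn n0).
apply: (fun a b c d e => (let: And3 _ _ z := H a b c d e in z)) => //.
- by move=> n; apply/measurable_EFinP.
- exact/measurable_EFinP.
- apply: aeW => x Dx; apply: cvg_EFin; first by apply: nearW.
  by rewrite (cvg_shiftn n0 (f^~ x)); exact: cf.
- apply: aeW => x n Dx; rewrite /= lee_fin; apply: Hn => //=.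
  exact: leq_addl.
Qed.

(** * Tauberian removal of the smoothing *)

Section Tauber.
Context {R : realType}.
Local Notation mu := (@lebesgue_measure R).
Variables (T : nat -> R -> R) (th : nat -> R) (al : R).
Hypothesis al0 : 0 < al.
Hypothesis th_cvg : th @ \oo --> al.
Hypothesis T0 : forall n x, 0 <= T n x.
Hypothesis Tm : forall n, measurable_fun setT (T n).
Hypothesis Tmono : forall n x h, 0 <= h -> T n (x + h) <= expR (th n * h) * T n x.
Hypothesis HQ : forall a, 0 < a -> exists Q : nat -> R -> R,
  [/\ \forall n \near \oo, forall x, (\int[mu]_z (pi^-1 * fej a z * T n (x - z))%:E = (Q n x)%:E)%E,
      forall x, (Q ^~ x) @ \oo --> al^-1 &
      exists C, \forall n \near \oo, forall x, Q n x <= C].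

Let pi0 : 0 < pi :> R := pi_gt0 R.

Let Kint (a : R) : 0 < a -> (\int[mu]_z (pi^-1 * fej a z)%:E = 1)%E.
Proof.
move=> a0; under eq_integral do rewrite EFinM.
rewrite ge0_integralZl//.
- by rewrite integral_fej// -EFinM mulVf// gt_eqF.
- by apply/measurable_EFinP; exact: fej_meas.
- by move=> x _; rewrite lee_fin fej_ge0.
- by rewrite lee_fin invr_ge0 ltW.
Qed.

Let Ktail (a e : R) : 0 < a -> 0 < e ->
  (\int[mu]_(z in [set x | (e < `|x|)%R]) (pi^-1 * fej a z)%:E <= (4 / (pi * a * e))%:E)%E.
Proof.
move=> a0 e0; under eq_integral do rewrite EFinM.
have mE : measurable [set x : R | (e < `|x|)%R].
  rewrite -[X in measurable X]setTI; apply: measurable_fun_ltr => //.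
rewrite ge0_integralZl//.
- have -> : 4 / (pi * a * e) = pi^-1 * (4 / (a * e)).
    by move: (pi : R) (pi_gt0 R) => p p0; field; rewrite !gt_eqF.
  rewrite EFinM lee_pmul2l ?lte_fin ?invr_gt0//.
  exact: integral_fej_tail.
- by apply/measurable_EFinP; apply: measurable_funTS; exact: fej_meas.
- by move=> x _; rewrite lee_fin fej_ge0.
- by rewrite lee_fin invr_ge0 ltW.
Qed.

Let Kcore (a e : R) : 0 < a -> 0 < e ->
  ((1 - 4 / (pi * a * e))%:E <= \int[mu]_(z in ~` [set x | (e < `|x|)%R]) (pi^-1 * fej a z)%:E <= 1)%E.
Proof.
move=> a0 e0.
have mE : measurable [set x : R | (e < `|x|)%R].
  rewrite -[X in measurable X]setTI; apply: measurable_fun_ltr => //.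
have K0 z : (0 <= (pi^-1 * fej a z)%:E :> \bar R)%E by rewrite lee_fin mulr_ge0 ?fej_ge0// invr_ge0 ltW.
have mK : measurable_fun setT (fun z => (pi^-1 * fej a z)%:E : \bar R).
  by apply/measurable_EFinP; apply: measurable_funM => //; exact: fej_meas.
have H : (\int[mu]_(z in [set x | (e < `|x|)%R]) (pi^-1 * fej a z)%:E + 
   \int[mu]_(z in ~` [set x | (e < `|x|)%R]) (pi^-1 * fej a z)%:E = 1)%E.
  rewrite -(Kint a0) -(setUv [set x | (e < `|x|)%R]) ge0_integral_setU//.
  - exact: measurableC.
  - by rewrite setUv.
  - by apply/disj_setPCl.
have I2 : (0 <= \int[mu]_(z in ~` [set x | (e < `|x|)%R]) (pi^-1 * fej a z)%:E)%E by exact: integral_ge0.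
have I1 : (0 <= \int[mu]_(z in [set x | (e < `|x|)%R]) (pi^-1 * fej a z)%:E)%E by exact: integral_ge0.
have I3 := Ktail a0 e0.
move: I1 I2 I3 H.
case: (\int[mu]_(z in [set x | (e < `|x|)%R]) (pi^-1 * fej a z)%:E)%E => [x||]//.
case: (\int[mu]_(z in ~` [set x | (e < `|x|)%R]) (pi^-1 * fej a z)%:E)%E => [y||]//.
rewrite !lee_fin => x0 y0 x1 /eqP; rewrite -EFinD eqe => /eqP xy.
by apply/andP; split; lra.
Qed.

(** On |z| <= e the one-sided growth bound compares every averaged value with the one at x + e; the
    kernel keeps mass at least 1 - 4 / (pi a e) on that window. *)
Let Qlow (a e x q : R) n : 0 < a -> 0 < e -> 0 <= th n ->
  (\int[mu]_z (pi^-1 * fej a z * T n (x - z))%:E = q%:E)%E ->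
  (1 - 4 / (pi * a * e)) * T n (x + e) <= expR (2 * e * th n) * q.
Proof.
move=> a0 e0 t0 Hq.
have mE : measurable [set x : R | (e < `|x|)%R].
  rewrite -[X in measurable X]setTI; apply: measurable_fun_ltr => //.
have K0 z : 0 <= pi^-1 * fej a z by rewrite mulr_ge0 ?fej_ge0// invr_ge0 ltW.
have mK : measurable_fun setT (fun z => pi^-1 * fej a z).
  by apply: measurable_funM => //; exact: fej_meas.
have mKT : measurable_fun setT (fun z => pi^-1 * fej a z * T n (x - z)).
  apply: measurable_funM => //; apply: measurableT_comp => //.
  exact: measurable_funB.
set D := ~` [set x : R | (e < `|x|)%R].
have mD : measurable D by exact: measurableC.
have H1 : (\int[mu]_(z in D) (pi^-1 * fej a z * (expR (- (2 * e * th n)) * T n (x + e)))%:E <= q%:E)%E.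
  rewrite -Hq.
  apply: (@le_trans _ _ (\int[mu]_(z in D) (pi^-1 * fej a z * T n (x - z))%:E)%E).
    apply: ge0_le_integral => //.
    - by move=> z _; rewrite lee_fin !mulr_ge0 ?expR_ge0 ?fej_ge0// invr_ge0 ltW.
    - by apply/measurable_EFinP; apply: measurable_funTS; apply: measurable_funM => //; exact: measurable_cst.
    - by apply/measurable_EFinP; apply: measurable_funTS.
    move=> z; rewrite /D/= => /negP; rewrite -leNgt ler_norml => /andP[z1 z2].
    rewrite lee_fin; apply: ler_wpM2l => //.
    have h0 : 0 <= e + z by lra.
    have := Tmono n (x - z) h0; rewrite (_ : x - z + (e + z) = x + e); last by ring.
    move=> H; rewrite expRN mulrC ler_pdivrMr ?expR_gt0// mulrC (le_trans H)// ler_wpM2r// ler_expR.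
    rewrite mulrC ler_wpM2r//; lra.
  apply: ge0_subset_integral => //.
  - exact/measurable_EFinP.
  - by move=> z _; rewrite lee_fin mulr_ge0.
move: H1; under eq_integral do rewrite EFinM.
rewrite ge0_integralZr//; first last.
- by rewrite lee_fin mulr_ge0 ?expR_ge0.
- by move=> z _; rewrite lee_fin.
- by apply/measurable_EFinP; apply: measurable_funTS.
move=> H1.
have /andP[c1 _] := Kcore a0 e0.
have H2 := le_trans (lee_wpmul2r _ c1) H1.
have {}H2 : (1 - 4 / (pi * a * e)) * (expR (- (2 * e * th n)) * T n (x + e)) <= q.
  by rewrite -lee_fin EFinM; apply: H2; rewrite lee_fin mulr_ge0 ?expR_ge0.
rewrite expRN mulrCA ler_pdivrMl ?expR_gt0// in H2.
Qed.

(** The bound in the other direction compares with the value at x - e; the kernel mass outside the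
    window is paid for by a global bound [C] on [T n]. *)
Let Qup (a e x q C : R) n : 0 < a -> 0 < e -> 0 <= th n -> (forall y, T n y <= C) ->
  (\int[mu]_z (pi^-1 * fej a z * T n (x - z))%:E = q%:E)%E ->
  q <= expR (2 * e * th n) * T n (x - e) + C * (4 / (pi * a * e)).
Proof.
move=> a0 e0 t0 TC Hq.
have C0 : 0 <= C by exact: le_trans (T0 n 0) (TC 0).
have mE : measurable [set x : R | (e < `|x|)%R].
  rewrite -[X in measurable X]setTI; apply: measurable_fun_ltr => //.
have K0 z : 0 <= pi^-1 * fej a z by rewrite mulr_ge0 ?fej_ge0// invr_ge0 ltW.
have mK : measurable_fun setT (fun z => pi^-1 * fej a z).
  by apply: measurable_funM => //; exact: fej_meas.
have mKT : measurable_fun setT (fun z => pi^-1 * fej a z * T n (x - z)).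
  apply: measurable_funM => //; apply: measurableT_comp => //.
  exact: measurable_funB.
set E := [set x : R | (e < `|x|)%R].
set D := ~` E.
have mD : measurable D by exact: measurableC.
rewrite -lee_fin -Hq -(setUv E) ge0_integral_setU//; first last.
- by apply/disj_setPCl.
- by move=> z _; rewrite lee_fin mulr_ge0.
- by rewrite setUv; apply/measurable_EFinP.
rewrite EFinD addeC; apply: leeD.
- apply: (@le_trans _ _ (\int[mu]_(z in D) (pi^-1 * fej a z * (expR (2 * e * th n) * T n (x - e)))%:E)%E).
    apply: ge0_le_integral => //.
    - by move=> z _; rewrite lee_fin mulr_ge0.
    - by apply/measurable_EFinP; apply: measurable_funTS.
    - by apply/measurable_EFinP; apply: measurable_funTS; apply: measurable_funM => //; exact: measurable_cst.
    move=> z; rewrite /D/= => /negP; rewrite -leNgt ler_norml => /andP[z1 z2].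
    rewrite lee_fin; apply: ler_wpM2l => //.
    have h0 : 0 <= e - z by lra.
    have := Tmono n (x - e) h0; rewrite (_ : x - e + (e - z) = x - z); last by ring.
    move=> H; rewrite (le_trans H)// ler_wpM2r// ler_expR mulrC ler_wpM2r//; lra.
  under eq_integral do rewrite EFinM.
  rewrite ge0_integralZr//; first last.
  - by rewrite lee_fin mulr_ge0 ?expR_ge0.
  - by move=> z _; rewrite lee_fin.
  - by apply/measurable_EFinP; apply: measurable_funTS.
  have /andP[_ c2] := Kcore a0 e0.
  rewrite -[leRHS]mul1e; apply: lee_wpmul2r => //.
  by rewrite lee_fin mulr_ge0 ?expR_ge0.
- apply: (@le_trans _ _ (\int[mu]_(z in E) (C * (pi^-1 * fej a z))%:E)%E).
    apply: ge0_le_integral => //.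
    - by move=> z _; rewrite lee_fin mulr_ge0.
    - by apply/measurable_EFinP; apply: measurable_funTS.
    - by apply/measurable_EFinP; apply: measurable_funTS; apply: measurable_funM => //; exact: measurable_cst.
    by move=> z _; rewrite lee_fin mulrC; apply: ler_wpM2r.
  under eq_integral do rewrite EFinM.
  rewrite ge0_integralZl//; first last.
  - by move=> z _; rewrite lee_fin.
  - by apply/measurable_EFinP; apply: measurable_funTS.
  by rewrite EFinM; apply: lee_wpmul2l; rewrite ?lee_fin//; exact: Ktail.
Qed.

Let th_pos : \forall n \near \oo, 0 <= th n.
Proof. by apply: (cvgr_ge al). Qed.

Lemma tauber_bnd : exists2 C, 0 <= C & \forall n \near \oo, forall x, T n x <= C.
Proof.
(* With window e = 1 this leaves kernel mass at least 1/2, whence the factor 2 in the bound. *)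
pose a := 8 / pi : R.
have a0 : 0 < a by rewrite divr_gt0.
have [Q [Q1 _ [C Q3]]] := HQ a0.
have t2 : \forall n \near \oo, th n <= al + 1 by apply: (cvgr_le al) => //; lra.
exists (2 * (expR (2 * (al + 1)) * `|C|)); first by rewrite !mulr_ge0 ?expR_ge0.
near=> n => x.
have t0 : 0 <= th n by near: n.
have t1 : th n <= al + 1 by near: n.
have q1 : (\int[mu]_z (pi^-1 * fej a z * T n (x - 1 - z))%:E = (Q n (x - 1))%:E)%E.
  by move: (x - 1); near: n.
have q2 : Q n (x - 1) <= C by move: (x - 1); near: n.
have := Qlow a0 ltr01 t0 q1.
rewrite subrK (_ : 4 / (pi * a * 1) = 1 / 2); last first.
  by rewrite /a; move: (pi : R) (pi_gt0 R) => p p0; field; rewrite gt_eqF.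
rewrite mulr1; have : expR (2 * th n) * Q n (x - 1) <= expR (2 * (al + 1)) * `|C|.
  apply: (@le_trans _ _ (expR (2 * th n) * `|C|)).
    by rewrite ler_wpM2l ?expR_ge0// (le_trans q2)// ler_norm.
  by rewrite ler_wpM2r// ler_expR ler_wpM2l.
move=> h1 h2; lra.
Unshelve. all: by end_near.
Qed.

(** Q at x - e bounds T(x) from above and Q at x + e bounds it from below. The window e is fixed
    first, to bring e^(2 e al) near 1; then a is taken large to shrink the tail mass of the
    kernel. *)
Lemma tauber x : (T ^~ x) @ \oo --> al^-1.
Proof.
have [C C0 HC] := tauber_bnd.
have small (del : R) : 0 < del -> exists2 e, 0 < e & exists2 a, 0 < a &
   [/\ 4 / (pi * a * e) < 1, expR (2 * e * al) * (al^-1) < (1 - 4 / (pi * a * e)) * (al^-1 + del) &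
    expR (2 * e * al) * (al^-1 - del) + C * (4 / (pi * a * e)) < al^-1].
  move=> d0.
  have ai : 0 < al^-1 by rewrite invr_gt0.
  have ce (k : R) : (fun e : R => expR (2 * e * al) * k) @ 0^'+ --> k.
    have {2}-> : k = expR (2 * 0 * al) * k by rewrite mulr0 mul0r expR0 mul1r.
    apply: cvgMl; apply: continuous_cvg; first exact: continuous_expR.
    by apply: cvg_at_right_filter; apply: cvgMl; apply: cvgMr.
  have h1 : \forall e \near (0:R)^'+, expR (2 * e * al) * al^-1 < al^-1 + del / 2.
    by apply: (cvgr_lt _ (ce al^-1)); lra.
  have h2 : \forall e \near (0:R)^'+, expR (2 * e * al) * (al^-1 - del) < al^-1 - del / 2.
    by apply: (cvgr_lt _ (ce (al^-1 - del))); lra.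
  have [e [e0 [e1 e2]]] : exists e : R, 0 < e /\ (expR (2 * e * al) * al^-1 < al^-1 + del / 2 /\ expR (2 * e * al) * (al^-1 - del) < al^-1 - del / 2).
    apply: (@filter_ex _ (0:R)^'+).
    near=> e; split; first by near: e; exact: nbhs_right_gt.
    by split; near: e.
  exists e => //.
  (* eta / 2 is going to be the tail mass 4 / (pi a e); one entry of the minimum for each of the
     three inequalities. *)
  pose eta := Num.min (1 / 2) (Num.min (del / 2 / (al^-1 + del)) (del / 2 / (C + 1))).
  have C1 : 0 < C + 1 by rewrite ltr_wpDl.
  have ad : 0 < al^-1 + del by rewrite addr_gt0.
  have eta0 : 0 < eta by rewrite !lt_min !divr_gt0.
  have m1 : eta <= 1/2 by rewrite ge_min lexx.
  have m2 : eta * (al^-1 + del) <= del / 2.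
    by rewrite -ler_pdivlMr ?addr_gt0// !ge_min lexx orbT.
  have m3 : eta * (C + 1) <= del / 2.
    by rewrite -ler_pdivlMr ?ltr_wpDl// !ge_min lexx !orbT.
  clearbody eta.
  exists (8 / (pi * e * eta)); first by rewrite divr_gt0// !mulr_gt0.
  rewrite (_ : 4 / (pi * (8 / (pi * e * eta)) * e) = eta / 2); last first.
    by move: (pi : R) (pi_gt0 R) => p p0; field; rewrite !gt_eqF.
  split; [lra|lra|].
  have : 0 <= eta * C by rewrite mulr_ge0// ltW.
  move=> ?; lra.
apply/cvgrPdist_lt => del del0.
have [e e0 [a a0 [s1 s2 s3]]] := small _ del0.
have [Q [Q1 Q2 _]] := HQ a0.
set eta := 4 / (pi * a * e) in s1 s2 s3 *.
have ec : (fun n => expR (2 * e * th n)) @ \oo --> expR (2 * e * al).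
  by apply: continuous_cvg; [exact: continuous_expR|exact: cvgMr].
have u1 : \forall n \near \oo, expR (2 * e * th n) * Q n (x - e) < (1 - eta) * (al^-1 + del).
  by apply: (cvgr_lt _ (cvgM ec (Q2 (x - e)))).
have u2 : \forall n \near \oo, expR (2 * e * th n) * (al^-1 - del) + C * eta < Q n (x + e).
  have : (fun n => expR (2 * e * th n) * (al^-1 - del) + C * eta - Q n (x + e)) @ \oo --> expR (2 * e * al) * (al^-1 - del) + C * eta - al^-1.
    by apply: cvgB; [apply: cvgD; [exact: cvgMl|exact: cvg_cst]|exact: Q2].
  move=> /cvgr_lt /(_ 0); rewrite subr_lt0 => /(_ s3); apply: filterS => n; rewrite subr_lt0; exact.
near=> n.
have t0 : 0 <= th n by near: n.
have TC : forall y, T n y <= C by near: n.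
have q1 : forall x, (\int[mu]_z (pi^-1 * fej a z * T n (x - z))%:E = (Q n x)%:E)%E by near: n.
have v1 : expR (2 * e * th n) * Q n (x - e) < (1 - eta) * (al^-1 + del) by near: n.
have v2 : expR (2 * e * th n) * (al^-1 - del) + C * eta < Q n (x + e) by near: n.
have := Qlow a0 e0 t0 (q1 (x - e)); rewrite subrK -/eta => b1.
have := Qup a0 e0 t0 TC (q1 (x + e)); rewrite addrK -/eta => b2.
have c1 : T n x < al^-1 + del.
  rewrite -(@ltr_pM2l _ (1 - eta)) ?subr_gt0//; exact: le_lt_trans v1.
have c2 : al^-1 - del < T n x.
  rewrite -(@ltr_pM2l _ (expR (2 * e * th n))) ?expR_gt0//; lra.
rewrite ltr_distl; lra.
Unshelve. all: by end_near.
Qed.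

End Tauber.

(** * Local limit theorem for the tilted law *)

Section LLT.
Context {d : measure_display} {Om : measurableType d} {R : realType}
  (P : probability Om R) (X : R -> Om -> R).
Hypothesis HX : levy P X.
Hypothesis Hm : forall u, P.-integrable setT (EFin \o (fun w => expR (u * X 1 w))).
Local Notation intble f := (P.-integrable setT (EFin \o f)).
Local Notation dps := (dcum P (X 1)).
Local Notation d2ps := (d2cum P (X 1)).
Local Notation mu := (@lebesgue_measure R).
Local Notation tl := (tilt_mean P X).
Local Notation wt := (tilt_wt P X).
Let mX t : measurable_fun setT (X t) := levy_meas HX t.

Lemma tl_tonelli s th (g : R * R -> R) : 0 <= s -> measurable_fun setT g -> (forall p, 0 <= g p) ->
  (forall u, bddm (fun y => g (u, y))) ->
  measurable_fun setT (fun u => tl s th (fun y => g (u, y))) /\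
  (\int[mu]_u (tl s th (fun y => g (u, y)))%:E =
   \int[P]_w \int[mu]_u (wt s th (X s w) * g (u, X s w - s * dps th)%R)%:E)%E.
Proof.
move=> s0 mg g0 bg.
pose K (p : R * Om) : \bar R := (wt s th (X s p.2) * g (p.1, X s p.2 - s * dps th))%:E.
have mX2 : measurable_fun setT (fun p : R * Om => X s p.2) by exact: measurableT_comp.
have mK : measurable_fun setT K.
  apply/measurable_EFinP; apply: measurable_funM.
    by apply: measurableT_comp => //; exact: wt_meas.
  apply: measurableT_comp => //; apply: measurable_fun_pair => //=.
  exact: measurable_funB.
have K0 p : (0 <= K p)%E by rewrite lee_fin mulr_ge0 ?expR_ge0.
have E u : (tl s th (fun y => g (u, y)))%:E = (\int[P]_w K (u, w))%E.
  by rewrite /tilt_mean -Ex_EFin//; exact: (tl_intble HX Hm th s0 (bg u)).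
split.
  apply/measurable_EFinP.
  have := @measurable_fun_fubini_tonelli_F _ _ _ _ R P K mK K0.
  by apply: eq_measurable_fun => u _; rewrite /= E.
under eq_integral do rewrite E.
exact: (@fubini_tonelli _ _ _ _ R mu P K mK K0).
Qed.

(** Adding 1 makes the cosine nonnegative, so that measurability comes from Tonelli. *)
Lemma phi_meas (th s : nat -> R) n y : (forall n, 0 <= s n) -> measurable_fun setT (phi P X th s n y).
Proof.
move=> s0.
have mc : measurable_fun setT (fun p : R * R => cos (p.1 / Num.sqrt (s n) * (y - p.2))).
  apply: measurableT_comp; first by apply: continuous_measurable_fun; exact: continuous_cos.
  apply: measurable_funM; first exact: measurable_funM.
  exact: measurable_funB.
have [|||mt _] := @tl_tonelli (s n) (th n) (fun p => 1 + cos (p.1 / Num.sqrt (s n) * (y - p.2))) (s0 n).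
- exact: measurable_funD.
- by move=> p; have := cos_geN1 (p.1 / Num.sqrt (s n) * (y - p.2)); lra.
- move=> u; split.
    apply: measurable_funD => //.
    exact: (measurableT_comp mc (measurable_pair1 _)).
  exists 2 => z /=; have := cos_geN1 (u / Num.sqrt (s n) * (y - z)); have := cos_le1 (u / Num.sqrt (s n) * (y - z)).
  by move=> ? ?; rewrite ler_norml; apply/andP; split; lra.
have -> : phi P X th s n y = (fun u => tl (s n) (th n) (fun z => 1 + cos (u / Num.sqrt (s n) * (y - z))) - 1).
  apply/funext => u; rewrite /phi /tilt_mean.
  have b : bddm (fun z => cos (u / Num.sqrt (s n) * (y - z))).
    split; first exact: (measurableT_comp mc (measurable_pair1 _)).
    by exists 1 => x; rewrite ler_norml cos_geN1 cos_le1.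
  have i1 := tl_intble HX Hm (th n) (s0 n) b; have i2 := wt_intble HX Hm (th n) (s0 n).
  under [in RHS]eq_fun do rewrite mulrDr mulr1.
  by rewrite (ExD i2 i1) (wt_Ex HX Hm _ (s0 n)) addrAC subrr add0r.
exact: measurable_funB.
Qed.

Lemma norm_phi_le1 (th s : nat -> R) n y u : (forall n, 0 <= s n) -> `|phi P X th s n y u| <= 1.
Proof.
move=> s0; apply: (tl_bnd HX Hm) => //.
  apply: measurableT_comp; first by apply: continuous_measurable_fun; exact: continuous_cos.
  by apply: measurable_funM => //; exact: measurable_funB.
by move=> x; rewrite ler_norml cos_geN1 cos_le1.
Qed.

Let fejb_meas (b y r : R) : 0 < b -> measurable_fun setT (fun x : R => fej b ((y - x) / r)).
Proof.
move=> b0; apply: measurableT_comp; first exact: fej_meas.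
by apply: measurable_funM => //; exact: measurable_funB.
Qed.

Let fejb_bdd (b y r : R) : 0 < b -> bddm (fun x => fej b ((y - x) / r)).
Proof.
move=> b0; split; first exact: fejb_meas.
by exists (b / 2) => x; rewrite ger0_norm ?fej_ge0// fej_le.
Qed.

(** The triangle representation [fejE] is averaged over the tilted law. Using 1 + cos in place of
    cos keeps the integrand nonnegative for Tonelli, and the extra b / 2 cancels. *)
Lemma tl_fej (th s : nat -> R) n y b : (forall n, 0 <= s n) -> 0 < b ->
  (\int[mu]_(u in `[0%R, b]) ((1 - u / b) * phi P X th s n y u)%:E =
   (tl (s n) (th n) (fun x => fej b ((y - x) / Num.sqrt (s n))))%:E)%E.
Proof.
move=> s0 b0.
set r := Num.sqrt (s n).
have mp := phi_meas th n y s0.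
have D0 u : `[0%R, b]%classic u -> 0 <= 1 - u / b <= 1.
  rewrite /= in_itv/= => /andP[u0 u1]; apply/andP; split.
    by rewrite subr_ge0 ler_pdivrMr// mul1r.
  by rewrite gerBl divr_ge0// ltW.
have mD : measurable (`[0%R, b]%classic : set R) by [].
have fD : (mu `[0%R, b]%classic < +oo)%E by rewrite lebesgue_measure_itv/= lte_fin b0 sube0 ltry.
have bint (h : R -> R) M : measurable_fun setT h -> (forall u, `[0%R, b]%classic u -> `|h u| <= M) ->
    mu.-integrable `[0%R, b] (EFin \o h).
  move=> mh hM; apply: (@le_integrable _ _ _ mu _ mD _ (EFin \o cst M)).
  - by apply/measurable_EFinP; apply: measurable_funTS.
  - move=> u Du /=; rewrite lee_fin (le_trans (hM _ Du))// ler_norm//.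
  - apply/integrableP; split; first exact/measurable_EFinP.
    by rewrite (eq_integral (fun=> `|M|%:E))// integral_cst//= lte_mul_pinfty.
have mub : measurable_fun setT (fun u : R => 1 - u / b).
  by apply: measurable_funB => //; exact: measurable_funM.
have i1 : mu.-integrable `[0%R, b] (EFin \o (fun u => 1 - u / b)).
  apply: (bint _ 1) => // u Du; have /andP[h0 h1] := D0 u Du; by rewrite ger0_norm.
have i2 : mu.-integrable `[0%R, b] (EFin \o (fun u => (1 - u / b) * phi P X th s n y u)).
  apply: (bint _ 1); first exact: measurable_funM.
  move=> u Du; have /andP[h0 h1] := D0 u Du; rewrite normrM -[leRHS]mulr1.
  by apply: ler_pM => //; [rewrite ger0_norm|exact: norm_phi_le1].
have I1 : (\int[mu]_(u in `[0%R, b]) (1 - u / b)%:E = (b / 2)%:E)%E.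
  have := fejE 0 b0; rewrite /fej eqxx => <-; apply: eq_integral => u _.
  by rewrite mulr0 cos0 mulr1.
have mc : measurable_fun setT (fun p : R * R => cos (p.1 / r * (y - p.2))).
  apply: measurableT_comp; first by apply: continuous_measurable_fun; exact: continuous_cos.
  apply: measurable_funM; first exact: measurable_funM.
  exact: measurable_funB.
pose g (p : R * R) := (if (0 <= p.1) && (p.1 <= b) then (1 - p.1 / b) * (1 + cos (p.1 / r * (y - p.2))) else 0).
have mg : measurable_fun setT g.
  apply: measurable_fun_ifT => //.
  - apply: measurable_and; apply: measurable_fun_ler => //.
  - apply: measurable_funM; last exact: measurable_funD.
    by apply: measurable_funB => //; exact: measurable_funM.
have gb p : 0 <= g p <= 2.
  rewrite /g; case: ifP => [h|_]; last by rewrite lexx/=.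
  have /andP[h0 h1] : 0 <= 1 - p.1 / b <= 1 by apply: D0; rewrite /= in_itv/= h.
  have c1 := cos_geN1 (p.1 / r * (y - p.2)); have c2 := cos_le1 (p.1 / r * (y - p.2)).
  apply/andP; split; first by apply: mulr_ge0 => //; lra.
  by rewrite -[leRHS]mul1r; apply: ler_pM => //; lra.
have [||mt] := @tl_tonelli (s n) (th n) g (s0 n) mg.
- by move=> p; have /andP[] := gb p.
- move=> u; split; first exact: (measurableT_comp mg (measurable_pair1 _)).
  by exists 2 => z; have /andP[h0 h1] := gb (u, z); rewrite ger0_norm.
have bc u : bddm (fun z => cos (u / r * (y - z))).
  split; first exact: (measurableT_comp mc (measurable_pair1 _)).
  by exists 1 => x; rewrite ler_norml cos_geN1 cos_le1.
have EL u : tl (s n) (th n) (fun z => g (u, z)) =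
    if (0 <= u) && (u <= b) then (1 - u / b) + (1 - u / b) * phi P X th s n y u else 0.
  rewrite /tilt_mean /g/=; case: ifP => _; last first.
    by under eq_fun do rewrite mulr0; rewrite Ex_cst.
  have j1 := wt_intble HX Hm (th n) (s0 n).
  have j2 := tl_intble HX Hm (th n) (s0 n) (bc u).
  transitivity ((1 - u / b) * (Ex P (fun w => wt (s n) (th n) (X (s n) w)) + phi P X th s n y u)); last first.
    by rewrite (wt_Ex HX Hm _ (s0 n)); ring.
  rewrite /phi /tilt_mean -(ExD j1 j2) -ExZl.
    by congr Ex; apply/funext => w; ring.
  exact: intbleD j1 j2.
have -> : (\int[mu]_u (tl (s n) (th n) (fun z => g (u, z)))%:E =
   (b / 2)%:E + \int[mu]_(u in `[0%R, b]) ((1 - u / b) * phi P X th s n y u)%:E)%E.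
  have EI := @integralD _ _ _ mu _ mD _ _ i1 i2.
  rewrite -I1; apply: etrans EI; rewrite [RHS]integral_mkcond; apply: eq_integral => u _.
  by rewrite EL patchE mem_setE in_itv/=; case: ifP.
have -> : (\int[P]_w \int[mu]_u (wt (s n) (th n) (X (s n) w) * g (u, (X (s n) w - s n * dps (th n))%R))%:E =
   (b / 2)%:E + (tl (s n) (th n) (fun x => fej b ((y - x) / r)))%:E)%E.
  have j1 := wt_intble HX Hm (th n) (s0 n).
  have j2 := tl_intble HX Hm (th n) (s0 n) (fejb_bdd y r b0).
  have jb := intbleZl (b / 2) j1.
  transitivity (\int[P]_w (b / 2 * wt (s n) (th n) (X (s n) w) + wt (s n) (th n) (X (s n) w) * fej b ((y - (X (s n) w - s n * dps (th n))) / r))%:E)%E.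
    apply: eq_integral => w _; set z := X (s n) w - _; set W := wt _ _ _.
    have W0 : 0 <= W by exact: expR_ge0.
    transitivity (\int[mu]_(u in `[0%R, b]) (W%:E * ((1 - u / b)%:E + ((1 - u / b) * cos (u * ((y - z) / r)))%:E)))%E.
      rewrite [RHS]integral_mkcond; apply: eq_integral => u _.
      rewrite patchE mem_setE in_itv/= /g/=; case: ifP => _; last by rewrite mulr0.
      by rewrite -EFinD -EFinM; congr EFin; rewrite (_ : u / r * (y - z) = u * ((y - z) / r)); ring.
    have ic : mu.-integrable `[0%R, b] (EFin \o (fun u => (1 - u / b) * cos (u * ((y - z) / r)))).
      apply: (bint _ 1).
        apply: measurable_funM => //; apply: measurableT_comp; last exact: measurable_funM.
        by apply: continuous_measurable_fun; exact: continuous_cos.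
      move=> u Du; have /andP[h0 h1] := D0 u Du; rewrite normrM -[leRHS]mulr1.
      by apply: ler_pM => //; [rewrite ger0_norm|rewrite ler_norml cos_geN1 cos_le1].
    have ii := @integrableD _ _ _ mu _ mD _ _ i1 ic.
    transitivity (W%:E * \int[mu]_(u in `[0%R, b]) ((1 - u / b)%:E + ((1 - u / b) * cos (u * ((y - z) / r)))%:E))%E.
      exact: (@integralZl _ _ _ mu _ mD _ ii W).
    rewrite (@integralD _ _ _ mu _ mD _ _ i1 ic) I1 fejE// -EFinD -EFinM; congr EFin; ring.
  rewrite (Ex_EFin (intbleD jb j2)) (ExD jb j2) (ExZl _ j1) (wt_Ex HX Hm _ (s0 n)) mulr1.
  by rewrite EFinD.
move=> H; move: H; case: (\int[mu]_(u in `[0%R, b]) _)%E => [v||]//.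
by rewrite -!EFinD => -[] /addrI ->.
Qed.

(** Change of measure to the tilt [th], whose mean is s psi'(th); the exponent s (th psi'(th) -
    psi(th)) is the Cramer rate s I(psi'(th)). *)
Lemma tail_prob s th x : 0 <= s ->
  prob P [set w | x < X s w - s * dps th] =
  expR (- (s * (th * dps th - psi P X th)) - th * x) *
  tl s th (fun y => if x < y then expR (- (th * (y - x))) else 0).
Proof.
move=> s0; rewrite -Ex_indic; last first.
  rewrite -[X in measurable X]setTI; apply: measurable_fun_ltr => //.
  exact: measurable_funB.
set c := expR (_ - _).
have -> : \1_[set w | x < X s w - s * dps th] =
  (fun w => c * (wt s th (X s w) * (if x < X s w - s * dps th then expR (- (th * (X s w - s * dps th - x))) else 0))).
  apply/funext => w; rewrite indicE; case: ifP => h.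
    rewrite mem_set//= /c /tilt_wt -!expRD -[LHS](expR0 R); congr expR; ring.
  by rewrite memNset ?mulr0//=; apply/negP; rewrite h.
have [z|z] := leP 0 th.
  have bd : bddm (fun y => if x < y then expR (- (th * (y - x))) else 0); last first.
    by rewrite (ExZl _ (tl_intble HX Hm th s0 bd)).
  split.
    apply: measurable_fun_ifT => //; first exact: measurable_fun_ltr.
    apply: measurableT_comp => //; apply: measurable_funN => //.
    by apply: measurable_funM => //; exact: measurable_funB.
  exists 1 => y; case: ifP => h; last by rewrite normr0.
  by rewrite ger0_norm ?expR_ge0// -expR0 ler_expR oppr_le0 mulr_ge0// subr_ge0 ltW.
(* For th < 0 the test function is unbounded, and integrability is read off the indicator
   instead. *)
rewrite ExZl//.
have -> : (EFin \o (fun w => wt s th (X s w) * (if x < X s w - s * dps th then expR (- (th * (X s w - s * dps th - x))) else 0)))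
  = (EFin \o (fun w => c^-1 * \1_[set w | x < X s w - s * dps th] w)).
  apply/funext => w /=; congr EFin; rewrite indicE; case: ifP => h.
    rewrite mem_set//= mulr1 /c /tilt_wt -expRD -expRN; congr expR; ring.
  by rewrite memNset ?mulr0//=; apply/negP; rewrite h.
apply: intbleZl; apply: (@Ex_bnd_int _ _ _ _ _ 1).
  apply: measurable_indic; rewrite -[X in measurable X]setTI; apply: measurable_fun_ltr => //.
  exact: measurable_funB.
by move=> w; rewrite indicE; case: (_ \in _); rewrite ?normr1 ?normr0.
Qed.

Section Sequence.
Variables (th s : nat -> R) (al sg : R).
Hypothesis al0 : 0 < al.
Hypothesis th_cvg : th @ \oo --> al.
Hypothesis s_cvg : s @ \oo --> +oo.
Hypothesis s_ge0 : forall n, 0 <= s n.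
Hypothesis th_gt0 : forall n, 0 < th n.
Hypothesis nonlat : ~ lattice P (X 1).
Hypothesis sg0 : 0 < sg.
Hypothesis sgE : sg = d2ps al.

(** The tail with its exponential factor removed and rescaled: near its mean the tilted law has
    density about 1 / sqrt(2 pi sg s_n), so the expected limit is the integral of e^(-al u) over u >
    0, that is 1 / al. *)
Definition Tn n x := Num.sqrt (2 * pi * sg * s n) *
  tl (s n) (th n) (fun y => if x < y then expR (- (th n * (y - x))) else 0).

Let rc : R := Num.sqrt (2 * pi * sg).
Let rc0 : 0 <= rc := sqrtr_ge0 _.

(** By [fej_scale] this is sqrt(2 pi sg s_n) times the tilted mean of fej a (y - Y) / pi, hence the
    normalised density at [y] smoothed at unit scale. *)
Definition Mn a n y := rc / pi *
  tl (s n) (th n) (fun x => fej (a * Num.sqrt (s n)) ((y - x) / Num.sqrt (s n))).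

Let s_pos : \forall n \near \oo, 0 < s n.
Proof. by move/cvgryPgt : s_cvg; apply. Qed.

Let pi0 : 0 < (pi : R) := pi_gt0 R.

Let gauss_int c : 0 < c -> mu.-integrable `[0%R, +oo[ (EFin \o (fun u : R => expR (- (c * u ^+ 2 / 2)))).
Proof.
move=> c0; apply/integrableP; split.
  apply/measurable_EFinP; apply: measurable_funTS; apply: measurableT_comp => //.
  apply: measurable_funN => //; apply: measurable_funM => //.
  by apply: measurable_funM => //; exact: measurable_funX.
under eq_integral => u _ do rewrite /= ger0_norm ?expR_ge0//.
by rewrite integral_gauss_ray// ltry.
Qed.

Let exp_int c : 0 < c -> mu.-integrable `]0%R, +oo[ (EFin \o (fun u : R => expR (- (c * u)))).
Proof.
move=> c0.
have mf : measurable_fun (`]0%R, +oo[%classic : set R) (fun u : R => expR (- (c * u))).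
  apply: measurable_funTS; apply: measurableT_comp => //.
  by apply: measurable_funN => //; exact: measurable_funM.
apply/integrableP; split; first exact/measurable_EFinP.
under eq_integral => u _ do rewrite /= ger0_norm ?expR_ge0// -mulNr.
rewrite integral_itv_obnd_cbnd ?integral_exp_ray ?ltry//.
apply/measurable_EFinP; apply: measurable_funTS; apply: measurableT_comp => //; exact: measurable_funM.
Qed.

Let exp_val c : 0 < c -> (\int[mu]_(u in `]0%R, +oo[) (expR (- (c * u)))%:E = (c^-1)%:E)%E.
Proof.
move=> c0; rewrite -integral_exp_ray// -integral_itv_obnd_cbnd.
  by apply: eq_integral => u _; rewrite mulNr.
apply/measurable_EFinP; apply: measurable_funTS; apply: measurableT_comp => //.
Qed.

(** The integrand of [tl_fej] for b = a sqrt(s_n), extended by zero so that all n share one domain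
    of integration. *)
Let fn a n y u := if u <= a * Num.sqrt (s n) then (1 - u / (a * Num.sqrt (s n))) * phi P X th s n y u else 0.

Let fn_meas a n y : measurable_fun setT (fn a n y).
Proof.
apply: measurable_fun_ifT => //; first exact: measurable_fun_ler.
apply: measurable_funM; last exact: phi_meas.
by apply: measurable_funB => //; exact: measurable_funM.
Qed.

Let fnE a n y : 0 < a -> 0 < s n -> (\int[mu]_(u in `[0%R, +oo[) (fn a n y u)%:E =
  (tl (s n) (th n) (fun x => fej (a * Num.sqrt (s n)) ((y - x) / Num.sqrt (s n))))%:E)%E.
Proof.
move=> a0 sn0; rewrite -tl_fej// ?mulr_gt0 ?sqrtr_gt0//.
rewrite [LHS]integral_mkcond [RHS]integral_mkcond; apply: eq_integral => u _.
rewrite !patchE !mem_setE !in_itv/= /fn andbT.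
by case: (leP 0 u) => //= _; case: ifP.
Qed.

Let fn_bnd a : 0 < a -> exists2 c, 0 < c & \forall n \near \oo, forall y u, 0 <= u -> `|fn a n y u| <= expR (- (c * u ^+ 2 / 2)).
Proof.
move=> a0; have [c c0 Hc] := phi_bound HX Hm th_cvg s_cvg s_ge0 nonlat a0.
exists c => //; near=> n => y u u0; rewrite /fn; case: ifP => [ua|_]; last by rewrite normr0 expR_ge0.
have sn0 : 0 < s n by near: n.
have b0 : 0 < a * Num.sqrt (s n) by rewrite mulr_gt0 ?sqrtr_gt0.
rewrite normrM -[leRHS]mul1r; apply: ler_pM => //.
  rewrite ger0_norm ?gerBl ?divr_ge0 ?(ltW b0)// subr_ge0 ler_pdivrMr// mul1r//.
by move: y u u0 ua; near: n; apply: filterS Hc => n Hc y u u0 ua; apply: Hc; rewrite u0.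
Unshelve. all: by end_near.
Qed.

(** In frequency form the integrand converges to a Gaussian under a Gaussian majorant, and sqrt(2 pi
    sg) / pi is the inverse of the half-line Gaussian integral. *)
Lemma Mn_cvg a y : 0 < a -> (fun n => Mn a n y) @ \oo --> (1 : R).
Proof.
move=> a0.
have -> : (1 : R) = rc / pi * (Num.sqrt (2 * pi / sg) / 2).
  have -> : rc / pi * (Num.sqrt (2 * pi / sg) / 2) = (rc * Num.sqrt (2 * pi / sg)) / (2 * pi).
    by move: (pi : R) pi0 => p p0; field; rewrite gt_eqF.
  rewrite /rc -sqrtrM ?mulr_ge0 ?(ltW pi0) ?(ltW sg0)//.
  have -> : 2 * pi * sg * (2 * pi / sg) = (2 * pi) ^+ 2.
    by move: (pi : R) pi0 => p p0; field; rewrite gt_eqF.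
  by rewrite sqrtr_sqr ger0_norm ?mulr_ge0 ?(ltW pi0)// divff// gt_eqF// mulr_gt0.
apply: cvgMr.
have [c c0 Hc] := fn_bnd a0.
have H : (fun n => \int[mu]_(u in `[0%R, +oo[) (fn a n y u)%:E)%E @ \oo --> ((Num.sqrt (2 * pi / sg) / 2)%:E)%E.
  rewrite -integral_gauss_ray//; apply: (dct_near _ _ _ _ (gauss_int c0)) => //.
  - by move=> n; apply: measurable_funTS; exact: fn_meas.
  - apply: measurable_funTS; apply: measurableT_comp => //.
    apply: measurable_funN => //; apply: measurable_funM => //.
    by apply: measurable_funM => //; exact: measurable_funX.
  - move=> u _.
    have b_cvg : (fun n => u / (a * Num.sqrt (s n))) @ \oo --> (0 : R).
      rewrite -(mulr0 u); apply: cvgMr; under eq_fun do rewrite invfM.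
      rewrite -(mulr0 a^-1); apply: cvgMr; exact: inv_sqrt_cvg.
    have g_cvg : (fun n => (1 - u / (a * Num.sqrt (s n))) * phi P X th s n y u) @ \oo --> expR (- (sg * u ^+ 2 / 2)).
      have -> : expR (- (sg * u ^+ 2 / 2)) = (1 - 0) * expR (- (sg * u ^+ 2 / 2)) by rewrite subr0 mul1r.
      apply: cvgM.
        by apply: cvgB; [exact: cvg_cst|].
      by rewrite sgE; exact: (clt_phi HX Hm).
    apply: cvg_trans g_cvg; apply: near_eq_cvg.
    have h : \forall n \near \oo, u / (a * Num.sqrt (s n)) <= 1 by apply: (cvgr_le _ b_cvg).
    near=> n; rewrite /fn; case: ifP => //.
    have sn0 : 0 < s n by near: n.
    have : u / (a * Num.sqrt (s n)) <= 1 by near: n.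
    by rewrite ler_pdivrMr ?mul1r ?mulr_gt0 ?sqrtr_gt0// => ->.
  - by apply: filterS Hc => n Hc u; rewrite /= in_itv/= andbT; exact: Hc.
suff H2 : (fun n => (tl (s n) (th n) (fun x => fej (a * Num.sqrt (s n)) ((y - x) / Num.sqrt (s n))))%:E) @ \oo
    --> ((Num.sqrt (2 * pi / sg) / 2)%:E) by exact: (fine_cvg H2).
apply: cvg_trans H; apply: near_eq_cvg.
by apply: filterS s_pos => n sn0; rewrite fnE.
Unshelve. all: by end_near.
Qed.

Lemma Mn_bnd a : 0 < a -> exists C, \forall n \near \oo, forall y, `|Mn a n y| <= C.
Proof.
move=> a0; have [c c0 Hc] := fn_bnd a0.
exists (rc / pi * (Num.sqrt (2 * pi / c) / 2)); near=> n => y.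
have sn0 : 0 < s n by near: n.
rewrite normrM ger0_norm ?divr_ge0 ?(ltW pi0)// ler_wpM2l ?divr_ge0 ?(ltW pi0)//.
have f0 : 0 <= tl (s n) (th n) (fun x => fej (a * Num.sqrt (s n)) ((y - x) / Num.sqrt (s n))).
  by apply: Ex_ge0 => w; rewrite mulr_ge0 ?expR_ge0 ?fej_ge0// mulr_gt0 ?sqrtr_gt0.
rewrite ger0_norm// -lee_fin -fnE// -integral_gauss_ray//.
apply: (@le_trans _ _ (\int[mu]_(u in `[0%R, +oo[) `|(fn a n y u)%:E|)%E).
  by rewrite (le_trans (lee_abs _))// le_abse_integral//; apply/measurable_EFinP; apply: measurable_funTS; exact: fn_meas.
apply: ge0_le_integral => //.
- by apply: measurableT_comp => //; apply/measurable_EFinP; apply: measurable_funTS; exact: fn_meas.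
- by case/integrableP : (gauss_int c0).
- move=> u; rewrite /= in_itv/= andbT => u0; rewrite lee_fin.
  by move: y u u0 {f0}; near: n.
Unshelve. all: by end_near.
Qed.

Let Mn_bddm a n y : 0 < a -> 0 < s n -> bddm (fun x => fej (a * Num.sqrt (s n)) ((y - x) / Num.sqrt (s n))).
Proof. by move=> a0 sn0; apply: fejb_bdd; rewrite mulr_gt0 ?sqrtr_gt0. Qed.

Let Mn_meas a n : 0 < a -> 0 < s n -> measurable_fun setT (Mn a n).
Proof.
move=> a0 sn0; apply: measurable_funM => //.
have b0 : 0 < a * Num.sqrt (s n) by rewrite mulr_gt0 ?sqrtr_gt0.
apply: (proj1 (@tl_tonelli (s n) (th n) (fun p => fej (a * Num.sqrt (s n)) ((p.1 - p.2) / Num.sqrt (s n))) (s_ge0 n) _ _ _)).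
- apply: measurableT_comp; first exact: fej_meas.
  by apply: measurable_funM => //; exact: measurable_funB.
- by move=> p; exact: fej_ge0.
- by move=> u; exact: Mn_bddm.
Qed.

Let g0 n x y := if x < y then expR (- (th n * (y - x))) else 0.

Let g0_meas n : measurable_fun setT (fun p : R * R => g0 n p.1 p.2).
Proof.
apply: measurable_fun_ifT => //; first exact: measurable_fun_ltr.
apply: measurableT_comp => //; apply: measurable_funN => //.
by apply: measurable_funM => //; exact: measurable_funB.
Qed.

Let g0_bnd n x y : 0 <= g0 n x y <= 1.
Proof.
rewrite /g0; case: ifP => h; last by rewrite lexx ler01.
by rewrite expR_ge0/= -expR0 ler_expR oppr_le0 mulr_ge0 ?(ltW (th_gt0 n))// subr_ge0 ltW.
Qed.

Let g0_bddm n x : bddm (g0 n x).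
Proof.
split; first exact: (measurableT_comp (g0_meas n) (measurable_pair1 x)).
by exists 1 => y; have /andP[h0 h1] := g0_bnd n x y; rewrite ger0_norm.
Qed.

(** Tonelli and the shift u = z + (y - x), with y the centred variable, move the smoothing from the
    tail onto the density; what remains is an exponential average of [Mn]. *)
Lemma Q_repr a n x : 0 < a -> 0 < s n ->
  (\int[mu]_z (pi^-1 * fej a z * Tn n (x - z))%:E =
   \int[mu]_(u in `]0%R, +oo[) (expR (- (th n * u)) * Mn a n (x + u))%:E)%E.
Proof.
move=> a0 sn0.
set r := Num.sqrt (s n); have r0 : 0 < r by rewrite sqrtr_gt0.
have rcE : Num.sqrt (2 * pi * sg * s n) = rc * r by rewrite sqrtrM// !mulr_ge0 ?(ltW pi0) ?(ltW sg0).
have k0 : 0 <= rc * r / pi by rewrite divr_ge0 ?mulr_ge0 ?(ltW r0) ?(ltW pi0).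
pose gz (p : R * R) := fej a p.1 * g0 n (x - p.1) p.2.
have mgz : measurable_fun setT gz.
  apply: measurable_funM; first by apply: measurableT_comp => //; exact: fej_meas.
  have := measurableT_comp (g0_meas n) (_ : measurable_fun setT (fun p : R * R => (x - p.1, p.2))).
  apply; apply: measurable_fun_pair => //; exact: measurable_funB.
have gz0 p : 0 <= gz p by rewrite mulr_ge0 ?fej_ge0//; case/andP : (g0_bnd n (x - p.1) p.2).
have bgz u : bddm (fun y => gz (u, y)).
  split; first exact: (measurableT_comp mgz (measurable_pair1 u)).
  exists (a / 2) => y; rewrite ger0_norm// /gz/= -[leRHS]mulr1.
  by have /andP[h0 h1] := g0_bnd n (x - u) y; apply: ler_pM => //; rewrite ?fej_ge0 ?fej_le.
have [mz Ez] := tl_tonelli (th n) (s_ge0 n) mgz gz0 bgz.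
have -> : (\int[mu]_z (pi^-1 * fej a z * Tn n (x - z))%:E =
   (rc * r / pi)%:E * \int[mu]_z (tl (s n) (th n) (fun y => gz (z, y)))%:E)%E.
  rewrite -ge0_integralZl//.
  - apply: eq_integral => z _; rewrite -EFinM; congr EFin.
    rewrite /Tn rcE /gz/=.
    have -> : tl (s n) (th n) (fun y => fej a z * g0 n (x - z) y) = fej a z * tl (s n) (th n) (g0 n (x - z)).
      rewrite /tilt_mean -ExZl; last exact: (tl_intble HX Hm _ (s_ge0 n) (g0_bddm n (x - z))).
      by congr Ex; apply/funext => w; ring.
    by rewrite -/(g0 n (x - z)); ring.
  - exact/measurable_EFinP.
  - move=> z _; rewrite lee_fin; apply: Ex_ge0 => w; by rewrite mulr_ge0 ?expR_ge0.
rewrite Ez.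
pose gu (p : R * R) := if 0 < p.1 then expR (- (th n * p.1)) * fej a (x + p.1 - p.2) else 0.
have mgu : measurable_fun setT gu.
  apply: measurable_fun_ifT => //; first exact: measurable_fun_ltr.
  apply: measurable_funM.
    apply: measurableT_comp => //; apply: measurable_funN => //; exact: measurable_funM.
  apply: measurableT_comp; first exact: fej_meas.
  by apply: measurable_funB => //; exact: measurable_funD.
have gu0 p : 0 <= gu p by rewrite /gu; case: ifP => // _; rewrite mulr_ge0 ?fej_ge0 ?expR_ge0.
have bgu u : bddm (fun y => gu (u, y)).
  split; first exact: (measurableT_comp mgu (measurable_pair1 u)).
  exists (expR (- (th n * u)) * (a / 2)) => y; rewrite ger0_norm// /gu/=; case: ifP => _.
    by rewrite ler_wpM2l ?expR_ge0 ?fej_le.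
  by rewrite mulr_ge0 ?expR_ge0 ?divr_ge0 ?(ltW a0).
have [mu_ Eu] := tl_tonelli (th n) (s_ge0 n) mgu gu0 bgu.
have -> : (\int[P]_w \int[mu]_u (wt (s n) (th n) (X (s n) w) * gz (u, (X (s n) w - s n * dps (th n))%R))%:E =
   \int[P]_w \int[mu]_u (wt (s n) (th n) (X (s n) w) * gu (u, (X (s n) w - s n * dps (th n))%R))%:E)%E.
  apply: eq_integral => w _; set W := wt _ _ _; set y := X (s n) w - _.
  rewrite -(@integral_shift _ (y - x) (fun u => (W * gu (u, y))%:E)).
  - apply: eq_integral => z _; congr (EFin (W * _)).
    rewrite /gz /gu /g0/= (_ : (0 < z + (y - x)) = (x - z < y)); last first.
      by apply/idP/idP => ?; lra.
    case: ifP => _; last by rewrite mulr0.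
    by rewrite mulrC; congr (expR (- (th n * _)) * fej a _); ring.
  - apply/measurable_EFinP; apply: measurable_funM => //.
    exact: (measurableT_comp mgu (measurable_pair2 y)).
  - by move=> u; rewrite lee_fin mulr_ge0 ?expR_ge0.
rewrite -Eu -ge0_integralZl//; first last.
- by move=> z _; rewrite lee_fin; apply: Ex_ge0 => w; rewrite mulr_ge0 ?expR_ge0.
- exact/measurable_EFinP.
rewrite [RHS]integral_mkcond; apply: eq_integral => u _.
rewrite patchE mem_setE in_itv/= andbT -EFinM /gu/=; case: ifP => u0; last first.
  by rewrite /tilt_mean; under eq_fun do rewrite mulr0; rewrite Ex_cst mulr0.
congr EFin; rewrite /Mn /tilt_mean.
have i1 := tl_intble HX Hm (th n) (s_ge0 n) (Mn_bddm (x + u) a0 sn0).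
rewrite mulrA -(ExZl _ i1).
have E : (fun w => wt (s n) (th n) (X (s n) w) * (expR (- (th n * u)) * fej a (x + u - (X (s n) w - s n * dps (th n))))) =
  (fun w => (expR (- (th n * u)) / r) * (wt (s n) (th n) (X (s n) w) * fej (a * r) ((x + u - (X (s n) w - s n * dps (th n))) / r))).
  by apply/funext => w; rewrite -fej_scale//; field; rewrite gt_eqF.
rewrite E (ExZl _ i1) (ExZl _ i1).
by move: (pi : R) pi0 => p p0; field; rewrite !gt_eqF.
Qed.

(** Supplies the input of the Tauberian theorem: once th_n >= al / 2, the function C e^(-al u / 2)
    dominates the average of [Mn], and the limit is the integral of e^(-al u). *)
Lemma Tn_Q a : 0 < a -> exists Q : nat -> R -> R,
  [/\ \forall n \near \oo, forall x, (\int[mu]_z (pi^-1 * fej a z * Tn n (x - z))%:E = (Q n x)%:E)%E,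
      forall x, (Q ^~ x) @ \oo --> al^-1 &
      exists C, \forall n \near \oo, forall x, Q n x <= C].
Proof.
move=> a0; have [C HC] := Mn_bnd a0.
pose I n x := (\int[mu]_(u in `]0%R, +oo[) (expR (- (th n * u)) * Mn a n (x + u))%:E)%E.
have al2 : 0 < al / 2 by rewrite divr_gt0.
have mth n : measurable_fun setT (fun u : R => expR (- (th n * u))).
  apply: measurableT_comp => //; apply: measurable_funN => //; exact: measurable_funM.
have thl : \forall n \near \oo, al / 2 <= th n by apply: (cvgr_ge al) => //; lra.
have mMx n x : 0 < s n -> measurable_fun setT (fun u : R => Mn a n (x + u)).
  move=> sn0; apply: (measurableT_comp (Mn_meas a0 sn0)); exact: measurable_funD.
have C0 : 0 <= C.
  have [n HCn] := filter_ex HC; exact: le_trans (HCn 0).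
have bnd : \forall n \near \oo, forall x u, 0 < u -> `|expR (- (th n * u)) * Mn a n (x + u)| <= C * expR (- (al / 2 * u)).
  near=> n => x u u0.
  have HCn : forall y, `|Mn a n y| <= C by near: n.
  rewrite normrM mulrC; apply: ler_pM => //.
  rewrite ger0_norm ?expR_ge0// ler_expR lerN2 ler_wpM2r ?(ltW u0)//.
  by near: n.
have M0 n y : 0 < s n -> 0 <= Mn a n y.
  move=> sn0; rewrite mulr_ge0 ?divr_ge0 ?(ltW pi0)//.
  by apply: Ex_ge0 => w; rewrite mulr_ge0 ?expR_ge0 ?fej_ge0// mulr_gt0 ?sqrtr_gt0.
have mexp : measurable_fun setT (fun u : R => C * expR (- (al / 2 * u))).
  apply: measurable_funM => //; apply: measurableT_comp => //.
  apply: measurable_funN => //; exact: measurable_funM.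
have Ib : \forall n \near \oo, forall x, (0 <= I n x <= (C * (al / 2)^-1)%:E)%E.
  near=> n => x.
  have sn0 : 0 < s n by near: n.
  rewrite integral_ge0/=; last by move=> u _; rewrite lee_fin mulr_ge0 ?expR_ge0 ?M0.
  rewrite EFinM -exp_val// -ge0_integralZl//; first last.
  - apply/measurable_EFinP; apply: measurable_funTS; apply: measurableT_comp => //.
    apply: measurable_funN => //; exact: measurable_funM.
  apply: ge0_le_integral => //.
  - by move=> u _; rewrite lee_fin mulr_ge0 ?expR_ge0 ?M0.
  - apply/measurable_EFinP; apply: measurable_funTS; apply: measurable_funM; [exact: mth|exact: mMx].
  - have hm : measurable_fun (`]0%R, +oo[%classic : set R) (EFin \o (fun u : R => C * expR (- (al / 2 * u)))).
      by apply/measurable_EFinP; exact: measurable_funTS.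
    exact: hm.
  - move=> u; rewrite /= in_itv/= andbT => u0.
    rewrite -EFinM lee_fin (le_trans (ler_norm _))//.
    by move: x u u0; near: n.
exists (fun n x => fine (I n x)); split.
- near=> n => x.
  have sn0 : 0 < s n by near: n.
  rewrite Q_repr// fineK//.
  have /andP[i0 i1] : (0 <= I n x <= (C * (al / 2)^-1)%:E)%E by move: x; near: n.
  by rewrite ge0_fin_numE//; apply: (le_lt_trans i1); rewrite ltry.
- move=> x; apply: fine_cvg; rewrite -exp_val//.
  pose fM n u := if 0 < s n then expR (- (th n * u)) * Mn a n (x + u) else 0.
  have H : (fun n => \int[mu]_(u in `]0%R, +oo[) (fM n u)%:E)%E @ \oo --> (\int[mu]_(u in `]0%R, +oo[) (expR (- (al * u)))%:E)%E.
    apply: (@dct_near _ _ _ mu _ fM _ (fun u => C * expR (- (al / 2 * u)))) => //.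
    + move=> n; rewrite /fM; case: (ltP 0 (s n)) => sn0; last exact: measurable_cst.
      apply: measurable_funTS; apply: measurable_funM; [exact: mth|exact: mMx].
    + apply: measurable_funTS; apply: measurableT_comp => //.
      apply: measurable_funN => //; exact: measurable_funM.
    + move=> u _.
      have H : (fun n => expR (- (th n * u)) * Mn a n (x + u)) @ \oo --> expR (- (al * u)).
        rewrite -[X in _ --> X]mulr1; apply: cvgM; last exact: Mn_cvg.
        by apply: continuous_cvg; [exact: continuous_expR|apply: cvgN; exact: cvgMl].
      apply: cvg_trans H; apply: near_eq_cvg; apply: filterS s_pos => n sn0.
      by rewrite /fM sn0.
    + have := @integrableZl _ _ _ mu _ (measurable_itv _) C _ (exp_int al2).
      by congr (mu.-integrable _ _); apply/funext => u /=; rewrite EFinM.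
    + apply: filterS bnd => n bnd u; rewrite /= in_itv/= andbT => u0; rewrite /fM.
      case: ifP => _; first exact: bnd.
      by rewrite normr0 mulr_ge0 ?expR_ge0.
  apply: cvg_trans H; apply: near_eq_cvg; apply: filterS s_pos => n sn0.
  by apply: eq_integral => u _; rewrite /fM sn0.
- exists (C * (al / 2)^-1); apply: filterS Ib => n Ib x.
  have /andP[i0 i1] := Ib x.
  by rewrite -lee_fin fineK// ge0_fin_numE// (le_lt_trans i1)// ltry.
Unshelve. all: by end_near.
Qed.

Let Tn_ge0 n x : 0 <= Tn n x.
Proof.
rewrite mulr_ge0 ?sqrtr_ge0//; apply: Ex_ge0 => w; rewrite mulr_ge0 ?expR_ge0//.
by case: ifP => // _; exact: expR_ge0.
Qed.

Let Tn_meas n : measurable_fun setT (Tn n).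
Proof.
apply: measurable_funM => //.
apply: (proj1 (@tl_tonelli (s n) (th n) (fun p => g0 n p.1 p.2) (s_ge0 n) (g0_meas n) _ _)).
- by move=> p; case/andP : (g0_bnd n p.1 p.2).
- exact: g0_bddm.
Qed.

(** Raising the threshold by h multiplies the integrand by e^(th h) and can only shrink its
    support. *)
Let Tn_mono n x h : 0 <= h -> Tn n (x + h) <= expR (th n * h) * Tn n x.
Proof.
move=> h0; rewrite /Tn mulrCA ler_wpM2l ?sqrtr_ge0// /tilt_mean.
have j1 := tl_intble HX Hm (th n) (s_ge0 n) (g0_bddm n x).
have j2 := tl_intble HX Hm (th n) (s_ge0 n) (g0_bddm n (x + h)).
rewrite -(ExZl _ j1); apply: (le_Ex j2 (intbleZl _ j1)) => w.
rewrite [leRHS]mulrCA; apply: ler_wpM2l; rewrite ?expR_ge0// /g0.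
set y := X (s n) w - _; case: ifP => c1.
  rewrite (_ : x < y); last by lra.
  by rewrite -expRD ler_expR le_eqVlt; apply/orP; left; apply/eqP; ring.
by case: ifP => _; rewrite ?mulr0// mulr_ge0 ?expR_ge0.
Qed.

Lemma Tn_bnd : exists2 C, 0 <= C & \forall n \near \oo, forall x, Tn n x <= C.
Proof. exact: (tauber_bnd al0 th_cvg Tn_ge0 Tn_meas Tn_mono Tn_Q). Qed.

Lemma Tn_cvg x : (Tn ^~ x) @ \oo --> al^-1.
Proof. exact: (tauber al0 th_cvg Tn_ge0 Tn_meas Tn_mono Tn_Q). Qed.

End Sequence.
End LLT.

(** * Layer-cake estimates and the norming constants *)

Section Layer.
Context {d : measure_display} {Om : measurableType d} {R : realType} (P : probability Om R).
Local Notation intble f := (P.-integrable setT (EFin \o f)).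
Local Notation mu := (@lebesgue_measure R).
Variable Y : Om -> R.
Hypothesis mY : measurable_fun setT Y.

Let mlt x : measurable [set w | x < Y w].
Proof. by rewrite -[X in measurable X]setTI; exact: measurable_fun_ltr. Qed.

Let indic_int A : measurable A -> intble (\1_A : Om -> R).
Proof.
move=> mA; apply: (@Ex_bnd_int _ _ _ _ _ 1); first exact: measurable_indic.
by move=> w; rewrite indicE; case: (_ \in _); rewrite ?normr1 ?normr0.
Qed.

Let layer0 (k c : R -> R) : measurable_fun setT k -> measurable_fun setT c -> (forall u, 0 <= k u) ->
  measurable_fun setT (fun u => k u * prob P [set w | c u < Y w]) /\
  (\int[mu]_u (k u * prob P [set w | c u < Y w])%:E =
   \int[P]_w \int[mu]_u (if c u < Y w then k u else 0)%:E)%E.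
Proof.
move=> mk mc k0.
pose K (p : R * Om) : \bar R := (if c p.1 < Y p.2 then k p.1 else 0)%:E.
have mK : measurable_fun setT K.
  apply/measurable_EFinP; apply: measurable_fun_ifT => //; last exact: measurableT_comp.
  by apply: measurable_fun_ltr; exact: measurableT_comp.
have K0 p : (0 <= K p)%E by rewrite lee_fin; case: ifP.
have E u : ((k u * prob P [set w | c u < Y w])%:E = \int[P]_w K (u, w))%E.
  rewrite -(Ex_indic P (mlt (c u))) -(ExZl _ (indic_int (mlt (c u)))).
  rewrite -(Ex_EFin (intbleZl _ (indic_int (mlt (c u))))).
  apply: eq_integral => w _; rewrite /K indicE/=; case: ifP => h.
    by rewrite mem_set// mulr1.
  by rewrite memNset/= ?mulr0// h.
split.
  apply/measurable_EFinP.
  have := @measurable_fun_fubini_tonelli_F _ _ _ _ R P K mK K0.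
  by apply: eq_measurable_fun => u _; rewrite /= E.
under eq_integral do rewrite E.
exact: (@fubini_tonelli _ _ _ _ R mu P K mK K0).
Qed.

Lemma tail_meas (c : R -> R) : measurable_fun setT c -> measurable_fun setT (fun u => prob P [set w | c u < Y w]).
Proof.
move=> mc; have [] := @layer0 (fun=> 1) c (measurable_cst _) mc (fun _ => ler01).
by move=> + _; apply: eq_measurable_fun => u _; rewrite mul1r.
Qed.

(** The threshold is a function [c] of the layer, so that layers can run downwards from a level as
    well as upwards. *)
Lemma layer_cake (k c f : R -> R) : measurable_fun setT k -> measurable_fun setT c -> (forall u, 0 <= k u) ->
  (forall z, \int[mu]_u (if (c u < z)%R then k u else 0)%:E = (f z)%:E)%E -> intble (f \o Y) ->
  (\int[mu]_u (k u * prob P [set w | c u < Y w])%:E = (Ex P (f \o Y))%:E)%E.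
Proof.
move=> mk mc k0 Hf fi; rewrite (layer0 mk mc k0).2 -(Ex_EFin fi).
by apply: eq_integral => w _; rewrite Hf.
Qed.

Lemma open_ray (f : R -> R) (a : R) : measurable_fun setT f ->
  (\int[mu]_u (if (a < u)%R then f u else 0)%:E = \int[mu]_(u in `[a, +oo[) (f u)%:E)%E.
Proof.
move=> mf; rewrite -integral_itv_obnd_cbnd; last by apply/measurable_EFinP; exact: measurable_funTS.
rewrite [RHS]integral_mkcond; apply: eq_integral => u _.
by rewrite patchE mem_setE in_itv/= andbT; case: ifP.
Qed.

Let open_seg (f : R -> R) (a b : R) : measurable_fun setT f ->
  (\int[mu]_u (if (a < u < b)%R then f u else 0)%:E = \int[mu]_(u in `[a, b]) (f u)%:E)%E.
Proof.
move=> mf; have mf' D : measurable_fun D (EFin \o f) by apply/measurable_EFinP; exact: measurable_funTS.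
rewrite -integral_itv_obnd_cbnd// -integral_itv_bndo_bndc//.
rewrite [RHS]integral_mkcond; apply: eq_integral => u _.
by rewrite patchE mem_setE in_itv/=; case: ifP.
Qed.

Let mexp (q : R) : measurable_fun setT (fun u : R => expR (q * u)).
Proof. by apply: measurableT_comp => //; exact: measurable_funM. Qed.

Let exp_ray_from (p a : R) : 0 < p -> (\int[mu]_(u in `[a, +oo[) (p * expR (- p * u))%:E = (expR (- p * a))%:E)%E.
Proof.
move=> p0; apply: (@FTC_ray R (fun u => - expR (- p * u)) _ a 0).
- by rewrite sub0r opprK.
- by move=> x _; apply: is_derive_eq; rewrite /GRing.scale/=; ring.
- apply: continuous_subspaceT => x; apply: cvgMr.
  by apply: continuous_cvg; [exact: continuous_expR|exact: cvgMr].
- by move=> x _; rewrite mulr_ge0 ?expR_ge0// ltW.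
- rewrite -oppr0; apply: cvgN; under eq_fun do rewrite mulNr.
  apply: (@cvg_comp _ _ _ (fun u => p * u) (fun y => expR (- y)) _ +oo%R); last exact: cvgr_expR.
  exact: gt0_cvgMry.
Qed.

Let exp_seg (a b : R) : (\int[mu]_(u in `[a, b]) (expR (1 * u))%:E = (if (a < b)%R then expR b - expR a else 0)%:E)%E.
Proof.
under eq_integral do rewrite mul1r.
case: ltgtP => ab; first by apply: (@FTC_bnd R expR) => //; exact: continuous_expR.
  by rewrite set_itv_ge ?integral_set0// bnd_simp -ltNge.
by rewrite ab set_itv1 integral_set1.
Qed.

Lemma intZ (D : set R) (f : R -> R) (c : R) : measurable D -> 0 <= c -> measurable_fun setT f -> (forall u, 0 <= f u) ->
  (\int[mu]_(u in D) (c * f u)%:E = c%:E * \int[mu]_(u in D) (f u)%:E)%E.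
Proof.
move=> mD c0 mf f0; under eq_integral do rewrite EFinM.
rewrite ge0_integralZl//.
- by apply/measurable_EFinP; exact: measurable_funTS.
- by move=> u _; rewrite lee_fin.
Qed.

(** Layer cake for e^(p min(Y, l)) with thresholds l - u, u > 0; the tail hypothesis bounds the
    layer integrand by C p e^((p - kap)(l - u)). *)
Lemma moment_le (N : nat) (p kap C l : R) : 0 < p -> kap < p -> l <= 0 ->
  (forall x, x <= 0 -> N%:R * prob P [set w | x < Y w] <= C * expR (- kap * x)) ->
  N%:R * Ex P (fun w => if Y w <= l then expR (p * Y w) else 0) <= C * p / (p - kap) * expR ((p - kap) * l).
Proof.
move=> p0 kp l0 HC.
have pk : 0 < p - kap by rewrite subr_gt0.
have C0 : 0 <= C.
  have := HC 0 (lexx 0); rewrite mulr0 expR0 mulr1; apply: le_trans.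
  by rewrite mulr_ge0// fine_ge0.
pose g (u : R) := expR (p * l) * (p * expR (- p * u)).
have mg : measurable_fun setT g by apply: measurable_funM => //; apply: measurable_funM => //; exact: mexp.
have g0 u : 0 <= g u by rewrite !mulr_ge0 ?expR_ge0// ltW.
pose k (u : R) := if 0 < u then g u else 0.
have mk : measurable_fun setT k by apply: measurable_fun_ifT => //; exact: measurable_fun_ltr.
have k0 u : 0 <= k u by rewrite /k; case: ifP.
have mc : measurable_fun setT (fun u : R => l - u) by exact: measurable_funB.
have imin : intble (fun w => expR (p * Num.min (Y w) l)).
  apply: (@Ex_bnd_int _ _ _ _ _ (expR (p * l))).
    by apply: measurableT_comp => //; apply: measurable_funM => //; exact: measurable_minr.
  by move=> w; rewrite ger0_norm ?expR_ge0// ler_expR ler_pM2l// ge_min lexx orbT.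
have EL : (\int[mu]_u (k u * prob P [set w | l - u < Y w])%:E = (Ex P (fun w => expR (p * Num.min (Y w) l)))%:E)%E.
  apply: (layer_cake mk mc k0 (f := fun z => expR (p * Num.min z l))) => // z.
  pose a := Num.max 0 (l - z).
  have -> : expR (p * Num.min z l) = expR (p * l) * expR (- p * a).
    rewrite -expRD; congr expR; rewrite /a maxEle minEle.
    by case: (leP 0 (l - z)) => h1; case: (leP z l) => h2; try lra; rewrite ?mulr0 ?addr0//; ring.
  have c0 : 0 <= expR (p * l) by exact: expR_ge0.
  have mm : measurable_fun setT (fun u : R => p * expR (- p * u)) by apply: measurable_funM => //; exact: mexp.
  have nn u : 0 <= p * expR (- p * u) by rewrite mulr_ge0 ?expR_ge0// ltW.
  rewrite EFinM -(exp_ray_from a p0) -(intZ (measurable_itv _) c0 mm nn).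
  rewrite -(open_ray a mg); apply: eq_integral => u _; rewrite /k /a gt_max.
  have -> : (l - u < z) = (l - z < u) by apply/idP/idP => h; lra.
  by case: (0 < u) => //=; case: ifP.
have N0 : 0 <= N%:R :> R by [].
have mif : measurable_fun setT (fun w => if Y w <= l then expR (p * Y w) else 0).
  apply: measurable_fun_ifT => //; first exact: measurable_fun_ler.
  by apply: measurableT_comp => //; exact: measurable_funM.
have iif : intble (fun w => if Y w <= l then expR (p * Y w) else 0).
  apply: (intble_le mif _ imin) => w; case: ifP => h; last by rewrite normr0 expR_ge0.
  by rewrite ger0_norm ?expR_ge0// ler_expR ler_pM2l// le_min lexx h.
apply: (@le_trans _ _ (N%:R * Ex P (fun w => expR (p * Num.min (Y w) l)))).
  apply: ler_wpM2l => //; apply: (le_Ex iif imin) => w; case: ifP => h; last exact: expR_ge0.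
  by rewrite ler_expR ler_pM2l// le_min lexx h.
have mt := tail_meas mc.
rewrite -lee_fin EFinM -EL -ge0_integralZl//; first last.
- by move=> u _; rewrite lee_fin mulr_ge0// fine_ge0.
- by apply/measurable_EFinP; exact: measurable_funM.
pose h (u : R) := C * p * expR ((p - kap) * l) * expR (- (p - kap) * u).
have h0 u : 0 <= h u by rewrite !mulr_ge0 ?expR_ge0// ltW.
have mh : measurable_fun setT h by apply: measurable_funM => //; exact: mexp.
apply: (@le_trans _ _ (\int[mu]_u (if (0 < u)%R then h u else 0)%:E)%E).
  apply: ge0_le_integral => //.
  - by move=> u _; rewrite -EFinM lee_fin !mulr_ge0// fine_ge0.
  - apply/measurable_EFinP; apply: measurable_funM => //; exact: measurable_funM.
  - by apply/measurable_EFinP; apply: measurable_fun_ifT => //; exact: measurable_fun_ltr.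
  move=> u _; rewrite -EFinM lee_fin /k; case: ifP => u0; last by rewrite mul0r mulr0.
  have lu : l - u <= 0 by lra.
  have H := HC _ lu.
  have -> : h u = g u * (C * expR (- kap * (l - u))).
    rewrite /h /g (_ : - kap * (l - u) = - kap * l + kap * u); last by ring.
    rewrite expRD (_ : - (p - kap) * u = - p * u + kap * u); last by ring.
    rewrite expRD (_ : (p - kap) * l = p * l + - kap * l); last by ring.
    by rewrite expRD; ring.
  by rewrite mulrCA; apply: ler_wpM2l.
have nn u : 0 <= expR (- (p - kap) * u) by exact: expR_ge0.
have c0 : 0 <= C * p * expR ((p - kap) * l) by rewrite !mulr_ge0 ?expR_ge0// ltW.
rewrite (open_ray 0 mh) (intZ (measurable_itv _) c0 (mexp _) nn).
rewrite integral_exp_ray// -EFinM lee_fin le_eqVlt; apply/orP; left; apply/eqP.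
by field; rewrite gt_eqF.
Qed.

(** Layer cake for e^y - e^l with y the value of Y clipped to [l, 0]; clipping at 0 and at l
    produces the two tail terms. *)
Lemma mean_band (N : nat) (l : R) : l < 0 ->
  (\int[mu]_(x in `[l, 0%R]) (expR x * (N%:R * prob P [set w | x < Y w]))%:E =
   (N%:R * Ex P (fun w => if (l < Y w) && (Y w <= 0) then expR (Y w) else 0)
    + N%:R * prob P [set w | 0 < Y w] - expR l * (N%:R * prob P [set w | l < Y w]))%:E)%E.
Proof.
move=> l0.
pose k (u : R) := if l < u < 0 then expR (1 * u) else 0.
have mk : measurable_fun setT k.
  apply: measurable_fun_ifT; [|exact: mexp|exact: measurable_cst].
  by apply: measurable_and; exact: measurable_fun_ltr.
have k0 u : 0 <= k u by rewrite /k; case: ifP => // _; exact: expR_ge0.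
pose f z := expR (Num.max l (Num.min z 0)) - expR l.
have fi : intble (f \o Y).
  apply: (@Ex_bnd_int _ _ _ _ _ 1).
    apply: measurable_funB => //; apply: measurableT_comp => //; apply: measurable_maxr => //; exact: measurable_minr.
  move=> w; rewrite /f/= ger0_norm; last by rewrite subr_ge0 ler_expR le_max lexx.
  rewrite lerBlDr (le_trans (y := 1))//; last by rewrite lerDl expR_ge0.
  by rewrite -expR0 ler_expR ge_max (ltW l0) ge_min lexx orbT.
have mid : measurable_fun setT (fun u : R => u) by [].
have EL := layer_cake mk mid k0 _ fi.
have {}EL : (\int[mu]_u (k u * prob P [set w | u < Y w])%:E = (Ex P (f \o Y))%:E)%E.
  apply: EL => z; rewrite /=.
  transitivity (\int[mu]_u (if (l < u < Num.max l (Num.min z 0))%R then expR (1 * u) else 0)%:E)%E.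
    apply: eq_integral => u _; rewrite /k lt_max lt_min.
    case: (ltP l u) => h1 /=; last by case: ifP.
    by rewrite (lt_gtF h1)/=; case: (u < z).
  rewrite open_seg; last exact: mexp.
  rewrite exp_seg /f; case: ifP => //; case: (leP (Num.min z 0) l) => h; last by rewrite h.
  by rewrite subrr.
have mt := tail_meas (@measurable_id _ R setT).
have i1 : intble (fun w => if (l < Y w) && (Y w <= 0) then expR (Y w) else 0).
  apply: (@Ex_bnd_int _ _ _ _ _ 1).
    apply: measurable_fun_ifT => //; last exact: measurableT_comp.
    by apply: measurable_and; [exact: measurable_fun_ltr|exact: measurable_fun_ler].
  move=> w; case: ifP => [/andP[_ h]|_]; last by rewrite normr0.
  by rewrite ger0_norm ?expR_ge0// -expR0 ler_expR.
have Ef : Ex P (f \o Y) = Ex P (fun w => if (l < Y w) && (Y w <= 0) then expR (Y w) else 0)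
   + prob P [set w | 0 < Y w] - expR l * prob P [set w | l < Y w].
  rewrite -(Ex_indic P (mlt 0)) -(Ex_indic P (mlt l)) -(ExZl _ (indic_int (mlt l))).
  rewrite -(ExD i1 (indic_int (mlt 0))) -(ExB (intbleD i1 (indic_int (mlt 0))) (intbleZl _ (indic_int (mlt l)))).
  congr Ex; apply/funext => w; rewrite /f/= !indicE.
  have -> : (w \in [set w | 0 < Y w]) = (0 < Y w) by apply/idP/idP; rewrite inE.
  have -> : (w \in [set w | l < Y w]) = (l < Y w) by apply/idP/idP; rewrite inE.
  rewrite minEle; case: (ltP l (Y w)) => h1; case: (leP (Y w) 0) => h2 /=.
  - by rewrite (max_r (ltW h1)) addr0 mulr1.
  - by rewrite (max_r (ltW l0)) expR0 add0r mulr1.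
  - by rewrite (max_l h1) subrr mulr0 addr0 subr0.
  - by have := lt_le_trans h2 h1; lra.
have -> : (\int[mu]_(x in `[l, 0%R]) (expR x * (N%:R * prob P [set w | x < Y w]))%:E =
   N%:R%:E * \int[mu]_u (k u * prob P [set w | u < Y w])%:E)%E.
  rewrite -ge0_integralZl//; first last.
  - by move=> u _; rewrite lee_fin mulr_ge0// fine_ge0.
  - by apply/measurable_EFinP; exact: measurable_funM.
  rewrite -open_seg; last by apply: measurable_funM => //; exact: measurable_funM.
  apply: eq_integral => u _; rewrite -EFinM /k; congr EFin; case: ifP => _.
    by rewrite mul1r mulrCA.
  by rewrite mul0r mulr0.
by rewrite EL Ef -EFinM; congr EFin; ring.
Qed.

(** Layer cake for the positive part of e^Y - e^l. *)
Lemma mean_above (N : nat) (l : R) : intble (expR \o Y) ->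
  (\int[mu]_(u in `[0%R, +oo[) (expR (l + u) * (N%:R * prob P [set w | l + u < Y w]))%:E =
   (N%:R * Ex P (fun w => if l < Y w then expR (Y w) else 0)
    - expR l * (N%:R * prob P [set w | l < Y w]))%:E)%E.
Proof.
move=> iY.
pose k (u : R) := if 0 < u then expR (l + u) else 0.
have mg : measurable_fun setT (fun u : R => expR (l + u)) by apply: measurableT_comp => //; exact: measurable_funD.
have mk : measurable_fun setT k.
  by apply: measurable_fun_ifT => //; exact: measurable_fun_ltr.
have k0 u : 0 <= k u by rewrite /k; case: ifP => // _; exact: expR_ge0.
pose f z := if l < z then expR z - expR l else 0.
have mY1 : measurable_fun setT (fun w => l < Y w) by exact: measurable_fun_ltr.
have i1 : intble (fun w => if l < Y w then expR (Y w) else 0).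
  apply: (intble_le _ _ iY); first by apply: measurable_fun_ifT => //; exact: measurableT_comp.
  move=> w; case: ifP => _; last by rewrite normr0 expR_ge0.
  by rewrite ger0_norm ?expR_ge0.
have i2 := intbleZl (expR l) (indic_int (mlt l)).
have Ef : f \o Y = (fun w => (if l < Y w then expR (Y w) else 0) - expR l * \1_[set w | l < Y w] w).
  apply/funext => w; rewrite /f/= indicE.
  have -> : (w \in [set w | l < Y w]) = (l < Y w) by apply/idP/idP; rewrite inE.
  by case: ifP => _; rewrite ?mulr1// mulr0 subr0.
have fi : intble (f \o Y) by rewrite Ef; exact: intbleB.
have mc : measurable_fun setT (fun u : R => l + u) by exact: measurable_funD.
have EL := layer_cake mk mc k0 _ fi.
have {}EL : (\int[mu]_u (k u * prob P [set w | l + u < Y w])%:E = (Ex P (f \o Y))%:E)%E.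
  apply: EL => z; rewrite /=.
  transitivity (\int[mu]_u (if (0 < u < z - l)%R then expR (l + u) else 0)%:E)%E.
    apply: eq_integral => u _; rewrite /k.
    have -> : (l + u < z) = (u < z - l) by apply/idP/idP => h; lra.
    by case: (0 < u) => //=; case: ifP.
  rewrite open_seg//.
  transitivity (\int[mu]_(u in `[0%R, (z - l)%R]) (expR l * expR (1 * u))%:E)%E.
    by apply: eq_integral => u _; rewrite expRD mul1r.
  have nn (u : R) : 0 <= expR (1 * u) by exact: expR_ge0.
  rewrite (intZ (measurable_itv _) (expR_ge0 l) (mexp 1) nn).
  rewrite exp_seg -EFinM; congr EFin; rewrite /f subr_gt0; case: ifP => _; last by rewrite mulr0.
  by rewrite mulrBr -!expRD addr0; congr (expR _ - _); ring.
have mt := tail_meas mc.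
have -> : (\int[mu]_(u in `[0%R, +oo[) (expR (l + u) * (N%:R * prob P [set w | l + u < Y w]))%:E =
   N%:R%:E * \int[mu]_u (k u * prob P [set w | l + u < Y w])%:E)%E.
  rewrite -ge0_integralZl//; first last.
  - by move=> u _; rewrite lee_fin mulr_ge0// fine_ge0.
  - by apply/measurable_EFinP; exact: measurable_funM.
  rewrite -open_ray; last by apply: measurable_funM => //; exact: measurable_funM.
  apply: eq_integral => u _; rewrite -EFinM /k; congr EFin; case: ifP => _.
    by rewrite mulrCA.
  by rewrite mul0r mulr0.
rewrite EL Ef (ExB i1 i2) (ExZl _ (indic_int (mlt l))) (Ex_indic P (mlt l)) -EFinM; congr EFin; ring.
Qed.

End Layer.

Lemma cvg_ext {R : realType} (f g : nat -> R) (l l' : R) : g @ \oo --> l -> l = l' -> g =1 f -> f @ \oo --> l'.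
Proof. by move=> h <- /funext <-. Qed.

Section Norming.
Let half_lt {R : realType} (a : R) : 0 < a -> a / 2 < a.
Proof. by move=> ?; lra. Qed.

Context {d : measure_display} {Om : measurableType d} {R : realType}
  (P : probability Om R) (X : R -> Om -> R).
Hypothesis HX : levy P X.
Hypothesis Hm : forall u, P.-integrable setT (EFin \o (fun w => expR (u * X 1 w))).
Hypothesis nonlat : ~ lattice P (X 1).
Variables (s : nat -> R) (lam alpha sg : R) (J : R -> R).
Hypothesis sgd : sg = d2cum P (X 1) alpha.
Hypothesis JE : J = IofPsi' (psi P X).
Hypothesis s_ge0 : forall N, 0 <= s N.
Hypothesis Hlam : (fun N : nat => ln N%:R / s N) @ \oo --> lam.
Hypothesis lam0 : 0 < lam.
Hypothesis alpha0 : 0 < alpha.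
Let ps := psi P X.
Hypothesis HalphaI : IofPsi' ps alpha = lam.
Let dps := dcum P (X 1).
Let mX t : measurable_fun setT (X t) := levy_meas HX t.
Let nc : ~ (exists c, prob P [set w | X 1 w = c] = 1).
Proof. by case: HX. Qed.

(** [yN] is the argument of I^-1 in B_N and [lB] is log B_N(0). *)
Definition yN N := (ln N%:R - ln (alpha * Num.sqrt (2 * pi * derive1n 2 ps alpha * s N))) / s N.
Definition lB N := s N * Iinv ps (yN N).

Let sg0 : 0 < sg.
Proof. by rewrite sgd; exact: d2cum_gt0. Qed.
Let sgE : derive1n 2 ps alpha = sg.
Proof. by rewrite sgd; exact: (derive1n2_cum (mX 1) Hm). Qed.

Let s_pos : \forall N \near \oo, 0 < s N.
Proof.
have : \forall N \near \oo, 0 < ln N%:R / s N by apply: (cvgr_gt lam).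
apply: filterS => N h; rewrite lt_neqAle s_ge0 andbT; apply/eqP => s0.
by move: h; rewrite -s0 invr0 mulr0 ltxx.
Qed.

Lemma ln_nat_cvg : (fun N => ln N%:R : R) @ \oo --> +oo.
Proof.
apply/cvgryPge => A; near=> N.
have h : expR A <= N%:R by near: N; exact: nbhs_infty_ger.
by rewrite -[A]expRK ler_ln ?posrE ?expR_gt0// (lt_le_trans (expR_gt0 A)).
Unshelve. all: by end_near.
Qed.

(** The ratio log N / s_N stays bounded while log N tends to infinity. *)
Lemma s_cvg : s @ \oo --> +oo.
Proof.
apply/cvgryPge => A; near=> N.
have sN : 0 < s N by near: N.
have r : ln N%:R / s N <= lam + 1 by near: N; apply: (cvgr_le lam) => //; lra.
have l : (lam + 1) * A <= ln N%:R.
  by near: N; move/cvgryPge : ln_nat_cvg; apply.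
rewrite ler_pdivrMr// in r.
by rewrite -(@ler_pM2l _ (lam + 1)) ?addr_gt0// (le_trans l).
Unshelve. all: by end_near.
Qed.

(** The correction is of order log(s_N) / s_N; it is bounded through log r <= r with r =
    sqrt(s_N). *)
Lemma yN_cvg : yN @ \oo --> lam.
Proof.
pose K := alpha * Num.sqrt (2 * pi * sg).
have k0 : 0 < 2 * pi * sg by rewrite !mulr_gt0// pi_gt0.
have K0 : 0 < K by rewrite mulr_gt0 ?sqrtr_gt0.
have E N : yN N = ln N%:R / s N - ln (alpha * Num.sqrt (2 * pi * derive1n 2 ps alpha * s N)) / s N.
  by rewrite /yN mulrBl.
rewrite (_ : yN = (fun N => ln N%:R / s N - ln (alpha * Num.sqrt (2 * pi * derive1n 2 ps alpha * s N)) / s N)).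
  2: by apply/funext => N; exact: E.
rewrite -[X in _ --> X]subr0; apply: cvgB => //.
apply: norm_cvg0.
have iv := inv_sqrt_cvg s_cvg.
apply: (@squeeze_cvgr _ _ _ _ (fun=> 0) (fun N => (`|ln K| + 1) / Num.sqrt (s N))).
- near=> N; apply/andP; split; first exact: normr_ge0.
  have s1 : 1 <= s N by near: N; move/cvgryPge : s_cvg; apply.
  have s0 : 0 < s N by rewrite (lt_le_trans ltr01).
  set r := Num.sqrt (s N).
  have r1 : 1 <= r by rewrite -sqrtr1 ler_wsqrtr.
  have r0 : 0 < r by rewrite (lt_le_trans ltr01).
  have sr : s N = r * r by rewrite -expr2 sqr_sqrtr// ltW.
  rewrite sgE sqrtrM ?(ltW k0)// mulrA -/K -/r lnM ?posrE//.
  rewrite normrM normfV (gtr0_norm s0) sr invfM mulrA ler_wpM2r ?invr_ge0 ?(ltW r0)//.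
  rewrite ler_pdivrMr// (le_trans (ler_normD _ _))// mulrDl mul1r lerD//.
    by rewrite ler_peMr.
  rewrite ger0_norm ?ln_ge0// -[leRHS]expRK ler_ln ?posrE ?expR_gt0//.
  by have := expR_ge1Dx r; lra.
- exact: cvg_cst.
- by rewrite -(mulr0 (`|ln K| + 1)); apply: cvgMr.
Unshelve. all: by end_near.
Qed.

Let Jc : continuous J.
Proof. by rewrite JE; exact: J_cont (mX 1) Hm. Qed.
Let Jlt (a b : R) : 0 <= a -> a < b -> J a < J b.
Proof. by rewrite JE; exact: (@J_lt _ _ _ P (X 1) (mX 1) Hm nc a b). Qed.
Let JltE (a b : R) : 0 <= a -> 0 <= b -> (J a < J b) = (a < b).
Proof. by rewrite JE; exact: (@J_ltE _ _ _ P (X 1) (mX 1) Hm nc a b). Qed.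
Let Jal : J alpha = lam.
Proof. by rewrite JE. Qed.

(** The tilt whose mean is exactly log B_N(0). The default [alpha] keeps it positive for the
    finitely many N without a root. *)
Definition thN N := xget alpha [set u | 0 < u /\ IofPsi' (psi P X) u = yN N].

Lemma thN_gt0 N : 0 < thN N.
Proof. by rewrite /thN; case: xgetP => [u _ [] //|_]. Qed.

(** The intermediate value theorem produces a root in [a, b], and strict monotonicity of [J] then
    locates the one selected by [xget]. *)
Let near_th a b : 0 < a -> a < alpha -> alpha < b ->
  \forall N \near \oo, [/\ J (thN N) = yN N & a < thN N < b].
Proof.
move=> a0 al lb.
have Ja : J a < lam by rewrite -Jal; apply: Jlt => //; exact: ltW.
have Jb : lam < J b by rewrite -Jal; apply: Jlt => //; exact: ltW.
near=> N.
have y1 : J a < yN N by near: N; exact: (cvgr_gt lam yN_cvg).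
have y2 : yN N < J b by near: N; exact: (cvgr_lt lam yN_cvg).
have ab : a <= b by rewrite ltW// (lt_trans al).
have [c /[!in_itv]/= /andP[c1 c2] Jcy] : exists2 c, c \in `[a, b] & J c = yN N.
  apply: IVT => //; first exact: continuous_subspaceT.
  by apply/andP; split; [rewrite ge_min (ltW y1)|rewrite le_max (ltW y2) orbT].
have c0 : 0 < c by rewrite (lt_le_trans a0).
have HJ : J (thN N) = yN N.
  by rewrite /thN JE; case: xgetP => [u _ []//|/(_ c)] []; split; rewrite -?JE.
split => //; have t0 := thN_gt0 N; apply/andP; split.
  by rewrite -(JltE (ltW a0) (ltW t0)) HJ.
by rewrite -(JltE (ltW t0)) ?HJ//; exact: le_trans (ltW a0) ab.
Unshelve. all: by end_near.
Qed.

Lemma thN_cvg : thN @ \oo --> alpha.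
Proof.
apply/cvgrPdist_lt => e e0.
pose a := Num.max (alpha / 2) (alpha - e / 2).
have a0 : 0 < a by rewrite lt_max divr_gt0.
have a1 : a < alpha by rewrite gt_max half_lt//= ltrBlDr ltrDl divr_gt0.
have a2 : alpha - e < a by rewrite lt_max; apply/orP; right; lra.
have b1 : alpha < alpha + e by lra.
apply: filterS (near_th a0 a1 b1) => N [_ /andP[h1 h2]].
by rewrite ltr_distl; apply/andP; split; lra.
Qed.

Lemma lB_th : \forall N \near \oo, lB N = s N * dps (thN N).
Proof.
have h1 := half_lt alpha0.
have h2 : alpha < alpha + 1 by rewrite ltrDl.
have h3 : 0 < alpha / 2 by rewrite divr_gt0.
apply: filterS (near_th h3 h1 h2) => N [HJ _].
by rewrite /lB -HJ JE (Iinv_J (mX 1) Hm nc)//; exact: ltW (thN_gt0 N).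
Qed.

Definition tail N x : R := N%:R * prob P [set w | x < X (s N) w - lB N].

(** By the choice of y_N, N e^(-s_N y_N) equals alpha sqrt(2 pi psi''(alpha) s_N), which is alpha
    times the normalisation in [Tn]. This explains the logarithmic correction in B_N. *)
Lemma tailE : \forall N \near \oo, forall x, tail N x = alpha * expR (- thN N * x) * Tn P X thN s sg N x.
Proof.
have h1 := half_lt alpha0.
have h2 : alpha < alpha + 1 by rewrite ltrDl.
have h3 : 0 < alpha / 2 by rewrite divr_gt0.
near=> N.
have [HJ _] : [/\ J (thN N) = yN N & alpha / 2 < thN N < alpha + 1] by near: N; exact: near_th.
have HB : lB N = s N * dps (thN N) by near: N; exact: lB_th.
have s0 : 0 < s N by near: N.
have N0 : (0 < N)%N by near: N; exact: nbhs_infty_gt.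
move=> x; rewrite /tail HB (tail_prob HX Hm)// /Tn expRD.
have -> : - (thN N * x) = - thN N * x by ring.
have NE : N%:R * expR (- (s N * (thN N * dcum P (X 1) (thN N) - psi P X (thN N)))) = alpha * Num.sqrt (2 * pi * sg * s N).
  have JE' : thN N * dcum P (X 1) (thN N) - psi P X (thN N) = J (thN N).
    by rewrite JE /IofPsi' (derive1_cum (mX 1) Hm).
  have k0 : 0 < alpha * Num.sqrt (2 * pi * sg * s N).
    by apply: mulr_gt0 => //; rewrite sqrtr_gt0; apply: mulr_gt0 => //; apply: mulr_gt0 => //; rewrite mulr_gt0// pi_gt0.
  rewrite JE' HJ /yN sgE mulrC [s N * _]mulrC divfK ?gt_eqF// opprB expRD expRN !lnK ?posrE ?ltr0n//.
  by rewrite divfK// pnatr_eq0 -lt0n.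
by rewrite -mulrA [LHS]mulrA NE; ring.
Unshelve. all: by end_near.
Qed.

Lemma tail_cvg x : (fun N => tail N x) @ \oo --> expR (- alpha * x).
Proof.
have T := Tn_cvg HX Hm alpha0 thN_cvg s_cvg s_ge0 thN_gt0 nonlat sg0 sgd x.
have H : (fun N => alpha * expR (- thN N * x) * Tn P X thN s sg N x) @ \oo --> expR (- alpha * x).
  have -> : expR (- alpha * x) = alpha * expR (- alpha * x) * alpha^-1.
    by rewrite mulrAC divff ?mul1r// gt_eqF.
  apply: cvgM; last exact: T.
  apply: cvgMr; apply: continuous_cvg; first exact: continuous_expR.
  by apply: cvgMl; apply: cvgN; exact: thN_cvg.
apply: cvg_trans H; apply: near_eq_cvg.
by apply: filterS tailE => N ->.
Qed.

(** Uniformity over all [x] is what dominates the layer-cake integrals below. *)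
Lemma tail_bnd : exists2 C, 0 <= C & \forall N \near \oo, forall x, tail N x <= C * expR (- thN N * x).
Proof.
have [C C0 HC] := Tn_bnd HX Hm alpha0 thN_cvg s_cvg s_ge0 thN_gt0 nonlat sg0 sgd.
exists (alpha * C); first by rewrite mulr_ge0// ltW.
near=> N => x.
have -> : tail N x = alpha * expR (- thN N * x) * Tn P X thN s sg N x by move: x; near: N; exact: tailE.
have h : Tn P X thN s sg N x <= C by move: x; near: N.
by rewrite mulrAC ler_wpM2r ?expR_ge0// ler_wpM2l// ltW.
Unshelve. all: by end_near.
Qed.

Section Means.
Local Notation mu := (@lebesgue_measure R).
Let Y N w := X (s N) w - lB N.
Let mY N : measurable_fun setT (Y N).
Proof. exact: measurable_funB. Qed.
Let iY N : P.-integrable setT (EFin \o (expR \o Y N)).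
Proof.
have := intbleZl (expR (- lB N)) (exp_intble HX Hm 1 (s_ge0 N)).
by congr (P.-integrable _ _); apply/funext => w /=; rewrite -expRD mul1r addrC.
Qed.
Let tail_ge0 N x : 0 <= tail N x.
Proof. by rewrite mulr_ge0// fine_ge0. Qed.
Let mtail N (c : R -> R) : measurable_fun setT c -> measurable_fun setT (fun u => tail N (c u)).
Proof. by move=> mc; apply: measurable_funM => //; exact: (tail_meas P (mY N)). Qed.

(** On x <= 0 the exponent th_N may be replaced by any larger one, and eventually th_N <= kap. *)
Lemma trunc_moment (p kap : R) : 0 < p -> alpha < kap -> kap < p -> exists2 K, 0 <= K &
  \forall N \near \oo, forall l, l <= 0 ->
  N%:R * Ex P (fun w => if Y N w <= l then expR (p * Y N w) else 0) <= K * expR ((p - kap) * l).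
Proof.
move=> p0 ak kp; have [C C0 HC] := tail_bnd.
exists (C * p / (p - kap)); first by rewrite divr_ge0 ?mulr_ge0// ltW// subr_gt0.
near=> N => l l0; apply: (moment_le (mY N) p0 kp l0) => x x0.
have tk : thN N <= kap by near: N; exact: (cvgr_le alpha thN_cvg).
have h : tail N x <= C * expR (- thN N * x) by move: x x0; near: N; apply: filterS HC => N HC x _; exact: HC.
apply: (le_trans h); rewrite ler_wpM2l// ler_expR ler_wnM2r// lerN2//.
Unshelve. all: by end_near.
Qed.

(** At alpha = 1 the layer integrand e^x [tail N x] tends to 1 on [l, 0]; the two boundary terms
    both tend to 1 and cancel. *)
Lemma mean_band_cvg l : alpha = 1 -> l < 0 ->
  (fun N => N%:R * Ex P (fun w => if (l < Y N w) && (Y N w <= 0) then expR (Y N w) else 0)) @ \oo --> - l.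
Proof.
move=> a1 l0; have [C C0 HC] := tail_bnd.
have I : (fun N => \int[mu]_(x in `[l, 0%R]) (expR x * tail N x)%:E)%E @ \oo --> (\int[mu]_(x in `[l, 0%R]) (1 : R)%:E)%E.
  have me : measurable_fun setT (fun x : R => expR x) by [].
  apply: (@dct_near _ _ _ mu _ _ _ (fun x => C * expR (- (alpha + 1) * l))) => //.
  - by move=> N; apply: measurable_funTS; apply: measurable_funM => //; exact: (mtail N (@measurable_id _ R setT)).
  - move=> x _; have -> : (1 : R) = expR x * expR (- alpha * x).
      by rewrite -expRD a1 mulN1r subrr expR0.
    by apply: cvgMr; exact: tail_cvg.
  - apply/integrableP; split; first exact: measurable_cst.
    under eq_integral do rewrite /=.
    by rewrite integral_cst//= lebesgue_measure_itv/= lte_fin l0 -EFinB -EFinM ltry.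
  - near=> N => x; rewrite /= in_itv/= => /andP[lx x0].
    have h : tail N x <= C * expR (- thN N * x) by move: x lx x0; near: N; apply: filterS HC => N HC x _ _; exact: HC.
    have t1 : thN N <= alpha + 1 by near: N; apply: (cvgr_le alpha thN_cvg); rewrite ltrDl.
    have t0 := thN_gt0 N.
    rewrite ger0_norm; last by apply: mulr_ge0; [exact: expR_ge0|exact: tail_ge0].
    apply: (@le_trans _ _ (1 * (C * expR (- thN N * x)))).
      by apply: ler_pM; rewrite ?expR_ge0 ?tail_ge0// -expR0 ler_expR.
    rewrite mul1r ler_wpM2l// ler_expR.
    apply: (@le_trans _ _ (- thN N * l)); first by rewrite ler_wnM2l// oppr_le0 ltW.
    by rewrite ler_wnM2r ?(ltW l0)// lerN2.
have V : (\int[mu]_(x in `[l, 0%R]) (1 : R)%:E = (- l)%:E)%E.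
  by rewrite integral_cst//= lebesgue_measure_itv/= lte_fin l0 mul1e -EFinB sub0r.
rewrite V in I.
have I2 : (fun N => (N%:R * Ex P (fun w => if (l < Y N w) && (Y N w <= 0) then expR (Y N w) else 0)
    + tail N 0 - expR l * tail N l)%R) @ \oo --> - l.
  rewrite (_ : (fun N => _) = (fun N => fine (\int[mu]_(x in `[l, 0%R]) (expR x * tail N x)%:E)%E)); first exact: (fine_cvg I).
  by apply/funext => N; rewrite (mean_band P (mY N) N l0).
have c1 : (fun N => tail N 0) @ \oo --> (1 : R).
  have := @tail_cvg 0; by rewrite mulr0 expR0.
have c2 : (fun N => expR l * tail N l) @ \oo --> (1 : R).
  have -> : (1 : R) = expR l * expR (- alpha * l) by rewrite -expRD a1 mulN1r subrr expR0.
  by apply: cvgMr; exact: tail_cvg.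
apply: (cvg_ext (cvgD (cvgB I2 c1) c2)); first exact: subrK.
by move=> N; rewrite !fctE; ring.
Unshelve. all: by end_near.
Qed.

Lemma mean_above_cvg l : 1 < alpha ->
  (fun N => N%:R * Ex P (fun w => if l < Y N w then expR (Y N w) else 0)) @ \oo -->
   alpha / (alpha - 1) * expR ((1 - alpha) * l).
Proof.
move=> a1; have [C C0 HC] := tail_bnd.
have ip (c : R) : 0 < c -> mu.-integrable `[0%R, +oo[ (EFin \o (fun u : R => expR (- c * u))).
  move=> c0; apply/integrableP; split.
    apply/measurable_EFinP; apply: measurable_funTS; apply: measurableT_comp => //; exact: measurable_funM.
  under eq_integral => u _ do rewrite /= ger0_norm ?expR_ge0//.
  by rewrite integral_exp_ray// ltry.
(* Midpoint of 1 and alpha: eventually th_N >= kap > 1, which makes e^(-(kap - 1) u) an integrable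
   majorant. *)
pose kap := (1 + alpha) / 2.
have k1 : 1 < kap by rewrite /kap; lra.
have k2 : kap < alpha by rewrite /kap; lra.
pose M := expR l * C * expR ((alpha + 1) * `|l|).
have kp0 : 0 < kap - 1 by rewrite subr_gt0.
have ap0 : 0 < alpha - 1 by rewrite subr_gt0.
have I : (fun N => \int[mu]_(u in `[0%R, +oo[) (expR (l + u) * tail N (l + u))%:E)%E @ \oo
   --> (\int[mu]_(u in `[0%R, +oo[) (expR ((1 - alpha) * l) * expR (- (alpha - 1) * u))%:E)%E.
  have me : measurable_fun setT (fun x : R => expR (l + x)) by apply: measurableT_comp => //; exact: measurable_funD.
  have mc : measurable_fun setT (fun x : R => l + x) by exact: measurable_funD.
  apply: (@dct_near _ _ _ mu _ _ _ (fun u => M * expR (- (kap - 1) * u))) => //.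
  - by move=> N; apply: measurable_funTS; apply: measurable_funM => //; exact: (mtail N mc).
  - apply: measurable_funTS; apply: measurable_funM => //; apply: measurableT_comp => //; exact: measurable_funM.
  - move=> u _; have -> : expR ((1 - alpha) * l) * expR (- (alpha - 1) * u) = expR (l + u) * expR (- alpha * (l + u)).
      by rewrite -!expRD; congr expR; ring.
    by apply: cvgMr; exact: tail_cvg.
  - have := @integrableZl _ _ _ mu _ (measurable_itv _) M _ (ip _ kp0).
    by congr (mu.-integrable _ _); apply/funext => u /=; rewrite EFinM.
  - near=> N => u; rewrite /= in_itv/= andbT => u0.
    have h : tail N (l + u) <= C * expR (- thN N * (l + u)).
      by move: (l + u); near: N.
    have t1 : thN N <= alpha + 1 by near: N; apply: (cvgr_le alpha thN_cvg); rewrite ltrDl.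
    have t2 : kap <= thN N by near: N; exact: (cvgr_ge alpha thN_cvg).
    have t0 := thN_gt0 N.
    rewrite ger0_norm; last by apply: mulr_ge0; [exact: expR_ge0|exact: tail_ge0].
    apply: (@le_trans _ _ (expR (l + u) * (C * expR (- thN N * (l + u))))).
      by rewrite ler_wpM2l ?expR_ge0.
    have -> : expR (l + u) * (C * expR (- thN N * (l + u))) = (expR l * C) * (expR (- thN N * l) * expR (u - thN N * u)).
      have -> : - thN N * (l + u) = - thN N * l + - thN N * u by ring.
      have -> : u - thN N * u = u + - thN N * u by ring.
      by rewrite !expRD; ring.
    rewrite /M -[leRHS]mulrA; apply: ler_wpM2l; first by rewrite mulr_ge0 ?expR_ge0.
    apply: ler_pM; rewrite ?expR_ge0// ler_expR.
      apply: (le_trans (ler_norm _)); rewrite normrM normrN (gtr0_norm t0).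
      by rewrite ler_wpM2r.
    have : kap * u <= thN N * u by rewrite ler_wpM2r.
    by move=> ?; lra.
have V : (\int[mu]_(u in `[0%R, +oo[) (expR ((1 - alpha) * l) * expR (- (alpha - 1) * u))%:E = (expR ((1 - alpha) * l) / (alpha - 1))%:E)%E.
  have -> : (\int[mu]_(u in `[0%R, +oo[) (expR ((1 - alpha) * l) * expR (- (alpha - 1) * u))%:E =
      (expR ((1 - alpha) * l))%:E * \int[mu]_(u in `[0%R, +oo[) (expR (- (alpha - 1) * u))%:E)%E.
    exact: (@integralZl _ _ _ mu _ (measurable_itv _) _ (ip _ ap0)).
  by rewrite integral_exp_ray// -EFinM.
rewrite V in I.
have I2 : (fun N => (N%:R * Ex P (fun w => if l < Y N w then expR (Y N w) else 0) - expR l * tail N l)%R) @ \oo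
   --> expR ((1 - alpha) * l) / (alpha - 1).
  rewrite (_ : (fun N => _) = (fun N => fine (\int[mu]_(u in `[0%R, +oo[) (expR (l + u) * tail N (l + u))%:E)%E)); first exact: (fine_cvg I).
  by apply/funext => N; rewrite (mean_above (mY N) N l (iY N)).
have c2 : (fun N => expR l * tail N l) @ \oo --> expR ((1 - alpha) * l).
  have -> : expR ((1 - alpha) * l) = expR l * expR (- alpha * l) by rewrite -expRD; congr expR; ring.
  by apply: cvgMr; exact: tail_cvg.
have -> : alpha / (alpha - 1) * expR ((1 - alpha) * l) = expR ((1 - alpha) * l) / (alpha - 1) + expR ((1 - alpha) * l).
  by field; rewrite gt_eqF.
apply: (cvg_ext (cvgD I2 c2)) => // N.
by rewrite /= subrK.
Unshelve. all: by end_near.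
Qed.

End Means.
End Norming.

(** * Maximal inequality *)

Section Maximal.
Context {d : measure_display} {Om : measurableType d} {R : realType} (P : probability Om R).
Local Notation intble f := (P.-integrable setT (EFin \o f)).

Lemma intble_mul (f g : Om -> R) : measurable_fun setT f -> measurable_fun setT g ->
  intble (fun w => f w ^+ 2) -> intble (fun w => g w ^+ 2) -> intble (fun w => f w * g w).
Proof.
move=> mf mg if2 ig2; apply: (@intble_le _ _ _ P _ (fun w => f w ^+ 2 + g w ^+ 2)).
- exact: measurable_funM.
- move=> w; rewrite normrM -(real_normK (num_real (f w))) -(real_normK (num_real (g w))).
  have := sqr_ge0 (`|f w| - `|g w|); rewrite sqrrB.
  have := mulr_ge0 (normr_ge0 (f w)) (normr_ge0 (g w)).
  by rewrite -mulr_natr; lra.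
- exact: intbleD.
Qed.

Lemma intble_sqrD (f g : Om -> R) : measurable_fun setT f -> measurable_fun setT g ->
  intble (fun w => f w ^+ 2) -> intble (fun w => g w ^+ 2) -> intble (fun w => (f w + g w) ^+ 2).
Proof.
move=> mf mg if2 ig2.
have := intbleD (intbleD if2 ig2) (intbleZl 2 (intble_mul mf mg if2 ig2)).
by congr (P.-integrable _ _); apply/funext => w /=; congr EFin; ring.
Qed.

Lemma intble_of_sqr (f : Om -> R) : measurable_fun setT f -> intble (fun w => f w ^+ 2) -> intble f.
Proof.
move=> mf if2; have i1 := intble_mul mf (measurable_cst (1 : R)) if2 (intble_cst P (1 ^+ 2)).
by move: i1; congr (P.-integrable _ _); apply/funext => w /=; rewrite mulr1.
Qed.

(** First passage of |D| to the level [e]. *)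
Definition fresh {T : Type} (D : nat -> T -> R) (e : R) (k : nat) (w : T) : bool :=
  (e <= `|D k w|) && all (fun l => `|D l w| < e) (iota 0 k).

Lemma fresh_meas {d'} {T : measurableType d'} (D : nat -> T -> R) e k :
  (forall l, (l <= k)%N -> measurable_fun setT (D l)) -> measurable_fun setT (fresh D e k).
Proof.
move=> mD; apply: measurable_and.
  by apply: measurable_fun_ler => //; apply: measurableT_comp => //; exact: mD.
have : (forall l, l \in iota 0 k -> measurable_fun setT (D l)).
  by move=> l; rewrite mem_iota add0n => /andP[_ lk]; apply: mD; exact: ltnW.
elim: (iota 0 k) => [|l s IH] ms; first exact: measurable_cst.
apply: measurable_and; last by apply: IH => j js; apply: ms; rewrite inE js orbT.
by apply: measurable_fun_ltr => //; apply: measurableT_comp => //; apply: ms; rewrite inE eqxx.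
Qed.

Lemma sum_fresh {T : Type} (D : nat -> T -> R) e m w :
  \sum_(k < m) (fresh D e k w)%:R = (has (fun l => e <= `|D l w|) (iota 0 m))%:R :> R.
Proof.
elim: m => [|m IH]; first by rewrite big_ord0.
rewrite -[in RHS](addn1 m) iotaD has_cat/= orbF add0n big_ord_recr/= IH /fresh.
have -> : all (fun l => `|D l w| < e) (iota 0 m) = ~~ has (fun l => e <= `|D l w|) (iota 0 m).
  by rewrite -all_predC; apply: eq_all => l /=; rewrite ltNge.
by case: (has _ _) => /=; rewrite ?andbF ?andbT ?addr0 ?add0r.
Qed.

(* Kolmogorov's argument: split [D m ^ 2] over the first index [k] at which
   [|D k| >= e] and discard the square of [D m - D k]. *)
Lemma kolmogorov (D : nat -> Om -> R) (m : nat) (e : R) : 0 <= e ->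
  (forall k, (k <= m)%N -> measurable_fun setT (D k)) -> intble (fun w => D m w ^+ 2) ->
  (forall k, (k <= m)%N -> intble (fun w => (fresh D e k w)%:R * D k w * (D m w - D k w)) /\
     Ex P (fun w => (fresh D e k w)%:R * D k w * (D m w - D k w)) = 0) ->
  e ^+ 2 * prob P [set w | exists2 k, (k <= m)%N & e <= `|D k w|] <= Ex P (fun w => D m w ^+ 2).
Proof.
move=> e0 mD iD orth.
pose S := [set w | has (fun l => e <= `|D l w|) (iota 0 m.+1)].
have -> : [set w | exists2 k, (k <= m)%N & e <= `|D k w|] = S.
  apply/seteqP; split => w /=.
    by move=> [k km ek]; apply/hasP; exists k => //; rewrite mem_iota.
  by move=> /hasP[k]; rewrite mem_iota => /andP[_ km] ek; exists k.
have mf k : (k <= m)%N -> measurable_fun setT (fun w => (fresh D e k w)%:R : R).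
  move=> km; have -> : (fun w => (fresh D e k w)%:R : R) = (fun w => if fresh D e k w then 1 else 0).
    by apply/funext => w; case: (fresh D e k w).
  apply: measurable_fun_ifT => //; apply: fresh_meas => l lk; apply: mD; exact: leq_trans km.
have mS : measurable S.
  have -> : S = [set w | \sum_(k < m.+1) (fresh D e k w)%:R = 1 :> R].
    apply/seteqP; split => w /=; rewrite sum_fresh /S/=; first by move=> ->.
    by case: (orb _ _) => // /esym/eqP; rewrite mulr0n oner_eq0.
  have ms : measurable_fun setT (fun w => \sum_(k < m.+1) (fresh D e k w)%:R : R).
    by apply: measurable_sum => k; exact: (mf k (ltn_ord k)).
  by rewrite -[X in measurable X]setTI; exact: (ms measurableT _ (measurable_set1 1)).
have ie : intble (\1_S : Om -> R).
  apply: (@Ex_bnd_int _ _ _ _ _ 1); first exact: measurable_indic.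
  by move=> w; rewrite indicE; case: (_ \in _); rewrite ?normr1 ?normr0.
have io (k : 'I_m.+1) := (orth k (ltn_ord k)).1.
have isum := @intble_sum _ _ _ P _ (index_enum 'I_m.+1) xpredT _ (fun k _ => io k).
have E0 : Ex P (fun w => \sum_(k < m.+1) (fresh D e k w)%:R * D k w * (D m w - D k w)) = 0.
  by rewrite Ex_sum// big1// => k _; rewrite (orth k (ltn_ord k)).2.
have -> : Ex P (fun w => D m w ^+ 2) =
   Ex P (fun w => D m w ^+ 2 + -2 * \sum_(k < m.+1) (fresh D e k w)%:R * D k w * (D m w - D k w)).
  by rewrite (ExD iD (intbleZl (-2) isum)) (ExZl _ isum) E0 mulr0 addr0.
rewrite -(Ex_indic P mS) -(ExZl _ ie).
apply: (le_Ex (intbleZl _ ie) (intbleD iD (intbleZl _ isum))) => w.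
have -> : \1_S w = \sum_(k < m.+1) (fresh D e k w)%:R :> R.
  by rewrite sum_fresh indicE; congr (nat_of_bool _)%:R; apply/idP/idP; rewrite inE.
have s1 : \sum_(k < m.+1) (fresh D e k w)%:R <= 1 :> R by rewrite sum_fresh; case: (has _ _).
have s0 : 0 <= \sum_(k < m.+1) (fresh D e k w)%:R :> R by rewrite sumr_ge0.
apply: (@le_trans _ _ ((\sum_(k < m.+1) (fresh D e k w)%:R) * D m w ^+ 2
    + -2 * \sum_(k < m.+1) (fresh D e k w)%:R * D k w * (D m w - D k w))); last first.
  by rewrite lerD2r ler_piMl// sqr_ge0.
rewrite mulr_suml !mulr_sumr -big_split/=; apply: ler_sum => k _.
rewrite /fresh; case: (leP e `|D k w|) => ek /=; last by rewrite !mul0r !mulr0 addr0.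
case: (all _ _) => /=; last by rewrite !mul0r !mulr0 addr0.
have : e ^+ 2 <= D k w ^+ 2.
  by rewrite -(real_normK (num_real (D k w))) lerXn2r ?nnegrE.
move: (D m w) (D k w) => x y h.
rewrite mulr1 !mul1r (_ : x ^+ 2 + -2 * (y * (x - y)) = (x - y) ^+ 2 + y ^+ 2); last by ring.
by rewrite (le_trans h)// lerDr sqr_ge0.
Qed.

End Maximal.

(** * Increments of independent particles on a time grid *)

Section Array.
Context {d : measure_display} {Om : measurableType d} {R : realType}
  (P : probability Om R) (xi : nat -> R -> Om -> R).
Local Notation intble f := (P.-integrable setT (EFin \o f)).
Hypothesis Hlevy : forall i, levy P (xi i).
Hypothesis Hident : forall i, fdd_eq P (xi i) P (xi 0%N).
Hypothesis Hindep : indep_family P xi.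
Hypothesis Hm : forall u : R, intble (fun w => expR (u * xi 0%N 1 w)).

Let mxi i t : measurable_fun setT (xi i t) := levy_meas (Hlevy i) t.

Lemma fdd1 i t (B : set R) : 0 <= t -> measurable B -> prob P (xi i t @^-1` B) = prob P (xi 0%N t @^-1` B).
Proof.
move=> t0 mB; have := @Hident i 1%N (fun=> t) (fun=> B) (fun _ => t0) (fun _ => mB).
by rewrite !bigcap_mkord !big_ord1.
Qed.

Let same_intble i t (f : R -> R) : 0 <= t -> measurable_fun setT f -> intble (f \o xi 0%N t) -> intble (f \o xi i t).
Proof.
move=> t0 mf; apply: (law1_intble (mxi 0%N t) (mxi i t) _ mf) => B mB.
by rewrite fdd1.
Qed.

Let same_Ex i t (f : R -> R) : 0 <= t -> measurable_fun setT f -> intble (f \o xi 0%N t) -> Ex P (f \o xi i t) = Ex P (f \o xi 0%N t).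
Proof.
move=> t0 mf i0; symmetry; apply: (law1_Ex (mxi 0%N t) (mxi i t) _ mf i0) => B mB.
by rewrite fdd1.
Qed.

Let mexp (u : R) : measurable_fun setT (fun x : R => expR (u * x)).
Proof. by apply: measurableT_comp => //; exact: measurable_funM. Qed.

Lemma mgf_ident i u : intble (fun w => expR (u * xi i 1 w)).
Proof. exact: (same_intble i ler01 (mexp u) (Hm u)). Qed.

Lemma psi_ident i : psi P (xi i) = psi P (xi 0%N).
Proof. by apply/funext => u; rewrite /psi (same_Ex i ler01 (mexp u) (Hm u)). Qed.

Section Grid.
Variable r : nat -> R.
Hypothesis r0 : r 0%N = 0.
Hypothesis r_mono : forall k, r k <= r k.+1.

Let r_ge0 k : 0 <= r k.
Proof. by elim: k => [|k IH]; [rewrite r0|exact: le_trans (r_mono k)]. Qed.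

Definition incr (i k : nat) (w : Om) : R := xi i (r k.+1) w - xi i (r k) w.

Let incr_meas i k : measurable_fun setT (incr i k).
Proof. exact: measurable_funB. Qed.

Lemma incr_sum i (j k : nat) w : (j <= k)%N -> xi i (r k) w - xi i (r j) w = \sum_(j <= l < k) incr i l w.
Proof. by move=> jk; rewrite telescope_sumr. Qed.

Definition rows (K : nat) i : set (set Om) := cyl (fun k : nat => xi i (r k)) `I_K.

Lemma rows_sub K i : rows K i `<=` measurable.
Proof. by apply: cyl_measurable => // k; exact: mxi. Qed.

Lemma rows_prod K n (A : nat -> set Om) : (forall i, rows K i (A i)) ->
  prob P (\bigcap_(i < n) A i) = \prod_(i < n) prob P (A i).
Proof.
move=> rA; have [B HB] := choice rA.
have mB i k : measurable (B i k) by case: (HB i).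
have := Hindep n K r_ge0 mB.
have E i : A i = \bigcap_(k in `I_K) [set w | B i k (xi i (r k) w)] by case: (HB i).
have -> : \bigcap_(i < n) A i = \bigcap_(i in `I_n) \bigcap_(k in `I_K) [set w | B i k (xi i (r k) w)].
  by apply: eq_bigcapr => i _; exact: E.
by move=> ->; apply: eq_bigr => i _; rewrite E.
Qed.

Lemma rows_gmeas K i k : (k < K)%N -> gmeas (rows K i) (xi i (r k)).
Proof. by move=> kK; exact: (@cyl_gmeas _ _ _ _ (fun k : nat => xi i (r k)) `I_K k kK). Qed.

(** Independence across particles is that of grid values, lifted to the sigma-algebras they
    generate; within one particle it is the independence of increments. *)
Lemma incr_array (n m : nat) (B : nat -> nat -> set R) : (forall i k, measurable (B i k)) ->
  prob P (\bigcap_(i < n) \bigcap_(k < m) [set w | B i k (incr i k w)]) =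
  \prod_(i < n) \prod_(k < m) prob P [set w | B i k (incr i k w)].
Proof.
move=> mB; rewrite (joint_prob (@rows_sub m.+1) (fun i => cylI (A := _)) (fun i => cylT _ _) (@rows_prod m.+1)).
- apply: eq_bigr => i _.
  by case: (Hlevy i) => _ _ H _ _; apply: H => //; rewrite r0.
- move=> i; apply: (@fin_bigcap_measurable _ (g_sigma_algebraType (rows m.+1 i)) _ `I_m) => //.
  move=> k km; rewrite -[X in measurable X]setTI.
  apply: (@measurable_funB _ (g_sigma_algebraType (rows m.+1 i)) R setT) => //; apply: rows_gmeas => //.
  exact: ltnW.
Qed.

Definition arr (n m : nat) (p : 'I_n * 'I_m) : Om -> R := incr p.1 p.2.

Lemma arr_indep (n m : nat) (A A' : pred ('I_n * 'I_m)) : (forall p, A p -> A' p -> False) ->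
  indep_sys P (cyl (@arr n m) [set p | A p]) (cyl (@arr n m) [set p | A' p]).
Proof.
move=> AA'; apply: mutual_indep => // [p|B mB]; first exact: incr_meas.
(* Events indexed by finite ordinals are padded with [setT] to families over all naturals. *)
pose B' (i k : nat) : set R := if insub i is Some i' then if insub k is Some k' then B (i', k') else setT else setT.
have mB' i k : measurable (B' i k) by rewrite /B'; case: insubP => // *; case: insubP.
have EB (i : 'I_n) (k : 'I_m) : B' i k = B (i, k) by rewrite /B' !valK.
transitivity (prob P (\bigcap_(i < n) \bigcap_(k < m) [set w | B' i k (incr i k w)])).
  congr prob; apply/seteqP; split => w H.
    move=> i /= im k /= km; have := H (Ordinal im, Ordinal km) I; rewrite /arr/=.
    by rewrite -(EB (Ordinal im) (Ordinal km)).
  by move=> [i k] _; rewrite /= /arr/= -EB; apply: H => /=.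
rewrite incr_array// pair_bigA/=; apply: eq_bigr => -[i k] _ /=.
by rewrite EB.
Qed.

Variables (v : R -> R) (n m : nat).
Hypothesis mv : measurable_fun setT v.
Let c1 := psi P (xi 0%N) 1.
Let V i w := v (xi i (r 1) w).
Hypothesis iV : intble (fun w => V 0%N w ^+ 2).

(** Growth of particle [i] since r_1 divided by its mean, a mean-one martingale. The index is
    shifted by one because r_0 = 0, and r_1 is the time at which the weights are read. *)
Definition mart i k w := expR (xi i (r k.+1) w - xi i (r 1) w - c1 * (r k.+1 - r 1)).
Definition ratio i k w := expR (xi i (r m.+1) w - xi i (r k.+1) w - c1 * (r m.+1 - r k.+1)).
Definition dev k w := \sum_(i < n) (v (xi i (r 1) w) * mart i k w) - n%:R * Ex P (fun w => v (xi 0%N (r 1) w)).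

(** Increment l covers [r_l, r_(l+1)]. Values up to time r_(k+1), in particular [dev k], thus belong
    to the past, and [ratio i k] to the future. *)
Let past (k : nat) := cyl (@arr n m.+1) [set p : 'I_n * 'I_m.+1 | (p.2 <= k)%N].
Let futr (k : nat) := cyl (@arr n m.+1) [set p : 'I_n * 'I_m.+1 | (k < p.2)%N].

Let past_futr k : indep_sys P (past k) (futr k).
Proof. by apply: (@arr_indep n m.+1 (fun p => (p.2 <= k)%N) (fun p => (k < p.2)%N)) => p; rewrite ltnNge => ->. Qed.

Lemma gsum (G : set (set Om)) (i : 'I_n) (j k : nat) : (j <= k)%N -> (k <= m.+1)%N ->
  (forall l : 'I_m.+1, (j <= l < k)%N -> gmeas G (arr (i, l))) ->
  gmeas G (fun w => xi i (r k) w - xi i (r j) w).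
Proof.
move=> jk km H.
have -> : (fun w => xi i (r k) w - xi i (r j) w) = (fun w => \sum_(l < m.+1 | (j <= l < k)%N) arr (i, l) w).
  apply/funext => w; rewrite incr_sum// big_nat.
  rewrite (big_nat_widen _ _ m.+1)// (big_nat_widenl _ 0)// big_mkord.
  by apply: eq_bigl => l; case: (leqP j l); case: (ltnP l k).
rewrite /gmeas; under eq_fun do rewrite big_mkcond/=.
apply: (@measurable_sum _ (g_sigma_algebraType G) R setT) => l.
by case: (boolP ((j <= l < k)%N)) => h; [exact: H|exact: measurable_cst].
Qed.

Let past_gmeas (i : 'I_n) k j : (j <= k)%N -> (k <= m)%N -> gmeas (past k) (xi i (r j.+1)).
Proof.
move=> jk km.
have -> : xi i (r j.+1) = (fun w => xi i (r j.+1) w - xi i (r 0) w).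
  by apply/funext => w; rewrite r0 (levy0 (Hlevy i)) subr0.
apply: gsum => // [|l /andP[_ lj]]; first by rewrite ltnS (leq_trans jk).
by apply: (@cyl_gmeas _ _ _ _ (@arr n m.+1)) => /=; rewrite -ltnS (leq_trans lj)// ltnS.
Qed.

Let gexp (G : set (set Om)) (f : Om -> R) (c : R) : gmeas G f -> gmeas G (fun w => expR (f w - c)).
Proof.
move=> gf; apply: (@measurableT_comp _ _ _ _ _ _ expR _ (fun w : g_sigma_algebraType G => f w - c)) => //.
exact: (@measurable_funB _ (g_sigma_algebraType G) R setT f (cst c)).
Qed.

Let futr_ratio (i : 'I_n) k : (k <= m)%N -> gmeas (futr k) (ratio i k).
Proof.
move=> km; apply: gexp; apply: gsum => // l /andP[kl _].
exact: (@cyl_gmeas _ _ _ _ (@arr n m.+1)).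
Qed.

Let past_V (i : 'I_n) k : (k <= m)%N -> gmeas (past k) (V i).
Proof. by move=> km; apply: (@measurableT_comp _ _ _ _ _ _ v) => //; exact: past_gmeas. Qed.

Let past_mart (i : 'I_n) k j : (j <= k)%N -> (k <= m)%N -> gmeas (past k) (mart i j).
Proof.
move=> jk km; apply: gexp.
by apply: (@measurable_funB _ (g_sigma_algebraType (past k)) R setT); exact: past_gmeas.
Qed.

Let past_dev k j : (j <= k)%N -> (k <= m)%N -> gmeas (past k) (dev j).
Proof.
move=> jk km; apply: (@measurable_funB _ (g_sigma_algebraType (past k)) R setT) => //.
apply: (@measurable_sum _ (g_sigma_algebraType (past k)) R setT) => i.
apply: (@measurable_funM _ (g_sigma_algebraType (past k)) R setT); first exact: past_V.
exact: past_mart.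
Qed.

Let r_le j k : (j <= k)%N -> r j <= r k.
Proof.
move=> jk; rewrite -(subnK jk); elim: (k - j)%N => [|l IH] //.
by rewrite addSn (le_trans IH).
Qed.

Let mom (i : nat) (u : R) (j k : nat) : (j <= k)%N ->
  intble (fun w => expR (u * (xi i (r k) w - xi i (r j) w))) /\
  Ex P (fun w => expR (u * (xi i (r k) w - xi i (r j) w))) = expR ((r k - r j) * psi P (xi 0%N) u).
Proof.
move=> jk; have h0 : 0 <= r k - r j by rewrite subr_ge0 r_le.
have law B : measurable B -> prob P (xi i (r k - r j) @^-1` B) =
   prob P ((fun w => xi i (r k) w - xi i (r j) w) @^-1` B).
  move=> mB; have := levy_incr_law (Hlevy i) (r_ge0 j) h0 mB.
  by rewrite (_ : r j + (r k - r j) = r k)//; ring.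
have mi : measurable_fun setT (fun w => xi i (r k) w - xi i (r j) w) by exact: measurable_funB.
have i1 := exp_intble (Hlevy i) (mgf_ident i) u h0.
split; first exact: (law1_intble (mxi i (r k - r j)) mi law (mexp u) i1).
rewrite -(psi_ident i) -(levy_mgf (Hlevy i) (mgf_ident i) u h0).
by rewrite (law1_Ex (mxi i (r k - r j)) mi law (mexp u) i1).
Qed.

Let ratio_Ex (i : nat) k : (k <= m)%N -> intble (ratio i k) /\ Ex P (ratio i k) = 1.
Proof.
move=> km; have [i1 E1] := @mom i 1 k.+1 m.+1 km.
have -> : ratio i k = (fun w => expR (- (c1 * (r m.+1 - r k.+1))) * expR (1 * (xi i (r m.+1) w - xi i (r k.+1) w))).
  by apply/funext => w; rewrite /ratio -expRD; congr expR; ring.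
split; first exact: intbleZl.
by rewrite (ExZl _ i1) E1 -expRD mulrC addNr expR0.
Qed.

Let Vi (i : nat) : intble (fun w => V i w ^+ 2) /\ Ex P (fun w => V i w ^+ 2) = Ex P (fun w => V 0%N w ^+ 2).
Proof.
have mv2 : measurable_fun setT (fun x => v x ^+ 2) by exact: measurable_funX.
by split; [exact: (same_intble i (r_ge0 1) mv2 iV)|exact: (same_Ex i (r_ge0 1) mv2 iV)].
Qed.

Let mV i : measurable_fun setT (V i).
Proof. exact: measurableT_comp. Qed.

Let iV1 i : intble (V i) := intble_of_sqr (mV i) (Vi i).1.

Let V1E i : Ex P (V i) = Ex P (V 0%N).
Proof. exact: (same_Ex i (r_ge0 1) mv (iV1 0)). Qed.

Let Y i k w := V i w * mart i k w.

Let mY i k : measurable_fun setT (Y i k).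
Proof.
apply: measurable_funM => //; apply: measurableT_comp => //.
by apply: measurable_funB => //; exact: measurable_funB.
Qed.

Let ind0 (i : 'I_n) (g : R -> R) : measurable_fun setT g -> gmeas (past 0) (fun w => g (V i w)).
Proof. by move=> mg; apply: (@measurableT_comp _ _ _ _ _ _ g) => //; exact: past_V. Qed.

Let Y_Ex (i : 'I_n) k : (k <= m)%N ->
  [/\ intble (fun w => Y i k w ^+ 2), intble (Y i k),
      Ex P (fun w => Y i k w ^+ 2) = Ex P (fun w => V 0%N w ^+ 2) * expR ((r k.+1 - r 1) * (psi P (xi 0%N) 2 - 2 * psi P (xi 0%N) 1)) &
      Ex P (Y i k) = Ex P (V 0%N)].
Proof.
move=> km.
have fut (u : R) : gmeas (futr 0) (fun w => expR (u * (xi i (r k.+1) w - xi i (r 1) w))).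
  apply: (@measurableT_comp _ _ _ _ _ _ (fun x => expR (u * x))); first exact: mexp.
  apply: gsum => // l /andP[kl _]; exact: (@cyl_gmeas _ _ _ _ (@arr n m.+1)).
have [i1 E1] := @mom i 1 1 k.+1 isT; have [i2 E2] := @mom i 2 1 k.+1 isT.
have mx2 : measurable_fun setT (fun x : R => x ^+ 2) by exact: measurable_funX.
have [j1 F1] := Ex_indep (past_futr 0) (ind0 i (@measurable_id _ R setT)) (fut 1) (iV1 i) i1.
have [j2 F2] := Ex_indep (past_futr 0) (ind0 i mx2) (fut 2) (Vi i).1 i2.
have EY : Y i k = (fun w => expR (- (c1 * (r k.+1 - r 1))) * (V i w * expR (1 * (xi i (r k.+1) w - xi i (r 1) w)))).
  by apply/funext => w; rewrite /Y /mart mulrCA -expRD; congr (_ * expR _); ring.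
have EY2 : (fun w => Y i k w ^+ 2) = (fun w => expR (- (2 * c1 * (r k.+1 - r 1))) * (V i w ^+ 2 * expR (2 * (xi i (r k.+1) w - xi i (r 1) w)))).
  by apply/funext => w; rewrite /Y /mart exprMn -expRM_natl mulrCA -expRD; congr (_ * expR _); ring.
rewrite EY2 EY; split; [exact: intbleZl|exact: intbleZl| |].
- rewrite (ExZl _ j2) F2 E2 (Vi i).2 mulrCA -expRD; congr (_ * expR _); rewrite /c1; move: (psi P (xi 0%N)) => q; ring.
- rewrite (ExZl _ j1) F1 E1 V1E mulrCA -expRD (_ : _ + _ = 0) ?expR0 ?mulr1// /c1; move: (psi P (xi 0%N)) => q; ring.
Qed.

Let dev_split k w : dev m w - dev k w = \sum_(i < n) Y i k w * (ratio i k w - 1).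
Proof.
transitivity (\sum_(i < n) Y i m w - \sum_(i < n) Y i k w); first by rewrite /dev; ring.
rewrite -sumrB; apply: eq_bigr => i _.
rewrite mulrBr mulr1 /Y -mulrA; congr (_ * _ - _).
rewrite /mart /ratio -expRD; congr expR; ring.
Qed.

Let mdev k : measurable_fun setT (dev k).
Proof. by apply: measurable_funB => //; apply: measurable_sum => i; exact: mY. Qed.

Let sum_sq (I : Type) (q : seq I) (f : I -> Om -> R) : (forall i, measurable_fun setT (f i)) ->
  (forall i, intble (fun w => f i w ^+ 2)) -> intble (fun w => (\sum_(i <- q) f i w) ^+ 2).
Proof.
move=> mf if2; elim: q => [|i q IH].
  by under eq_fun do rewrite big_nil; exact: intble_cst.
under eq_fun do rewrite big_cons.
by apply: intble_sqrD => //; exact: measurable_sum.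
Qed.

Let idev k : (k <= m)%N -> intble (fun w => dev k w ^+ 2).
Proof.
move=> km; apply: intble_sqrD => //; last exact: intble_cst.
- by apply: measurable_sum => i; exact: mY.
- by apply: sum_sq => i; [exact: mY|case: (Y_Ex i km)].
Qed.

(** Each summand is a past quantity times [ratio i k w - 1], a future quantity of mean 0. *)
Let orth e k : (k <= m)%N -> intble (fun w => (fresh dev e k w)%:R * dev k w * (dev m w - dev k w)) /\
     Ex P (fun w => (fresh dev e k w)%:R * dev k w * (dev m w - dev k w)) = 0.
Proof.
move=> km.
have -> : (fun w => (fresh dev e k w)%:R * dev k w * (dev m w - dev k w)) =
  (fun w => \sum_(i < n) ((fresh dev e k w)%:R * dev k w * Y i k w) * (ratio i k w - 1)).
  by apply/funext => w; rewrite dev_split mulr_sumr; apply: eq_bigr => i _; rewrite mulrA.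
have H (i : 'I_n) : intble (fun w => ((fresh dev e k w)%:R * dev k w * Y i k w) * (ratio i k w - 1)) /\
   Ex P (fun w => ((fresh dev e k w)%:R * dev k w * Y i k w) * (ratio i k w - 1)) = 0.
  have [ir Er] := ratio_Ex i km; have [iY2 _ _ _] := Y_Ex i km.
  have fE : (fun w => (fresh dev e k w)%:R * dev k w * Y i k w) = (fun w => if fresh dev e k w then dev k w * Y i k w else 0).
    by apply/funext => w; case: (fresh _ _ _ _); rewrite ?mul1r ?mul0r.
  have gp : gmeas (past k) (fun w => (fresh dev e k w)%:R * dev k w * Y i k w).
    rewrite fE; apply: (@measurable_fun_ifT _ _ (g_sigma_algebraType (past k)) R) => //.
    - by apply: (@fresh_meas _ _ (g_sigma_algebraType (past k))) => l lk; exact: past_dev.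
    - apply: (@measurable_funM _ (g_sigma_algebraType (past k)) R setT); first exact: past_dev.
      apply: (@measurable_funM _ (g_sigma_algebraType (past k)) R setT); first exact: past_V.
      exact: past_mart.
  have ip : intble (fun w => (fresh dev e k w)%:R * dev k w * Y i k w).
    have ia := intble_mul (mdev k) (mY i k) (idev km) iY2.
    rewrite fE; apply: (@intble_le _ _ _ P _ (fun w => `|dev k w * Y i k w|)).
    - apply: measurable_fun_ifT => //; first by apply: fresh_meas => l _; exact: mdev.
      exact: measurable_funM.
    - by move=> w; case: ifP => _; rewrite ?normr0// normr_ge0.
    - have := integrable_abse ia; congr (P.-integrable _ _).
  have gr : gmeas (futr k) (fun w => ratio i k w - 1).
    by apply: (@measurable_funB _ (g_sigma_algebraType (futr k)) R setT) => //; exact: futr_ratio.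
  have i1 : intble (fun w => ratio i k w - 1) by apply: intbleB => //; exact: intble_cst.
  have [j1 ->] := Ex_indep (past_futr k) gp gr ip i1.
  by split => //; rewrite (ExB ir (intble_cst P 1)) Er Ex_cst subrr mulr0.
split; first by apply: intble_sum => i _; exact: (H i).1.
by rewrite Ex_sum ?big1// => i _; [exact: (H i).2|exact: (H i).1].
Qed.

(** Cross terms vanish by independence of the particles, and the variance of one particle is at most
    its second moment. *)
Let var_le : Ex P (fun w => dev m w ^+ 2) <=
  n%:R * (Ex P (fun w => V 0%N w ^+ 2) * expR ((r m.+1 - r 1) * (psi P (xi 0%N) 2 - 2 * psi P (xi 0%N) 1))).
Proof.
pose mu := Ex P (V 0%N); pose Z i w := Y i m w - mu.
have mZ i : measurable_fun setT (Z i) by exact: measurable_funB.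
have iZ2 (i : 'I_n) : intble (fun w => Z i w ^+ 2).
  by apply: intble_sqrD => //; [case: (Y_Ex i (leqnn m))|exact: intble_cst].
have iZ (i : 'I_n) : intble (Z i) by exact: intble_of_sqr.
have EZ (i : 'I_n) : Ex P (Z i) = 0.
  have [_ iY _ EY] := Y_Ex i (leqnn m).
  by rewrite (ExB iY (intble_cst P mu)) EY Ex_cst subrr.
have -> : (fun w => dev m w ^+ 2) = (fun w => \sum_(i < n) \sum_(j < n) Z i w * Z j w).
  apply/funext => w.
  have -> : dev m w = \sum_(i < n) Z i w.
    by rewrite /Z sumrB sumr_const card_ord /dev -/mu mulr_natl.
  rewrite expr2 mulr_suml; apply: eq_bigr => i _; exact: mulr_sumr.
have iZZ (i j : 'I_n) : intble (fun w => Z i w * Z j w) by apply: intble_mul.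
rewrite Ex_sum; last by move=> i _; apply: intble_sum.
rewrite mulr_natl -[X in _ *+ X]card_ord -sumr_const; apply: ler_sum => i _.
rewrite Ex_sum// (bigD1 i)//= big1 ?addr0; last first.
  move=> j ji.
  have gZ (k : 'I_n) : gmeas (cyl (@arr n m.+1) [set p : 'I_n * 'I_m.+1 | p.1 == k]) (Z k).
    have gl (l : 'I_m.+1) : gmeas (cyl (@arr n m.+1) [set p : 'I_n * 'I_m.+1 | p.1 == k]) (arr (k, l)).
      by apply: (@cyl_gmeas _ _ _ _ (@arr n m.+1)) => /=.
    apply: (@measurable_funB _ (g_sigma_algebraType _) R setT) => //.
    apply: (@measurable_funM _ (g_sigma_algebraType _) R setT).
      apply: (@measurableT_comp _ _ _ _ _ _ v) => //.
      have -> : xi k (r 1) = (fun w => xi k (r 1) w - xi k (r 0) w).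
        by apply/funext => w; rewrite r0 (levy0 (Hlevy k)) subr0.
      exact: gsum.
    by apply: gexp; apply: gsum.
  have ind := @arr_indep n m.+1 (fun p => p.1 == i) (fun p => p.1 == j).
  have [|_ ->] := Ex_indep (ind _) (gZ i) (gZ j) (iZ i) (iZ j); last by rewrite EZ mul0r.
  by move=> p /eqP p1 /eqP p2; move: ji; rewrite -p2 p1 eqxx.
have [iY2 iY EY2 EY] := Y_Ex i (leqnn m).
rewrite -EY2.
have -> : (fun w => Z i w * Z i w) = (fun w => Y i m w ^+ 2 + (- (2 * mu) * Y i m w + mu ^+ 2)).
  by apply/funext => w; rewrite /Z; ring.
have i3 := intbleD (intbleZl (- (2 * mu)) iY) (intble_cst P (mu ^+ 2)).
rewrite (ExD iY2 i3) (ExD (intbleZl (- (2 * mu)) iY) (intble_cst P (mu ^+ 2))) (ExZl _ iY) EY Ex_cst -/mu.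
have -> : - (2 * mu) * mu + mu ^+ 2 = - mu ^+ 2 by ring.
by rewrite gerDl oppr_le0 sqr_ge0.
Qed.

Lemma dev_max e : 0 <= e -> e ^+ 2 * prob P [set w | exists2 k, (k <= m)%N & e <= `|dev k w|] <=
  n%:R * (Ex P (fun w => v (xi 0%N (r 1) w) ^+ 2) * expR ((r m.+1 - r 1) * (psi P (xi 0%N) 2 - 2 * psi P (xi 0%N) 1))).
Proof.
move=> e0; apply: le_trans var_le.
by apply: kolmogorov => // [|k km]; [exact: idev|exact: orth].
Qed.

End Grid.
End Array.

Lemma ray_measure_eq {R : realType} (m1 m2 : {measure set R -> \bar R}) :
  (m1 setT < +oo)%E -> (forall x : R, m1 `]x, +oo[%classic = m2 `]x, +oo[%classic) ->
  forall A : set R, measurable A -> m1 A = m2 A.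
Proof.
move=> fin eqr; apply: (@measure_unique _ _ _ (@RGenOInfty.G R) (fun k => `](- k%:R), +oo[%classic)).
- exact: RGenOInfty.measurableE.
- move=> _ _ [x ->] [y ->]; exists (Num.max x y).
  by apply/seteqP; split => z /=; rewrite !in_itv/= !andbT gt_max; [case=> -> ->|case/andP].
- by move=> i; exists (- i%:R).
- apply/seteqP; split => // x _; exists (Num.truncn `|x|).+1 => //=.
  rewrite in_itv/= andbT ltrNl (le_lt_trans (ler_norm _))// normrN.
  by case/andP : (truncn_itv (normr_ge0 x)).
- by move=> _ [x ->].
- move=> k; apply: (le_lt_trans _ fin).
  by apply: le_measure; rewrite ?inE//; exact: measurable_itv.
Qed.

Lemma law1_of_tail {d1 d2} {O1 : measurableType d1} {O2 : measurableType d2} {R : realType}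
  (P1 : probability O1 R) (P2 : probability O2 R) (X1 : O1 -> R) (X2 : O2 -> R) :
  measurable_fun setT X1 -> measurable_fun setT X2 ->
  (forall x, prob P1 [set w | x < X1 w] = prob P2 [set w | x < X2 w]) ->
  forall B, measurable B -> prob P1 (X1 @^-1` B) = prob P2 (X2 @^-1` B).
Proof.
move=> mX1 mX2 tl B mB.
pose Y1 : {mfun O1 >-> R} := HB.pack X1 (isMeasurableFun.Build _ _ _ _ _ mX1).
pose Y2 : {mfun O2 >-> R} := HB.pack X2 (isMeasurableFun.Build _ _ _ _ _ mX2).
rewrite /prob; congr fine.
apply: (@ray_measure_eq R (distribution P1 Y1) (distribution P2 Y2)) => //.
  exact: (le_lt_trans (@probability_le1 _ _ _ (distribution P1 Y1) setT measurableT) (ltry _)).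
move=> x; change (P1 (X1 @^-1` `]x, +oo[%classic) = P2 (X2 @^-1` `]x, +oo[%classic)).
have E (O : Type) (X : O -> R) : X @^-1` `]x, +oo[%classic = [set w | x < X w].
  by apply/seteqP; split => w /=; rewrite in_itv/= andbT.
rewrite !E !prob_EFin ?tl//.
- by rewrite -[X in measurable X]setTI; exact: measurable_fun_ltr.
- by rewrite -[X in measurable X]setTI; exact: measurable_fun_ltr.
Qed.

(** * The Renyi representation and equality of grid laws *)

Section ExpDensity.
Context {d : measure_display} {Om : measurableType d} {R : realType} (Q : probability Om R).
Local Notation mu := (@lebesgue_measure R).
Local Notation intble f := (Q.-integrable setT (EFin \o f)).

(** The tail identifies the law, by comparison on rays with the measure of density a e^(-a y); a
    layer-cake decomposition of [f] then passes from sets to integrals. *)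
Lemma exp_density (Z : Om -> R) (a M : R) (f : R -> R) : 0 < a -> measurable_fun setT Z ->
  (forall x, 0 <= x -> prob Q [set w | x < Z w] = expR (- a * x)) ->
  measurable_fun setT f -> (forall y, 0 <= f y <= M) ->
  (\int[Q]_w (f (Z w))%:E = \int[mu]_y (if (0 < y)%R then a * expR (- a * y) * f y else 0)%:E)%E.
Proof.
move=> a0 mZ tZ mf fM.
have f0 y : 0 <= f y by case/andP : (fM y).
pose dn y := if 0 < y then a * expR (- a * y) else 0 : R.
have mexp : measurable_fun setT (fun y : R => a * expR (- a * y)).
  by apply: measurable_funM => //; apply: measurableT_comp => //; exact: measurable_funM.
have mdn : measurable_fun setT dn by apply: measurable_fun_ifT => //; exact: measurable_fun_ltr.
have dn0 y : 0 <= dn y by rewrite /dn; case: ifP => // _; rewrite mulr_ge0 ?expR_ge0// ltW.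
have ray x : (\int[mu]_(y in `]x, +oo[) (dn y)%:E = (expR (- a * Num.max x 0))%:E)%E.
  transitivity (\int[mu]_(y in `[(Num.max x 0)%R, +oo[) (a * expR (- a * y))%:E)%E.
    rewrite -open_ray// [LHS]integral_mkcond; apply: eq_integral => y _.
    by rewrite patchE mem_setE in_itv/= andbT /dn gt_max; case: (x < y) => //=; case: ifP.
  apply: (@FTC_ray R (fun u => - expR (- a * u)) _ _ 0).
  - by rewrite sub0r opprK.
  - by move=> y _; apply: is_derive_eq; rewrite /GRing.scale/=; ring.
  - apply: continuous_subspaceT => y; apply: cvgMr.
    by apply: continuous_cvg; [exact: continuous_expR|exact: cvgMr].
  - by move=> y _; rewrite mulr_ge0 ?expR_ge0// ltW.
  - rewrite -oppr0; apply: cvgN; under eq_fun do rewrite mulNr.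
    apply: (@cvg_comp _ _ _ (fun u => a * u) (fun y => expR (- y)) _ +oo%R); last exact: cvgr_expR.
    exact: gt0_cvgMry.
have tail x : prob Q [set w | x < Z w] = expR (- a * Num.max x 0).
  case: (leP 0 x) => x0; first exact: tZ.
  rewrite mulr0 expR0; apply/eqP; rewrite eq_le.
  have m y : measurable [set w | y < Z w] by rewrite -[X in measurable X]setTI; exact: measurable_fun_ltr.
  rewrite -!lee_fin -!prob_EFin// probability_le1//=.
  have -> : (1%:E = Q [set w | (0 < Z w)%R] :> \bar R)%E by rewrite prob_EFin// tZ// mulr0 expR0.
  by apply: le_measure; rewrite ?inE// => w /=; exact: lt_trans.
have setlaw (B : set R) : measurable B -> (prob Q (Z @^-1` B))%:E = (\int[mu]_(y in B) (dn y)%:E)%E.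
  move=> mB.
  have mZB : measurable (Z @^-1` B) by rewrite -[X in measurable X]setTI; exact: (mZ measurableT _ mB).
  rewrite -prob_EFin// => {mZB}.
  pose nu (A : set R) := (\int[mu]_(y in A) (dn y)%:E)%E.
  have nu0 : nu set0 = 0%E by rewrite /nu integral_set0.
  have nuge A : (0 <= nu A)%E by apply: integral_ge0 => y _; rewrite lee_fin.
  have nusig : semi_sigma_additive nu.
    move=> /= F mF tF mUF; rewrite /nu; apply: cvg_toP.
      apply: ereal_nondecreasing_is_cvgn => m n mn.
      by apply: lee_sum_nneg_natr => // k _ _; exact: nuge.
    rewrite ge0_integral_bigcup//=.
    - by apply: measurable_funTS; exact/measurable_EFinP.
    - by move=> y _; rewrite lee_fin.
  pose numu : {measure set R -> \bar R} := HB.pack nu (isMeasure.Build _ _ _ nu nu0 nuge nusig).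
  pose Y : {mfun Om >-> R} := HB.pack Z (isMeasurableFun.Build _ _ _ _ _ mZ).
  apply: (@ray_measure_eq R (distribution Q Y) numu) => //.
    exact: (le_lt_trans (@probability_le1 _ _ _ (distribution Q Y) setT measurableT) (ltry _)).
  move=> x; transitivity ((expR (- a * Num.max x 0))%:E); last by rewrite -ray.
  change (Q (Z @^-1` `]x, +oo[%classic) = (expR (- a * Num.max x 0))%:E).
  have -> : Z @^-1` `]x, +oo[%classic = [set w | x < Z w].
    by apply/seteqP; split => w /=; rewrite in_itv/= andbT.
  rewrite prob_EFin ?tail//.
  by rewrite -[X in measurable X]setTI; exact: measurable_fun_ltr.
have mfZ : measurable_fun setT (f \o Z) by exact: measurableT_comp.
have ifZ : intble (f \o Z).
  apply: (@Ex_bnd_int _ _ _ _ _ M) => // w.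
  by rewrite /= ger0_norm//; case/andP : (fM (Z w)).
have M0 : 0 <= M by case/andP : (fM 0) => h1 h2; exact: le_trans h2.
pose k (t : R) : R := if 0 < t then 1 else 0.
have mk : measurable_fun setT k by apply: measurable_fun_ifT => //; exact: measurable_fun_ltr.
have k0 t : 0 <= k t by rewrite /k; case: ifP.
have band (c z : R) : 0 <= c -> 0 <= z -> (\int[mu]_t (if (t < z)%R then c * k t else 0)%:E = (c * z)%:E)%E.
  move=> c0 z0; transitivity (\int[mu]_(t in `]0%R, z[) (c%:E))%E.
    rewrite [RHS]integral_mkcond; apply: eq_integral => t _.
    rewrite patchE mem_setE in_itv/= /k; case: (0 < t); case: (t < z) => //=; rewrite ?mulr1 ?mulr0//.
  rewrite integral_cst//= lebesgue_measure_itv/= lte_fin.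
  by case: ltgtP z0 => // [z0 _|<- _]; rewrite ?mulr0 ?mule0// sube0 -EFinM.
have mid : measurable_fun setT (fun t : R => t) by [].
have fmax : f \o Z = (fun z => Num.max z 0) \o (f \o Z) by apply/funext => w; rewrite /= max_l.
rewrite (Ex_EFin ifZ) fmax -(@layer_cake _ _ _ Q (f \o Z) mfZ k (fun t => t) (fun z => Num.max z 0) mk mid k0); first last.
- by rewrite -fmax.
- move=> z; case: (leP 0 z) => z0.
    by have := band 1 z ler01 z0; under eq_integral do rewrite mul1r; rewrite mul1r.
  apply: integral0_eq => t _; rewrite /k.
  by case: (ltP t z) => // tz; rewrite ltNge (le_trans (ltW tz) (ltW z0)).
pose K (p : R * R) : \bar R := (if p.1 < f p.2 then dn p.2 * k p.1 else 0)%:E.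
have mK : measurable_fun setT K.
  apply/measurable_EFinP; apply: measurable_fun_ifT => //.
    by apply: measurable_fun_ltr => //; exact: measurableT_comp.
  by apply: measurable_funM; exact: measurableT_comp.
have K0 p : (0 <= K p)%E by rewrite lee_fin; case: ifP => // _; exact: mulr_ge0.
transitivity (\int[mu]_t \int[mu]_y K (t, y))%E.
  apply: eq_integral => t _.
  have mB : measurable [set y | t < f y] by rewrite -[X in measurable X]setTI; exact: measurable_fun_ltr.
  have -> : [set w | t < (f \o Z) w] = Z @^-1` [set y | t < f y] by [].
  rewrite EFinM setlaw// -ge0_integralZl//; first last.
  - by rewrite lee_fin.
  - by move=> y _; rewrite lee_fin.
  - by apply/measurable_EFinP; exact: measurable_funTS.
  rewrite [LHS]integral_mkcond; apply: eq_integral => y _; rewrite patchE /K/=.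
  case: ifP => h; first by rewrite inE/= in h; rewrite h -EFinM mulrC.
  by case: ifP => // h'; rewrite mem_set in h.
rewrite (@fubini_tonelli _ _ _ _ R mu mu K mK K0).
apply: eq_integral => y _; rewrite /K/= band//.
by rewrite /dn; case: ifP => _; rewrite ?mul0r.
Qed.
End ExpDensity.

Section Renyi.
Context {d : measure_display} {Om : measurableType d} {R : realType} (Q : probability Om R).
Local Notation mu := (@lebesgue_measure R).
Local Notation intble f := (Q.-integrable setT (EFin \o f)).
Variable E : nat -> Om -> R.
Hypothesis mE : forall j, measurable_fun setT (E j).
Hypothesis tE : forall j x, 0 <= x -> prob Q [set w | x < E j w] = expR (- x).
Hypothesis indE : forall (n : nat) (C : nat -> set R), (forall j, measurable (C j)) ->
  prob Q (\bigcap_(j in `I_n) [set w | C j (E j w)]) = \prod_(j < n) prob Q [set w | C j (E j w)].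

Lemma exp_cut M m : indep_sys Q (cyl (fun i : 'I_M => E i) [set i : 'I_M | i == m :> nat])
  (cyl (fun i : 'I_M => E i) [set i : 'I_M | (m < i)%N]).
Proof.
apply: (@mutual_indep _ _ _ Q _ (fun i : 'I_M => E i) (fun i => i == m :> nat) (fun i => (m < i)%N)) => // [B mB|i /eqP ->].
- pose C (j : nat) : set R := if insub j is Some i then B i else setT.
  have CE (i : 'I_M) : C i = B i by rewrite /C valK.
  have mC j : measurable (C j) by rewrite /C; case: insubP.
  transitivity (prob Q (\bigcap_(j in `I_M) [set w | C j (E j w)])).
    congr prob; apply/seteqP; split => w Hw.
      by move=> j /= jM; have := Hw (Ordinal jM) I; rewrite -CE.
    by move=> i _; rewrite /= -CE; apply: Hw => /=.
  by rewrite indE//; apply: eq_bigr => i _; rewrite CE.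
- by rewrite ltnn.
Qed.

Variable h : R -> R.
Hypothesis mh : measurable_fun setT h.
Hypothesis h01 : forall y, 0 <= h y <= 1.

(** By [HE], [H] is the integral of [ga] over (x, oo), so powers of the mean [ph] become iterated
    integrals of [ga]. *)
Let ph x := Ex Q (fun w => h (x + E 0%N w)).
Let ga z := h z * expR (- z).
Let H x := expR (- x) * ph x.

Let h0 y : 0 <= h y. Proof. by case/andP : (h01 y). Qed.
Let ga0 z : 0 <= ga z. Proof. by rewrite mulr_ge0 ?expR_ge0. Qed.
Let mga : measurable_fun setT ga.
Proof. by apply: measurable_funM => //; apply: measurableT_comp => //; exact: measurable_funN. Qed.

Let mhx x : measurable_fun setT (fun y : R => h (x + y)).
Proof. by apply: measurableT_comp => //; exact: measurable_funD. Qed.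

Let hx_int x j c : intble (fun w => h (x + E j w / c)).
Proof.
apply: (@Ex_bnd_int _ _ _ _ _ 1).
  by apply: measurableT_comp => //; apply: measurable_funD => //; exact: measurable_funM.
by move=> w; rewrite ger0_norm//; case/andP : (h01 (x + E j w / c)).
Qed.

Let ph01 x : 0 <= ph x <= 1.
Proof.
rewrite /ph Ex_ge0//= -(Ex_cst Q 1); apply: le_Ex => //.
- by have := hx_int x 0%N 1; under eq_fun do rewrite divr1.
- exact: intble_cst.
- by move=> w; case/andP : (h01 (x + E 0%N w)).
Qed.

Let shiftE (a x : R) (f : R -> R) : measurable_fun setT f -> (forall y, 0 <= f y) ->
  (\int[mu]_y (if (0 < y)%R then expR (- a * y) * f (x + y) else 0)%:E =
   (expR (a * x))%:E * \int[mu]_z (if (x < z)%R then expR (- a * z) * f z else 0)%:E)%E.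
Proof.
move=> mf f0.
have mg : measurable_fun setT (fun z => if x < z then expR (- a * z) * f z else 0).
  apply: measurable_fun_ifT => //; first exact: measurable_fun_ltr.
  by apply: measurable_funM => //; apply: measurableT_comp => //; exact: measurable_funM.
have g0 z : 0 <= (if x < z then expR (- a * z) * f z else 0).
  by case: ifP => // _; rewrite mulr_ge0 ?expR_ge0.
have mgE : measurable_fun setT (EFin \o (fun z => if x < z then expR (- a * z) * f z else 0)) by exact/measurable_EFinP.
rewrite -(@integral_shift _ x _ mgE); last by move=> z; rewrite lee_fin.
rewrite -(intZ measurableT (expR_ge0 (a * x)) (f := fun y => if x < y + x then expR (- a * (y + x)) * f (y + x) else 0)); first last.
- by move=> y; exact: g0.
- by apply: (measurableT_comp mg); exact: measurable_funD.
apply: eq_integral => y _; congr EFin.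
rewrite (_ : (x < y + x) = (0 < y)); last by apply/idP/idP => ?; lra.
case: ifP => _; last by rewrite mulr0.
rewrite mulrA -expRD (addrC x y); congr (expR _ * _); ring.
Qed.

Let HE x : (\int[mu]_z (if (x < z)%R then ga z else 0)%:E = (H x)%:E)%E.
Proof.
have tE1 y : 0 <= y -> prob Q [set w | y < E 0%N w] = expR (- 1 * y) by move=> y0; rewrite tE// mulN1r.
have := @exp_density _ _ _ Q (E 0%N) 1 1 (fun y => h (x + y)) ltr01 (mE 0) tE1 (mhx x) (fun y => h01 _).
rewrite (Ex_EFin (f := fun w => h (x + E 0%N w))); last by have := hx_int x 0%N 1; under eq_fun do rewrite divr1.
under [X in _ = X -> _]eq_integral do rewrite mul1r.
rewrite shiftE// => e; rewrite /H EFinM -/(ph x).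
have -> : (\int[mu]_z (if (x < z)%R then ga z else 0)%:E = \int[mu]_z (if (x < z)%R then expR (- 1 * z) * h z else 0)%:E)%E.
  by apply: eq_integral => z _; rewrite /ga mulN1r mulrC.
rewrite [ph x](_ : _ = Ex Q (fun w => h (x + E 0%N w)))// e muleA -EFinM -expRD mul1r addNr expR0 mul1e//.
Qed.

Let mH : measurable_fun setT H.
Proof.
pose K (p : R * R) : \bar R := (if p.1 < p.2 then ga p.2 else 0)%:E.
have mK : measurable_fun setT K.
  apply/measurable_EFinP; apply: measurable_fun_ifT => //; last exact: measurableT_comp.
  exact: measurable_fun_ltr.
have K0 p : (0 <= K p)%E by rewrite lee_fin; case: ifP.
apply/measurable_EFinP; have := @measurable_fun_fubini_tonelli_F _ _ _ _ R mu K mK K0.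
by apply: eq_measurable_fun => x _; rewrite /= -HE.
Qed.

Let H0 x : 0 <= H x.
Proof. by rewrite mulr_ge0 ?expR_ge0//; case/andP : (ph01 x). Qed.

Let mph : measurable_fun setT ph.
Proof.
have -> : ph = (fun x => expR x * H x) by apply/funext => x; rewrite /H mulrA -expRD subrr expR0 mul1r.
exact: measurable_funM.
Qed.

Let mgH k : measurable_fun setT (fun z => ga z * H z ^+ k).
Proof. by apply: measurable_funM => //; exact: measurable_funX. Qed.

Let gH0 k z : 0 <= ga z * H z ^+ k.
Proof. by rewrite mulr_ge0// exprn_ge0. Qed.

(* The square [{z, y > x}] is cut along its diagonal. *)
Let powH k x : (\int[mu]_z (if (x < z)%R then ga z * H z ^+ k else 0)%:E = (H x ^+ k.+1 / k.+1%:R)%:E)%E.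
Proof.
elim: k x => [|k IH] x.
  by under eq_integral do rewrite expr0 mulr1; rewrite HE expr1 divr1.
pose A z := if x < z then ga z * H z ^+ k else 0.
have mA : measurable_fun setT A by apply: measurable_fun_ifT => //; exact: measurable_fun_ltr.
have A0 z : 0 <= A z by rewrite /A; case: ifP.
pose B y := if x < y then ga y else 0.
have mB : measurable_fun setT B by apply: measurable_fun_ifT => //; exact: measurable_fun_ltr.
have B0 y : 0 <= B y by rewrite /B; case: ifP.
pose K (p : R * R) : \bar R := (if p.2 <= p.1 then A p.1 * B p.2 else 0)%:E.
have mAB : measurable_fun setT (fun p : R * R => A p.1 * B p.2).
  by apply: measurable_funM; exact: measurableT_comp.
have mK : measurable_fun setT K.
  by apply/measurable_EFinP; apply: measurable_fun_ifT => //; exact: measurable_fun_ler.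
have K0 p : (0 <= K p)%E by rewrite lee_fin; case: ifP => // _; exact: mulr_ge0.
pose L (p : R * R) : \bar R := (if p.1 < p.2 then A p.1 * B p.2 else 0)%:E.
have mL : measurable_fun setT L.
  by apply/measurable_EFinP; apply: measurable_fun_ifT => //; exact: measurable_fun_ltr.
have L0 p : (0 <= L p)%E by rewrite lee_fin; case: ifP => // _; exact: mulr_ge0.
have EL : (\int[mu]_z \int[mu]_y L (z, y) = \int[mu]_z (if (x < z)%R then ga z * H z ^+ k.+1 else 0)%:E)%E.
  apply: eq_integral => z _; rewrite /L/= /A; case: ifP => xz; last first.
    by rewrite integral0_eq// => y _; rewrite mul0r; case: ifP.
  transitivity ((ga z * H z ^+ k)%:E * \int[mu]_y (if (z < y)%R then ga y else 0)%:E)%E.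
    rewrite -(intZ measurableT (gH0 k z) (f := fun y => if z < y then ga y else 0)); first last.
    - by move=> y; case: ifP.
    - by apply: measurable_fun_ifT => //; exact: measurable_fun_ltr.
    apply: eq_integral => y _; rewrite /B; case: ifP => zy; last by rewrite mulr0.
    by rewrite (lt_trans xz zy).
  by rewrite HE -EFinM exprSr mulrA.
have EK : (\int[mu]_z \int[mu]_y K (z, y) = (k.+1%:R^-1)%:E * \int[mu]_z (if (x < z)%R then ga z * H z ^+ k.+1 else 0)%:E)%E.
  have k0 : 0 <= k.+1%:R^-1 :> R by [].
  rewrite (@fubini_tonelli _ _ _ _ R mu mu K mK K0) -(intZ measurableT k0 (f := fun z => if x < z then ga z * H z ^+ k.+1 else 0)); first last.
  - by move=> y; case: ifP => // _; exact: gH0.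
  - by apply: measurable_fun_ifT => //; exact: measurable_fun_ltr.
  apply: eq_integral => y _; rewrite /K/= /B; case: ifP => xy; last first.
    by rewrite integral0_eq ?mulr0// => z _; rewrite mulr0; case: ifP.
  transitivity ((ga y)%:E * \int[mu]_z (if (y < z)%R then ga z * H z ^+ k else 0)%:E)%E.
    rewrite open_ray; last exact: mgH.
    rewrite -(intZ (measurable_itv _) (ga0 y) (mgH k) (gH0 k)).
    rewrite [RHS]integral_mkcond; apply: eq_integral => z _; rewrite patchE mem_setE in_itv/= andbT.
    case: ifP => yz; last by [].
    by rewrite /A (lt_le_trans xy yz) mulrC.
  by rewrite IH -EFinM; congr EFin; ring.
have AB : (\int[mu]_z \int[mu]_y L (z, y) + \int[mu]_z \int[mu]_y K (z, y) = (H x ^+ k.+1 / k.+1%:R * H x)%:E)%E.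
  rewrite -ge0_integralD//; first last.
  - exact: (@measurable_fun_fubini_tonelli_F _ _ _ _ R mu K mK K0).
  - by move=> z _; exact: integral_ge0.
  - exact: (@measurable_fun_fubini_tonelli_F _ _ _ _ R mu L mL L0).
  - by move=> z _; exact: integral_ge0.
  transitivity (\int[mu]_z (H x * A z)%:E)%E.
    apply: eq_integral => z _; rewrite mulrC EFinM -HE -(intZ measurableT (A0 z) mB B0).
    rewrite -ge0_integralD//; first last.
    - by apply: (measurableT_comp mK).
    - by apply: (measurableT_comp mL).
    apply: eq_integral => y _; rewrite /L /K/= -/(B y).
    by case: ltP => _; rewrite ?adde0 ?add0e.
  by rewrite (intZ measurableT (H0 x) mA A0) IH -EFinM mulrC.
rewrite EL EK in AB.
have I0 : (0 <= \int[mu]_z (if (x < z)%R then ga z * H z ^+ k.+1 else 0)%:E)%E.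
  by apply: integral_ge0 => z _; rewrite lee_fin; case: ifP.
move: AB I0; case: (\int[mu]_z _)%E => [v| |]//; last first.
  by rewrite mulry gtr0_sg ?invr_gt0// mul1e.
rewrite -EFinM -EFinD => -[AB] _; congr EFin.
have k0 : k.+1%:R != 0 :> R by [].
have k2 : k.+2%:R != 0 :> R by [].
have k1 : k.+2%:R = k.+1%:R + 1 :> R by rewrite -natr1.
apply: (@mulfI _ (k.+2%:R / k.+1%:R)); first by rewrite mulf_neq0// invr_eq0.
transitivity (v + k.+1%:R^-1 * v); first by rewrite k1; field.
rewrite AB [in RHS]exprSr; field.
by apply/andP; split; rewrite gt_eqF// ltr_wpDr.
Qed.

(** E_m / (k + 1) has the law of the minimum of k + 1 exponentials. Against its density, [powH]
    evaluates the integral of h ph^k. *)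
Lemma renyi_step m k x :
  intble (fun w => h (x + E m w / k.+1%:R) * ph (x + E m w / k.+1%:R) ^+ k) /\
  Ex Q (fun w => h (x + E m w / k.+1%:R) * ph (x + E m w / k.+1%:R) ^+ k) = ph x ^+ k.+1.
Proof.
have k0 : 0 < k.+1%:R :> R by [].
pose f y := h y * ph y ^+ k.
have mf : measurable_fun setT f by apply: measurable_funM => //; exact: measurable_funX.
have f01 y : 0 <= f y <= 1.
  have /andP[p0 p1] := ph01 y; have /andP[q0 q1] := h01 y.
  by rewrite mulr_ge0 ?exprn_ge0//= -[leRHS]mul1r ler_pM ?exprn_ge0// exprn_ile1.
have fi : intble (fun w => f (x + E m w / k.+1%:R)).
  apply: (@Ex_bnd_int _ _ _ _ _ 1).
    by apply: measurableT_comp => //; apply: measurable_funD => //; exact: measurable_funM.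
  by move=> w; rewrite ger0_norm; case/andP : (f01 (x + E m w / k.+1%:R)).
split => //; apply: EFin_inj; rewrite -(Ex_EFin fi).
have mZ : measurable_fun setT (fun w => E m w / k.+1%:R) by exact: measurable_funM.
have tZ y : 0 <= y -> prob Q [set w | y < E m w / k.+1%:R] = expR (- k.+1%:R * y).
  move=> y0; rewrite -(_ : [set w | k.+1%:R * y < E m w] = [set w | y < E m w / k.+1%:R]).
    by rewrite tE ?mulNr// mulr_ge0.
  by apply/seteqP; split => w /=; rewrite ltr_pdivlMr// mulrC.
have mfx : measurable_fun setT (fun y => f (x + y)) by apply: measurableT_comp => //; exact: measurable_funD.
rewrite (@exp_density _ _ _ Q _ k.+1%:R 1 (fun y => f (x + y)) k0 mZ tZ mfx (fun y => f01 _)).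
transitivity (k.+1%:R%:E * \int[mu]_y (if (0 < y)%R then expR (- k.+1%:R * y) * f (x + y) else 0)%:E)%E.
  rewrite -(intZ measurableT (ltW k0) (f := fun y => if 0 < y then expR (- k.+1%:R * y) * f (x + y) else 0)); first last.
  - by move=> y; case: ifP => // _; rewrite mulr_ge0 ?expR_ge0//; case/andP : (f01 (x + y)).
  - apply: measurable_fun_ifT => //; first exact: measurable_fun_ltr.
    by apply: measurable_funM => //; apply: measurableT_comp => //; exact: measurable_funM.
  by apply: eq_integral => y _; case: ifP => _; rewrite ?mulr0// mulrA.
rewrite shiftE//; last by move=> y; case/andP : (f01 y).
have -> : (\int[mu]_z (if (x < z)%R then expR (- k.+1%:R * z) * f z else 0)%:E =
   \int[mu]_z (if (x < z)%R then ga z * H z ^+ k else 0)%:E)%E.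
  apply: eq_integral => z _; case: ifP => // _; congr EFin.
  rewrite /f /ga /H exprMn -expRM_natl.
  have -> : - k.+1%:R * z = - z + k%:R * - z by rewrite -natr1; ring.
  by rewrite expRD; ring.
rewrite powH -!EFinM; congr EFin.
rewrite /H exprMn -expRM_natl.
have e1 : expR (k.+1%:R * x) * expR (k.+1%:R * - x) = 1 by rewrite -expRD mulrN subrr expR0.
transitivity ((expR (k.+1%:R * x) * expR (k.+1%:R * - x)) * ph x ^+ k.+1).
  by field.
by rewrite e1 mul1r.
Qed.

(** Renyi's formula for the (j + 1)-st smallest of [N] independent exponentials, built from E_m,
    E_(m+1), ...; the offset [m] is what the induction moves. *)
Definition spacing (N m j : nat) (w : Om) : R := \sum_(l < j.+1) E (m + l)%N w / (N - l)%:R.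

(** The smallest value is peeled off. By lack of memory the others are the order statistics of a
    fresh sample started from it; [decouple] freezes E_m, and [renyi_step] closes the induction. *)
Lemma renyi N m x : intble (fun w => \prod_(j < N) h (x + spacing N m j w)) /\
  Ex Q (fun w => \prod_(j < N) h (x + spacing N m j w)) = ph x ^+ N.
Proof.
have pint N' m' (a : Om -> R) : measurable_fun setT a -> intble (fun w => \prod_(j < N') h (a w + spacing N' m' j w)).
  move=> ma; apply: (@Ex_bnd_int _ _ _ _ _ 1).
    apply: measurable_prod => j _; apply: measurableT_comp => //; apply: measurable_funD => //.
    by apply: measurable_sum => l; exact: measurable_funM.
  move=> w; rewrite ger0_norm ?prodr_ge0//.
  elim/big_rec : _ => // j y _ y1; case/andP : (h01 (a w + spacing N' m' j w)) => p0 p1.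
  have [y0|y0] := leP 0 y; first by rewrite mulr_ile1.
  by rewrite (le_trans _ ler01)// mulr_ge0_le0// ltW.
split; first exact: pint.
elim: N m x => [|N IH] m x.
  by under eq_fun do rewrite big_ord0; rewrite Ex_cst expr0.
pose a w := x + E m w / N.+1%:R.
have ma : measurable_fun setT a by apply: measurable_funD => //; exact: measurable_funM.
have spl w : \prod_(j < N.+1) h (x + spacing N.+1 m j w) = h (a w) * \prod_(j < N) h (a w + spacing N m.+1 j w).
  rewrite big_ord_recl; congr (h _ * _).
    by rewrite /spacing big_ord1 addn0 subn0.
  apply: eq_bigr => j _; congr h.
  rewrite /spacing big_ord_recl addn0 subn0 /a -!addrA; congr (_ + (_ + _)).
  by apply: eq_bigr => l _; rewrite /bump/= addnS subSS.
pose M := (m + N).+1; pose X (i : 'I_M) := E i.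
have mM : (m < M)%N by rewrite ltnS leq_addr.
pose G := cyl X [set i : 'I_M | i == m :> nat]; pose G' := cyl X [set i : 'I_M | (m < i)%N].
have ind : indep_sys Q G G' by exact: exp_cut.
have gm : gmeas G (E m) by apply: (@cyl_gmeas _ _ _ _ X [set i : 'I_M | i == m :> nat] (Ordinal mM)) => /=.
have gs j : (j < N)%N -> gmeas G' (spacing N m.+1 j).
  move=> jN; apply: (@measurable_sum _ (g_sigma_algebraType G') R setT) => l.
  apply: (@measurable_funM _ (g_sigma_algebraType G') R setT) => //.
  have lM : (m.+1 + l < M)%N by rewrite addSn ltnS ltn_add2l (leq_trans (ltn_ord l)).
  by apply: (@cyl_gmeas _ _ _ _ X [set i | (m < i)%N] (Ordinal lM)) => /=; rewrite addSn ltnS leq_addr.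
pose K (p : g_sigma_algebraType G * g_sigma_algebraType G') : \bar R :=
  (h (a p.1) * \prod_(j < N) h (a p.1 + spacing N m.+1 j p.2))%:E.
have ga' : measurable_fun setT (a : g_sigma_algebraType G -> R).
  apply: (@measurable_funD _ (g_sigma_algebraType G) R setT) => //.
  exact: (@measurable_funM _ (g_sigma_algebraType G) R setT).
have mK : measurable_fun setT K.
  apply/measurable_EFinP; apply: measurable_funM.
    by apply: measurableT_comp => //; exact: measurableT_comp.
  apply: measurable_prod => j _; apply: measurableT_comp => //; apply: measurable_funD.
    exact: measurableT_comp.
  by apply: (measurableT_comp (gs j (ltn_ord j))).
have K0 p : (0 <= K p)%E by rewrite lee_fin mulr_ge0 ?prodr_ge0.
have D := @decouple _ _ _ Q G G' K ind mK K0.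
have [i1 E1] := renyi_step m N x.
apply: EFin_inj; rewrite -(Ex_EFin (pint N.+1 m _ (measurable_cst x))).
transitivity (\int[Q]_w K (w, w))%E; first by apply: eq_integral => w _; rewrite spl.
rewrite D -E1 -(Ex_EFin i1); apply: eq_integral => w _.
rewrite /K/= (Ex_EFin (intbleZl _ (pint N m.+1 _ (measurable_cst (a w))))) ExZl; last exact: pint.
by rewrite IH.
Qed.

End Renyi.

Lemma bernoulli_ge {R : realType} (y : R) M : 0 <= y <= 1 -> 1 - M%:R * y <= (1 - y) ^+ M.
Proof.
move=> /andP[y0 y1]; elim: M => [|M IH]; first by rewrite mul0r subr0 expr0.
rewrite exprS (le_trans _ (ler_wpM2l _ IH)) ?subr_ge0// -natr1.
have : 0 <= M%:R * (y * y) by rewrite mulr_ge0// mulr_ge0.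
by move: (M%:R : R) => z; lra.
Qed.

(* [(1 - e^(-jx))^M -> 1_{c < x}] when [M ~ j e^(jc)] *)
Lemma step_poly {R : realType} (c : R) : exists p : nat -> {poly R},
  (forall j x, 0 <= x -> 0 <= (p j).[expR (- x)] <= 1) /\
  (forall x, 0 <= x -> (fun j => (p j).[expR (- x)]) @ \oo --> (if c < x then 1 else 0 : R)).
Proof.
case: (ltP c 0) => [c0|c0].
  exists (fun=> 1); split=> [j x x0|x x0]; first by rewrite hornerE ler01 lexx.
  by rewrite (lt_le_trans c0 x0); under eq_fun do rewrite hornerE; exact: cvg_cst.
pose y (j : nat) x := expR (- x) ^+ j : R.
have yE j x : y j x = expR (- (j%:R * x)) by rewrite /y -expRM_natl mulrN.
have y01 j x : 0 <= x -> 0 <= y j x <= 1.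
  by move=> x0; rewrite yE expR_ge0 -[leRHS]expR0 ler_expR oppr_le0 mulr_ge0.
pose M (j : nat) := (Num.truncn (j%:R * expR (j%:R * c))).+1.
have a0 (j : nat) : 0 <= j%:R * expR (j%:R * c) by rewrite mulr_ge0 ?expR_ge0.
have M1 (j : nat) : j%:R * expR (j%:R * c) <= (M j)%:R.
  by have /andP[_ /ltW] := truncn_itv (a0 j).
have M2 (j : nat) : (M j)%:R <= j.+1%:R * expR (j%:R * c).
  have /andP[h _] := truncn_itv (a0 j).
  rewrite /M -!natr1 mulrDl mul1r lerD// -expR0 ler_expR mulr_ge0//.
exists (fun j => (1 - 'X^j) ^+ M j).
have pE j x : ((1 - 'X^j) ^+ M j).[expR (- x)] = (1 - y j x) ^+ M j by rewrite !hornerE.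
split=> [j x x0|x x0].
  have /andP[h1 h2] := y01 j x x0.
  by rewrite pE exprn_ge0 ?subr_ge0//= exprn_ile1 ?subr_ge0// gerBl.
under eq_fun do rewrite pE.
have hc := @cvg_harmonic R.
case: ltP => xc; last first.
  apply: (@squeeze_cvgr _ _ _ _ (fun=> 0) (@harmonic R)) => //; last exact: cvg_cst.
  apply: nearW => j; have /andP[h1 h2] := y01 j x x0.
  rewrite exprn_ge0 ?subr_ge0//=.
  apply: (@le_trans _ _ (expR (- j%:R))).
    rewrite (le_trans (lerXn2r (M j) _ _ (expR_ge1Dx (- y j x)))) ?nnegrE ?subr_ge0 ?expR_ge0//.
    rewrite -expRM_natl ler_expR mulrN lerN2.
    rewrite (le_trans _ (ler_wpM2r h1 (M1 j)))// yE -mulrA -expRD ler_peMr//.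
    by rewrite -expR0 ler_expR -mulrBr mulr_ge0// subr_ge0.
  rewrite expRN /harmonic/= lef_pV2 ?posrE ?expR_gt0// -natr1 addrC; exact: expR_ge1Dx.
(* Then (j + 1) k <= 1 + j (x - c) / 2 <= e^(j (x - c) / 2), and squaring yields the O(1 / j) bound
   on M y. *)
pose k := Num.min 1 ((x - c) / 2).
have k0 : 0 < k by rewrite lt_min ltr01 divr_gt0// subr_gt0.
have k1 : k <= 1 by rewrite ge_min lexx.
have k2 : k <= (x - c) / 2 by rewrite ge_min lexx orbT.
apply: (@squeeze_cvgr _ _ _ _ (fun j => 1 - (k ^+ 2)^-1 * harmonic j) (fun=> 1)) => //; last 2 first.
- by rewrite -[X in _ --> X]subr0 -(mulr0 (k ^+ 2)^-1); apply: cvgB; [exact: cvg_cst|exact: cvgMr].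
- exact: cvg_cst.
apply: nearW => j; have /andP[h1 h2] := y01 j x x0.
rewrite exprn_ile1 ?subr_ge0 ?gerBl// andbT.
apply: le_trans (bernoulli_ge (M j) (y01 j x x0)); rewrite lerB//.
apply: le_trans (ler_wpM2r h1 (M2 j)) _.
set n := j.+1%:R : R; have n0 : 0 < n by rewrite /n.
rewrite yE -mulrA -expRD (_ : j%:R * c - _ = - (j%:R * (x - c))); last by ring.
rewrite expRN /harmonic/= -/n -invfM ler_pdivrMr ?expR_gt0//.
have h : n * k <= expR (j%:R * ((x - c) / 2)).
  apply: le_trans (expR_ge1Dx _); rewrite /n -natr1 mulrDl mul1r addrC lerD//.
  by rewrite ler_wpM2l.
have -> : j%:R * (x - c) = j%:R * ((x - c) / 2) + j%:R * ((x - c) / 2) by field.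
rewrite expRD mulrC ler_pdivlMr ?mulr_gt0 ?exprn_gt0//.
have nk : 0 <= n * k by rewrite mulr_ge0// ltW.
apply: le_trans (ler_pM nk nk h h); rewrite le_eqVlt; apply/orP; left; apply/eqP; ring.
Qed.

(** * Laplace transforms at integer points determine finite-dimensional laws *)

Section Laplace.
Context {d1 d2 : measure_display} {O1 : measurableType d1} {O2 : measurableType d2}
  {R : realType} (P1 : probability O1 R) (P2 : probability O2 R) (m : nat).
Variables (S1 : 'I_m -> O1 -> R) (S2 : 'I_m -> O2 -> R).
Hypotheses (mS1 : forall k, measurable_fun setT (S1 k)) (mS2 : forall k, measurable_fun setT (S2 k)).

Section Rays.
Hypotheses (S1_ge0 : forall k w, 0 <= S1 k w) (S2_ge0 : forall k w, 0 <= S2 k w).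
Hypothesis laplace : forall n : 'I_m -> nat,
  Ex P1 (fun w => expR (- \sum_k (n k)%:R * S1 k w)) = Ex P2 (fun w => expR (- \sum_k (n k)%:R * S2 k w)).

Let mono {d} {O : measurableType d} (P : probability O R) (S : 'I_m -> O -> R) (n : 'I_m -> nat) :
  (forall k, measurable_fun setT (S k)) -> (forall k w, 0 <= S k w) ->
  P.-integrable setT (EFin \o (fun w => expR (- \sum_k (n k)%:R * S k w))).
Proof.
move=> mS S0; apply: (@Ex_bnd_int _ _ _ _ _ 1).
  by apply: measurableT_comp => //; apply: measurable_funN; apply: measurable_sum => k; exact: measurable_funM.
move=> w; rewrite ger0_norm ?expR_ge0// -[leRHS]expR0 ler_expR oppr_le0 sumr_ge0// => k _.
by rewrite mulr_ge0.
Qed.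

(** The sum of all sizes serves as a common degree bound, so that the product of polynomials
    distributes over functions into one range of exponents. *)
Let Ex_poly {d} {O : measurableType d} (P : probability O R) (S : 'I_m -> O -> R) (p : 'I_m -> {poly R}) :
  (forall k, measurable_fun setT (S k)) -> (forall k w, 0 <= S k w) ->
  Ex P (fun w => \prod_k (p k).[expR (- S k w)]) =
  \sum_(f : {ffun 'I_m -> 'I_(\sum_k size (p k))})
    (\prod_k (p k)`_(f k)) * Ex P (fun w => expR (- \sum_k (f k)%:R * S k w)).
Proof.
move=> mS S0.
have E w : \prod_k (p k).[expR (- S k w)] = \sum_(f : {ffun 'I_m -> 'I_(\sum_k size (p k))})
    (\prod_k (p k)`_(f k)) * expR (- \sum_k (f k)%:R * S k w).
  transitivity (\prod_k \sum_(i < \sum_k size (p k)) (p k)`_i * expR (- S k w) ^+ i).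
    apply: eq_bigr => k _; apply: horner_coef_wide.
    by rewrite (bigD1 k)//= leq_addr.
  rewrite bigA_distr_bigA; apply: eq_bigr => f _; rewrite big_split/=; congr (_ * _).
  rewrite -sumrN expR_sum; apply: eq_bigr => k _.
  by rewrite -expRM_natl mulrN.
under eq_fun do rewrite E.
rewrite Ex_sum; last by move=> f _; apply: intbleZl; apply: mono.
by apply: eq_bigr => f _; rewrite ExZl//; apply: mono.
Qed.

Let Ex_rays {d} {O : measurableType d} (P : probability O R) (S : 'I_m -> O -> R)
    (p : 'I_m -> nat -> {poly R}) (c : 'I_m -> R) :
  (forall k, measurable_fun setT (S k)) -> (forall k w, 0 <= S k w) ->
  (forall k j x, 0 <= x -> 0 <= (p k j).[expR (- x)] <= 1) ->
  (forall k x, 0 <= x -> (fun j => (p k j).[expR (- x)]) @ \oo --> (if c k < x then 1 else 0 : R)) ->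
  (fun j => \int[P]_w (\prod_k (p k j).[expR (- S k w)])%:E)%E @ \oo -->
  (prob P (\bigcap_k [set w | c k < S k w]))%:E.
Proof.
move=> mS S0 p01 pc.
have mA : measurable (\bigcap_k [set w | c k < S k w]).
  apply: fin_bigcap_measurable => // k _.
  by rewrite -[X in measurable X]setTI; exact: measurable_fun_ltr.
rewrite -(Ex_indic P mA) -Ex_EFin; last first.
  by apply: (@Ex_bnd_int _ _ _ _ _ 1) => [|w]; [exact: measurable_indic|rewrite indicE; case: (_ \in _); rewrite ?normr1 ?normr0].
apply: (@dct_near _ _ _ P setT _ _ (fun=> 1)) => //.
- move=> j; apply: measurable_prod => k _.
  apply: (@measurableT_comp _ _ _ _ _ _ (fun x => (p k j).[x])).
    by apply: continuous_measurable_fun; exact: continuous_horner.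
  by apply: measurableT_comp => //; exact: measurable_funN.
- move=> w _.
  have -> : \1_(\bigcap_k [set w | c k < S k w]) w = \prod_k (if c k < S k w then 1 else 0) :> R.
    rewrite indicE; case: (boolP [forall k, c k < S k w]) => [/forallP h|].
      by rewrite big1 => [|k _]; rewrite ?h// mem_set// => k _; exact: h.
    rewrite negb_forall => /existsP[k kc]; rewrite memNset/=; last by move=> /(_ k I)/=; apply/negP.
    by rewrite (bigD1 k)//= (negbTE kc) mul0r.
  apply: cvg_big => [|k _]; last exact: pc.
  by move=> x; apply: mul_continuous.
- exact: intble_cst.
- near=> j => w _; rewrite ger0_norm; last by apply: prodr_ge0 => k _; case/andP : (p01 k j _ (S0 k w)).
  by apply: prodr_ile1 => k _; exact: p01.
Unshelve. all: by end_near.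
Qed.

(** Polynomials in the e^(-S_k) expand into Laplace transforms at integer points, and those of
    [step_poly] converge boundedly to indicators of rays. *)
Lemma laplace_rays (c : 'I_m -> R) :
  prob P1 (\bigcap_k [set w | c k < S1 k w]) = prob P2 (\bigcap_k [set w | c k < S2 k w]).
Proof.
have [p Hp] := choice (fun k => step_poly (c k)).
have h1 := @Ex_rays _ _ P1 _ p c mS1 S1_ge0 (fun k => (Hp k).1) (fun k => (Hp k).2).
have h2 := @Ex_rays _ _ P2 _ p c mS2 S2_ge0 (fun k => (Hp k).1) (fun k => (Hp k).2).
have bi d (O : measurableType d) (P : probability O R) (S : 'I_m -> O -> R) j :
    (forall k, measurable_fun setT (S k)) -> (forall k w, 0 <= S k w) ->
    P.-integrable setT (EFin \o (fun w => \prod_k (p k j).[expR (- S k w)])).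
  move=> mS S0; apply: (@Ex_bnd_int _ _ _ _ _ 1).
    apply: measurable_prod => k _; apply: (@measurableT_comp _ _ _ _ _ _ (fun x => (p k j).[x])).
      by apply: continuous_measurable_fun; exact: continuous_horner.
    by apply: measurableT_comp => //; exact: measurable_funN.
  move=> w; rewrite ger0_norm; last by apply: prodr_ge0 => k _; case/andP : ((Hp k).1 j _ (S0 k w)).
  by apply: prodr_ile1 => k _; exact: (Hp k).1.
have E : (fun j => \int[P1]_w (\prod_k (p k j).[expR (- S1 k w)])%:E)%E = (fun j => \int[P2]_w (\prod_k (p k j).[expR (- S2 k w)])%:E)%E.
  apply/funext => j; rewrite !Ex_EFin; [|exact: bi|exact: bi].
  congr EFin; rewrite !Ex_poly//; apply: eq_bigr => f _; congr (_ * _).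
  by rewrite (laplace (fun k => f k)).
by rewrite E in h1; apply: EFin_inj; exact: (cvg_unique _ h1 h2).
Qed.
End Rays.

Hypothesis rays : forall c : 'I_m -> R,
  prob P1 (\bigcap_k [set w | c k < S1 k w]) = prob P2 (\bigcap_k [set w | c k < S2 k w]).

Let X1 w := [tuple S1 k w | k < m].
Let X2 w := [tuple S2 k w | k < m].

Let mtup {d} {O : measurableType d} (S : 'I_m -> O -> R) :
  (forall k, measurable_fun setT (S k)) -> measurable_fun setT (fun w => [tuple S k w | k < m]).
Proof.
move=> mS; apply/measurable_fun_tnthP => k.
by rewrite (_ : _ \o _ = S k)//; apply/funext => w /=; rewrite tnth_mktuple.
Qed.

Let boxes : set (set (m.-tuple R)) := [set C | exists c : 'I_m -> R,
  C = \bigcap_i [set x | c i < tnth x i]].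

Let boxes_measurable : boxes `<=` measurable.
Proof.
move=> _ [c ->]; apply: fin_bigcap_measurable => // i _.
rewrite -[X in measurable X]setTI; apply: measurable_fun_ltr => //; exact: measurable_tnth.
Qed.

(** A ray in one coordinate is the increasing union of boxes whose other sides start at -n. *)
Let measurable_boxes : @measurable _ (m.-tuple R) = <<s boxes >>.
Proof.
apply/seteqP; split; last first.
  by apply: smallest_sub => //; exact: (@sigma_algebra_measurable _ (m.-tuple R)).
apply: smallest_sub; first exact: smallest_sigma_algebra.
move=> A; rewrite -bigcup_seq => -[i /= _ [B mB <-]].
suff : measurable_fun setT (fun x : g_sigma_algebraType boxes => tnth (x : m.-tuple R) i).
  by move=> /(_ measurableT B mB).
apply: (measurability _ (RGenOInfty.measurableE R)) => _ [_ [c ->] <-]; rewrite setTI.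
have -> : (fun x : g_sigma_algebraType boxes => tnth (x : m.-tuple R) i) @^-1` `]c, +oo[%classic =
    \bigcup_n \bigcap_j [set x : g_sigma_algebraType boxes | (if j == i then c else - n%:R) < tnth (x : m.-tuple R) j].
  apply/seteqP; split=> x /=; rewrite in_itv/= andbT; last by move=> [n _ /(_ i I)]/=; rewrite eqxx.
  move=> cx; exists (Num.truncn (\sum_j `|tnth (x : m.-tuple R) j|)).+1 => // j _ /=.
  case: eqP => [->//|_]; rewrite ltrNl.
  have s0 : 0 <= \sum_j `|tnth (x : m.-tuple R) j| by rewrite sumr_ge0.
  have /andP[_] := truncn_itv s0; apply: le_lt_trans.
  by rewrite (bigD1 j)//= (le_trans (ler_norm _))// normrN lerDl sumr_ge0.
by apply: bigcup_measurable => n _; apply: sub_sigma_algebra; exists (fun j => if j == i then c else - n%:R).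
Qed.

Let dist_eq (A : set (m.-tuple R)) : measurable A -> P1 (X1 @^-1` A) = P2 (X2 @^-1` A).
Proof.
move=> mA.
pose Y1 : {mfun O1 >-> (m.-tuple R)%type} := HB.pack X1 (isMeasurableFun.Build _ _ _ _ _ (mtup mS1)).
pose Y2 : {mfun O2 >-> (m.-tuple R)%type} := HB.pack X2 (isMeasurableFun.Build _ _ _ _ _ (mtup mS2)).
apply: (@measure_unique _ _ _ boxes (fun n => \bigcap_i [set x | - n%:R < tnth x i]) measurable_boxes _ _ _
  (distribution P1 Y1) (distribution P2 Y2)) => //.
- move=> _ _ [c ->] [c' ->]; exists (fun i => Num.max (c i) (c' i)).
  rewrite -bigcapI; apply: eq_bigcapr => i _; apply/seteqP; split => x /=; rewrite gt_max; first by case=> -> ->.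
  by move/andP.
- by move=> n; exists (fun=> - n%:R).
- apply/seteqP; split => // x _; exists (Num.truncn (\sum_j `|tnth x j|)).+1 => // j _ /=; rewrite ltrNl.
  have s0 : 0 <= \sum_j `|tnth x j| by rewrite sumr_ge0.
  have /andP[_] := truncn_itv s0; apply: le_lt_trans.
  by rewrite (bigD1 j)//= (le_trans (ler_norm _))// normrN lerDl sumr_ge0.
- move=> _ [c ->].
  change (P1 (X1 @^-1` \bigcap_i [set x | c i < tnth x i]) = P2 (X2 @^-1` \bigcap_i [set x | c i < tnth x i])).
  have e (O : Type) (S : 'I_m -> O -> R) : (fun w => [tuple S k w | k < m]) @^-1` (\bigcap_i [set x | c i < tnth x i]) =
      \bigcap_k [set w | c k < S k w].
    by apply/seteqP; split => w H i _; have := H i I; rewrite /= tnth_mktuple.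
  rewrite /X1 /X2 !e !prob_EFin ?rays//; apply: fin_bigcap_measurable => // k _.
  + by rewrite -[X in measurable X]setTI; exact: measurable_fun_ltr.
  + by rewrite -[X in measurable X]setTI; exact: measurable_fun_ltr.
- move=> k; apply: (le_lt_trans (@probability_le1 _ _ _ (distribution P1 Y1) _ _) (ltry _)).
  by apply: boxes_measurable; exists (fun=> - k%:R).
Qed.

Lemma rays_Ex (f : m.-tuple R -> R) M : measurable_fun setT f -> (forall x, `|f x| <= M) ->
  Ex P1 (fun w => f [tuple S1 k w | k < m]) = Ex P2 (fun w => f [tuple S2 k w | k < m]).
Proof.
move=> mf fM.
have m1 : measurable_fun setT (f \o X1) := measurableT_comp mf (mtup mS1).
have m2 : measurable_fun setT (f \o X2) := measurableT_comp mf (mtup mS2).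
apply: (@law1_Ex _ _ _ _ _ P1 P2 (f \o X1) (f \o X2) m1 m2 _ id) => //.
- move=> B mB; have mfB : measurable (f @^-1` B) by rewrite -[X in measurable X]setTI; exact: mf.
  exact: (congr1 fine (dist_eq mfB)).
- by apply: (@Ex_bnd_int _ _ _ _ _ M) => // w; exact: fM.
Qed.
End Laplace.

Section Prob.
Context {d : measure_display} {Om : measurableType d} {R : realType} (P : probability Om R).

Lemma prob_le (A B : set Om) : measurable A -> measurable B -> A `<=` B -> prob P A <= prob P B.
Proof. by move=> mA mB AB; rewrite -lee_fin -!prob_EFin// le_measure ?inE. Qed.

Lemma prob_leU (A B C : set Om) : measurable A -> measurable B -> measurable C -> C `<=` A `|` B ->
  prob P C <= prob P A + prob P B.
Proof.
move=> mA mB mC CAB; apply: (le_trans (prob_le mC (measurableU _ _ mA mB) CAB)).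
by rewrite -lee_fin EFinD -!prob_EFin//; [exact: measureU2|exact: measurableU].
Qed.

Variable E : Om -> R.
Hypothesis mE : measurable_fun setT E.
Hypothesis tE : forall x, 0 <= x -> prob P [set w | x < E w] = expR (- x).

Let mgt y : measurable [set w | y < E w].
Proof. by rewrite -[X in measurable X]setTI; exact: measurable_fun_ltr. Qed.
Let mge y : measurable [set w | y <= E w].
Proof. by rewrite -[X in measurable X]setTI; exact: measurable_fun_ler. Qed.

(** An excess over e^(-y) would be e^(-z) with z < y, contradicting the strict tail at the midpoint
    of z and y. *)
Lemma exp_ge y : 0 <= y -> prob P [set w | y <= E w] = expR (- y).
Proof.
move=> y0; apply/eqP; rewrite eq_le -{2}tE// prob_le//=; last by move=> w /=; exact: ltW.
rewrite andbT leNgt; apply/negP => h.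
have p1 : prob P [set w | y <= E w] <= 1 by rewrite -lee_fin -prob_EFin ?probability_le1.
have p0 : 0 < prob P [set w | y <= E w] by rewrite (lt_trans (expR_gt0 _) h).
pose z := - ln (prob P [set w | y <= E w]).
have z0 : 0 <= z by rewrite oppr_ge0 -ln1 ler_ln ?posrE.
have ez : expR (- z) = prob P [set w | y <= E w] by rewrite opprK lnK.
have zy : z < y by rewrite -ltrN2 -ltr_expR ez.
have : prob P [set w | y <= E w] <= prob P [set w | (z + y) / 2 < E w].
  by apply: prob_le => // w /=; apply: lt_le_trans; rewrite midf_lt.
rewrite tE ?divr_ge0 ?addr_ge0// -ez ler_expR lerN2; apply/negP; rewrite -ltNge.
by case: (midf_lt zy).
Qed.

Lemma exp_noatom y : prob P [set w | E w = y] = 0.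
Proof.
have me : measurable [set w | E w = y].
  rewrite (_ : [set w | E w = y] = E @^-1` [set y]) //.
  by rewrite -[X in measurable X]setTI; apply: mE => //; exact: measurable_set1.
apply/eqP; rewrite eq_le fine_ge0// andbT.
case: (leP 0 y) => y0.
  rewrite -(lerD2r (expR (- y))) add0r -{1}tE// -(exp_ge y0) -lee_fin EFinD -!prob_EFin//.
  rewrite -measureU//; last by apply/seteqP; split => w // [/= ->]; rewrite ltxx.
  by apply: le_measure; rewrite ?inE//; [exact: measurableU|move=> w [/= ->//|/ltW]].
have := prob_setC P (mgt 0); rewrite tE// oppr0 expR0 subrr => <-.
by apply: prob_le => //; [exact: measurableC|move=> w /= -> /lt_trans/(_ y0); rewrite ltxx].
Qed.
End Prob.

Section Quantile.
Context {d : measure_display} {Om : measurableType d} {R : realType} (P : probability Om R).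
Variable X : Om -> R.
Hypothesis mX : measurable_fun setT X.

Definition survival x := prob P [set w | x < X w].
Local Notation T := survival.

Lemma gt_measurable x : measurable [set w | x < X w].
Proof. by rewrite -[X in measurable X]setTI; exact: measurable_fun_ltr. Qed.

Lemma survival_le x y : x <= y -> T y <= T x.
Proof.
move=> xy; rewrite -lee_fin -!prob_EFin; [|exact: gt_measurable|exact: gt_measurable].
by apply: le_measure; rewrite ?inE; [exact: gt_measurable|exact: gt_measurable|move=> w /=; exact: le_lt_trans].
Qed.

Let Y : {mfun Om >-> R} := HB.pack X (isMeasurableFun.Build _ _ _ _ _ mX).

Let ccdfE x : ccdf (P := P) Y x = (T x)%:E.
Proof.
rewrite -prob_EFin; last exact: gt_measurable.
by congr (P _); apply/seteqP; split => w /=; rewrite in_itv/= andbT.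
Qed.

Let fineE : fine \o ccdf (P := P) Y = T.
Proof. by apply/funext => x; rewrite /= ccdfE. Qed.

Let T_small a : 0 < a -> exists x, T x < a.
Proof.
move=> a0; have h : T x @[x --> +oo%R] --> (0 : R).
  by rewrite -fineE; exact: (fine_cvg (cvg_ccdfy0 Y)).
have [x [_ H]] : \forall x \near +oo%R, T x < a by apply: (cvgr_lt 0 h).
by exists (x + 1); apply: H; rewrite ltrDl.
Qed.

Let T_big a : a < 1 -> exists x, a < T x.
Proof.
move=> a1; have h : T x @[x --> -oo%R] --> (1 : R).
  by rewrite -fineE; exact: (fine_cvg (cvg_ccdfNy1 Y)).
have [x [_ H]] : \forall x \near -oo%R, a < T x by apply: (cvgr_gt 1 h).
by exists (x - 1); apply: H; rewrite gtrBl.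
Qed.

Let T_rc x : T y @[y --> x^'+] --> T x.
Proof.
have h : ccdf (P := P) Y y @[y --> x^'+] --> (T x)%:E by rewrite -ccdfE; exact: ccdf_right_continuous.
have h2 := fine_cvg h; rewrite fineE in h2; exact: h2.
Qed.

(* The quantile function in exponential scale: [qt E] has the law of [X] for [E] exponential. *)
Definition qt (y : R) : R := if 0 < y then sup [set x | 1 - expR (- y) < T x] else 0.

(** Right-continuity of the survival function makes this an exact equivalence with strict
    inequalities on both sides; measurability and law of [qt] then reduce to tails. *)
Lemma qt_gt x y : 0 < y -> (x < qt y) = (1 - expR (- y) < T x).
Proof.
move=> y0; rewrite /qt y0; set a := 1 - _.
have a0 : 0 < a by rewrite subr_gt0 -expR0 ltr_expR oppr_lt0.
have a1 : a < 1 by rewrite gtrBl expR_gt0.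
have hs : has_sup [set x | a < T x].
  split; first by have [z az] := T_big a1; exists z.
  have [z za] := T_small a0; exists z => u /= au; rewrite leNgt; apply/negP => zu.
  by have := lt_le_trans au (survival_le (ltW zu)); rewrite ltNge (ltW za).
apply/idP/idP => h.
  have e0 : 0 < sup [set x | a < T x] - x by rewrite subr_gt0.
  have [e /= ae] := sup_adherent e0 hs; rewrite opprB addrCA subrr addr0 => xe.
  exact: lt_le_trans ae (survival_le (ltW xe)).
have : \forall z \near x^'+, a < T z /\ x < z.
  near=> z; split; last by near: z; exact: nbhs_right_gt.
  by near: z; exact: (cvgr_gt (T x) (T_rc (x := x))).
move/filter_ex => [z [az xz]]; apply: (lt_le_trans xz).
exact: (sup_upper_bound hs).
Unshelve. all: by end_near.
Qed.

Lemma qt_measurable : measurable_fun setT qt.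
Proof.
apply: (measurability _ (RGenOInfty.measurableE R)) => _ [_ [x ->] <-]; rewrite setTI.
have -> : qt @^-1` `]x, +oo[%classic =
   ([set y : R | 0 < y] `&` [set y | 1 - expR (- y) < T x]) `|` ([set y : R | y <= 0] `&` [set y | x < 0]).
  apply/seteqP; split => y /=; rewrite in_itv/= andbT.
    case: (ltP 0 y) => y0; first by rewrite qt_gt//; left.
    by rewrite /qt (le_gtF y0) => ?; right.
  by case=> -[y0]; [rewrite qt_gt|rewrite /qt (le_gtF y0)].
have me : measurable_fun setT (fun y : R => 1 - expR (- y)).
  by apply: measurable_funB => //; apply: measurableT_comp => //; exact: measurable_funN.
apply: measurableU; apply: measurableI.
- by rewrite -[X in measurable X]setTI; exact: measurable_fun_ltr.
- by rewrite -[X in measurable X]setTI; exact: measurable_fun_ltr.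
- by rewrite -[X in measurable X]setTI; exact: measurable_fun_ler.
- by rewrite -[X in measurable X]setTI; exact: measurable_fun_ltr.
Qed.

(** The equivalence [qt_gt] switches at the level -log(1 - T x). The case T x = 1 is separate
    because that level is infinite. *)
Lemma qt_law {d'} {Om' : measurableType d'} (Q : probability Om' R) (E : Om' -> R) x :
  measurable_fun setT E -> (forall y, 0 <= y -> prob Q [set w | y < E w] = expR (- y)) ->
  prob Q [set w | x < qt (E w)] = T x.
Proof.
move=> mE tE.
have mq : measurable [set w | x < qt (E w)].
  rewrite -[X in measurable X]setTI; apply: measurable_fun_ltr => //.
  by apply: measurableT_comp => //; exact: qt_measurable.
have mgt y : measurable [set w | y < E w] by rewrite -[X in measurable X]setTI; exact: measurable_fun_ltr.
have T1 : T x <= 1 by rewrite -lee_fin -prob_EFin ?probability_le1//; exact: gt_measurable.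
have p1 : prob Q [set w | x < qt (E w)] <= 1 by rewrite -lee_fin -prob_EFin ?probability_le1.
have E0 : prob Q [set w | 0 < E w] = 1 by rewrite tE// oppr0 expR0.
move: T1; rewrite le_eqVlt => /orP[/eqP T1|T1].
  apply/eqP; rewrite T1 eq_le p1 -E0 prob_le// => w /= Ew.
  by rewrite qt_gt// T1 gtrBl expR_gt0.
have T0 : 0 <= T x by exact: fine_ge0.
pose y0 := - ln (1 - T x).
have ey : expR (- y0) = 1 - T x by rewrite opprK lnK// posrE subr_gt0.
have y00 : 0 <= y0 by rewrite oppr_ge0 -ln1 ler_ln ?posrE ?subr_gt0// gerBl.
apply/eqP; rewrite eq_le; apply/andP; split.
  have := prob_setC Q (mgt y0); rewrite tE// ey opprB addrC subrK => <-.
  apply: prob_le => //; first exact: measurableC.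
  move=> w /= + yw; rewrite qt_gt ?(le_lt_trans y00)// ltrBlDr -ltrBlDl -ey ltr_expR ltrN2.
  by rewrite ltNge (ltW yw).
rewrite -(lerD2r (expR (- y0))) {1}ey addrC subrK -(exp_ge mE tE y00) -{1}E0.
have my0 : measurable [set w | y0 <= E w] by rewrite -[X in measurable X]setTI; exact: measurable_fun_ler.
apply: prob_leU => // w /= w0.
case: (leP y0 (E w)) => h; first by right.
by left; rewrite qt_gt// ltrBlDr -ltrBlDl -ey ltr_expR ltrN2.
Qed.

End Quantile.

(** Grid values are partial sums of increments, which are independent on both sides with equal
    marginals; the starting time [s] drops out by stationarity. *)
Lemma increments_law {d1 d2} {O1 : measurableType d1} {O2 : measurableType d2} {R : realType}
  (P1 : probability O1 R) (P2 : probability O2 R) (X1 : R -> O1 -> R) (X2 : R -> O2 -> R)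
  (s : R) (t : nat -> R) (m : nat) (F : ('I_m -> R) -> R) (M : R) :
  levy P1 X1 -> levy P2 X2 -> fdd_eq P2 X2 P1 X1 -> 0 <= s -> t 0%N = 0 -> (forall k, t k <= t k.+1) ->
  measurable_fun setT (fun x : m.-tuple R => F (fun k => \sum_(l < m | (l < k)%N) tnth x l)) ->
  (forall z, `|F z| <= M) ->
  Ex P1 (fun w => F (fun k => X1 (s + t k) w - X1 s w)) = Ex P2 (fun w => F (fun k => X2 (t k) w)).
Proof.
move=> L1 L2 fdd s0 t0 tm mF FM.
have tge k : 0 <= t k by elim: k => [|k IH]; [rewrite t0|exact: le_trans (tm k)].
pose D1 (l : 'I_m) w := X1 (s + t l.+1) w - X1 (s + t l) w.
pose D2 (l : 'I_m) w := X2 (t l.+1) w - X2 (t l) w.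
have tel d (O : measurableType d) (X : R -> O -> R) (u : R) (k : 'I_m) w :
    \sum_(l < m | (l < k)%N) (X (u + t l.+1) w - X (u + t l) w) = X (u + t k) w - X (u + t 0%N) w.
  rewrite -(telescope_sumr (fun l => X (u + t l) w) (leq0n k)) (big_nat_widen _ _ m) ?(ltnW (ltn_ord k))//.
  by rewrite big_mkord.
have E1 w : F (fun k => X1 (s + t k) w - X1 s w) = F (fun k => \sum_(l < m | (l < k)%N) tnth [tuple D1 l w | l < m] l).
  congr F; apply/funext => k; have := tel _ _ X1 s k w; rewrite t0 addr0 => <-.
  by apply: eq_bigr => l _; rewrite tnth_mktuple.
have E2 w : F (fun k => X2 (t k) w) = F (fun k => \sum_(l < m | (l < k)%N) tnth [tuple D2 l w | l < m] l).
  congr F; apply/funext => k; have := tel _ _ X2 0 k w; rewrite t0 !addr0 (levy0 L2) subr0 add0r => <-.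
  by apply: eq_bigr => l _; rewrite tnth_mktuple !add0r.
under eq_fun do rewrite E1; under [in RHS]eq_fun do rewrite E2.
have mray (c : R) : measurable [set x : R | c < x] by rewrite -[X in measurable X]setTI; exact: measurable_fun_ltr.
apply: (@rays_Ex _ _ _ _ _ P1 P2 _ D1 D2 _ _ _ _ M mF) => [l|l|c|x]; [exact: (levy_incr_meas L1)|exact: (levy_incr_meas L2)| |exact: FM].
pose B (k : nat) : set R := if insub k is Some l then [set x | c l < x] else setT.
have mB k : measurable (B k) by rewrite /B; case: insubP.
have BE (l : 'I_m) : B l = [set x | c l < x] by rewrite /B valK.
have toB d (O : measurableType d) (D : nat -> O -> R) :
    \bigcap_(l : 'I_m) [set w | c l < D l w] = \bigcap_(k in `I_m) [set w | B k (D k w)].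
  apply/seteqP; split=> w H; first by move=> k /= km; have /= -> := BE (Ordinal km); exact: (H (Ordinal km) I).
  by move=> l _ /=; have := H l (ltn_ord l); rewrite /= BE.
rewrite (toB _ _ (fun l w => X1 (s + t l.+1) w - X1 (s + t l) w)) (toB _ _ (fun l w => X2 (t l.+1) w - X2 (t l) w)).
case: (L1) => _ _ H1 _ _; case: (L2) => _ _ H2 _ _.
rewrite (H1 m (fun k => s + t k))// ?t0 ?addr0//; last by move=> k; rewrite lerD2l.
rewrite (H2 m t)// ?t0//; apply: eq_bigr => l _.
have dt : 0 <= t l.+1 - t l by rewrite subr_ge0.
have := levy_incr_law L1 (addr_ge0 s0 (tge l)) dt (mB l).
have := levy_incr_law L2 (tge l) dt (mB l).
rewrite -addrA !(addrC (t l) (_ - _)) !subrK => e2 e1.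
rewrite [LHS]e1 [RHS]e2.
have := fdd 1%N (fun=> t l.+1 - t l) (fun=> B l) (fun _ => dt) (fun _ => mB l).
by rewrite !bigcap_mkord !big_ord1 => ->.
Qed.

Lemma exp_indep_prod {d} {Om : measurableType d} {R : realType} (Q : probability Om R)
    (E : nat -> Om -> R) (xi : nat -> R -> Om -> R) : exp_indep Q E xi ->
  forall (n : nat) (C : nat -> set R), (forall j, measurable (C j)) ->
  prob Q (\bigcap_(j in `I_n) [set w | C j (E j w)]) = \prod_(j < n) prob Q [set w | C j (E j w)].
Proof.
move=> [_ _ H] n C mC.
have := H n 0%N (fun=> 0) C (fun _ _ => setT) (fun _ => lexx _) mC (fun _ _ => measurableT).
rewrite (_ : \bigcap_(i in `I_n) \bigcap_(k in `I_0) _ = setT) ?setIT ?prob_setT ?mulr1//.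
by apply/seteqP; split => // w _ i _ k.
Qed.

(** * Coupled and original sums agree in law on finite grids *)

Section GridLaw.
Context {d d' : measure_display} {Om : measurableType d} {Om' : measurableType d'} {R : realType}
  (P : probability Om R) (Q : probability Om' R)
  (xi : nat -> R -> Om -> R) (xi' : nat -> R -> Om' -> R) (E : nat -> Om' -> R).
Hypothesis Hlevy : forall i, levy P (xi i).
Hypothesis Hident : forall i, fdd_eq P (xi i) P (xi 0%N).
Hypothesis Hindep : indep_family P xi.
Hypothesis Hlevy' : forall i, levy Q (xi' i).
Hypothesis Hident' : forall i, fdd_eq Q (xi' i) P (xi 0%N).
Hypothesis Hindep' : indep_family Q xi'.
Hypothesis HE : exp_indep Q E xi'.
Variables (s : R) (t : nat -> R) (m N : nat) (v : R -> R).
Hypotheses (s0 : 0 <= s) (t0 : t 0%N = 0) (t_mono : forall k, t k <= t k.+1).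
Hypotheses (mv : measurable_fun setT v) (v0 : forall x, 0 <= v x).
Local Notation intble P f := (P.-integrable setT (EFin \o f)).

Let t_ge0 k : 0 <= t k.
Proof. by elim: k => [|k IH]; [rewrite t0|exact: le_trans (t_mono k)]. Qed.

(** Weight read at time [s] times the growth since. In [gridS'] the positions come in decreasing
    order, as [qt] decreases on positive levels, and each rank carries its own copy [xi' j] as
    growth. *)
Definition gridS (k : 'I_m) w := \sum_(i < N) v (xi i s w) * expR (xi i (s + t k) w - xi i s w).
Definition arrive j w := qt P (xi 0%N s) (spacing E N 0 j w).
Definition gridS' (k : 'I_m) w := \sum_(j < N) v (arrive j w) * expR (xi' j (t k) w).

Let mE j : measurable_fun setT (E j). Proof. by case: HE. Qed.
Let tE j x : 0 <= x -> prob Q [set w | x < E j w] = expR (- x).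
Proof. by case: HE => _ h _; exact: h. Qed.
Let indE (n : nat) (C : nat -> set R) : (forall j, measurable (C j)) ->
  prob Q (\bigcap_(j in `I_n) [set w | C j (E j w)]) = \prod_(j < n) prob Q [set w | C j (E j w)].
Proof. exact: (exp_indep_prod HE). Qed.
Let mxi i u : measurable_fun setT (xi i u). Proof. exact: levy_meas. Qed.
Let mxi' i u : measurable_fun setT (xi' i u). Proof. exact: levy_meas. Qed.

Lemma arrive_meas j : measurable_fun setT (arrive j).
Proof.
apply: measurableT_comp; first exact: qt_measurable.
by apply: measurable_sum => l; exact: measurable_funM.
Qed.

Lemma gridS_meas k : measurable_fun setT (gridS k).
Proof.
apply: measurable_sum => i; apply: measurable_funM; first exact: measurableT_comp.
by apply: measurableT_comp => //; exact: measurable_funB.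
Qed.

Lemma gridS'_meas k : measurable_fun setT (gridS' k).
Proof.
apply: measurable_sum => j; apply: measurable_funM.
  by apply: measurableT_comp => //; exact: arrive_meas.
exact: measurableT_comp.
Qed.

Section Laplace.
Variable n : 'I_m -> nat.

(** Laplace functional of one particle with position [a] and growth [z]; it factorises over
    particles, and [g] below averages out the growth. *)
Let F (a : R) (z : 'I_m -> R) := expR (- (v a * \sum_k (n k)%:R * expR (z k))).

Let F01 a z : 0 <= F a z <= 1.
Proof.
rewrite expR_ge0 -[leRHS]expR0 ler_expR oppr_le0 mulr_ge0// sumr_ge0// => k _.
Qed.

Let Fle a z : `|F a z| <= 1.
Proof. by have /andP[h1 h2] := F01 a z; rewrite ger0_norm. Qed.

Let F_meas {d0} {O : measurableType d0} (a : O -> R) (z : 'I_m -> O -> R) :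
  measurable_fun setT a -> (forall k, measurable_fun setT (z k)) -> measurable_fun setT (fun w => F (a w) (z^~ w)).
Proof.
move=> ma mz; apply: measurableT_comp => //; apply: measurable_funN; apply: measurable_funM.
  exact: measurableT_comp.
by apply: measurable_sum => k; apply: measurable_funM => //; exact: measurableT_comp.
Qed.

Let Fprod d0 (O : measurableType d0) (a : nat -> O -> R) (z : nat -> 'I_m -> O -> R) w :
  expR (- \sum_k (n k)%:R * \sum_(i < N) v (a i w) * expR (z i k w)) = \prod_(i < N) F (a i w) (fun k => z i k w).
Proof.
rewrite -expR_sum; congr expR; rewrite sumrN; congr (- _).
under eq_bigr do rewrite mulr_sumr; rewrite exchange_big/=; apply: eq_bigr => i _.
by rewrite mulr_sumr; apply: eq_bigr => k _; ring.
Qed.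

Let F_int {d0} {O : measurableType d0} (mu : probability O R) (a : O -> R) (z : 'I_m -> O -> R) :
  measurable_fun setT a -> (forall k, measurable_fun setT (z k)) -> intble mu (fun w => F (a w) (z^~ w)).
Proof. by move=> ma mz; apply: (@Ex_bnd_int _ _ _ _ _ 1) => //; exact: F_meas. Qed.

Let g a := Ex P (fun w => F a (fun k => xi 0%N (s + t k) w - xi 0%N s w)).

Let g' j a : g a = Ex Q (fun w => F a (fun k => xi' j (t k) w)).
Proof.
apply: (@increments_law _ _ _ _ _ P Q (xi 0%N) (xi' j) s t m (F a) 1) => //.
apply: (F_meas (a := fun=> a) (z := fun k (x : m.-tuple R) => \sum_(l < m | (l < k)%N) tnth x l)) => // k.
under eq_fun do rewrite big_mkcond; apply: measurable_sum => l.
by case: (l < k)%N; [exact: measurable_tnth|exact: measurable_cst].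
Qed.

Let g01 a : 0 <= g a <= 1.
Proof.
rewrite /g Ex_ge0/=; last by move=> w; case/andP : (F01 a (fun k => xi 0%N (s + t k) w - xi 0%N s w)).
rewrite -(Ex_cst P 1); apply: le_Ex; [|exact: intble_cst|by move=> w; case/andP : (F01 a (fun k => xi 0%N (s + t k) w - xi 0%N s w))].
by apply: (@F_int _ _ P _ (fun k w => xi 0%N (s + t k) w - xi 0%N s w)) => // k; exact: measurable_funB.
Qed.

Let mg : measurable_fun setT g.
Proof.
pose K (p : R * Om) : \bar R := (F p.1 (fun k => xi 0%N (s + t k) p.2 - xi 0%N s p.2))%:E.
have mK : measurable_fun setT K.
  apply/measurable_EFinP; apply: (F_meas (z := fun k (p : R * Om) => xi 0%N (s + t k) p.2 - xi 0%N s p.2)) => // k.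
  by apply: (measurableT_comp (f := fun w => xi 0%N (s + t k) w - xi 0%N s w)) => //; exact: measurable_funB.
have K0 p : (0 <= K p)%E by rewrite lee_fin; case/andP : (F01 p.1 (fun k => xi 0%N (s + t k) p.2 - xi 0%N s p.2)).
apply/measurable_EFinP; have := @measurable_fun_fubini_tonelli_F _ _ _ _ R P K mK K0.
apply: eq_measurable_fun => a _; rewrite /= -Ex_EFin//.
by apply: (@F_int _ _ P _ (fun k w => xi 0%N (s + t k) w - xi 0%N s w)) => // k; exact: measurable_funB.
Qed.

Let mz1 i k : measurable_fun setT (fun w => xi i (s + t k) w - xi i s w).
Proof. exact: measurable_funB. Qed.

Let row_Ex : Ex P (fun w => F (xi 0%N s w) (fun k => xi 0%N (s + t k) w - xi 0%N s w)) = Ex P (g \o xi 0%N s).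
Proof.
(* Since t_0 = 0 this grid begins 0, s, s + t_1: its first increment is the position, the later ones
   are the growth. *)
pose r (k : nat) := if k is k'.+1 then s + t k' else 0.
have rm k : r k <= r k.+1 by case: k => [|k]/=; [rewrite t0 addr0|rewrite lerD2l].
pose A (p : 'I_1 * 'I_m.+1) := p.2 == ord0; pose A' (p : 'I_1 * 'I_m.+1) := p.2 != ord0.
have ind := @arr_indep _ _ _ P xi Hlevy Hindep r erefl rm 1 m.+1 A A' (fun p h => elimN idP^~ h).
set G := cyl _ _ in ind; set H := cyl _ _ in ind.
have gG : gmeas G (xi 0%N s).
  have -> : xi 0%N s = (fun w => xi 0%N (r 1%N) w - xi 0%N (r 0%N) w).
    by apply/funext => w; rewrite /= t0 addr0 (levy0 (Hlevy 0%N)) subr0.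
  apply: (gsum (m := m) (i := ord0 : 'I_1)) => // l /andP[_ l0].
  by apply: (@cyl_gmeas _ _ _ _ (@arr _ _ R xi r 1 m.+1)) => /=; rewrite /A/= -val_eqE/= -leqn0.
have gH (k : 'I_m) : gmeas H (fun w => xi 0%N (s + t k) w - xi 0%N s w).
  have -> : (fun w => xi 0%N (s + t k) w - xi 0%N s w) = (fun w => xi 0%N (r k.+1) w - xi 0%N (r 1%N) w).
    by rewrite /= t0 addr0.
  apply: (gsum (m := m) (i := ord0 : 'I_1)) => // [|l /andP[l0 _]]; first by rewrite ltnS ltnW.
  by apply: (@cyl_gmeas _ _ _ _ (@arr _ _ R xi r 1 m.+1)) => /=; rewrite /A'/= -val_eqE/= -lt0n.
pose K (p : g_sigma_algebraType G * g_sigma_algebraType H) : \bar R :=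
  (F (xi 0%N s p.1) (fun k => xi 0%N (s + t k) p.2 - xi 0%N s p.2))%:E.
have mK : measurable_fun setT K.
  apply/measurable_EFinP; apply: F_meas => [|k]; first exact: (measurableT_comp gG).
  exact: (measurableT_comp (gH k)).
have K0 p : (0 <= K p)%E by rewrite lee_fin; case/andP : (F01 (xi 0%N s p.1) (fun k => xi 0%N (s + t k) p.2 - xi 0%N s p.2)).
have := decouple ind mK K0; rewrite /K/= => D.
have ig : intble P (g \o xi 0%N s).
  apply: (@Ex_bnd_int _ _ _ _ _ 1); first exact: measurableT_comp.
  by move=> w; rewrite /= ger0_norm; case/andP : (g01 (xi 0%N s w)).
apply: EFin_inj; rewrite -(Ex_EFin ig) -Ex_EFin; last by apply: (@F_int _ _ P _ (fun k w => xi 0%N (s + t k) w - xi 0%N s w)).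
rewrite [LHS]D; apply: eq_integral => w _.
by rewrite Ex_EFin//; apply: (@F_int _ _ P (fun=> _) (fun k w => xi 0%N (s + t k) w - xi 0%N s w)).
Qed.

Let row_ident i : Ex P (fun w => F (xi i s w) (fun k => xi i (s + t k) w - xi i s w)) =
  Ex P (fun w => F (xi 0%N s w) (fun k => xi 0%N (s + t k) w - xi 0%N s w)).
Proof.
pose r (k : nat) := if k is k'.+1 then s + t k' else s.
have r_ge0 k : 0 <= r k by case: k => //= k; rewrite addr_ge0.
pose G (x : m.+1.-tuple R) := F (tnth x ord0) (fun k => tnth x (lift ord0 k) - tnth x ord0).
have e j w : F (xi j s w) (fun k => xi j (s + t k) w - xi j s w) = G [tuple xi j (r l) w | l < m.+1].
  by rewrite /G !tnth_mktuple; congr (F _ _); apply/funext => k; rewrite tnth_mktuple.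
under eq_fun do rewrite e; under [in RHS]eq_fun do rewrite e.
apply: (@rays_Ex _ _ _ _ _ P P _ _ _ _ _ _ G 1) => // [c||x]; last exact: Fle.
- pose B (k : nat) : set R := if insub k is Some l then [set x | c l < x] else setT.
  have mray (y : R) : measurable [set x : R | y < x] by rewrite -[X in measurable X]setTI; exact: measurable_fun_ltr.
  have mB k : measurable (B k) by rewrite /B; case: insubP.
  have BE (l : 'I_m.+1) : B l = [set x | c l < x] by rewrite /B valK.
  have toB j : \bigcap_(l : 'I_m.+1) [set w | c l < xi j (r l) w] = \bigcap_(k in `I_m.+1) [set w | B k (xi j (r k) w)].
    apply/seteqP; split=> w Hw; first by move=> k /= km; have /= -> := BE (Ordinal km); exact: (Hw (Ordinal km) I).
    by move=> l _ /=; have := Hw l (ltn_ord l); rewrite /= BE.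
  by rewrite !toB; exact: Hident.
- apply: F_meas => [|k]; first exact: measurable_tnth.
  by apply: measurable_funB; exact: measurable_tnth.
Qed.

Let laplaceS : Ex P (fun w => expR (- \sum_k (n k)%:R * gridS k w)) = Ex P (g \o xi 0%N s) ^+ N.
Proof.
under eq_fun do rewrite (Fprod (fun i => xi i s) (fun i k w => xi i (s + t k) w - xi i s w)).
pose r (k : nat) := if k is k'.+1 then s + t k' else 0.
have rm k : r k <= r k.+1 by case: k => [|k]/=; [rewrite t0 addr0|rewrite lerD2l].
have [||_ ->] := Ex_prod (fun i => rows_sub Hlevy (r := r) (K := m.+2) (i := i)) (fun i => cylI (A := _)) (fun i => cylT _ _)
  (rows_prod Hindep (r := r) erefl rm (K := m.+2)) N
  (f := fun i w => F (xi i s w) (fun k => xi i (s + t k) w - xi i s w)).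
- move=> i; have g1 : gmeas (rows xi r m.+2 i) (xi i s).
    have -> : s = r 1%N by rewrite /= t0 addr0.
    exact: rows_gmeas.
  apply: (F_meas (O := g_sigma_algebraType (rows xi r m.+2 i)) (z := fun k w => xi i (s + t k) w - xi i s w)) => // k.
  apply: (@measurable_funB _ (g_sigma_algebraType (rows xi r m.+2 i)) R setT) => //.
  by apply: (rows_gmeas (k := k.+1)); rewrite ltnS ltnW// ltnS.
- by move=> i; apply: (@F_int _ _ P _ (fun k w => xi i (s + t k) w - xi i s w)).
- rewrite -row_Ex -[X in _ ^+ X]card_ord -prodr_const; apply: eq_bigr => i _; exact: row_ident.
Qed.

(** Given the positions, the growth integrates to a product of [g] over the ordered positions. That
    product is symmetric, so [renyi] replaces the order statistics by an independent sample, which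
    [qt] maps to the law of xi(s). *)
Let laplaceS' : Ex Q (fun w => expR (- \sum_k (n k)%:R * gridS' k w)) = Ex P (g \o xi 0%N s) ^+ N.
Proof.
under eq_fun do rewrite (Fprod arrive (fun j k w => xi' j (t k) w)).
pose G := cyl E `I_N; pose Hr := rows xi' t m; pose H := joint N Hr.
have Gm : G `<=` measurable by exact: cyl_measurable.
have Hrm j : Hr j `<=` measurable by exact: (rows_sub Hlevy').
have ind : indep_sys Q G H.
  apply: indep_sysP => //; [exact: joint_measurable|exact: cylI|by apply: jointI => j; exact: cylI|].
  move=> _ _ [C [mC ->]] [A [rA ->]].
  have [B HB] := choice rA.
  have mB j k : measurable (B j k) by case: (HB j).
  have EA : \bigcap_(i in `I_N) A i = \bigcap_(i in `I_N) \bigcap_(k in `I_m) [set w | B i k (xi' i (t k) w)].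
    by apply: eq_bigcapr => i _; case: (HB i).
  by rewrite EA; case: HE => _ _ /(_ N m t C B t_ge0 mC mB) ->; rewrite -indE.
have gG j : (j < N)%N -> gmeas G (arrive j).
  move=> jN; apply: (@measurableT_comp _ _ _ _ _ _ (qt P (xi 0%N s))); first exact: qt_measurable.
  apply: (@measurable_sum _ (g_sigma_algebraType G) R setT) => l.
  apply: (@measurable_funM _ (g_sigma_algebraType G) R setT) => //.
  by apply: (@cyl_gmeas _ _ _ _ E) => /=; rewrite add0n (leq_ltn_trans _ jN)// -ltnS.
have gH j (k : 'I_m) : (j < N)%N -> gmeas H (xi' j (t k)).
  by move=> jN; apply: (gmeas_sub (joint_sub (fun j => cylT _ _) jN)); exact: rows_gmeas.
pose K (p : g_sigma_algebraType G * g_sigma_algebraType H) : \bar R :=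
  (\prod_(j < N) F (arrive j p.1) (fun k => xi' j (t k) p.2))%:E.
have mK : measurable_fun setT K.
  apply/measurable_EFinP; apply: measurable_prod => j _; apply: F_meas => [|k].
    exact: (measurableT_comp (gG j (ltn_ord j))).
  exact: (measurableT_comp (gH j k (ltn_ord j))).
have K0 p : (0 <= K p)%E.
  by rewrite lee_fin; apply: prodr_ge0 => j _; case/andP : (F01 (arrive j p.1) (fun k => xi' j (t k) p.2)).
have D := decouple ind mK K0.
pose h y := g (qt P (xi 0%N s) y).
have mh : measurable_fun setT h by apply: measurableT_comp => //; exact: qt_measurable.
have [ir Er] := renyi mE tE indE mh (fun y => g01 _) N 0 0.
have pint : intble Q (fun w => \prod_(j < N) F (arrive j w) (fun k => xi' j (t k) w)).
  apply: (@Ex_bnd_int _ _ _ _ _ 1) => [|w].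
    by apply: measurable_prod => j _; apply: (F_meas (z := fun k => xi' j (t k))) => //; exact: arrive_meas.
  rewrite ger0_norm; last by apply: prodr_ge0 => j _; case/andP : (F01 (arrive j w) (fun k => xi' j (t k) w)).
  by apply: prodr_ile1 => j _; exact: F01.
transitivity (Ex Q (fun w => \prod_(j < N) h (0 + spacing E N 0 j w))).
  apply: EFin_inj; rewrite -(Ex_EFin pint) -(Ex_EFin ir) [LHS]D; apply: eq_integral => w _; rewrite /K/=.
  have [||i1 E1] := Ex_prod Hrm (fun i => cylI (A := _)) (fun i => cylT _ _)
    (rows_prod Hindep' t0 t_mono (K := m)) N (f := fun j w' => F (arrive j w) (fun k => xi' j (t k) w')).
  - move=> j; apply: (F_meas (O := g_sigma_algebraType (Hr j)) (a := fun=> arrive j w) (z := fun k w => xi' j (t k) w)) => // k.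
    exact: rows_gmeas.
  - by move=> j; apply: (@F_int _ _ Q (fun=> arrive j w) (fun k => xi' j (t k))).
  rewrite (Ex_EFin i1) E1; congr EFin; apply: eq_bigr => j _.
  by rewrite -g' /h add0r.
rewrite Er; congr (_ ^+ N).
have mq : measurable_fun setT (fun w => qt P (xi 0%N s) (E 0%N w)).
  by apply: measurableT_comp => //; exact: qt_measurable.
under eq_fun do rewrite add0r.
apply/esym; apply: (law1_Ex (mxi 0%N s) mq _ mg).
- move=> B mB; apply: law1_of_tail => // x.
  by rewrite (qt_law P (mxi 0%N s))//; exact: tE.
- apply: (@Ex_bnd_int _ _ _ _ _ 1); first exact: measurableT_comp.
  by move=> w; rewrite /= ger0_norm; case/andP : (g01 (xi 0%N s w)).
Qed.

Lemma grid_laplace : Ex P (fun w => expR (- \sum_k (n k)%:R * gridS k w)) =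
  Ex Q (fun w => expR (- \sum_k (n k)%:R * gridS' k w)).
Proof. by rewrite laplaceS laplaceS'. Qed.
End Laplace.

Lemma grid_rays c : prob P (\bigcap_k [set w | c k < gridS k w]) = prob Q (\bigcap_k [set w | c k < gridS' k w]).
Proof.
apply: laplace_rays => [k|k|k w|k w|n].
- exact: gridS_meas.
- exact: gridS'_meas.
- by apply: sumr_ge0 => i _; rewrite mulr_ge0 ?expR_ge0.
- by apply: sumr_ge0 => i _; rewrite mulr_ge0 ?expR_ge0.
- exact: grid_laplace.
Qed.

Lemma grid_Ex (f : m.-tuple R -> R) M : measurable_fun setT f -> (forall x, `|f x| <= M) ->
  Ex P (fun w => f [tuple gridS k w | k < m]) = Ex Q (fun w => f [tuple gridS' k w | k < m]).
Proof.
move=> mf fM; apply: (rays_Ex _ _ _ mf fM); [exact: gridS_meas|exact: gridS'_meas|exact: grid_rays].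
Qed.
End GridLaw.

(** * The Skorokhod topology *)

Section Skorokhod.
Context {R : realType}.
Variable T : R.
Hypothesis T0 : 0 < T.

(** A cell is described by which points of [s] lie at or below the argument. The supremum of the
    reachable times is attained thanks to the left limit there, and right-continuity moves past it
    unless it is T. *)
Lemma cadlag_partition (x : R -> R) e : cadlag_on T x -> 0 < e -> exists2 s : seq R,
  (forall u, u \in s -> 0 <= u <= T) &
  forall a b, 0 <= a < T -> 0 <= b < T -> (forall u, u \in s -> (u <= a) = (u <= b)) -> `|x a - x b| <= e.
Proof.
move=> [xr xl] e0.
pose good c := exists2 s : seq R, (forall u, u \in s -> 0 <= u <= T) &
  forall a b, 0 <= a < c -> 0 <= b < c -> (forall u, u \in s -> (u <= a) = (u <= b)) -> `|x a - x b| <= e.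
suff : good T by [].
pose B := [set c | 0 <= c <= T /\ good c].
have e2 : 0 < e / 2 by rewrite divr_gt0.
have B0 : B 0.
  split; first by rewrite lexx ltW.
  by exists [::] => // a b /andP[h1 h2]; have := le_lt_trans h1 h2; rewrite ltxx.
have hs : has_sup B by split; [exists 0|exists T => c [/andP[]]].
set sg := sup B.
have s0 : 0 <= sg by exact: (sup_upper_bound hs).
have sT : sg <= T by apply: sup_le_ub; [exists 0|move=> c [/andP[]]].
have gs : good sg.
  move: s0; rewrite le_eqVlt => /orP[/eqP <-|s0]; first by case: B0.
  have xc : x @ sg^'- --> lim (x @ sg^'-) by apply: xl; rewrite s0.
  move/cvgrPdist_lt : (xc) => /(_ _ e2)[eta /= eta0 H].
  have [b [/andP[b0 bT] [q qT qb]] ba] := sup_adherent eta0 hs.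
  have near_sg a : b <= a -> a < sg -> `|lim (x @ sg^'-) - x a| < e / 2.
    move=> ba' asg; apply: H => //=; rewrite ger0_norm ?subr_ge0 ?(ltW asg)//.
    by rewrite ltrBlDr -ltrBlDl (lt_le_trans ba).
  exists (b :: q) => [u|a a' /andP[a0 as_] /andP[a'0 a's] ab].
    by rewrite inE => /orP[/eqP ->|/qT//]; rewrite b0.
  have := ab b (mem_head _ _); case: (leP b a) => h /esym h'; last first.
    apply: qb => [||u uq]; rewrite ?a0 ?a'0//=; first by rewrite ltNge h'.
    by apply: ab; rewrite inE uq orbT.
  have h1 := near_sg a h as_; have h2 := near_sg a' h' a's.
  rewrite (le_trans (ler_distD (lim (x @ sg^'-)) _ _))// [leRHS]splitr lerD// ltW//.
  by rewrite distrC.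
case: (ltP sg T) => sgT; last by have -> : T = sg by apply/eqP; rewrite eq_le sgT sT.
have xc : x @ sg^'+ --> x sg by apply: xr; rewrite s0.
move/cvgrPdist_lt : (xc) => /(_ _ e2)[eta /= eta0 H].
have near_sg a : sg <= a -> a < sg + eta -> `|x sg - x a| < e / 2.
  rewrite le_eqVlt => /orP[/eqP <-|sa] ae; first by rewrite subrr normr0.
  by apply: H => //=; rewrite distrC ger0_norm ?subr_ge0 ?(ltW sa)// ltrBlDl.
pose c := Num.min (sg + eta) T.
have sc : sg < c by rewrite lt_min ltrDl eta0.
have : B c; last by move=> /(sup_upper_bound hs); rewrite leNgt sc.
split; first by rewrite (le_trans s0 (ltW sc)) ge_min lexx orbT.
case: gs => q qT qb; exists (sg :: q) => [u|a a' /andP[a0 ac] /andP[a'0 a'c] ab].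
  by rewrite inE => /orP[/eqP ->|/qT//]; rewrite s0.
have := ab sg (mem_head _ _); case: (leP sg a) => h /esym h'; last first.
  apply: qb => [||u uq]; rewrite ?a0 ?a'0//=; first by rewrite ltNge h'.
  by apply: ab; rewrite inE uq orbT.
have lt_eta z : z < c -> z < sg + eta by move=> /lt_le_trans; apply; rewrite ge_min lexx.
have h1 := near_sg a h (lt_eta _ ac); have h2 := near_sg a' h' (lt_eta _ a'c).
rewrite (le_trans (ler_distD (x sg) _ _))// [leRHS]splitr lerD// ltW//.
by rewrite distrC.
Qed.

(** There are finitely many cells, labelled by boolean tuples; one representative value in each
    bounds the path there up to 1. *)
Lemma cadlag_bounded (x : R -> R) : cadlag_on T x -> exists M, forall t, 0 <= t <= T -> `|x t| <= M.
Proof.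
move=> cx; have [s _ sb] := cadlag_partition cx ltr01.
pose pt a : (size s).-tuple bool := [tuple nth 0 s i <= a | i < size s].
pose rep p := xget 0 [set a | 0 <= a < T /\ pt a = p].
exists (\sum_p `|x (rep p)| + 1 + `|x T|) => t /andP[t0 tT].
have sum0 : 0 <= \sum_p `|x (rep p)| by exact: sumr_ge0.
move: tT; rewrite le_eqVlt => /orP[/eqP ->|tT]; first by rewrite lerDr addr_ge0.
have [r0 rp] : 0 <= rep (pt t) < T /\ pt (rep (pt t)) = pt t.
  by rewrite /rep; case: xgetP => [a _ []//|/(_ t)[]/=]; rewrite t0 tT.
have := sb t (rep (pt t)); rewrite t0 tT r0 => /(_ isT isT).
have ptE u : u \in s -> (u <= t) = (u <= rep (pt t)).
  move=> us; have iu : (index u s < size s)%N by rewrite index_mem.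
  have := congr1 (fun p : (size s).-tuple bool => tnth p (Ordinal iu)) rp.
  by rewrite !tnth_mktuple /= nth_index// => ->.
move=> /(_ ptE) h; apply: (@le_trans _ _ (`|x (rep (pt t))| + 1)).
  by rewrite -lerBlDl (le_trans (lerB_dist _ _)).
rewrite -addrA lerD ?lerDl//.
by rewrite (bigD1 (pt t))//= lerDl sumr_ge0.
Qed.

Definition stepf (h : R) (z : nat -> R) (t : R) : R := z (Num.truncn (t / h)).

Lemma stepf_cadlag h z : 0 < h -> cadlag_on T (stepf h z).
Proof.
move=> h0; split=> t /andP[t0 tT].
  have /andP[k1 k2] := truncn_itv (divr_ge0 t0 (ltW h0)); set k := Num.truncn _ in k1 k2.
  apply: cvg_near_cst; near=> t'; rewrite /stepf -/k; congr z; apply/eqP; rewrite truncn_eq.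
    apply/andP; split.
      by rewrite (le_trans k1)// ler_pM2r ?invr_gt0// ltW//; near: t'; exact: nbhs_right_gt.
    rewrite ltr_pdivrMr//; near: t'; apply: nbhs_right_lt.
    by rewrite -ltr_pdivrMr.
  rewrite divr_ge0 ?(ltW h0)// (le_trans t0)// ltW//; near: t'; exact: nbhs_right_gt.
have [k /andP[k1 k2]] : exists k : nat, k%:R * h < t <= k.+1%:R * h.
  have t_ge0 := ltW t0.
  have /andP[k1 k2] := truncn_itv (divr_ge0 t_ge0 (ltW h0)); set k := Num.truncn _ in k1 k2.
  rewrite ler_pdivlMr// in k1; rewrite ltr_pdivrMr// in k2.
  move: k1; rewrite le_eqVlt => /orP[/eqP k1|k1]; last by exists k; rewrite k1 ltW.
  case: (k) k1 => [|j] k1; first by move: t0; rewrite -k1 mul0r ltxx.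
  by exists j; rewrite -k1 lexx ltr_pM2r// ltr_nat ltnSn.
suff : stepf h z @ t^'- --> z k by move=> /cvgP.
apply: cvg_near_cst; near=> t'; rewrite /stepf; congr z; apply/eqP.
have kt : k%:R * h < t' by near: t'; exact: nbhs_left_gt.
rewrite truncn_eq ?ler_pdivlMr// ?ltr_pdivrMr//.
  rewrite (ltW kt)/= (lt_le_trans _ k2)//; near: t'; exact: nbhs_left_lt.
by rewrite mul0r (le_trans _ (ltW kt))// mulr_ge0// ltW.
Unshelve. all: by end_near.
Qed.

(** The inverse of 1 plus the sum of all inverse distances lies below every positive distance;
    coinciding points contribute 0, the inverse of 0 being 0. *)
Let gap (s : seq R) : exists2 rho : R, 0 < rho & forall u u', u \in s -> u' \in s -> u != u' -> rho <= `|u - u'|.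
Proof.
pose S := \sum_(u <- s) \sum_(u' <- s) `|u - u'|^-1.
have S0 : 0 <= S by apply: sumr_ge0 => u _; apply: sumr_ge0 => u' _; rewrite invr_ge0.
exists (1 + S)^-1; first by rewrite invr_gt0 ltr_wpDr.
move=> u u' us u's uu'; have d0 : 0 < `|u - u'| by rewrite normr_gt0 subr_eq0.
rewrite -[leRHS]invrK lef_pV2 ?posrE ?invr_gt0 ?ltr_wpDr//.
rewrite (le_trans (y := S)) ?lerDr// /S (big_rem u)//= (big_rem u' u's)/= -addrA lerDl.
by rewrite addr_ge0// sumr_ge0// => *; rewrite ?sumr_ge0// => *; rewrite invr_ge0.
Qed.

Let hat (z : R) := Num.max 0 (1 - `|z|).

Let hat_far z : 1 <= `|z| -> hat z = 0.
Proof. by move=> h; rewrite /hat max_l// subr_le0. Qed.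

Let hat01 z : 0 <= hat z <= 1.
Proof. by rewrite /hat le_max lexx/= ge_max ler01 gerBl normr_ge0. Qed.

Let hat_lip a b : `|hat a - hat b| <= `|a - b|.
Proof.
have h1 := ler_distD b a 0; have h2 := ler_distD a b 0; rewrite !subr0 in h1 h2; rewrite (distrC b a) in h2.
have h3 := normr_ge0 a; have h4 := normr_ge0 b; have h5 := normr_ge0 (a - b).
rewrite /hat ler_norml; move: `|a| `|b| `|a - b| h1 h2 h3 h4 h5 => p q r *.
by case: (leP 0 (1 - p)) => ?; case: (leP 0 (1 - q)) => ?; apply/andP; split; lra.
Qed.

(* The time change moves the points [u] of a partition adapted to [x] to the next grid points. *)
Lemma J1close_step (x : R -> R) delta : cadlag_on T x -> 0 < delta -> exists2 h0, 0 < h0 &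
  forall (h : R) (n : nat), 0 < h < h0 -> n%:R * h = T -> J1close T delta x (stepf h (fun k => x (k%:R * h))).
Proof.
move=> cx d0; have [s1 s1T s1b] := cadlag_partition cx d0.
pose s := undup s1.
have sT u : u \in s -> 0 <= u <= T by rewrite mem_undup; exact: s1T.
have sb a b : 0 <= a < T -> 0 <= b < T -> (forall u, u \in s -> (u <= a) = (u <= b)) -> `|x a - x b| <= delta.
  by move=> ha hb hu; apply: s1b => // u us; apply: hu; rewrite mem_undup.
have us : uniq s by exact: undup_uniq.
have [rho0 rho00 gapP] := gap [:: 0, T & s].
pose rho := rho0 / 2; have rho_gt0 : 0 < rho by rewrite divr_gt0.
pose r := (size s)%:R : R; have r0 : 0 <= r by [].
(* With r points in the partition, r h < rho makes the correction a strict contraction, hence [la]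
   increasing, and r h <= delta bounds the displacement. *)
exists (Num.min (rho / (r + 1)) (delta / (r + 1))).
  by rewrite lt_min !divr_gt0// ltr_wpDl.
move=> h n /andP[h_gt0]; rewrite lt_min => /andP[hr hd] nh.
have r1 : 0 < r + 1 by rewrite ltr_wpDl.
rewrite ltr_pdivlMr// in hr; rewrite ltr_pdivlMr// in hd.
have h_rho : h <= rho by rewrite (le_trans _ (ltW hr))// ler_peMr ?(ltW h_gt0)// lerDr.
have rh_rho : r * h < rho by rewrite (le_lt_trans _ hr)// mulrC ler_wpM2l ?(ltW h_gt0)// lerDl.
have rh_d : r * h <= delta by rewrite (le_trans _ (ltW hd))// mulrC ler_wpM2l ?(ltW h_gt0)// lerDl.
have /choice[c cP] (u : R) : exists c : nat, forall k : nat, (u <= k%:R * h) = (c <= k)%N.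
  have ex : exists k : nat, u <= k%:R * h.
    exists (Num.truncn (`|u| / h)).+1; rewrite -ler_pdivrMr//.
    rewrite (le_trans _ (ltW (truncnS_gt _)))// ler_wpM2r ?invr_ge0 ?(ltW h_gt0)//; exact: ler_norm.
  case: (ex_minnP ex) => c uc cmin; exists c => k; apply/idP/idP; first exact: cmin.
  by move=> ck; rewrite (le_trans uc)// ler_wpM2r ?(ltW h_gt0)// ler_nat.
pose g u := (c u)%:R * h.
have g_ge u : u <= g u by rewrite cP.
have g_lt u : 0 <= u -> g u < u + h.
  move=> u0; rewrite /g; case E : (c u) => [|k]; first by rewrite mul0r ltr_wpDl.
  by rewrite -natr1 mulrDl mul1r ltrD2r ltNge cP E ltnn.
have gT u : u <= T -> g u <= T by rewrite -nh cP => ck; rewrite ler_wpM2r ?(ltW h_gt0)// ler_nat.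
pose coef u := g u - u.
have coef0 u : u \in s -> 0 <= coef u <= h.
  by move=> /sT/andP[u0 _]; rewrite subr_ge0 g_ge lerBlDl ltW// g_lt.
(* One tent of radius [rho] around each image point [g u]. As [rho] is half the minimal gap, all
   other tents vanish there, whence [la (g u) = u]; likewise 0 and T stay fixed. *)
pose corr t := \sum_(u <- s) coef u * hat ((t - g u) / rho).
pose la t := t - corr t.
have term_ge0 u t : u \in s -> 0 <= coef u * hat ((t - g u) / rho).
  by move=> /coef0/andP[? _]; rewrite mulr_ge0//; case/andP : (hat01 ((t - g u) / rho)).
have far u p : u \in s -> p \in [:: 0, T & s] -> p != u -> forall q, p <= q <= p + h -> hat ((q - g u) / rho) = 0.
  move=> us' ps pu q /andP[q1 q2]; apply: hat_far; rewrite normrM normfV (gtr0_norm rho_gt0) ler_pdivlMr// mul1r.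
  have uu : u \in [:: 0, T & s] by rewrite !inE us' !orbT.
  have := gapP p u ps uu pu; have := g_ge u; have /andP[u0 _] := sT u us'; have := g_lt u u0.
  have : rho0 = rho + rho by rewrite /rho -splitr.
  case: (ger0P (p - u)) => pu0; case: (ger0P (q - g u)) => qg *; lra.
have la0 : la 0 = 0.
  rewrite /la /corr big_seq big1 ?subr0// => u us'; have [u0|u0] := eqVneq 0 u.
    have -> : coef u = 0; last by rewrite mul0r.
    rewrite /coef -u0 subr0 /g; have -> : c 0 = 0%N by apply/eqP; rewrite -leqn0 -cP mul0r.
    by rewrite mul0r.
  by rewrite (far u 0)// ?mulr0// ?inE ?eqxx// lexx add0r ltW.
have laT : la T = T.
  rewrite /la /corr big_seq big1 ?subr0// => u us'; have [u0|u0] := eqVneq T u.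
    have -> : coef u = 0; last by rewrite mul0r.
    by apply/eqP; rewrite subr_eq0 eq_le g_ge andbT -{2}u0 gT// u0.
  by rewrite (far u T)// ?mulr0// ?inE ?eqxx ?orbT// lexx lerDl ltW.
have lag u : u \in s -> la (g u) = u.
  move=> us'; rewrite /la /corr (bigD1_seq u)//= subrr mul0r big_seq_cond big1 ?addr0.
    by rewrite /hat normr0 subr0 max_r// mulr1 /coef opprB addrC subrK.
  move=> u' /andP[u's u'u]; rewrite (far u' u)// ?mulr0//; first by rewrite !inE us' !orbT.
    by rewrite eq_sym.
  by rewrite g_ge ltW// g_lt; case/andP : (sT u us').
have corr_lip a b : `|corr b - corr a| <= r * h / rho * `|b - a|.
  rewrite /corr -sumrB (le_trans (ler_norm_sum _ _ _))// big_seq.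
  apply: (@le_trans _ _ (\sum_(u <- s | u \in s) h / rho * `|b - a|)).
    apply: ler_sum => u us'; have /andP[k0 kh] := coef0 u us'.
    rewrite -mulrBr normrM (ger0_norm k0) -mulrA ler_pM//.
    rewrite (le_trans (hat_lip _ _))// -mulrBl opprB addrA subrK normrM mulrC ger0_norm//.
    by rewrite invr_ge0 ltW.
  rewrite -big_seq big_const_seq count_predT iter_addr_0 -mulr_natl -/r.
  by rewrite !mulrA.
have q1 : r * h / rho < 1 by rewrite ltr_pdivrMr// mul1r.
have la_mono a b : a < b -> la a < la b.
  move=> ab; have := corr_lip a b; rewrite (gtr0_norm (_ : 0 < b - a)) ?subr_gt0// => H.
  have : r * h / rho * (b - a) < b - a by rewrite gtr_pMl ?subr_gt0.
  by have := ler_norm (corr b - corr a); rewrite /la; lra.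
have la_le a b : (la a <= la b) = (a <= b).
  case: (leP a b); last by move=> /la_mono; rewrite ltNge => /negbTE.
  by rewrite le_eqVlt => /orP[/eqP ->|/la_mono/ltW ->]; rewrite ?lexx.
exists la; split; first split => //.
- by move=> a b _ ab _; exact: la_mono.
- apply: continuous_subspaceT => a; apply/cvgrPdist_lt => e e0; near=> b.
  have : `|la a - la b| <= 2 * `|a - b|.
    have -> : la a - la b = (a - b) + (corr b - corr a) by rewrite /la; ring.
    rewrite (le_trans (ler_normD _ _))// mulrDl mul1r lerD//.
    by rewrite (le_trans (corr_lip _ _))// (distrC b) ler_piMl// ltW.
  move=> /le_lt_trans; apply; rewrite -ltr_pdivlMl//.
  by near: b; apply: cvgr_dist_lt => //; rewrite mulr_gt0// invr_gt0.
move=> t /andP[t0 tT]; split.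
  rewrite /la addrAC subrr sub0r normrN /corr ger0_norm; last by rewrite big_seq sumr_ge0// => u us'; exact: term_ge0.
  apply: le_trans rh_d; rewrite big_seq (@le_trans _ _ (\sum_(u <- s | u \in s) h))//.
    apply: ler_sum => u us'; have /andP[k0 kh] := coef0 u us'; have /andP[p0 p1] := hat01 ((t - g u) / rho).
    by rewrite -[leRHS]mulr1 ler_pM.
  by rewrite -big_seq big_const_seq count_predT iter_addr_0 -mulr_natl.
rewrite /stepf; set k := Num.truncn _.
have th0 : 0 <= t / h by rewrite divr_ge0 // ltW.
move: tT; rewrite le_eqVlt => /orP[/eqP tT|tT].
  have -> : k = n by rewrite /k tT -nh mulfK ?gt_eqF// natrK.
  by rewrite tT laT nh subrr normr0 ltW.
have kt : k%:R * h <= t by rewrite -ler_pdivlMr//; case/andP : (truncn_itv th0).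
(* [la t] and the grid point k h lie in the same cell: u <= la t means g u <= t, and [g u], the
   first grid point from [u] on, is at most t exactly when u <= k h. *)
apply: sb => [||u us'].
- by rewrite -{1}la0 la_le t0/= -laT la_mono.
- by rewrite mulr_ge0 ?(ltW h_gt0)//= (le_lt_trans kt).
- by rewrite -{1}(lag u us') la_le cP /g -ler_pdivlMr// truncn_ge_nat.
Unshelve. all: by end_near.
Qed.
End Skorokhod.

(** * Functionals along grid values: measurability and law *)

Section Functional.
Context {R : realType}.
Variables (T : R) (F : (R -> R) -> R) (M : R).
Hypothesis T0 : 0 < T.
Hypothesis FM : forall x, cadlag_on T x -> `|F x| <= M.
Hypothesis Fc : J1continuous T F.

Let h (n : nat) := T / n.+1%:R.
Let h0 n : 0 < h n. Proof. by rewrite divr_gt0. Qed.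
(** On [0, T] the step index runs from 0 to n + 1, the last value being taken at T itself, whence n
    + 2 coordinates. *)
Let ph n (z : n.+2.-tuple R) := F (stepf (h n) (nth 0 z)).
Let rd (n : nat) (y : R) : R := (Num.floor (y * n.+1%:R))%:~R / n.+1%:R.

Let rd_near n y : `|rd n y - y| <= n.+1%:R^-1.
Proof.
have n0 : 0 < n.+1%:R :> R by [].
have /andP[h1 h2] := floor_itv (y * n.+1%:R).
rewrite intrD in h2.
by rewrite ler_norml; apply/andP; split; rewrite -(ler_pM2r n0) ?mulNr mulVf ?gt_eqF// mulrBl divfK ?gt_eqF//; lra.
Qed.

Let ph_sup n (z : n.+2.-tuple R) e : 0 < e -> exists2 delta, 0 < delta &
  forall z' : n.+2.-tuple R, (forall k, `|tnth z k - tnth z' k| <= delta) -> `|ph z - ph z'| < e.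
Proof.
move=> e0; have [delta d0 H] := Fc (stepf_cadlag T (nth 0 z) (h0 n)) e0.
exists delta => // z' zz'; apply: H; first exact: stepf_cadlag.
exists id; split; first by split => //; apply: continuous_subspaceT => u; exact: cvg_id.
move=> t _; rewrite subrr normr0 (ltW d0); split => //; rewrite /stepf; set k := Num.truncn _.
case: (ltnP k n.+2) => kn; last by rewrite !nth_default ?size_tuple// subrr normr0 ltW.
by have := zz' (Ordinal kn); rewrite !(tnth_nth 0).
Qed.

(** J1-continuity makes [ph] continuous in the sup norm. Rounding the coordinates to multiples of 1
    / (j + 1) gives approximations with countably many values, measurable for the product
    sigma-algebra. *)
Lemma step_functional_meas n : measurable_fun setT (@ph n).
Proof.
pose rdt j (z : n.+2.-tuple R) := [tuple rd j (tnth z k) | k < n.+2].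
apply: (@measurable_fun_cvg _ _ _ setT (fun j z => ph (rdt j z))) => [j|z _]; last first.
  apply/cvgrPdist_lt => e e0; have [delta d0 H] := ph_sup z e0.
  near=> j; apply: H => k; rewrite tnth_mktuple distrC (le_trans (rd_near _ _))//.
  by near: j; have := @near_infty_natSinv_lt R (PosNum d0); apply: filterS => j /ltW.
move=> _ Y mY; rewrite setTI.
have -> : (fun z => ph (rdt j z)) @^-1` Y = \bigcup_(f : {ffun 'I_n.+2 -> int})
   ((if `[< Y (ph [tuple (f k)%:~R / j.+1%:R | k < n.+2]) >] then setT else set0) `&`
    \bigcap_k [set z | (f k)%:~R <= tnth z k * j.+1%:R < (f k + 1)%:~R]).
  apply/seteqP; split => z /=.
    move=> Yz; exists [ffun k => Num.floor (tnth z k * j.+1%:R)] => //; split.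
      rewrite asboolT//; rewrite (_ : [tuple _ | _ < _] = rdt j z)//.
      by apply: eq_mktuple => k; rewrite ffunE.
    by move=> k _ /=; rewrite ffunE; exact: floor_itv.
  move=> [f _ [+ fz]]; case: asboolP => // Yf _.
  rewrite (_ : rdt j z = [tuple (f k)%:~R / j.+1%:R | k < n.+2])//.
  by apply: eq_mktuple => k; rewrite /rd (floor_def (fz k I)).
apply: countable_bigcupT_measurable => [|f]; first exact: countableP.
apply: measurableI; first by case: ifP.
apply: fin_bigcap_measurable => [|k _]; first exact: finite_finset.
have mt : measurable_fun setT (fun z : n.+2.-tuple R => tnth z k * j.+1%:R).
  by apply: measurable_funM => //; exact: measurable_tnth.
rewrite (_ : [set z | _] = [set z : n.+2.-tuple R | (f k)%:~R <= tnth z k * j.+1%:R] `&`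
   [set z | tnth z k * j.+1%:R < (f k + 1)%:~R]); last by apply/seteqP; split => z /= => [/andP[]|[-> ->]].
apply: measurableI; rewrite -[X in measurable X]setTI.
  exact: measurable_fun_ler.
exact: measurable_fun_ltr.
Unshelve. all: by end_near.
Qed.

Let F_cvg x : cadlag_on T x -> (fun n => @ph n [tuple x (k%:R * h n) | k < n.+2]) @ \oo --> F x.
Proof.
move=> cx; apply/cvgrPdist_lt => e e0.
have [delta d0 H] := Fc cx e0; have [r0 r00 Hr] := J1close_step T0 cx d0.
near=> n; apply: H; first exact: stepf_cadlag.
have hn : 0 < h n < r0.
  rewrite h0/=; near: n.
  have p0 : 0 < r0 / T by rewrite divr_gt0.
  have := @near_infty_natSinv_lt R (PosNum p0); apply: filterS => n /= hh.
  by rewrite /h mulrC -ltr_pdivlMr.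
have nT : n.+1%:R * h n = T by rewrite /h mulrC divfK.
have [la [tc Hla]] := Hr _ _ hn nT; exists la; split => // t tT; have [h1 h2] := Hla t tT; split => //.
move: h2; rewrite /stepf; set k := Num.truncn _.
suff kn : (k < n.+2)%N by rewrite (nth_mktuple _ 0 (Ordinal kn)).
case/andP : tT => t0 tT.
rewrite ltnS /k truncn_le_nat ltr_pdivrMr// (le_lt_trans tT)// -nT ltr_pM2r// ltr_nat//.
Unshelve. all: by end_near.
Qed.

(** Measurability is derived from J1-continuity: along a cadlag path [F] is the limit of its values
    on grid step paths, by [J1close_step]. *)
Lemma functional_meas {d} {O : measurableType d} (X : O -> R -> R) :
  (forall w, cadlag_on T (X w)) -> (forall t, 0 <= t <= T -> measurable_fun setT (X^~ t)) ->
  measurable_fun setT (fun w => F (X w)) /\ forall n, measurable_fun setT (fun w => @ph n [tuple X w (k%:R * h n) | k < n.+2]).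
Proof.
move=> cX mX.
have mn n : measurable_fun setT (fun w => @ph n [tuple X w (k%:R * h n) | k < n.+2]).
  apply: (measurableT_comp (@step_functional_meas n)); apply/measurable_fun_tnthP => k.
  rewrite (_ : _ \o _ = X^~ (k%:R * h n)); last by apply/funext => w /=; rewrite tnth_mktuple.
  apply: mX; rewrite mulr_ge0 ?(ltW (h0 n))//=.
  by rewrite /h mulrCA ger_pMr// ler_pdivrMr// mul1r ler_nat -ltnS.
split => //; apply: (@measurable_fun_cvg _ _ _ setT (fun n w => @ph n [tuple X w (k%:R * h n) | k < n.+2])) => // w _.
exact: F_cvg.
Qed.

Lemma functional_law {d1 d2} {O1 : measurableType d1} {O2 : measurableType d2}
  (P1 : probability O1 R) (P2 : probability O2 R) (X1 : O1 -> R -> R) (X2 : O2 -> R -> R) :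
  (forall w, cadlag_on T (X1 w)) -> (forall w, cadlag_on T (X2 w)) ->
  (forall t, 0 <= t <= T -> measurable_fun setT (X1^~ t)) ->
  (forall t, 0 <= t <= T -> measurable_fun setT (X2^~ t)) ->
  (forall n (f : n.+2.-tuple R -> R), measurable_fun setT f -> (forall z, `|f z| <= M) ->
    Ex P1 (fun w => f [tuple X1 w (k%:R * (T / n.+1%:R)) | k < n.+2]) =
    Ex P2 (fun w => f [tuple X2 w (k%:R * (T / n.+1%:R)) | k < n.+2])) ->
  (\int[P1]_w (F (X1 w))%:E = \int[P2]_w (F (X2 w))%:E)%E.
Proof.
move=> c1 c2 m1 m2 eqf.
have phM n z : `|@ph n z| <= M by apply: FM; exact: stepf_cadlag.
have cv d (O : measurableType d) (P : probability O R) (X : O -> R -> R) :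
    (forall w, cadlag_on T (X w)) -> (forall t, 0 <= t <= T -> measurable_fun setT (X^~ t)) ->
    (fun n => \int[P]_w (@ph n [tuple X w (k%:R * h n) | k < n.+2])%:E)%E @ \oo --> (\int[P]_w (F (X w))%:E)%E.
  move=> cX mX; have [mF mn] := functional_meas cX mX.
  apply: (@dct_near _ _ _ P setT _ _ (fun=> M)) => //.
  - by move=> w _; exact: F_cvg.
  - exact: intble_cst.
  - by near=> n => w _; exact: phM.
have h1 := cv _ _ P1 X1 c1 m1; have h2 := cv _ _ P2 X2 c2 m2.
have E : (fun n => \int[P1]_w (@ph n [tuple X1 w (k%:R * h n) | k < n.+2])%:E)%E =
         (fun n => \int[P2]_w (@ph n [tuple X2 w (k%:R * h n) | k < n.+2])%:E)%E.
  apply/funext => n.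
  have [_ mn1] := functional_meas c1 m1; have [_ mn2] := functional_meas c2 m2.
  rewrite !Ex_EFin; last 2 first.
  - by apply: (@Ex_bnd_int _ _ _ _ _ M) => // w; exact: phM.
  - by apply: (@Ex_bnd_int _ _ _ _ _ M) => // w; exact: phM.
  by rewrite (eqf n (@ph n) (@step_functional_meas n) (phM n)).
by rewrite E in h1; exact: (cvg_unique _ h1 h2).
Unshelve. all: by end_near.
Qed.
End Functional.

(** * The coupled processes *)

Section Points.
Context {d : measure_display} {Om : measurableType d} {R : realType} (Q : probability Om R).
Variable E : nat -> Om -> R.
Hypothesis mE : forall j, measurable_fun setT (E j).
Hypothesis tE : forall j x, 0 <= x -> prob Q [set w | x < E j w] = expR (- x).
Hypothesis indE : forall (n : nat) (C : nat -> set R), (forall j, measurable (C j)) ->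
  prob Q (\bigcap_(j in `I_n) [set w | C j (E j w)]) = \prod_(j < n) prob Q [set w | C j (E j w)].

Let mgt j y : measurable [set w | y < E j w].
Proof. by rewrite -[X in measurable X]setTI; exact: measurable_fun_ltr. Qed.
Let mle j y : measurable [set w | E j w <= y].
Proof. by rewrite -[X in measurable X]setTI; exact: measurable_fun_ler. Qed.

Lemma ae_prob0 (p : Om -> Prop) (A : set Om) : measurable A -> prob Q A = 0 -> ~` [set w | p w] `<=` A ->
  {ae Q, forall w, p w}.
Proof. by move=> mA A0 sub; exists A; split => //; rewrite prob_EFin// A0. Qed.

Lemma exp_pos_ae : {ae Q, forall w, forall j, 0 < E j w}.
Proof.
apply: ae_foralln => j; apply: (ae_prob0 (measurableC (mgt j 0))) => //.
by rewrite prob_setC// tE// oppr0 expR0 subrr.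
Qed.

(** Almost surely infinitely many E_l exceed 1, because failure from index n on has probability at
    most (1 - e^(-1))^m for every m. *)
Lemma Gam_unbounded_ae : {ae Q, forall w, forall C, exists j, C < Gam E j w}.
Proof.
have frequent : {ae Q, forall w, forall n, exists2 l, (n <= l)%N & 1 < E l w}.
  apply: ae_foralln => n; pose A := \bigcap_(l in [set l | (n <= l)%N]) [set w | E l w <= 1].
  have mA : measurable A by apply: bigcap_measurable => [|l _]; [exists n => /=|exact: mle].
  apply: (ae_prob0 mA); last by move=> w /= H l /= nl; rewrite leNgt; apply/negP => h; apply: H; exists l.
  pose q : R := 1 - expR (- 1).
  have q01 : 0 <= q < 1 by rewrite subr_ge0 -[leRHS]expR0 ler_expR lerN10 gtrBl expR_gt0.
  have qm m : prob Q A <= q ^+ m.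
    pose C (l : nat) : set R := if (n <= l)%N then [set x | x <= 1] else setT.
    have mC l : measurable (C l).
      by rewrite /C; case: ifP => // _; rewrite -[X in measurable X]setTI; exact: measurable_fun_ler.
    have mCE l : measurable [set w | C l (E l w)].
      by rewrite -[X in measurable X]setTI; exact: (mE _ measurableT (mC l)).
    apply: (@le_trans _ _ (prob Q (\bigcap_(j in `I_(n + m)) [set w | C j (E j w)]))).
      apply: prob_le => // [|w Aw j _]; first exact: fin_bigcap_measurable.
      by rewrite /C/=; case: ifP => // nj; exact: Aw.
    rewrite indE// big_split_ord/=; apply: le_trans (ler_piMl _ _) _; first by rewrite prodr_ge0// => l _; exact: fine_ge0.
      by apply: prodr_ile1 => l _; rewrite fine_ge0//= -lee_fin -prob_EFin// probability_le1.
    rewrite -[X in _ ^+ X]card_ord -prodr_const; apply: ler_prod => l _.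
    rewrite fine_ge0//= /C leq_addr /q -(tE (n + l) ler01) -prob_setC// prob_le//; first exact: mle.
      exact: measurableC.
    by move=> w /=; rewrite leNgt => /negP.
  apply/eqP; rewrite eq_le fine_ge0// andbT leNgt; apply/negP => p0.
  have : (fun m => q ^+ m) @ \oo --> 0 by apply: cvg_expr; rewrite ger0_norm; case/andP : q01.
  move/cvgr_lt => /(_ _ p0) [m _ /(_ m (leqnn m))] /=; rewrite ltNge; apply/negP; rewrite negbK; exact: qm.
apply: filterS2 frequent exp_pos_ae => w fr pos C.
have mono j k : (j <= k)%N -> Gam E j w <= Gam E k w.
  by move=> jk; rewrite /Gam (big_ord_widen k.+1 (fun l => E l w))// [leRHS](bigID (fun l : 'I_k.+1 => (l < j.+1)%N))/= lerDl sumr_ge0// => l _; exact: ltW.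
have big K : exists j, K%:R < Gam E j w.
  elim: K => [|K [j IH]]; first by exists 0%N; rewrite /Gam big_ord1.
  have [l jl El] := fr j.+1; exists l; case: l jl El => // l jl El.
  have h := lt_le_trans IH (mono j l jl).
  by rewrite /Gam big_ord_recr/= -natr1; exact: ltrD h El.
have [j Hj] := big (Num.truncn `|C|).+1; exists j.
by rewrite (le_lt_trans _ Hj)// (le_trans (ler_norm _))// ltW// truncnS_gt.
Qed.

(** With the other summands frozen, the event asks E_0 to take one fixed value. *)
Lemma Gam_noatom j c : prob Q [set w | Gam E j w = c] = 0.
Proof.
have ind := indep_sys_sym (exp_cut mE indE j.+1 0).
set G := cyl _ _ in ind; set H := cyl _ _ in ind.
pose rest w := \sum_(l < j) E (bump 0 l) w.
have gG : gmeas G rest.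
  apply: (@measurable_sum _ (g_sigma_algebraType G) R setT) => l.
  by apply: (@cyl_gmeas _ _ _ _ (fun i : 'I_j.+1 => E i) _ (lift ord0 l)).
have gH : gmeas H (E 0%N) by apply: (@cyl_gmeas _ _ _ _ (fun i : 'I_j.+1 => E i) _ ord0).
pose K (p : g_sigma_algebraType G * g_sigma_algebraType H) : \bar R := (if rest p.1 + E 0%N p.2 == c then 1 else 0)%:E.
have mK : measurable_fun setT K.
  apply/measurable_EFinP; apply: measurable_fun_ifT => //; apply: measurable_fun_eqr => //.
  by apply: measurable_funD; [exact: (measurableT_comp gG)|exact: (measurableT_comp gH)].
have K0 p : (0 <= K p)%E by rewrite lee_fin; case: ifP.
have mGam : measurable [set w | Gam E j w = c].
  rewrite (_ : [set w | _] = Gam E j @^-1` [set c])//.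
  by rewrite -[X in measurable X]setTI; apply: measurable_sum => //; exact: measurable_set1.
apply: EFin_inj; rewrite -(Ex_indic Q mGam) -Ex_EFin; last first.
  by apply: (@Ex_bnd_int _ _ _ _ _ 1) => [|w]; [exact: measurable_indic|rewrite indicE; case: (_ \in _); rewrite ?normr1 ?normr0].
transitivity (\int[Q]_w K (w, w))%E.
  apply: eq_integral => w _; rewrite /K/= indicE; congr EFin.
  have -> : rest w + E 0%N w = Gam E j w by rewrite /Gam big_ord_recl addrC.
  by case: eqP => h; [rewrite mem_set|rewrite memNset].
rewrite (decouple ind mK K0) integral0_eq// => w _.
transitivity ((prob Q [set w' | E 0%N w' = c - rest w])%:E); last by rewrite (exp_noatom (mE 0) (tE 0)).
have mS : measurable [set w' | E 0%N w' = c - rest w].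
  rewrite (_ : [set w' | _] = E 0%N @^-1` [set c - rest w])//.
  by rewrite -[X in measurable X]setTI; apply: mE => //; exact: measurable_set1.
rewrite -(Ex_indic Q mS) -Ex_EFin; last first.
  by apply: (@Ex_bnd_int _ _ _ _ _ 1) => [|w']; [exact: measurable_indic|rewrite indicE; case: (_ \in _); rewrite ?normr1 ?normr0].
apply: eq_integral => w' _; rewrite /K/= indicE; congr EFin.
rewrite (_ : (_ == c) = (E 0%N w' == c - rest w)); last by apply/eqP/eqP => [<-|->]; ring.
by case: eqP => h; [rewrite mem_set|rewrite memNset].
Qed.
End Points.

Lemma invn_cvg0 {R : realType} : (fun N : nat => (N%:R : R)^-1) @ \oo --> (0 : R).
Proof. by rewrite -(cvg_shiftn 1); under eq_fun do rewrite addn1; exact: cvg_harmonic. Qed.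

(** N times the spacing converges term by term, as N / (N - l) tends to 1; the bounds x - x^2 <= 1 -
    e^(-x) <= x transfer this. *)
Lemma spacing_cvg {d} {Om : measurableType d} {R : realType} (E : nat -> Om -> R) j w : (forall l, 0 < E l w) ->
  (fun N => N%:R * (1 - expR (- spacing E N 0 j w))) @ \oo --> Gam E j w.
Proof.
move=> E0.
have c1 : (fun N => N%:R * spacing E N 0 j w) @ \oo --> Gam E j w.
  have -> : (fun N => N%:R * spacing E N 0 j w) = (fun N => \sum_(l < j.+1) E l w * (N%:R / (N - l)%:R)).
    by apply/funext => N; rewrite mulr_sumr; apply: eq_bigr => l _; rewrite add0n; ring.
  rewrite /Gam; apply: cvg_big => [|l _]; first by move=> x; apply: add_continuous.
  rewrite -[X in _ --> X]mulr1; apply: cvgMr.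
  rewrite -(cvg_shiftn l.+1); apply: (@cvg_ext R _ (fun n => 1 + l%:R * harmonic n) (1 + l%:R * 0)).
  - by apply: cvgD; [exact: cvg_cst|apply: cvgMr; exact: cvg_harmonic].
  - by rewrite mulr0 addr0.
  move=> n; rewrite /harmonic/= addnS subSn ?leq_addl// addnK -addSn natrD.
  by rewrite mulrDl divff.
have c2 : (fun N => N%:R * spacing E N 0 j w - (N%:R * spacing E N 0 j w) ^+ 2 * N%:R^-1) @ \oo --> Gam E j w.
  rewrite -[X in _ --> X]subr0 -(mulr0 (Gam E j w ^+ 2)); apply: cvgB => //; apply: cvgM; last exact: invn_cvg0.
  by under eq_fun do rewrite expr2; rewrite expr2; exact: cvgM.
apply: squeeze_cvgr c2 c1; near=> N.
have N0 : (0 < N)%N by near: N; exact: nbhs_infty_gt.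
have x0 : 0 <= spacing E N 0 j w by apply: sumr_ge0 => l _; rewrite divr_ge0// ltW.
move: (spacing _ _ _ _ _) x0 => x x0.
have Nn : N%:R != 0 :> R by rewrite pnatr_eq0 -lt0n.
have -> : N%:R * x - (N%:R * x) ^+ 2 / N%:R = N%:R * (x - x ^+ 2) by field.
have h1 : expR (- x) <= (1 + x)^-1 by rewrite expRN lef_pV2 ?posrE ?expR_gt0 ?ltr_wpDr// expR_ge1Dx.
have h2 : (1 + x)^-1 <= 1 - x + x ^+ 2.
  rewrite -[leLHS]mul1r ler_pdivrMr ?ltr_wpDr//.
  have : 0 <= x ^+ 3 by rewrite exprn_ge0.
  rewrite !exprS expr0; lra.
have h3 := expR_ge1Dx (- x).
by apply/andP; split; rewrite ler_wpM2l//; lra.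
Unshelve. all: by end_near.
Qed.

(** By [qt_gt], bounding the log-weight by u - e and u + e, u the logarithm of the limit, compares N
    (1 - e^(-spacing)), which tends to Gamma_j, with N times the tail at those points. The tail
    limits lie strictly on either side of Gamma_j. *)
Lemma arrive_cvg {d d'} {Om : measurableType d} {Om' : measurableType d'} {R : realType} (P : probability Om R)
  (xi : nat -> R -> Om -> R) (E : nat -> Om' -> R) (s l : nat -> R) (alpha : R) j w :
  0 < alpha -> (forall t, measurable_fun setT (xi 0%N t)) ->
  (forall x, (fun N => N%:R * prob P [set w | x < xi 0%N (s N) w - l N]) @ \oo --> expR (- alpha * x)) ->
  (forall l, 0 < E l w) ->
  (fun N => expR (arrive P xi E (s N) N j w - l N)) @ \oo --> Upt alpha E j w.
Proof.
move=> al0 mxi tl E0.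
have G0 : 0 < Gam E j w.
  by rewrite /Gam big_ord_recl ltr_wpDr// sumr_ge0// => i _; exact: ltW.
pose u := - alpha^-1 * ln (Gam E j w).
have -> : Upt alpha E j w = expR u by rewrite /Upt /powR gt_eqF.
have eu : Gam E j w = expR (- alpha * u).
  by rewrite /u mulrA mulrNN divff ?gt_eqF// mul1r lnK.
apply: continuous_cvg; first exact: continuous_expR.
apply/cvgrPdist_le => e e0.
have sp := @spacing_cvg _ _ _ E j w E0.
have N_tail x N : N%:R * prob P [set w | x < xi 0%N (s N) w - l N] = N%:R * survival P (xi 0%N (s N)) (x + l N).
  congr (_ * prob P _); apply/seteqP; split => w' /=; rewrite ltrBrDr//.
have lo : \forall N \near \oo, N%:R * (1 - expR (- spacing E N 0 j w)) < N%:R * survival P (xi 0%N (s N)) (u - e + l N).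
  pose mid := (Gam E j w + expR (- alpha * (u - e))) / 2.
  have lt1 : Gam E j w < expR (- alpha * (u - e)) by rewrite eu ltr_expR !mulNr ltrN2 ltr_pM2l// gtrBl.
  have [m1 m2] := midf_lt lt1.
  near=> N; apply: (@lt_trans _ _ mid).
    by near: N; apply: (cvgr_lt _ sp).
  by rewrite -N_tail; near: N; apply: (cvgr_gt _ (tl (u - e))).
have hi : \forall N \near \oo, N%:R * survival P (xi 0%N (s N)) (u + e + l N) < N%:R * (1 - expR (- spacing E N 0 j w)).
  have lt1 : expR (- alpha * (u + e)) < Gam E j w by rewrite eu ltr_expR !mulNr ltrN2 ltr_pM2l// ltrDl.
  have [m1 m2] := midf_lt lt1.
  near=> N; apply: (@lt_trans _ _ ((expR (- alpha * (u + e)) + Gam E j w) / 2)).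
    by rewrite -N_tail; near: N; apply: (cvgr_lt _ (tl (u + e))).
  by near: N; apply: (cvgr_gt _ sp).
near=> N.
have jN : (j < N)%N by near: N; exact: nbhs_infty_gt.
have N0 : 0 < N%:R :> R by rewrite ltr0n (leq_ltn_trans _ jN).
have sp0 : 0 < spacing E N 0 j w.
  rewrite /spacing big_ord_recl ltr_wpDr ?sumr_ge0// => [i _|]; first by rewrite divr_ge0// ltW.
  by rewrite divr_gt0// subn0.
have h1 : u - e + l N < arrive P xi E (s N) N j w.
  by rewrite /arrive qt_gt// -(ltr_pM2l N0); near: N.
have h2 : arrive P xi E (s N) N j w <= u + e + l N.
  by rewrite leNgt /arrive qt_gt// -leNgt -(ler_pM2l N0) ltW//; near: N.
by rewrite ler_distl; apply/andP; split; lra.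
Unshelve. all: by end_near.
Qed.

Lemma fin_exists_measurable {d} {Om : measurableType d} (I : finType) (p : I -> set Om) :
  (forall i, measurable (p i)) -> measurable [set w | exists i, p i w].
Proof.
move=> mp; have -> : [set w | exists i, p i w] = \big[setU/set0]_(i : I) p i.
  by rewrite -bigcup_seq; apply/seteqP; split=> w [i]; [exists i => //=; rewrite mem_index_enum|move=> _; exists i].
exact: bigsetU_measurable.
Qed.

(** * Transfer of the maximal inequality to the coupled sums *)

Section Deviation.
Context {d d' : measure_display} {Om : measurableType d} {Om' : measurableType d'} {R : realType}
  (P : probability Om R) (Q : probability Om' R)
  (xi : nat -> R -> Om -> R) (xi' : nat -> R -> Om' -> R) (E : nat -> Om' -> R).
Local Notation intble f := (P.-integrable setT (EFin \o f)).
Hypothesis Hlevy : forall i, levy P (xi i).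
Hypothesis Hident : forall i, fdd_eq P (xi i) P (xi 0%N).
Hypothesis Hindep : indep_family P xi.
Hypothesis Hm : forall u : R, intble (fun w => expR (u * xi 0%N 1 w)).
Hypothesis Hlevy' : forall i, levy Q (xi' i).
Hypothesis Hident' : forall i, fdd_eq Q (xi' i) P (xi 0%N).
Hypothesis Hindep' : indep_family Q xi'.
Hypothesis HE : exp_indep Q E xi'.
Variables (s : R) (N : nat) (v : R -> R).
Hypotheses (s0 : 0 <= s) (mv : measurable_fun setT v) (v0 : forall x, 0 <= v x).
Hypothesis iv : intble (fun w => v (xi 0%N s w) ^+ 2).
Let ps := psi P (xi 0%N).
Let mean := N%:R * Ex P (fun w => v (xi 0%N s w)).

(** Counterpart of [dev] on [Q]: growth divided by its mean e^(psi(1) t), and the total centred. *)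
Definition devQ (t : R) (w : Om') : R :=
  \sum_(j < N) v (arrive P xi E s N j w) * expR (xi' j t w - ps 1 * t) - mean.

Lemma devQ_meas t : measurable_fun setT (devQ t).
Proof.
apply: measurable_funB => //; apply: measurable_sum => j; apply: measurable_funM.
  exact: (measurableT_comp mv (arrive_meas Hlevy HE s N j)).
apply: measurableT_comp => //; apply: measurable_funB => //.
exact: (levy_meas (Hlevy' j)).
Qed.

(** The exceedance event is a Borel condition on finitely many grid sums, so [grid_Ex] applied to
    its indicator carries [dev_max] from [P] to [Q]. *)
Lemma devQ_grid (t : nat -> R) m e : t 0%N = 0 -> (forall k, t k <= t k.+1) -> 0 <= e ->
  e ^+ 2 * prob Q [set w | exists k : 'I_m.+1, e <= `|devQ (t k) w|] <=
  N%:R * (Ex P (fun w => v (xi 0%N s w) ^+ 2) * expR (t m * (ps 2 - 2 * ps 1))).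
Proof.
move=> t0 tm e0.
(* The grid of [dev_max] has the extra initial time 0, so its index is one ahead of that of [t]. *)
pose r (k : nat) := if k is k'.+1 then s + t k' else 0.
have rm k : r k <= r k.+1 by case: k => [|k]/=; [rewrite t0 addr0|rewrite lerD2l].
have r1 : r 1%N = s by rewrite /= t0 addr0.
have := @dev_max _ _ _ P xi Hlevy Hident Hindep Hm r erefl rm v N m mv.
rewrite r1 => /(_ iv e e0); rewrite (_ : r m.+1 - s = t m); last by rewrite /= addrC addKr.
apply: le_trans; rewrite ler_wpM2l ?exprn_ge0//.
pose B : set (m.+1.-tuple R) := [set z | exists k : 'I_m.+1, e <= `|tnth z k * expR (- (ps 1 * t k)) - mean|].
have mB : measurable B.
  apply: fin_exists_measurable => k; rewrite -[X in measurable X]setTI; apply: measurable_fun_ler => //.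
  apply: measurableT_comp => //; apply: measurable_funB => //; apply: measurable_funM => //; exact: measurable_tnth.
have mi : measurable_fun setT (\1_B : m.+1.-tuple R -> R) by exact: measurable_indic.
have i1 z : `|\1_B z| <= 1 :> R by rewrite indicE; case: (_ \in _); rewrite ?normr1 ?normr0.
have := grid_Ex Hlevy Hident Hindep Hlevy' Hident' Hindep' HE N s0 t0 tm mv v0 mi i1.
have preE (d0 : measure_display) (O : measurableType d0) (mu : probability O R) (S : 'I_m.+1 -> O -> R) :
    (forall k, measurable_fun setT (S k)) -> Ex mu (fun w => \1_B [tuple S k w | k < m.+1]) =
    prob mu [set w | exists k : 'I_m.+1, e <= `|S k w * expR (- (ps 1 * t k)) - mean|].
  move=> mS; rewrite -Ex_indic; last first.
    apply: fin_exists_measurable => k; rewrite -[X in measurable X]setTI; apply: measurable_fun_ler => //.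
    by apply: measurableT_comp => //; apply: measurable_funB => //; apply: measurable_funM.
  congr (Ex mu _); apply/funext => w; rewrite !indicE; congr (_%:R); congr (nat_of_bool _).
  by apply/idP/idP => /set_mem[k h]; apply/mem_set; exists k; move: h; rewrite tnth_mktuple.
rewrite !preE; first last.
- by move=> k; apply: gridS_meas.
- by move=> k; apply: (gridS'_meas Hlevy Hlevy' HE).
move=> eqPQ; rewrite le_eqVlt; apply/orP; left; apply/eqP.
have dQ (k : 'I_m.+1) w : devQ (t k) w = gridS' P xi xi' E s t N v k w * expR (- (ps 1 * t k)) - mean.
  by rewrite /devQ /gridS' mulr_suml; congr (_ - _); apply: eq_bigr => j _; rewrite expRD mulrA.
have dP (k : 'I_m.+1) w : dev P xi r v N k w = gridS xi s t N v k w * expR (- (ps 1 * t k)) - mean.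
  rewrite /dev /gridS /mean -r1 mulr_suml; congr (_ - _); apply: eq_bigr => i _.
  rewrite /mart -mulrA -expRD r1; congr (_ * expR _); rewrite /= -/ps; ring.
transitivity (prob Q [set w | exists k : 'I_m.+1, e <= `|gridS' P xi xi' E s t N v k w * expR (- (ps 1 * t k)) - mean|]).
  by congr prob; apply/seteqP; split => w /= [k h]; exists k; rewrite ?dQ// -dQ.
rewrite -eqPQ; congr prob; apply/seteqP; split => w /= [k].
  by move=> h; exists k; [rewrite -ltnS|rewrite dP].
by move=> km h; have km' : (k < m.+1)%N by []; exists (Ordinal km'); rewrite -dP.
Qed.

Variable T : R.
Hypothesis T0 : 0 < T.

Definition dyadic (p k : nat) : R := k%:R * (T / (2 ^ p)%:R).

Lemma dyadic_itv p k : (k <= 2 ^ p)%N -> 0 <= dyadic p k <= T.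
Proof.
move=> kp; have p0 : 0 < (2 ^ p)%:R :> R by rewrite ltr0n expn_gt0.
rewrite mulr_ge0 ?divr_ge0 ?(ltW T0)//= /dyadic mulrCA ger_pMr// ler_pdivrMr// mul1r ler_nat//.
Qed.

Definition dev_event (e : R) : set Om' :=
  [set w | exists p k, (k <= 2 ^ p)%N /\ e <= `|devQ (dyadic p k) w|].

(** Dyadic grids are nested, index k becoming 2 k, so the events increase; the bound does not depend
    on the mesh and passes to their union. *)
Lemma dev_event_prob e : 0 <= e -> measurable (dev_event e) /\ e ^+ 2 * prob Q (dev_event e) <=
  N%:R * (Ex P (fun w => v (xi 0%N s w) ^+ 2) * expR (T * (ps 2 - 2 * ps 1))).
Proof.
move=> e0; pose A p := [set w | exists k : 'I_(2 ^ p).+1, e <= `|devQ (dyadic p k) w|].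
have mA p : measurable (A p).
  apply: fin_exists_measurable => k; rewrite -[X in measurable X]setTI; apply: measurable_fun_ler => //.
  by apply: measurableT_comp => //; exact: devQ_meas.
have AE : dev_event e = \bigcup_p A p.
  apply/seteqP; split => w /=; first by move=> [p [k [kp h]]]; exists p => //; exists (Ordinal (kp : (k < (2 ^ p).+1)%N)).
  by move=> [p _ [k h]]; exists p, k; split => //; rewrite -ltnS.
have mU : measurable (dev_event e) by rewrite AE; exact: bigcupT_measurable.
split => //.
have bnd p : e ^+ 2 * prob Q (A p) <= N%:R * (Ex P (fun w => v (xi 0%N s w) ^+ 2) * expR (T * (ps 2 - 2 * ps 1))).
  (* Capping at T gives a monotone sequence on all naturals that agrees with the dyadic grid on the
     indices used. *)
  pose t k := Num.min (dyadic p k) T.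
  have p0 : 0 < (2 ^ p)%:R :> R by rewrite ltr0n expn_gt0.
  have t0 : t 0%N = 0 by rewrite /t /dyadic mul0r min_l// ltW.
  have tm k : t k <= t k.+1.
    by rewrite /t le_min2//= /dyadic ler_wpM2r ?divr_ge0 ?(ltW T0)// ler_nat.
  have tp : t (2 ^ p)%N = T by rewrite /t /dyadic mulrC divfK ?gt_eqF// minxx.
  have := devQ_grid (2 ^ p) t0 tm e0; rewrite tp; apply: le_trans.
  rewrite ler_wpM2l ?exprn_ge0// prob_le//.
    apply: fin_exists_measurable => k; rewrite -[X in measurable X]setTI; apply: measurable_fun_ler => //.
    by apply: measurableT_comp => //; exact: devQ_meas.
  move=> w [k h]; exists k; rewrite /t min_l//.
  by have /andP[] := @dyadic_itv p k (ltn_ord k).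
have cv : (fun p => e ^+ 2 * prob Q (A p)) @ \oo --> e ^+ 2 * prob Q (dev_event e).
  apply: cvgMr; have := @nondecreasing_cvg_mu _ _ _ Q A mA; rewrite -AE => /(_ mU) H.
  apply: (fine_cvg (f := Q \o A)); rewrite -prob_EFin//; apply: H.
  apply/nondecreasing_seqP => p; apply/subsetPset => w [k h].
  have k2 : (k.*2 < (2 ^ p.+1).+1)%N by rewrite ltnS expnS mul2n leq_double -ltnS.
  exists (Ordinal k2); rewrite (_ : dyadic _ _ = dyadic p k)//=.
  rewrite /dyadic /= expnS natrM -muln2 natrM; field.
  by rewrite pnatr_eq0 -lt0n expn_gt0.
rewrite -(cvg_lim _ cv)//; apply: limr_le; first exact: cvgP cv.
exact: nearW.
Qed.
End Deviation.

Section Paths.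
Context {R : realType}.

Lemma cadlag0_on (T : R) (x : R -> R) : cadlag0 x -> cadlag_on T x.
Proof. by move=> [h1 h2]; split => t /andP[t0 tT]; [exact: h1|exact: h2]. Qed.

Lemma cadlag0_shift (s : R) (x : R -> R) : 0 <= s -> cadlag0 x -> cadlag0 (fun t => x (s + t)).
Proof.
move=> s0 [h1 h2]; split=> t t0.
  have /h1 : 0 <= s + t by rewrite addr_ge0.
  move=> h A /h [e /= e0 H]; exists e => // u /= ut tu.
  by apply: H; rewrite /= ?ltrD2l// opprD addrACA subrr add0r.
have /h2 xl : 0 < s + t by rewrite ltr_wpDl.
apply/cvg_ex; exists (lim (x @ (s + t)^'-)) => A /xl [e /= e0 H]; exists e => // u /= ut tu.
by apply: H; rewrite /= ?ltrD2l// opprD addrACA subrr add0r.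
Qed.

Lemma cadlag_expsum (T : R) n (a : 'I_n -> R) (x : 'I_n -> R -> R) (c b k : R) :
  (forall i, cadlag0 (x i)) ->
  cadlag_on T (fun t => \sum_(i < n) a i * expR (x i t - c * t) - b * expR (k * t)).
Proof.
move=> cx.
have H (F : set_system R) (t : R) (y : 'I_n -> R) : Filter F -> id @ F --> t -> (forall i, x i @ F --> y i) ->
    (fun t => \sum_(i < n) a i * expR (x i t - c * t) - b * expR (k * t)) @ F -->
    \sum_(i < n) a i * expR (y i - c * t) - b * expR (k * t).
  move=> FF Ft Fx; apply: cvgB.
    apply: cvg_big => [|i _]; first by move=> z; apply: add_continuous.
    apply: cvgMr; apply: continuous_cvg; first exact: continuous_expR.
    by apply: cvgB => //; exact: cvgMr.
  by apply: cvgMr; apply: continuous_cvg; [exact: continuous_expR|exact: cvgMr].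
split=> t /andP[t0 tT].
  by apply: H; [exact: cvg_at_right_filter|move=> i; apply: (cx i).1].
apply/cvg_ex; exists (\sum_(i < n) a i * expR (lim (x i @ t^'-) - c * t) - b * expR (k * t)).
by apply: H; [exact: cvg_at_left_filter|move=> i; apply: (cx i).2].
Qed.

(** A violation at t < T would persist immediately to the right of t, where dyadic points lie; T
    itself is dyadic. *)
Lemma dyadic_ext (T e : R) (g : R -> R) : 0 < T -> (forall t, 0 <= t < T -> g @ t^'+ --> g t) ->
  (forall p k, (k <= 2 ^ p)%N -> `|g (dyadic T p k)| <= e) -> forall t, 0 <= t <= T -> `|g t| <= e.
Proof.
move=> T0 gr gd t /andP[t0]; rewrite le_eqVlt => /orP[/eqP ->|tT].
  by have := gd 0%N 1%N isT; rewrite /dyadic expn0 divr1 mul1r.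
rewrite leNgt; apply/negP => eg.
have gt : g @ t^'+ --> g t by apply: gr; rewrite t0.
have [eta /= eta0 H] : \forall u \near t^'+, e < `|g u| by apply: (cvgr_gt _ (cvg_norm gt)).
have [p hp] : exists p, T / (2 ^ p)%:R < eta.
  have q0 : 0 < eta / T by rewrite divr_gt0.
  have [p _ /(_ p (leqnn p)) /= Hp] := @near_infty_natSinv_lt R (PosNum q0).
  exists p; rewrite mulrC -ltr_pdivlMr// (le_lt_trans _ Hp)// lef_pV2 ?posrE ?ltr0n ?expn_gt0// ler_nat.
  exact: ltn_expl.
have p0 : 0 < (2 ^ p)%:R :> R by rewrite ltr0n expn_gt0.
set h := T / _ in hp; have h0 : 0 < h by rewrite divr_gt0.
have /andP[i1 i2] := truncn_itv (divr_ge0 t0 (ltW h0)); set i := Num.truncn _ in i1 i2.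
rewrite ler_pdivlMr// in i1; rewrite ltr_pdivrMr// in i2.
have ip : (i.+1 <= 2 ^ p)%N.
  rewrite -(ltr_nat R) -(ltr_pM2r h0) (le_lt_trans i1)// /h mulrC divfK ?gt_eqF//.
have := gd p i.+1 ip; rewrite leNgt => /negP; apply; apply: H => //=.
rewrite distrC ger0_norm ?subr_ge0 ?(ltW i2)// ltrBlDl (le_lt_trans _ (_ : t + h < _)) ?ltrD2l//.
by rewrite /dyadic -/h -natr1 mulrDl mul1r lerD2r.
Qed.

Lemma geo2_cvg0 : (fun m => (2 ^+ m)^-1 : R) @ \oo --> (0 : R).
Proof. by under eq_fun do rewrite -exprVn; apply: cvg_expr; rewrite ger0_norm; lra. Qed.

(** The second hypothesis identifies the limit of [x]; the first, summed from k on, gives 3 * 2 *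
    2^-k. *)
Lemma geometric_limit (x y : nat -> R) (z : R) k0 :
  (forall k, (k0 <= k)%N -> `|x k - x k.+1| <= 3 * (2 ^+ k)^-1) ->
  (forall k, (k0 <= k)%N -> `|x k - y k| <= 2 * (2 ^+ k)^-1) -> y @ \oo --> z ->
  forall k, (k0 <= k)%N -> `|x k - z| <= 6 * (2 ^+ k)^-1.
Proof.
move=> h1 h2 yz k kk.
have geo := geo2_cvg0.
have xz : x @ \oo --> z.
  rewrite -[X in _ --> X]add0r (_ : x = (fun m => (x m - y m) + y m)); last by apply/funext => m; rewrite subrK.
  apply: cvgD => //; apply: norm_cvg0.
  apply: (@squeeze_cvgr _ _ _ _ (fun=> 0) (fun m => 2 * (2 ^+ m)^-1)).
  - by near=> m; rewrite normr_ge0/= h2//; near: m; exact: nbhs_infty_ge.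
  - exact: cvg_cst.
  - by rewrite -(mulr0 2); exact: cvgMr.
have tele m : `|x k - x (k + m)%N| <= 6 * (2 ^+ k)^-1 - 6 * (2 ^+ (k + m))^-1.
  elim: m => [|m IH]; first by rewrite addn0 !subrr normr0.
  rewrite (le_trans (ler_distD (x (k + m)%N) _ _))// addnS.
  have := h1 (k + m)%N (leq_trans kk (leq_addr _ _)).
  have -> : (2 ^+ (k + m).+1)^-1 = (2 ^+ (k + m))^-1 / 2 :> R by rewrite exprS invfM mulrC.
  by move: IH; lra.
have cv : (fun m => `|x k - x (k + m)%N|) @ \oo --> `|x k - z|.
  apply: cvg_norm; apply: cvgB; first exact: cvg_cst.
  by apply: (@cvg_ext R _ (fun m => x (m + k)%N) z) => [||m]; rewrite ?cvg_shiftn// addnC.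
rewrite -(cvg_lim _ cv)//; apply: limr_le; first exact: cvgP cv.
apply: nearW => m; apply: le_trans (tele m) _; rewrite gerBl mulr_ge0// invr_ge0 exprn_ge0//.
Unshelve. all: by end_near.
Qed.
End Paths.

Section Atoms.
Context {d d' : measure_display} {Om : measurableType d} {Om' : measurableType d'} {R : realType}
  (P : probability Om R) (xi : nat -> R -> Om -> R) (E : nat -> Om' -> R) (s l : nat -> R) (alpha : R).
Hypothesis alpha0 : 0 < alpha.
Hypothesis mxi : forall t, measurable_fun setT (xi 0%N t).
Hypothesis tl : forall x,
  (fun N => N%:R * prob P [set w | x < xi 0%N (s N) w - l N]) @ \oo --> expR (- alpha * x).

Definition weight N j w : R := expR (arrive P xi E (s N) N j w - l N).
Definition trunc (u y : R) : R := if expR u < y then y else 0.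

Variable w : Om'.
Hypothesis E_gt0 : forall j, 0 < E j w.
Hypothesis Gam_unb : forall C, exists j, C < Gam E j w.
Variable u : R.
Hypothesis no_atom : forall j, Upt alpha E j w != expR u.

Let W_cvg j : (fun N => weight N j w) @ \oo --> Upt alpha E j w.
Proof. exact: arrive_cvg. Qed.

Let trunc_cvg j : (fun N => trunc u (weight N j w)) @ \oo --> trunc u (Upt alpha E j w).
Proof.
rewrite /trunc; case: ltgtP (no_atom j) => // h _.
  have e : \forall N \near \oo, weight N j w = (if expR u < weight N j w then weight N j w else 0).
    by apply: filterS (cvgr_gt _ (@W_cvg j) _ h) => N ->.
  exact: (cvg_trans (near_eq_cvg e) (@W_cvg j)).
by apply: cvg_near_cst; apply: filterS (cvgr_lt _ (@W_cvg j) _ h) => N /ltW wu; rewrite ltNge wu.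
Qed.

Let Gam_mono j k : (j <= k)%N -> Gam E j w <= Gam E k w.
Proof.
move=> jk; rewrite /Gam (big_ord_widen k.+1 (fun l => E l w))//.
by rewrite [leRHS](bigID (fun l : 'I_k.+1 => (l < j.+1)%N))/= lerDl sumr_ge0// => i _; exact: ltW.
Qed.

Let cut : exists J, Upt alpha E J w < expR u /\ forall j, (J <= j)%N -> Upt alpha E j w < expR u.
Proof.
have Upt_lt j : expR (- alpha * u) < Gam E j w -> Upt alpha E j w < expR u.
  move=> h; have g0 := lt_trans (expR_gt0 _) h.
  rewrite /Upt /powR gt_eqF// ltr_expR mulNr -ltrN2 opprK ltr_pdivlMl//.
  by rewrite mulrN -mulNr -ltr_expR lnK.
have [J HJ] := Gam_unb (expR (- alpha * u)).
by exists J; split=> [|j Jj]; apply: Upt_lt => //; exact: lt_le_trans (Gam_mono Jj).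
Qed.

(** Weights decrease with the rank, so once the one of rank J is below e^u only J terms survive.
    These converge because no limit point sits on the cut, and bounded factors make the convergence
    uniform in [t]. *)
Lemma trunc_sum_cvg (x : nat -> R -> R) (M : nat -> R) (D : set R) :
  (forall j t, D t -> `|x j t| <= M j) -> forall e, 0 < e ->
  \forall N \near \oo, forall t, D t ->
   `|\sum_(j < N) trunc u (weight N j w) * x j t - limn (fun n => \sum_(j < n) trunc u (Upt alpha E j w) * x j t)| <= e.
Proof.
move=> xM e e0; have [J [UJ HJ]] := cut.
have lE t : limn (fun n => \sum_(j < n) trunc u (Upt alpha E j w) * x j t) = \sum_(j < J) trunc u (Upt alpha E j w) * x j t.
  apply: lim_near_cst => //; near=> n.
  have Jn : (J <= n)%N by near: n; exact: nbhs_infty_ge.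
  rewrite (big_ord_widen n (fun j => trunc u (Upt alpha E j w) * x j t) Jn) [RHS]big_mkcond.
  apply: eq_bigr => j _; case: ltnP => // Jj.
  by rewrite /trunc ltNge (ltW (HJ j Jj)) mul0r.
pose om N j := trunc u (weight N j w) - trunc u (Upt alpha E j w).
have c0 : (fun N => \sum_(j < J) `|om N j| * M j) @ \oo --> (0 : R).
  have : (fun N => \sum_(j < J) `|om N j| * M j) @ \oo --> (\sum_(j < J) 0 : R); last by rewrite big1.
  apply: cvg_big => [|j _]; first by move=> z; apply: add_continuous.
  have cj : (fun N => `|om N j|) @ \oo --> `|0 : R|.
    apply: cvg_norm; rewrite -(subrr (trunc u (Upt alpha E j w))).
    by apply: cvgB; [exact: trunc_cvg|exact: cvg_cst].
  by rewrite normr0 in cj; rewrite -(mul0r (M j)); exact: cvgMl.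
near=> N.
have JN : (J < N)%N by near: N; exact: nbhs_infty_gt.
have WJ : weight N J w < expR u by near: N; exact: (cvgr_lt _ (@W_cvg J)).
have sm : \sum_(j < J) `|om N j| * M j <= e by near: N; exact: (cvgr_le _ c0).
move=> t Dt; rewrite lE.
have sp0 j : (j < N)%N -> 0 < spacing E N 0 j w.
  move=> jN; rewrite /spacing big_ord_recl ltr_wpDr ?sumr_ge0// => [i _|]; first by rewrite divr_ge0// ltW.
  by rewrite divr_gt0// subn0 ltr0n (leq_ltn_trans _ jN).
have gtE j : (j < N)%N -> (expR u < weight N j w) = (1 - expR (- spacing E N 0 j w) < survival P (xi 0%N (s N)) (u + l N)).
  by move=> jN; rewrite /weight ltr_expR ltrBrDr /arrive qt_gt// sp0.
have Wj j : (J <= j)%N -> (j < N)%N -> weight N j w <= expR u.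
  move=> Jj jN; rewrite leNgt gtE//; apply/negP => h.
  move: WJ; rewrite ltNge => /negP; apply; rewrite ltW// gtE//.
  apply: le_lt_trans h; rewrite lerB// ler_expR lerN2 /spacing.
  rewrite (big_ord_widen j.+1 (fun i => E (0 + i)%N w / (N - i)%:R))// [leRHS](bigID (fun i : 'I_j.+1 => (i < J.+1)%N))/= lerDl.
  by rewrite sumr_ge0// => i _; rewrite divr_ge0// ltW.
have -> : \sum_(j < N) trunc u (weight N j w) * x j t = \sum_(j < J) trunc u (weight N j w) * x j t.
  rewrite (big_ord_widen N (fun j => trunc u (weight N j w) * x j t) (ltnW JN)) [RHS]big_mkcond.
  apply: eq_bigr => j _; case: ltnP => // Jj.
  by rewrite /trunc ltNge (Wj j Jj (ltn_ord j)) mul0r.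
apply: le_trans sm; rewrite -sumrB (le_trans (ler_norm_sum _ _ _))//.
by apply: ler_sum => j _; rewrite -mulrBl normrM ler_wpM2l// xM.
Unshelve. all: by end_near.
Qed.
End Atoms.

(** * Almost sure uniform convergence of the coupled processes *)

Section Coupling.
Context {d d' : measure_display} {Om : measurableType d} {Om' : measurableType d'} {R : realType}
  (P : probability Om R) (Q : probability Om' R)
  (xi : nat -> R -> Om -> R) (xi' : nat -> R -> Om' -> R) (E : nat -> Om' -> R).
Local Notation intble f := (P.-integrable setT (EFin \o f)).
Hypothesis Hlevy : forall i, levy P (xi i).
Hypothesis Hident : forall i, fdd_eq P (xi i) P (xi 0%N).
Hypothesis Hindep : indep_family P xi.
Hypothesis Hm : forall u : R, intble (fun w => expR (u * xi 0%N 1 w)).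
Hypothesis Hlevy' : forall i, levy Q (xi' i).
Hypothesis Hident' : forall i, fdd_eq Q (xi' i) P (xi 0%N).
Hypothesis Hindep' : indep_family Q xi'.
Hypothesis HE : exp_indep Q E xi'.
Variables (s l be : nat -> R) (alpha c T : R) (bl : R -> R) (Y : Om' -> R -> R).
Hypotheses (s_ge0 : forall N, 0 <= s N) (alpha0 : 0 < alpha) (T0 : 0 < T).
Let ps1 := psi P (xi 0%N) 1.
Let k1 := ps1 - c.
Let Yv N w := xi 0%N (s N) w - l N.
Hypothesis tl : forall x, (fun N => N%:R * prob P [set w | x < xi 0%N (s N) w - l N]) @ \oo --> expR (- alpha * x).
Hypothesis second_moment : forall e, 0 < e -> exists u0, forall u, u <= u0 -> \forall N \near \oo,
  N%:R * Ex P (fun w => if Yv N w <= u then expR (2 * Yv N w) else 0) <= e.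
Hypothesis centering : forall e, 0 < e -> exists u0, forall u, u <= u0 -> \forall N \near \oo,
  `|be N - N%:R * Ex P (fun w => if Yv N w <= u then expR (Yv N w) else 0) - bl u| <= e.
Hypothesis Ylimit : {ae Q, forall w, forall t, 0 <= t ->
  (fun tau => limn (fun n => \sum_(i < n) trunc (ln tau) (Upt alpha E i w) * expR (xi' i t w - c * t))
     - bl (ln tau) * expR (k1 * t)) @ 0^'+ --> Y w t}.
Hypothesis Ymeas : forall t, measurable_fun setT (fun w => Y w t).
Hypothesis Ycadlag : forall w, cadlag0 (Y w).

Local Notation W := (weight P xi E s l).
Let v N u x : R := if x - l N <= u then expR (x - l N) else 0.

(** The coupled copy of (Z_N - A_N) / B_N: [be] stands for A_N(0) / B_N(0), and e^(k1 t) for the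
    growth of A_N relative to that of B_N. *)
Definition approx N w t := \sum_(j < N) W N j w * expR (xi' j t w - c * t) - be N * expR (k1 * t).

Let bg N u t w := \sum_(j < N) trunc u (W N j w) * expR (xi' j t w - c * t).
Let dv N u t w := devQ P xi xi' E (s N) N (v N u) t w.
Let cen N u := be N - N%:R * Ex P (fun w => if Yv N w <= u then expR (Yv N w) else 0) - bl u.

(** Cut at level u: large weights with the limiting compensator [bl u], then the compensated small
    weights [dv], and finally the error [cen] of replacing the true centring by its limit. *)
Let approx_split N u w t :
  approx N w t = (bg N u t w - bl u * expR (k1 * t)) + expR (k1 * t) * (dv N u t w - cen N u).
Proof.
have k1E j : expR (xi' j t w - c * t) = expR (k1 * t) * expR (xi' j t w - ps1 * t).
  by rewrite -expRD; congr expR; rewrite /k1; ring.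
have spl j : W N j w * expR (xi' j t w - c * t) = trunc u (W N j w) * expR (xi' j t w - c * t) +
    expR (k1 * t) * (v N u (arrive P xi E (s N) N j w) * expR (xi' j t w - ps1 * t)).
  rewrite [X in _ = _ + X]mulrCA -k1E -mulrDl; congr (_ * _).
  by rewrite /trunc /v /weight ltr_expR; case: ltP => _; rewrite ?addr0 ?add0r.
rewrite /approx (eq_bigr _ (fun j _ => spl (nat_of_ord j))) big_split/= -mulr_sumr -/(bg N u t w).
rewrite /dv /devQ /cen /v /Yv -/ps1; ring.
Qed.

Let mv N u : measurable_fun setT (v N u).
Proof.
have mx : measurable_fun setT (fun x : R => x - l N) by exact: measurable_funB.
apply: measurable_fun_ifT => //; first exact: measurable_fun_ler.
exact: measurableT_comp.
Qed.

Let v0 N u x : 0 <= v N u x.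
Proof. by rewrite /v; case: ifP. Qed.

Let v2E N u w : v N u (xi 0%N (s N) w) ^+ 2 = if Yv N w <= u then expR (2 * Yv N w) else 0.
Proof. by rewrite /v /Yv; case: ifP => _; rewrite ?expr0n//= -expRM_natl. Qed.

Let mxi i t : measurable_fun setT (xi i t) := levy_meas (Hlevy i) t.
Let mxi' i t : measurable_fun setT (xi' i t) := levy_meas (Hlevy' i) t.

Let iv N u : intble (fun w => v N u (xi 0%N (s N) w) ^+ 2).
Proof.
apply: (@intble_le _ _ _ P _ (fun w => expR (- (2 * l N)) * expR (2 * xi 0%N (s N) w))).
- by apply: measurable_funX; exact: measurableT_comp.
- move=> w; rewrite v2E -expRD /Yv; case: ifP => _; rewrite ?normr0 ?expR_ge0//.
  by rewrite ger0_norm ?expR_ge0// ler_expR le_eqVlt; apply/orP; left; apply/eqP; ring.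
- by apply: intbleZl; exact: (exp_intble (Hlevy 0%N) Hm).
Qed.

Let mW N j : measurable_fun setT (W N j).
Proof.
by apply: measurableT_comp => //; apply: measurable_funB => //; exact: (arrive_meas Hlevy HE (s N) N j).
Qed.

Let mexp j t : measurable_fun setT (fun w => expR (xi' j t w - c * t)).
Proof. by apply: measurableT_comp => //; exact: measurable_funB. Qed.

Let mbg N u t : measurable_fun setT (bg N u t).
Proof.
apply: measurable_sum => j; apply: measurable_funM => //.
by apply: measurable_fun_ifT => //; exact: measurable_fun_ltr.
Qed.

Let mapprox N t : measurable_fun setT (fun w => approx N w t).
Proof. by apply: measurable_funB => //; apply: measurable_sum => j; exact: measurable_funM. Qed.

Lemma approx_cadlag N w : cadlag_on T (approx N w).
Proof.
apply: (@cadlag_expsum R T N (fun j => W N j w) (fun j t => xi' j t w)) => j.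
by case: (Hlevy' j).
Qed.

(** Bounds e^(k1 t) on [0, T]; [err] is scaled so that Kt (err + err) = eps. *)
Let Kt := expR (`|k1| * T).
Let eps (k : nat) : R := (2 ^+ k)^-1.
Let eps0 k : 0 < eps k. Proof. by rewrite invr_gt0 exprn_gt0. Qed.
Let err k := eps k / (2 * Kt).
Let Kt0 : 0 < Kt. Proof. exact: expR_gt0. Qed.
Let err0 k : 0 < err k. Proof. by rewrite divr_gt0// mulr_gt0. Qed.

Let dev_ev N u k := dev_event P xi xi' E (s N) N (v N u) T (err k).

Let mdev N u k : measurable (dev_ev N u k).
Proof. by have [] := dev_event_prob Hlevy Hident Hindep Hm Hlevy' Hident' Hindep' HE N (s_ge0 N) (mv N u) (v0 N u) (iv N u) T0 (ltW (err0 k)). Qed.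

(** Chebyshev through [dev_event_prob]: a truncated second moment of at most eps err^2 / C makes the
    deviation event have probability at most eps. Taking u_k <= -k sends the cut to zero. *)
Let levels : exists u : nat -> R, (forall k, u k <= - k%:R) /\
  forall k, \forall N \near \oo, prob Q (dev_ev N (u k) k) <= eps k /\ `|cen N (u k)| <= err k.
Proof.
suff /choice[u Hu] : forall k : nat, exists u, u <= - k%:R /\
    \forall N \near \oo, prob Q (dev_ev N u k) <= eps k /\ `|cen N u| <= err k.
  by exists u; split=> k; case: (Hu k).
move=> k; pose C := expR (T * (psi P (xi 0%N) 2 - 2 * psi P (xi 0%N) 1)).
have C0 : 0 < C by exact: expR_gt0.
have e0 : 0 < eps k * err k ^+ 2 / C by rewrite divr_gt0// mulr_gt0// exprn_gt0.
have [u1 H1] := second_moment e0; have [u2 H2] := centering (err0 k).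
exists (Num.min (- k%:R) (Num.min u1 u2)); rewrite ge_min lexx; split => //.
set u := Num.min _ _.
have uu1 : u <= u1 by rewrite !ge_min lexx orbT.
have uu2 : u <= u2 by rewrite !ge_min lexx !orbT.
apply: filterS2 (H1 _ uu1) (H2 _ uu2) => N h1 h2; split => //.
have [_] := dev_event_prob Hlevy Hident Hindep Hm Hlevy' Hident' Hindep' HE N (s_ge0 N) (mv N u) (v0 N u) (iv N u) T0 (ltW (err0 k)).
under eq_fun do rewrite v2E.
rewrite -/C mulrA => h3; have p0 : 0 < err k ^+ 2 by rewrite exprn_gt0.
rewrite -(ler_pM2l p0) (le_trans h3)//.
by rewrite ler_pdivlMr// in h1; rewrite [leRHS]mulrC.
Qed.

Section Levels.
Variable u : nat -> R.
Hypothesis uk : forall k, u k <= - k%:R.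
Hypothesis Hu : forall k, \forall N \near \oo, prob Q (dev_ev N (u k) k) <= eps k /\ `|cen N (u k)| <= err k.

Let good w := [/\ forall j, 0 < E j w, forall C, exists j, C < Gam E j w,
  forall j k, Upt alpha E j w != expR (u k) &
  forall t, 0 <= t ->
  (fun tau => limn (fun n => \sum_(i < n) trunc (ln tau) (Upt alpha E i w) * expR (xi' i t w - c * t))
     - bl (ln tau) * expR (k1 * t)) @ 0^'+ --> Y w t].

Let good_ae : {ae Q, forall w, good w}.
Proof.
case: (HE) => mE tE _.
have indE (n : nat) (C : nat -> set R) : (forall j, measurable (C j)) ->
    prob Q (\bigcap_(j in `I_n) [set w | C j (E j w)]) = \prod_(j < n) prob Q [set w | C j (E j w)].
  exact: (exp_indep_prod HE).
have na : {ae Q, forall w, forall j k, Gam E j w != expR (- alpha * u k)}.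
  apply: ae_foralln => j; apply: ae_foralln => k.
  apply: (ae_prob0 _ (Gam_noatom mE tE indE j (expR (- alpha * u k)))).
    rewrite (_ : [set w | _] = Gam E j @^-1` [set expR (- alpha * u k)])//.
    by rewrite -[X in measurable X]setTI; apply: measurable_sum => //; exact: measurable_set1.
  by move=> w /= /negP; rewrite negbK => /eqP.
apply: filterS2 (filterI (exp_pos_ae mE tE) (Gam_unbounded_ae mE tE indE)) (filterI na Ylimit) => w [h1 h2] [h3 h4].
split => // j k; apply: contra (h3 j k) => /eqP UE.
have g0 : 0 < Gam E j w by rewrite /Gam big_ord_recl ltr_wpDr// sumr_ge0// => i _; exact: ltW.
move: UE; rewrite /Upt /powR gt_eqF// => /expR_inj <-.
by rewrite mulrA mulrNN divff ?(gt_eqF alpha0)// mul1r lnK.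
Qed.

(** Truncated sums converge almost surely without a rate; this event turns that into a probability
    estimate against all later indices M and all dyadic times at once. *)
Let cauchy_ev k N := [set w | exists M p i,
  [/\ (N <= M)%N, (i <= 2 ^ p)%N & eps k < `|bg N (u k) (dyadic T p i) w - bg M (u k) (dyadic T p i) w|]].

Let mcauchy k N : measurable (cauchy_ev k N).
Proof.
have -> : cauchy_ev k N = \bigcup_(x : nat * nat * nat) (if (N <= x.1.1)%N && (x.2 <= 2 ^ x.1.2)%N then
    [set w | eps k < `|bg N (u k) (dyadic T x.1.2 x.2) w - bg x.1.1 (u k) (dyadic T x.1.2 x.2) w|] else set0).
  apply/seteqP; split => w /=.
    by move=> [M [p [i [NM ip h]]]]; exists (M, p, i) => //=; rewrite NM ip.
  by move=> [[[M p] i] _ /=]; case: ifP => // /andP[NM ip] h; exists M, p, i.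
apply: countable_bigcupT_measurable => [|[[M p] i]/=]; first exact: countableP.
case: ifP => // _; rewrite -[X in measurable X]setTI; apply: measurable_fun_ltr => //.
by apply: measurableT_comp => //; exact: measurable_funB.
Qed.

Let bgL k t w := limn (fun n => \sum_(i < n) trunc (u k) (Upt alpha E i w) * expR (xi' i t w - c * t)).

Let bg_cvg k w : good w -> forall e, 0 < e ->
  \forall N \near \oo, forall t, 0 <= t <= T -> `|bg N (u k) t w - bgL k t w| <= e.
Proof.
move=> [h1 h2 h3 _] e e0.
have /choice[Mb HM] (j : nat) : exists Mb, forall t, 0 <= t <= T -> `|expR (xi' j t w - c * t)| <= Mb.
  have cx : forall i : 'I_1, cadlag0 (fun t => xi' j t w) by move=> _; case: (Hlevy' j).
  have [Mb H] := cadlag_bounded T0 (@cadlag_expsum R T 1 (fun=> 1) (fun _ t => xi' j t w) c 0 0 cx).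
  by exists Mb => t /H; rewrite big_ord1 mul1r mul0r subr0.
exact: (@trunc_sum_cvg _ _ _ _ R P xi E s l alpha alpha0 (mxi 0%N) tl w h1 h2 (u k) (h3^~ k)
  (fun j t => expR (xi' j t w - c * t)) Mb [set t | 0 <= t <= T] (fun j t => HM j t) e e0).
Qed.

Let cauchy_prob k : \forall N \near \oo, prob Q (cauchy_ev k N) <= eps k.
Proof.
have mi N : measurable_fun setT (fun w => (\1_(cauchy_ev k N) w)%:E : \bar R).
  by apply/measurable_EFinP; exact: measurable_indic.
have i1 : {ae Q, forall w, forall N, setT w -> (`|(\1_(cauchy_ev k N) w)%:E| <= (1 : R)%:E)%E}.
  by apply: aeW => w N _; rewrite indicE; case: (_ \in _); rewrite lee_fin ?normr1 ?normr0.
have lim0 : {ae Q, forall w, setT w -> (fun N => (\1_(cauchy_ev k N) w)%:E : \bar R) @ \oo --> (0 : R)%:E}.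
  apply: filterS good_ae => w gw _; apply: cvg_near_cst.
  have e2 : 0 < eps k / 2 by rewrite divr_gt0.
  have [n _ Hn] := bg_cvg k gw e2; exists n => // N nN; congr EFin.
  rewrite indicE memNset// => -[M [p [i [NM ip]]]]; rewrite ltNge => /negP; apply.
  have tT := dyadic_itv T0 ip.
  rewrite (le_trans (ler_distD (bgL k (dyadic T p i) w) _ _))// [leRHS]splitr lerD//; first exact: (Hn N nN _ tT).
  by rewrite distrC; exact: (Hn M (leq_trans nN NM) _ tT).
have [_ _ cv] := @dominated_convergence _ _ R Q setT measurableT (fun N w => (\1_(cauchy_ev k N) w)%:E) (fun=> 0%:E) (fun=> 1%:E)
  mi (measurable_cst _) lim0 (intble_cst Q 1) i1.
have E0 : (\int[Q]_(w in setT) 0%:E = (0 : R)%:E)%E by rewrite integral0.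
rewrite E0 in cv.
have EN N : (\int[Q]_(w in setT) (\1_(cauchy_ev k N) w)%:E = (prob Q (cauchy_ev k N))%:E)%E.
  by rewrite -prob_EFin// integral_indic// setIT.
have cv2 : (fun N => prob Q (cauchy_ev k N)) @ \oo --> (0 : R).
  have h : (fine \o (fun N => \int[Q]_(w in setT) (\1_(cauchy_ev k N) w)%:E)%E) @ \oo --> (0 : R) by exact: (fine_cvg cv).
  by rewrite (_ : (fun N => _) = fine \o (fun N => \int[Q]_(w in setT) (\1_(cauchy_ev k N) w)%:E)%E)//; apply/funext => N /=; rewrite EN.
exact: (cvgr_le _ cv2).
Qed.

Lemma threshold : exists n : nat -> nat, forall k N, (n k <= N)%N ->
  [/\ prob Q (dev_ev N (u k) k) <= eps k, `|cen N (u k)| <= err k & prob Q (cauchy_ev k N) <= eps k].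
Proof.
suff /choice[n Hn] : forall k, exists n, forall N, (n <= N)%N ->
  [/\ prob Q (dev_ev N (u k) k) <= eps k, `|cen N (u k)| <= err k & prob Q (cauchy_ev k N) <= eps k] by exists n.
move=> k; have [n1 _ h1] := Hu k; have [n2 _ h2] := cauchy_prob k.
exists (maxn n1 n2) => N; rewrite geq_max => /andP[n1N n2N].
by have [h3 h4] := h1 N n1N; split => //; exact: h2.
Qed.

Variables (n nu : nat -> nat).
Hypothesis Hn : forall k N, (n k <= N)%N ->
  [/\ prob Q (dev_ev N (u k) k) <= eps k, `|cen N (u k)| <= err k & prob Q (cauchy_ev k N) <= eps k].
Hypotheses (nu_ge : forall k, (n k <= nu k)%N) (nu_geS : forall k, (n k <= nu k.+1)%N) (nu_mono : forall k, (nu k <= nu k.+1)%N).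

(** Both nu_k and nu_(k+1) are examined at the same level u_k, so that consecutive approximations
    can be compared there. *)
Let bad k := dev_ev (nu k) (u k) k `|` dev_ev (nu k.+1) (u k) k `|` cauchy_ev k (nu k).

(** Borel-Cantelli for three events of probability at most 2^-k each; the sum is written 6 / 2^(k+1)
    to match the summable bound used. *)
Let eventually_fine : {ae Q, forall w, exists k0, forall k, (k0 <= k)%N -> ~ bad k w}.
Proof.
have mbad k : measurable (bad k) by apply: measurableU; [apply: measurableU|].
have bk k : (Q (bad k) <= (6 / (2 ^ k.+1)%:R)%:E)%E.
  have [h1 _ h2] := Hn (nu_ge k); have [h3 _ _] := Hn (nu_geS k).
  rewrite prob_EFin// lee_fin.
  have -> : 6 / (2 ^ k.+1)%:R = eps k + eps k + eps k.
    by rewrite /eps expnS natrM natrX; field; rewrite expf_neq0.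
  have m1 := mdev (nu k) (u k) k; have m2 := mdev (nu k.+1) (u k) k.
  apply: le_trans (prob_leU Q (measurableU _ _ m1 m2) (mcauchy k (nu k)) (mbad k) (@subset_refl _ _)) _.
  rewrite lerD//; apply: le_trans (prob_leU Q m1 m2 (measurableU _ _ m1 m2) (@subset_refl _ _)) _.
  exact: (lerD h1 h3).
have mls : measurable (lim_sup_set bad).
  by apply: bigcap_measurable => [|j _]; [exists 0%N|exact: bigcup_measurable].
exists (lim_sup_set bad); split => //.
  apply: lim_sup_set_cvg0 => //; apply: (@le_lt_trans _ _ (\sum_(0 <= k <oo) (6 / (2 ^ k.+1)%:R)%:E)%E).
    by apply: lee_nneseries => k _ //; exact: bk.
  by apply: le_lt_trans (epsilon_trick0 xpredT _) (ltry _).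
move=> w /= H m _; apply: contrapT => nb; apply: H; exists m => k mk bw.
by apply: nb; exists k.
Qed.

Let exp_uk : (fun k => expR (u k)) @ \oo --> 0^'+.
Proof.
move=> A [e /= e0 H].
have [k0 _ Hk] : \forall k \near \oo, harmonic k < e by apply: (cvgr_lt 0 (@cvg_harmonic R)).
exists k0 => // k kk; apply: H => //=; last exact: expR_gt0.
rewrite sub0r normrN ger0_norm ?expR_ge0// (le_lt_trans _ (Hk k kk))// /harmonic/=.
apply: (@le_trans _ _ (expR (- k%:R))); first by rewrite ler_expR.
by rewrite expRN lef_pV2 ?posrE ?expR_gt0// -natr1 addrC; exact: expR_ge1Dx.
Qed.

(** At a dyadic time consecutive approximations differ by at most 3 eps: two deviations and one
    difference of truncated sums. They are compared with the truncated limit at level u_k, which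
    tends to Y because tau = e^(u_k) decreases to 0 in the defining limit. *)
Lemma approx_uniform : {ae Q, forall w, exists k0, forall k, (k0 <= k)%N ->
  forall t, 0 <= t <= T -> `|approx (nu k) w t - Y w t| <= 6 * eps k}.
Proof.
apply: filterS2 good_ae eventually_fine => w gw [k0 Hk0]; exists k0 => k kk.
apply: (dyadic_ext T0) => [t tT|p i ip].
  apply: cvgB; first exact: (approx_cadlag (nu k) w).1.
  by apply: (Ycadlag w).1; case/andP : tT.
move: k kk; have tT := dyadic_itv T0 ip; set t := dyadic T p i in tT *.
have t0 : 0 <= t by case/andP : tT.
(* Off the deviation event, what [approx_split] leaves beside the large weights is at most Kt (err +
   err). *)
have near1 k N : (n k <= N)%N -> ~ dev_ev N (u k) k w -> `|approx N w t - (bg N (u k) t w - bl (u k) * expR (k1 * t))| <= eps k.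
  move=> nN nd; have [_ cn _] := Hn nN.
  rewrite (approx_split N (u k)) addrAC subrr add0r normrM ger0_norm ?expR_ge0//.
  have eK : expR (k1 * t) <= Kt.
    rewrite ler_expR (le_trans (ler_norm _))// normrM (ger0_norm t0) ler_wpM2l//.
    by case/andP : tT.
  have -> : eps k = Kt * (err k + err k) by rewrite /err; field; rewrite gt_eqF.
  rewrite ler_pM ?expR_ge0// (le_trans (ler_normB _ _))// lerD//.
  by rewrite leNgt; apply/negP => h; apply: nd; exists p, i; split => //; exact: ltW.
have nb k : (k0 <= k)%N -> [/\ ~ dev_ev (nu k) (u k) k w, ~ dev_ev (nu k.+1) (u k) k w & ~ cauchy_ev k (nu k) w].
  by move=> /Hk0 h; split=> h'; apply: h; [left; left|left; right|right].
have bgM k M : (k0 <= k)%N -> (nu k <= M)%N -> `|bg (nu k) (u k) t w - bg M (u k) t w| <= eps k.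
  move=> /nb[_ _ h] nM; rewrite leNgt; apply/negP => h'; apply: h.
  by exists M, p, i; split.
apply: (@geometric_limit R (fun k => approx (nu k) w t) (fun k => bgL k t w - bl (u k) * expR (k1 * t)) (Y w t) k0) => [k kk|k kk|].
- have [b1 b2 _] := nb k kk.
  have h1 := near1 k (nu k) (nu_ge k) b1; have h2 := near1 k (nu k.+1) (nu_geS k) b2.
  have h3 := bgM k (nu k.+1) kk (nu_mono k).
  rewrite -/(eps k); move: h1 h2 h3; set a := approx _ _ _; set a' := approx _ _ _; set b := bg _ _ _ _; set b' := bg _ _ _ _.
  move: a a' b b' (bl (u k) * expR (k1 * t)) (eps k) => a a' b b' r e h1 h2 h3.
  have -> : a - a' = (a - (b - r)) + (b - b') - (a' - (b' - r)) by ring.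
  rewrite (le_trans (ler_normB _ _))//; have := ler_normD (a - (b - r)) (b - b').
  move: h1 h2 h3; move: `|a - _| `|a' - _| `|b - b'| `|_ + _| => q1 q2 q3 q4; lra.
- have [b1 _ _] := nb k kk; have h1 := near1 k (nu k) (nu_ge k) b1.
  have h2 : `|bg (nu k) (u k) t w - bgL k t w| <= eps k.
    apply/ler_addgt0Pr => e e0; have [m _ Hm'] := bg_cvg k gw e0.
    rewrite (le_trans (ler_distD (bg (maxn m (nu k)) (u k) t w) _ _))// lerD//.
      by apply: bgM => //; exact: leq_maxr.
    by apply: (Hm' (maxn m (nu k))) => //=; exact: leq_maxl.
  rewrite -/(eps k); move: h1 h2; set a := approx _ _ _; set b := bg _ _ _ _; set b' := bgL _ _ _.
  move: a b b' (bl (u k) * expR (k1 * t)) (eps k) => a b b' r e h1 h2.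
  have -> : a - (b' - r) = (a - (b - r)) + (b - b') by ring.
  rewrite (le_trans (ler_normD _ _))//; move: h1 h2; move: `|a - _| `|b - b'| => q1 q2; lra.
- have [_ _ _ /(_ t t0) Yt] := gw.
  have := cvg_comp _ _ exp_uk Yt; apply: cvg_trans; apply: near_eq_cvg; apply: nearW => k /=.
  by rewrite expRK.
Qed.
End Levels.

(** Otherwise some indices keep the expectations at distance [e]. A subsequence of them taken beyond
    all thresholds converges uniformly almost surely, hence in J1 with the identity time change, and
    dominated convergence contradicts the distance. *)
Theorem approx_weak (F : (R -> R) -> R) (M : R) : (forall x, cadlag_on T x -> `|F x| <= M) -> J1continuous T F ->
  (fun N => \int[Q]_w (F (approx N w))%:E)%E @ \oo --> (\int[Q]_w (F (Y w))%:E)%E.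
Proof.
move=> FM Fc; have [u [uk Hu]] := levels; have [n Hn] := @threshold u Hu.
have Yon w := cadlag0_on T (Ycadlag w).
have mFY : measurable_fun setT (fun w => F (Y w)).
  by have [] := @functional_meas R T F T0 Fc _ _ Y Yon (fun t _ => Ymeas t).
have mFa N : measurable_fun setT (fun w => F (approx N w)).
  by have [] := @functional_meas R T F T0 Fc _ _ (approx N) (approx_cadlag N) (fun t _ => mapprox N t).
have ia N : Q.-integrable setT (EFin \o (fun w => F (approx N w))).
  by apply: (@Ex_bnd_int _ _ _ _ _ M) => // w; exact: FM (approx_cadlag N w).
have iY : Q.-integrable setT (EFin \o (fun w => F (Y w))).
  by apply: (@Ex_bnd_int _ _ _ _ _ M) => // w; exact: FM (Yon w).
suff : (fun N => Ex Q (fun w => F (approx N w))) @ \oo --> Ex Q (fun w => F (Y w)).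
  move=> H; rewrite (Ex_EFin iY) (_ : (fun N => \int[Q]_w _)%E = EFin \o (fun N => Ex Q (fun w => F (approx N w)))).
    by apply: cvg_EFin; [exact: nearW|exact: H].
  by apply/funext => N; rewrite /= Ex_EFin.
apply/cvgrPdist_lt => e e0; apply: contrapT => nc.
have /choice[f Hf] : forall m, exists N, (m <= N)%N /\ e <= `|Ex Q (fun w => F (Y w)) - Ex Q (fun w => F (approx N w))|.
  move=> m; apply: contrapT => H; apply: nc; exists m => // N /= mN; rewrite ltNge; apply/negP => h.
  by apply: H; exists N.
(* Each index is at least its predecessor and the thresholds of both adjacent levels, since level k
   is used at nu_k and at nu_(k+1). *)
pose nu := fix g k := if k is k'.+1 then f (maxn (g k') (maxn (n k') (n k))) else f (n 0%N).
have nu_S k : (maxn (nu k) (maxn (n k) (n k.+1)) <= nu k.+1)%N by exact: (Hf _).1.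
have nu_ge k : (n k <= nu k)%N.
  by case: k => [|k]; [exact: (Hf _).1|move: (nu_S k); rewrite !geq_max => /and3P[]].
have nu_geS k : (n k <= nu k.+1)%N by move: (nu_S k); rewrite !geq_max => /and3P[].
have nu_mono k : (nu k <= nu k.+1)%N by move: (nu_S k); rewrite !geq_max => /and3P[].
have far k : e <= `|Ex Q (fun w => F (Y w)) - Ex Q (fun w => F (approx (nu k) w))| by case: k => [|k]; exact: (Hf _).2.
have geo : (fun m => 6 * eps m) @ \oo --> (0 : R).
  by rewrite -(mulr0 6); apply: cvgMr; exact: geo2_cvg0.
have aF : {ae Q, forall w, setT w -> (fun k => (F (approx (nu k) w))%:E) @ \oo --> (F (Y w))%:E}.
  apply: filterS (approx_uniform uk Hn nu_ge nu_geS nu_mono) => w [k0 Hk] _.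
  apply: cvg_EFin; first exact: nearW.
  apply/cvgrPdist_lt => r r0; have [delta d0 Hd] := Fc _ (Yon w) _ r0.
  near=> k; apply: Hd; first exact: approx_cadlag.
  exists id; split; first by split => //; apply: continuous_subspaceT => z; exact: cvg_id.
  move=> t tT; rewrite subrr normr0 (ltW d0); split => //.
  have kk : (k0 <= k)%N by near: k; exact: nbhs_infty_ge.
  have ed : 6 * eps k <= delta by near: k; exact: (cvgr_le _ geo).
  by rewrite distrC (le_trans (Hk k kk t tT)).
have bd : {ae Q, forall w, forall k, setT w -> (`|(F (approx (nu k) w))%:E| <= M%:E)%E}.
  by apply: aeW => w k _; rewrite lee_fin FM//; exact: approx_cadlag.
have mEF (g : Om' -> R) : measurable_fun setT g -> measurable_fun setT (fun w => (g w)%:E : \bar R) by move=> ?; exact/measurable_EFinP.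
have [_ _ cv] := @dominated_convergence _ _ R Q setT measurableT (fun k w => (F (approx (nu k) w))%:E) (fun w => (F (Y w))%:E) (fun=> M%:E)
  (fun k => mEF _ (mFa (nu k))) (mEF _ mFY) aF (intble_cst Q M) bd.
rewrite (Ex_EFin iY) in cv.
have cv2 : (fun k => Ex Q (fun w => F (approx (nu k) w))) @ \oo --> Ex Q (fun w => F (Y w)) by exact: (fine_cvg cv).
move/cvgrPdist_lt : cv2 => /(_ e e0)[m _ /(_ m (leqnn m))/=].
by rewrite ltNge far.
Unshelve. all: by end_near.
Qed.
End Coupling.

Lemma exp_small {R : realType} (K a e : R) : 0 <= K -> 0 < a -> 0 < e ->
  exists2 u0, u0 <= 0 & forall u, u <= u0 -> K * expR (a * u) <= e.
Proof.
move=> K0 a0 e0; exists (Num.min 0 (ln (e / (K + 1)) / a)); first by rewrite ge_min lexx.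
move=> u; rewrite le_min => /andP[_ h].
have K1 : 0 < K + 1 by rewrite ltr_wpDl.
apply: (@le_trans _ _ ((K + 1) * expR (a * u))); first by rewrite ler_wpM2r ?expR_ge0// lerDl.
rewrite mulrC -ler_pdivlMr// -[leRHS](lnK (x := e / (K + 1))) ?posrE ?divr_gt0//.
by rewrite ler_expR mulrC -ler_pdivlMr.
Qed.

(* For [alpha < 1] the untruncated series of nonnegative terms converges, hence so do its truncations. *)
Lemma trunc_series_cvg {R : realType} (U a : nat -> R) (y : R) : (forall i, 0 < U i) -> (forall i, 0 <= a i) ->
  (fun n => \sum_(i < n) U i * a i) @ \oo --> y ->
  (fun tau => limn (fun n => \sum_(i < n) trunc (ln tau) (U i) * a i)) @ 0^'+ --> y.
Proof.
move=> U0 a0 Sy.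
have term0 i : 0 <= U i * a i by rewrite mulr_ge0// ltW.
have t_le u i : 0 <= trunc u (U i) * a i <= U i * a i.
  by rewrite /trunc; case: ifP => _; rewrite ?mul0r ?lexx term0.
have nd (b : nat -> R) : (forall i, 0 <= b i) -> nondecreasing_seq (fun n => \sum_(i < n) b i).
  by move=> b0; apply/nondecreasing_seqP => n; rewrite big_ord_recr/= lerDl.
have Sle n : \sum_(i < n) U i * a i <= y.
  by rewrite -(cvg_lim _ Sy)//; apply: nondecreasing_cvgn_le; [exact: (nd (fun i => U i * a i))|exact: cvgP Sy].
have tc u : cvgn (fun n => \sum_(i < n) trunc u (U i) * a i).
  apply: nondecreasing_is_cvgn; first by apply: (nd (fun i => trunc u (U i) * a i)) => i; case/andP : (t_le u i).
  exists y => _ [n _ <-]; apply: le_trans (Sle n).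
  by apply: ler_sum => i _; case/andP : (t_le u i).
apply/cvgrPdist_le => e e0.
have [n _ /(_ n (leqnn n)) /= Hn] : \forall n \near \oo, y - e <= \sum_(i < n) U i * a i.
  by apply: (cvgr_ge y) => //; rewrite gtrBl.
near=> tau; have tau0 : 0 < tau by near: tau; exact: nbhs_right_gt.
have tauU : forall i : 'I_n, tau < U i.
  by near: tau; apply: filter_forall => i; exact: nbhs_right_lt.
rewrite ger0_norm; last first.
  rewrite subr_ge0; apply: limr_le => //; apply: nearW => k; apply: le_trans (Sle k).
  by apply: ler_sum => i _; case/andP : (t_le (ln tau) i).
rewrite lerBlDl -lerBlDr (le_trans Hn)// (le_trans (_ : _ <= \sum_(i < n) trunc (ln tau) (U i) * a i))//.
  by apply: ler_sum => i _; rewrite /trunc lnK// tauU.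
by apply: nondecreasing_cvgn_le => //; apply: (nd (fun i => trunc (ln tau) (U i) * a i)) => i; case/andP : (t_le (ln tau) i).
Unshelve. all: by end_near.
Qed.

(** * Centring in the three regimes and return to the original process *)

Theorem theorem1p4 (R : realType) (d : measure_display) (Om : measurableType d)
  (P : probability Om R) (xi : nat -> R -> Om -> R)
  (Hlevy : forall i, levy P (xi i))
  (Hident : forall i, fdd_eq P (xi i) P (xi 0%N))
  (Hindep : indep_family P xi)
  (Hmgf : forall u : R, P.-integrable setT (fun w => (expR (u * xi 0%N 1 w))%:E))
  (Hnonlattice : ~ lattice P (xi 0%N 1))
  (s : nat -> R) (Hs : forall N, 0 <= s N)
  (lam : R) (Hlam : (fun N : nat => ln N%:R / s N) @ \oo --> lam)
  (Hlam0 : 0 < lam) (Hlam2 : lam < lambda2 (psi P (xi 0%N)))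
  (alpha : R) (Halpha : 0 < alpha) (HalphaI : IofPsi' (psi P (xi 0%N)) alpha = lam)
  (T : R) (HT : 0 < T)
  (* a construction of Y_{alpha;xi}: i.i.d. copies xi' of xi, independent of
     the arrivals Gamma_j = E_0 + ... + E_j of a unit Poisson process *)
  (d' : measure_display) (Om' : measurableType d') (Q : probability Om' R)
  (xi' : nat -> R -> Om' -> R) (E : nat -> Om' -> R) (Y : Om' -> R -> R)
  (Hlevy' : forall i, levy Q (xi' i))
  (Hident' : forall i, fdd_eq Q (xi' i) P (xi 0%N))
  (Hindep' : indep_family Q xi')
  (HE : exp_indep Q E xi')
  (HYmeas : forall t, measurable_fun setT (fun w => Y w t))
  (HYcadlag : forall w, cadlag0 (Y w))
  (HY : {ae Q, forall w, forall t, 0 <= t -> Ylim (psi P (xi 0%N)) alpha xi' E w t (Y w t)}) :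
  weak_conv_D T P
    (fun N w t => (Z xi s N w t - An P xi s lam alpha N t) / Bn P xi s alpha N t) Q Y.
Proof.
have HX := Hlevy 0%N; have mxi i t : measurable_fun setT (xi i t) := levy_meas (Hlevy i) t.
have nc : ~ (exists c, prob P [set w | xi 0%N 1 w = c] = 1) by case: HX.
pose ps := psi P (xi 0%N); pose c := ps alpha / alpha; pose k1 := ps 1 - c.
pose l N := lB P (xi 0%N) s alpha N.
pose Yv N w := xi 0%N (s N) w - l N.
have JltE (a b : R) : 0 <= a -> 0 <= b -> (IofPsi' ps a < IofPsi' ps b) = (a < b).
  exact: (@J_ltE _ _ _ P (xi 0%N 1) (mxi 0%N 1) Hmgf nc a b).
have l1E : lambda1 ps = IofPsi' ps 1 by rewrite /lambda1 /IofPsi' mul1r.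
(* I(psi'(u)) increases in u and lambda_1 is its value at 1, so the regimes of [lam] are those of
   [alpha] compared with 1; lambda_2 gives alpha < 2 in the same way. *)
have case1 : (lam < lambda1 ps) = (alpha < 1) by rewrite l1E -HalphaI JltE// ltW.
have case2 : (lam == lambda1 ps) = (alpha == 1).
  apply/eqP/eqP => [h|a1]; last by rewrite l1E -HalphaI a1.
  apply/eqP; rewrite eq_le !leNgt -case1 h ltxx /= -(JltE 1 alpha)// ?ltW// -l1E -h.
  by rewrite [IofPsi' ps alpha]HalphaI ltxx.
have alpha2 : alpha < 2 by rewrite -(JltE alpha 2)// ?ltW// [IofPsi' ps alpha]HalphaI.
pose be N := An P xi s lam alpha N 0 * expR (- l N).
(* The compensator of the limit at tau = e^u: log(1 / tau) = -u for alpha = 1, and alpha tau^(1 -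
   alpha) / (alpha - 1) for alpha > 1. *)
pose bl u : R := if alpha < 1 then 0 else if alpha == 1 then - u else alpha / (alpha - 1) * expR ((1 - alpha) * u).
have Bn0 N : Bn P xi s alpha N 0 = expR (l N) by rewrite /Bn mulr0 expR0 mul1r.
have iE N u : P.-integrable setT (EFin \o (fun w => expR (u * Yv N w))).
  have i1 := exp_intble HX Hmgf u (Hs N).
  rewrite (_ : (fun w => expR (u * Yv N w)) = (fun w => expR (- (u * l N)) * expR (u * xi 0%N (s N) w))).
    exact: intbleZl.
  by apply/funext => w; rewrite -expRD /Yv; congr expR; ring.
have iE1 N : P.-integrable setT (EFin \o (fun w => expR (Yv N w))).
  by have := iE N 1; under eq_fun do rewrite mul1r.
have mYv N : measurable_fun setT (Yv N) by exact: measurable_funB.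
have meY N : measurable_fun setT (fun w => expR (Yv N w)) by exact: measurableT_comp.
have iC N (p : Om -> bool) : measurable_fun setT p ->
    P.-integrable setT (EFin \o (fun w => if p w then expR (Yv N w) else 0)).
  move=> mp; apply: (intble_le _ _ (iE1 N)); first exact: measurable_fun_ifT.
  by move=> w; case: ifP => _; rewrite ?normr0 ?expR_ge0// ger0_norm ?expR_ge0.
have mle N u : measurable_fun setT (fun w => Yv N w <= u) by exact: measurable_fun_ler.
have be_eq1 N : alpha = 1 -> be N = N%:R * Ex P (fun w => if Yv N w <= 0 then expR (Yv N w) else 0).
  move=> a1; have Bn1 := Bn0 N; rewrite a1 in Bn1.
  rewrite /be /An -/ps case1 case2 a1 ltxx eqxx mulr0 expR0 mul1r -mulrA; congr (_ * _).
  rewrite mulrC -ExZl; last first.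
    have := intbleZl (expR (l N)) (iC N _ (mle N 0)); congr (P.-integrable _ _); apply/funext => w /=; congr EFin.
    rewrite Bn1 expRK /Yv subr_le0; case: ifP => _; rewrite ?mulr0 ?mulr1// -expRD; congr expR; ring.
  congr (Ex P _); apply/funext => w; rewrite Bn1 expRK /Yv subr_le0; case: ifP => _; rewrite ?mulr0// mulr1 -expRD.
  by congr expR; ring.
have be_gt1 N : 1 < alpha -> be N = N%:R * Ex P (fun w => expR (Yv N w)).
  move=> a1; rewrite /be /An -/ps case1 case2 ltNge (ltW a1) gt_eqF//= mulr0 expR0 mul1r.
  have i0 i : P.-integrable setT (EFin \o (fun w => expR (xi i (s N) w))) /\
      Ex P (fun w => expR (xi i (s N) w)) = Ex P (fun w => expR (xi 0%N (s N) w)).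
    have i1 := exp_intble HX Hmgf 1 (Hs N).
    have law B : measurable B -> prob P (xi 0%N (s N) @^-1` B) = prob P (xi i (s N) @^-1` B).
      by move=> mB; rewrite (fdd1 Hident i (Hs N) mB).
    have me : measurable_fun setT (fun x : R => expR (1 * x)) by apply: measurableT_comp => //; exact: measurable_funM.
    have j1 := law1_intble (mxi 0%N (s N)) (mxi i (s N)) law me i1.
    have := law1_Ex (mxi 0%N (s N)) (mxi i (s N)) law me i1.
    by move: j1; rewrite /comp; under eq_fun do rewrite mul1r; under [X in Ex P X = _]eq_fun do rewrite mul1r;
      under [X in _ = Ex P X]eq_fun do rewrite mul1r.
  transitivity (N%:R * Ex P (fun w => expR (xi 0%N (s N) w)) * expR (- l N)).
    congr (_ * _); rewrite /Z; under eq_fun do under eq_bigr do rewrite addr0.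
    rewrite Ex_sum; last by move=> i _; exact: (i0 i).1.
    rewrite (eq_bigr (fun=> Ex P (fun w => expR (xi 0%N (s N) w)))); last by move=> i _; exact: (i0 i).2.
    by rewrite sumr_const card_ord mulr_natl.
  rewrite -mulrA; congr (_ * _); rewrite mulrC -ExZl; last exact: (i0 0%N).1.
  by congr (Ex P _); apply/funext => w; rewrite -expRD /Yv addrC.
(* [p] marks the part of the weights whose mean is the centring. Removing what lies at or below u
   leaves a mean above u, to which the limits of the means apply. *)
have split_ N u (p : Om -> bool) : measurable_fun setT p -> (forall w, Yv N w <= u -> p w) ->
    N%:R * Ex P (fun w => if p w then expR (Yv N w) else 0) - N%:R * Ex P (fun w => if Yv N w <= u then expR (Yv N w) else 0) =
    N%:R * Ex P (fun w => if (u < Yv N w) && p w then expR (Yv N w) else 0).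
  move=> mp up; rewrite -mulrBr -ExB; [|exact: iC|exact: iC].
  congr (_ * Ex P _); apply/funext => w; have := up w; case: (leP (Yv N w) u) => h /= => [->//|_].
    by rewrite subrr.
  by rewrite subr0.
have centering e : 0 < e -> exists u0, forall u, u <= u0 -> \forall N \near \oo,
    `|be N - N%:R * Ex P (fun w => if Yv N w <= u then expR (Yv N w) else 0) - bl u| <= e.
  move=> e0; rewrite /bl; case: (ltgtP alpha 1) => a1.
  (* For alpha < 1 nothing is subtracted, and the mean below u is itself small: the exponent is
     taken midway between alpha and 1. *)
  - have [k0 k2] := midf_lt a1.
    have [K K0 HK] := trunc_moment HX Hmgf Hnonlattice erefl erefl Hs Hlam Hlam0 Halpha HalphaI ltr01 k0 k2.
    have a0 : 0 < 1 - (alpha + 1) / 2 by rewrite subr_gt0.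
    have [u0 u00 Hu0] := exp_small K0 a0 e0; exists u0 => u uu0.
    apply: filterS HK => N /(_ u (le_trans uu0 u00)).
    under eq_fun do rewrite mul1r.
    rewrite /be /An -/ps case1 a1 mul0r subr0 sub0r normrN ger0_norm; first by move=> /le_trans; apply; exact: Hu0.
    by rewrite mulr_ge0// Ex_ge0// => w; case: ifP.
  - exists 0 => u _.
    have H := mean_above_cvg HX Hmgf Hnonlattice erefl erefl Hs Hlam Hlam0 Halpha HalphaI (l := u) a1.
    move/cvgrPdist_le : H => /(_ _ e0); apply: filterS => N; rewrite distrC; congr (`|_ - _| <= _).
    rewrite be_gt1//; have := @split_ N u xpredT (measurable_cst true) (fun _ _ => isT) => ->.
    by congr (_ * Ex P _); apply/funext => w; rewrite andbT.
  - exists (-1) => u u1; have u0 : u < 0 by rewrite (le_lt_trans u1)// ltrN10.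
    have H := mean_band_cvg HX Hmgf Hnonlattice erefl erefl Hs Hlam Hlam0 Halpha HalphaI a1 u0.
    move/cvgrPdist_le : H => /(_ _ e0); apply: filterS => N; rewrite distrC; congr (`|_ - _| <= _).
    rewrite be_eq1//; have := @split_ N u (fun w => Yv N w <= 0) (mle N 0) => -> // w /le_trans; apply.
    exact: ltW.
have second e : 0 < e -> exists u0, forall u, u <= u0 -> \forall N \near \oo,
    N%:R * Ex P (fun w => if Yv N w <= u then expR (2 * Yv N w) else 0) <= e.
  (* An exponent midway between alpha and 2; this is where lam < lambda_2 enters the variance
     bound. *)
  move=> e0; have [k0 k2] := midf_lt alpha2.
  have p2 : 0 < 2 :> R by [].
  have [K K0 HK] := trunc_moment HX Hmgf Hnonlattice erefl erefl Hs Hlam Hlam0 Halpha HalphaI p2 k0 k2.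
  have a0 : 0 < 2 - (alpha + 2) / 2 by rewrite subr_gt0.
  have [u0 u00 Hu0] := exp_small K0 a0 e0; exists u0 => u uu0.
  by apply: filterS HK => N /(_ u (le_trans uu0 u00)) /le_trans; apply; exact: Hu0.
have Ylimit : {ae Q, forall w, forall t, 0 <= t ->
    (fun tau => limn (fun n => \sum_(i < n) trunc (ln tau) (Upt alpha E i w) * expR (xi' i t w - c * t))
     - bl (ln tau) * expR (k1 * t)) @ 0^'+ --> Y w t}.
  case: (HE) => mE tE _; apply: filterS2 HY (exp_pos_ae mE tE) => w Yw E0 t /Yw.
  have tr (tau x y : R) : 0 < tau -> trunc (ln tau) x * y = if tau < x then x * y else 0.
    by move=> tau0; rewrite /trunc lnK//; case: ifP; rewrite ?mul0r.
  rewrite /Ylim /bl; case: (ltgtP alpha 1) => a1 H.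
  - under eq_fun do rewrite mul0r subr0.
    apply: (@trunc_series_cvg R (fun i => Upt alpha E i w) (fun i => expR (xi' i t w - c * t)) (Y w t)) => // i.
    have g0 : 0 < Gam E i w by rewrite /Gam big_ord_recl ltr_wpDr// sumr_ge0// => j _; exact: ltW.
    exact: powR_gt0.
  - apply: cvg_trans H; apply: near_eq_cvg; near=> tau.
    have tau0 : 0 < tau by near: tau; exact: nbhs_right_gt.
    congr (_ - _); first by congr (limn _); apply/funext => n; apply: eq_bigr => i _; rewrite tr.
    by rewrite /powR (gt_eqF tau0) -/ps -/c -/k1 [in LHS](mulrAC alpha).
  - apply: cvg_trans H; apply: near_eq_cvg; near=> tau.
    have tau0 : 0 < tau by near: tau; exact: nbhs_right_gt.
    congr (_ - _).
      congr (limn _); apply/funext => n; apply: eq_bigr => i _; rewrite tr//.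
      by rewrite /c a1 divr1.
    by rewrite lnV ?posrE// /k1 /c a1 divr1 subrr mul0r expR0 mulr1.
have tl x : (fun N => N%:R * prob P [set w | x < xi 0%N (s N) w - l N]) @ \oo --> expR (- alpha * x).
  exact: (tail_cvg HX Hmgf Hnonlattice erefl erefl Hs Hlam Hlam0 Halpha HalphaI).
move=> F [M FM] Fc.
have main := @approx_weak _ _ _ _ _ P Q xi xi' E Hlevy Hident Hindep Hmgf Hlevy' Hident' Hindep' HE
  s l be alpha c T bl Y Hs Halpha HT tl second centering Ylimit HYmeas HYcadlag F M FM Fc.
apply: cvg_trans main; apply: near_eq_cvg; apply: nearW => N.
(* Dividing by B_N(t) = e^(c t + l N) brings the original process into the shape of [approx], the
   factors e^(psi(1) t) and e^(c t) merging into e^(k1 t). *)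
have pathE w t : (Z xi s N w t - An P xi s lam alpha N t) / Bn P xi s alpha N t =
    \sum_(i < N) expR (- l N) * expR (xi i (s N + t) w - c * t) - be N * expR (k1 * t).
  have AE : An P xi s lam alpha N t = expR (ps 1 * t) * An P xi s lam alpha N 0.
    rewrite /An -/ps mulr0 expR0; case: ifP => _; first by rewrite mulr0.
    by case: ifP => _; rewrite mul1r ?mulrA.
  have BE : Bn P xi s alpha N t = expR (c * t) * expR (l N) by [].
  rewrite AE BE /be /Z -expRD -expRN mulrBl mulr_suml; congr (_ - _).
    by apply: eq_bigr => i _; rewrite -!expRD; congr expR; ring.
  have gen (p q r A : R) : expR (p * t) * A * expR (- (q * t + r)) = A * expR (- r) * expR ((p - q) * t).
    by rewrite mulrAC -expRD mulrC -mulrA -expRD; congr (_ * expR _); ring.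
  exact: gen.
(* Weight at time s_N and growth since then are separated, the form in which [grid_Ex] compares the
   two spaces. *)
have gridE w t : \sum_(i < N) expR (- l N) * expR (xi i (s N + t) w - c * t) =
    (\sum_(i < N) expR (xi i (s N) w - l N) * expR (xi i (s N + t) w - xi i (s N) w)) * expR (- (c * t)).
  by rewrite mulr_suml; apply: eq_bigr => i _; rewrite -!expRD; congr expR; ring.
apply/esym; apply: (@functional_law R T F M HT FM Fc _ _ _ _ P Q).
- move=> w; rewrite (_ : (fun t => _) = (fun t => \sum_(i < N) expR (- l N) * expR (xi i (s N + t) w - c * t) - be N * expR (k1 * t))).
    by apply: (@cadlag_expsum R T N (fun=> expR (- l N)) (fun i t => xi i (s N + t) w)) => i; apply: (@cadlag0_shift R (s N) (fun t => xi i t w)) => //; case: (Hlevy i).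
  by apply/funext => t; exact: pathE.
- by move=> w; apply: approx_cadlag.
- move=> t _; under eq_fun do rewrite pathE.
  apply: measurable_funB => //; apply: measurable_sum => i; apply: measurable_funM => //.
  by apply: measurableT_comp => //; exact: measurable_funB.
- move=> t _; apply: measurable_funB => //; apply: measurable_sum => j; apply: measurable_funM.
    by apply: measurableT_comp => //; apply: measurable_funB => //; exact: (arrive_meas Hlevy HE (s N) N j).
  by apply: measurableT_comp => //; apply: measurable_funB => //; exact: (levy_meas (Hlevy' j)).
move=> n f mf fM; pose t (k : nat) := k%:R * (T / n.+1%:R).
have t0 : t 0%N = 0 by rewrite /t mul0r.
have tm k : t k <= t k.+1 by rewrite /t ler_wpM2r ?divr_ge0 ?(ltW HT)// ler_nat.
(* Both processes are the same affine function of the raw grid sums, so the deterministic factors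
   are absorbed into the test function. *)
pose G (z : n.+2.-tuple R) := f [tuple tnth z k * expR (- (c * t k)) - be N * expR (k1 * t k) | k < n.+2].
have mG : measurable_fun setT G.
  apply: measurableT_comp => //; apply/measurable_fun_tnthP => k.
  rewrite (_ : _ \o _ = (fun z : n.+2.-tuple R => tnth z k * expR (- (c * t k)) - be N * expR (k1 * t k))).
    by apply: measurable_funB => //; apply: measurable_funM => //; exact: measurable_tnth.
  by apply/funext => z /=; rewrite tnth_mktuple.
have mv : measurable_fun setT (fun x : R => expR (x - l N)) by apply: measurableT_comp => //; exact: measurable_funB.
have := grid_Ex Hlevy Hident Hindep Hlevy' Hident' Hindep' HE N (Hs N) t0 tm mv (fun x => expR_ge0 _) mG (fun z => fM _).
rewrite /G => H.
transitivity (Ex P (fun w => f [tuple tnth [tuple gridS xi (s N) t N (fun x => expR (x - l N)) k w | k < n.+2] k * expR (- (c * t k)) - be N * expR (k1 * t k) | k < n.+2])).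
  by congr (Ex P _); apply/funext => w; congr f; apply: eq_mktuple => k; rewrite tnth_mktuple pathE gridE.
rewrite H; congr (Ex Q _); apply/funext => w; congr f; apply: eq_mktuple => k; rewrite tnth_mktuple.
rewrite /approx /gridS' mulr_suml; congr (_ - _); apply: eq_bigr => j _.
by rewrite -mulrA -expRD.
Unshelve. all: by end_near.
Qed.
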